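(* Let $R=\{\pm\alpha\}$ be the root system of rank 1, let $k\in\mathbb{C}$ and $\vartheta\in\mathfrak{h}^*/W$, let $\lambda\in\mathfrak{h}^*$ be the preimage of $\vartheta$ with $\Re(\lambda(\alpha^\vee))\geq 0$, and identify $\mathfrak{h}^*$ with $\mathbb{C}$ via $\nu\mapsto\nu(\alpha^\vee)$. Set $\Lambda=e^{\pi \mathrm{i}\lambda}$ and $q=e^{2\pi \mathrm{i}k}$. Then the monodromy of the trigonometric KZ local system $\mathcal{K}(\vartheta,k)$, as a representation of the extended affine Hecke algebra $H_q^{\mathrm{ext}}$, is isomorphic to the covariant representation $K(\Theta)$ except in the following cases: (1) If $\lambda,k\in\mathbb{Z}$ and $|\lambda|\geq\max(k,1-k)$, the monodromy of $\mathcal{K}(\vartheta,k)$ is isomorphic to $(-\Lambda,1)\oplus(-\Lambda,-1)$. (2) If $\lambda,k\in\frac12+\mathbb{Z}$ and $|\lambda|\geq\max(k,1-k)$, the monodromy of $\mathcal{K}(\vartheta,k)$ is isomorphic to the induced representation $I(-\Lambda)$. (3) If one of $k+\lambda$, $k-\lambda$ lies in $\mathbb{Z}_{>0}$, $\lambda\notin\frac12+\mathbb{Z}$, and (1) does not apply, the monodromy of $\mathcal{K}(\vartheta,k)$ is isomorphic to $K(\Theta)^-$.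
   Context: Setting (rank 1). $\mathfrak{h}$ is the one-dimensional complex space spanned by the coroot $\alpha^\vee$, $W=\{1,s\}$ acts by $\pm1$, $\rho=\alpha/2$, $P=\mathbb{Z}\rho$, $Q^\vee=\mathbb{Z}\alpha^\vee$, $P^\vee=\mathbb{Z}\lambda_1^\vee$ with $\lambda_1^\vee=\alpha^\vee/2$, and $S\mathfrak{h}$ is the symmetric algebra of $\mathfrak h$. The degenerate affine Hecke algebra $H_k$ is generated by $W$ and $S\mathfrak{h}$ with relation $s\xi=s(\xi)s-k\alpha(\xi)$ for $\xi\in\mathfrak{h}$. For $\vartheta\in\mathfrak{h}^*/W$, the covariant representation of $H_k$ is $K_\vartheta=\mathrm{Ind}_{S\mathfrak{h}^W\otimes\mathbb{C}W}^{H_k}\mathbb{C}_\vartheta$, where $S\mathfrak{h}^W$ acts on $\mathbb{C}_\vartheta$ by evaluation at $\vartheta$ and $W$ acts trivially; it has dimension 2. Trigonometric KZ connection. Let $H=\mathrm{Hom}_{\mathbb Z}(P,\mathbb{C}^\times)\cong\mathbb{C}^\times$ with coordinate $x=e^{\rho}$, and $H_{\mathrm{reg}}=H\setminus\{\pm1\}$. On the trivial bundle over $H_{\mathrm{reg}}$ with fibre $K_\vartheta$ consider the $W$-equivariant connection whose covariant derivative along the translation-invariant vector field $\xi\in\mathfrak{h}$ is $$\nabla_\xi=\partial_\xi-k\,\alpha(\xi)\frac{1-s}{1-e^{-\alpha}}+\tfrac{k}{2}\alpha(\xi)+\xi ,$$ where $s$ and $\xi$ act on the fibre $K_\vartheta$.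 Here $W$ acts on $H_{\mathrm{reg}}$ by $x\mapsto x^{-1}$ and simultaneously on the fibre. The local system of its horizontal sections on $H_{\mathrm{reg}}/W$ is $\mathcal{K}(\vartheta,k)$. The connection is invariant under translation by $\Omega^\vee=P^\vee/Q^\vee\cong\mathbb{Z}/2$, which acts by $x\mapsto -x$, hence descends to $T=H/\Omega^\vee$ (coordinate $Z=x^2=e^{\alpha}$), and its monodromy is a representation of the orbifold fundamental group $\pi_1^{\mathrm{orb}}(T_{\mathrm{reg}}/W)$, where $T_{\mathrm{reg}}=H_{\mathrm{reg}}/\Omega^\vee$. Monodromy as a representation of $H_q^{\mathrm{ext}}$. With a base point at which $Z$ is a small positive number, the generator $T$ acts by analytic continuation along the path from the base point to its image under $s$ which is straight except near $Z=1$, which it goes around in a small positively oriented circular arc (composed with the action of $s$); the generator $Y$ acts by $e^{\pi \mathrm{i}k}$ times the analytic continuation along the path $x\mapsto e^{\pi \mathrm{i}a}x$, $0\le a\le1$ (composed with translation by $\Omega^\vee$). The resulting representation factors through the extended affine Hecke algebra $H_q^{\mathrm{ext}}$, $q=e^{2\pi \mathrm{i}k}$, generated by invertible elements $T,Y$ with relations $$(T-1)(T+q)=0,\qquad TY-Y^{-1}T=(1-q)Y .$$ Representations of $H_q^{\mathrm{ext}}$. $(y,t)$ denotes the one-dimensional representation $Y\mapsto y$, $T\mapsto t$. For $\mu\in\mathbb{C}^\times$, $I(\mu)=\mathrm{Ind}_{\mathbb{C}[Y^{\pm1}]}^{H_q^{\mathrm{ext}}}\mathbb{C}_\mu$, where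 $Y$ acts on $\mathbb{C}_\mu$ by $\mu$. Let $H_q$ be the subalgebra generated by $T$; the subalgebra $\mathbb{C}[Y+Y^{-1}]$ is central. $\Theta$ is the $W$-orbit $\{\Lambda,\Lambda^{-1}\}$. $K(\Theta)=\mathrm{Ind}_{H_q\otimes\mathbb{C}[Y+Y^{-1}]}^{H_q^{\mathrm{ext}}}\mathbb{C}_\Theta$ where $Y+Y^{-1}$ acts on $\mathbb{C}_\Theta$ by $\Lambda+\Lambda^{-1}$ and $T$ by $1$; $K(\Theta)^-$ is defined in the same way but with $T$ acting by $-q$.
   Formalization: Y acts by the inverse of e^{πik} times continuation along x↦e^{πia}x (the operator as described violates TY−Y^{-1}T=(1−q)Y), and −Λ in (1),(2) is replaced by Λ^{-1} (in (1) the number −Λ is impossible: k=0, λ=1 gives Y=−1=Λ). *)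

(* Defs.v *)
From HB Require Import structures.
From mathcomp Require Import all_boot all_order all_algebra.
From mathcomp Require Import generic_quotient ring_quotient.
From mathcomp Require Import all_classical all_reals all_analysis.
From mathcomp Require Import complex.

Set Implicit Arguments.
Unset Strict Implicit.
Unset Printing Implicit Defensive.

Import Order.TTheory GRing.Theory Num.Theory numFieldNormedType.Exports.
Local Open Scope classical_set_scope.
Local Open Scope quotient_scope.
Local Open Scope ring_scope.

Section PresentedAlgebra.
Variables (F : fieldType) (X : Type).

Inductive word :=
| Gen of X
| Cst of F
| Add of word & word
| Mul of word & word.

HB.instance Definition _ := gen_eqMixin word.
HB.instance Definition _ := gen_choiceMixin word.

Variable rel : word -> word -> Prop.

(* The least congruence that contains [rel] and makes words into a unital
   associative F-algebra. *)
Inductive wcong : word -> word -> Prop :=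
| wcong_rel a b : rel a b -> wcong a b
| wcong_refl a : wcong a a
| wcong_sym a b : wcong a b -> wcong b a
| wcong_trans b a c : wcong a b -> wcong b c -> wcong a c
| wcong_add a a' b b' : wcong a a' -> wcong b b' ->
    wcong (Add a b) (Add a' b')
| wcong_mul a a' b b' : wcong a a' -> wcong b b' ->
    wcong (Mul a b) (Mul a' b')
| wcong_addA a b c : wcong (Add a (Add b c)) (Add (Add a b) c)
| wcong_addC a b : wcong (Add a b) (Add b a)
| wcong_add0 a : wcong (Add (Cst 0) a) a
| wcong_addN a : wcong (Add (Mul (Cst (- 1)) a) a) (Cst 0)
| wcong_mulA a b c : wcong (Mul a (Mul b c)) (Mul (Mul a b) c)
| wcong_mul1 a : wcong (Mul (Cst 1) a) a
| wcong_mulDl a b c : wcong (Mul (Add a b) c) (Add (Mul a c) (Mul b c))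
| wcong_mulDr a b c : wcong (Mul a (Add b c)) (Add (Mul a b) (Mul a c))
| wcong_cstD x y : wcong (Cst (x + y)) (Add (Cst x) (Cst y))
| wcong_cstM x y : wcong (Cst (x * y)) (Mul (Cst x) (Cst y))
| wcong_cstC x a : wcong (Mul (Cst x) a) (Mul a (Cst x)).

Definition wcongb (a b : word) : bool := `[< wcong a b >].

Lemma wcongb_equiv : equiv_class_of wcongb.
Proof.
split=> [a|a b|b a c]; first by apply/asboolP; exact: wcong_refl.
- by apply/asboolP/asboolP; exact: wcong_sym.
- by move=> /asboolP ab /asboolP bc; apply/asboolP; exact: wcong_trans ab bc.
Qed.

Canonical wcongb_equivRel := EquivRelPack wcongb_equiv.
Canonical wcongb_encModRel := defaultEncModRel wcongb.

Definition presented := {eq_quot wcongb}.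

HB.instance Definition _ := Choice.on presented.
HB.instance Definition _ : EqQuotient word wcongb presented :=
  EqQuotient.on presented.

Definition pcl (a : word) : presented := \pi_presented a.

Lemma pclP a b : pcl a = pcl b <-> wcong a b.
Proof.
by split=> [/eqP|ab]; [rewrite /pcl piE => /asboolP
                      |apply/eqP; rewrite /pcl piE; apply/asboolP].
Qed.

Lemma pcl_repr (x : presented) : pcl (repr x) = x.
Proof. exact: reprK. Qed.

Definition padd (x y : presented) := pcl (Add (repr x) (repr y)).
Definition pmul (x y : presented) := pcl (Mul (repr x) (repr y)).
Definition popp (x : presented) := pcl (Mul (Cst (- 1)) (repr x)).

Lemma wcong_repr a : wcong (repr (pcl a)) a.
Proof. by apply/pclP; rewrite pcl_repr. Qed.

Lemma paddE a b : padd (pcl a) (pcl b) = pcl (Add a b).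
Proof. by apply/pclP; apply: wcong_add; exact: wcong_repr. Qed.

Lemma pmulE a b : pmul (pcl a) (pcl b) = pcl (Mul a b).
Proof. by apply/pclP; apply: wcong_mul; exact: wcong_repr. Qed.

Lemma poppE a : popp (pcl a) = pcl (Mul (Cst (- 1)) a).
Proof.
by apply/pclP; apply: wcong_mul; [exact: wcong_refl|exact: wcong_repr].
Qed.

Lemma paddA : associative padd.
Proof.
move=> x y z; rewrite -(pcl_repr x) -(pcl_repr y) -(pcl_repr z) !paddE.
by apply/pclP; exact: wcong_addA.
Qed.

Lemma paddC : commutative padd.
Proof.
move=> x y; rewrite -(pcl_repr x) -(pcl_repr y) !paddE.
by apply/pclP; exact: wcong_addC.
Qed.

Lemma padd0 : left_id (pcl (Cst 0)) padd.
Proof.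
by move=> x; rewrite -(pcl_repr x) paddE; apply/pclP; exact: wcong_add0.
Qed.

Lemma paddN : left_inverse (pcl (Cst 0)) popp padd.
Proof.
by move=> x; rewrite -(pcl_repr x) poppE paddE; apply/pclP; exact: wcong_addN.
Qed.

HB.instance Definition _ :=
  GRing.isZmodule.Build presented paddA paddC padd0 paddN.

Lemma pmulA : associative pmul.
Proof.
move=> x y z; rewrite -(pcl_repr x) -(pcl_repr y) -(pcl_repr z) !pmulE.
by apply/pclP; exact: wcong_mulA.
Qed.

Lemma pmul1l : left_id (pcl (Cst 1)) pmul.
Proof.
by move=> x; rewrite -(pcl_repr x) pmulE; apply/pclP; exact: wcong_mul1.
Qed.

Lemma pmul1r : right_id (pcl (Cst 1)) pmul.
Proof.
move=> x; rewrite -(pcl_repr x) pmulE; apply/pclP.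
by apply: (wcong_trans (b := Mul (Cst 1) (repr x)));
  [apply: wcong_sym; exact: wcong_cstC|exact: wcong_mul1].
Qed.

Lemma pmulDl : left_distributive pmul (@GRing.add presented).
Proof.
move=> x y z; rewrite -(pcl_repr x) -(pcl_repr y) -(pcl_repr z).
rewrite -[_ + _]/(padd _ _) -[X in _ = X]/(padd _ _) !(pmulE, paddE).
by apply/pclP; exact: wcong_mulDl.
Qed.

Lemma pmulDr : right_distributive pmul (@GRing.add presented).
Proof.
move=> x y z; rewrite -(pcl_repr x) -(pcl_repr y) -(pcl_repr z).
rewrite -[_ + _]/(padd _ _) -[X in _ = X]/(padd _ _) !(pmulE, paddE).
by apply/pclP; exact: wcong_mulDr.
Qed.

HB.instance Definition _ := GRing.Zmodule_isPzRing.Build presented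
  pmulA pmul1l pmul1r pmulDl pmulDr.

Definition pgen (x : X) : presented := pcl (Gen x).
Definition pcst (c : F) : presented := pcl (Cst c).

Lemma pcl_add a b : pcl (Add a b) = pcl a + pcl b.
Proof. by rewrite -paddE. Qed.

Lemma pcl_mul a b : pcl (Mul a b) = pcl a * pcl b.
Proof. by rewrite -pmulE. Qed.

Lemma pcst1 : pcst 1 = 1. Proof. by []. Qed.

Lemma pcstD x y : pcst (x + y) = pcst x + pcst y.
Proof. by rewrite -pcl_add; apply/pclP; exact: wcong_cstD. Qed.

Lemma pcstM x y : pcst (x * y) = pcst x * pcst y.
Proof. by rewrite -pcl_mul; apply/pclP; exact: wcong_cstM. Qed.

Lemma pcstC x (a : presented) : pcst x * a = a * pcst x.
Proof.
by rewrite -(pcl_repr a) -!pcl_mul; apply/pclP; exact: wcong_cstC.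
Qed.

(* Let B be a subalgebra of H and chi : B -> F a character.  Then
   Ind_B^H F_chi = H (x)_B F_chi = H / H.(ker chi), and the left ideal
   H.(ker chi) is generated by the elements b - chi(b), where b runs over any
   set of generators of B.  [D b c] says that b is one of the chosen generators
   of B and chi(b) = c. *)
Section Induced.
Variable D : presented -> F -> Prop.

Inductive left_ideal : presented -> Prop :=
| left_ideal_gen b c : D b c -> left_ideal (b - pcst c)
| left_ideal_0 : left_ideal 0
| left_ideal_add a b : left_ideal a -> left_ideal b -> left_ideal (a + b)
| left_ideal_mul a b : left_ideal b -> left_ideal (a * b).

Definition left_idealb : {pred presented} := fun a => `[< left_ideal a >].

Lemma left_ideal_zmod_closed : zmod_closed left_idealb.
Proof.
split; first by apply/asboolP; exact: left_ideal_0.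
move=> a b /asboolP Ia /asboolP Ib; apply/asboolP.
by apply: left_ideal_add => //; rewrite -mulN1r; exact: left_ideal_mul.
Qed.

HB.instance Definition _ :=
  GRing.isZmodClosed.Build presented left_idealb left_ideal_zmod_closed.

Definition Ind : Type := Quotient.quot left_idealb.

HB.instance Definition _ := Choice.on Ind.
HB.instance Definition _ := GRing.Zmodule.on Ind.

Definition icl (a : presented) : Ind :=
  \pi_(Quotient.quot left_idealb) a.

Lemma iclP a b : icl a = icl b <-> left_ideal (a - b).
Proof.
split=> [/eqP|ab].
  by rewrite /icl -Quotient.idealrBE => /asboolP.
by apply/eqP; rewrite /icl -Quotient.idealrBE; apply/asboolP.
Qed.

Definition irepr (v : Ind) : presented :=
  repr (v : Quotient.quot left_idealb).

Lemma icl_repr v : icl (irepr v) = v.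
Proof. exact: reprK. Qed.

Lemma icl_add a b : icl (a + b) = icl a + icl b.
Proof. exact: (Quotient.pi_add left_idealb a b). Qed.

Definition iact (a : presented) (v : Ind) : Ind := icl (a * irepr v).

Lemma iactE a b : iact a (icl b) = icl (a * b).
Proof.
apply/iclP; rewrite -mulrBr; apply: left_ideal_mul.
by apply/iclP; exact: icl_repr.
Qed.

Lemma iactD a u v : iact a (u + v) = iact a u + iact a v.
Proof.
by rewrite -(icl_repr u) -(icl_repr v) -icl_add !iactE mulrDr icl_add.
Qed.

Lemma iactDl a b v : iact (a + b) v = iact a v + iact b v.
Proof. by rewrite -(icl_repr v) !iactE mulrDl icl_add. Qed.

Lemma iactM a b v : iact (a * b) v = iact a (iact b v).
Proof. by rewrite -(icl_repr v) !iactE mulrA. Qed.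

Lemma iact1 v : iact 1 v = v.
Proof. by rewrite -{1}(icl_repr v) iactE mul1r icl_repr. Qed.

Definition iscale (c : F) : Ind -> Ind := iact (pcst c).

Lemma iscaleA a b v : iscale a (iscale b v) = iscale (a * b) v.
Proof. by rewrite /iscale pcstM iactM. Qed.

Lemma iscale1 : left_id 1 iscale.
Proof. exact: iact1. Qed.

Lemma iscaleDr : right_distributive iscale (@GRing.add Ind).
Proof. by move=> c; exact: iactD. Qed.

Lemma iscaleDl v : {morph iscale^~ v : a b / a + b}.
Proof. by move=> a b; rewrite /iscale pcstD iactDl. Qed.

HB.instance Definition _ := GRing.Zmodule_isLmodule.Build F Ind
  iscaleA iscale1 iscaleDr iscaleDl.

Lemma iactZ a c (v : Ind) : iact a (c *: v) = c *: iact a v.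
Proof.
by rewrite -[c *: v]/(iact _ _) -[c *: _]/(iact _ _) -!iactM pcstC.
Qed.

End Induced.

End PresentedAlgebra.

Arguments Cst {F X}.
Arguments Gen {F X}.
Arguments iact {F X rel D}.

Section Rank1.
Variable R : realType.
Local Notation C := (R[i]).
(* [R[i]] carries its topology under the alias [^o]. *)
Local Notation Ctop := (R[i]^o).

Definition expC (z : C) : C :=
  (expR (complex.Re z))%:C%C *
  (cos (complex.Im z) +i* sin (complex.Im z))%C.

Definition piI : C := 'i%C * (pi : R)%:C%C.

(* h is identified with C by c |-> c.alpha^vee and h^* with C by
   nu |-> nu(alpha^vee); s acts by the sign on both. *)
Definition alpha (xi : C) : C := 2 * xi.
Definition rho (xi : C) : C := alpha xi / 2.

Inductive dahaGen := GenS | GenXi of C.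

Section Daha.
Variable k : C.

Local Notation gs := (Gen GenS : word C dahaGen).
Local Notation gxi := (fun xi : C => Gen (GenXi xi) : word C dahaGen).

Inductive dahaRel : word C dahaGen -> word C dahaGen -> Prop :=
| daha_ss : dahaRel (Mul gs gs) (Cst 1)
| daha_linear a xi eta :
    dahaRel (gxi (a * xi + eta)) (Add (Mul (Cst a) (gxi xi)) (gxi eta))
| daha_comm xi eta : dahaRel (Mul (gxi xi) (gxi eta)) (Mul (gxi eta) (gxi xi))
| daha_cross xi :
    dahaRel (Mul gs (gxi xi)) (Add (Mul (gxi (- xi)) gs) (Cst (- (k * alpha xi)))).

Definition Hk := presented dahaRel.

Definition sH : Hk := pgen dahaRel GenS.
Definition xiH (xi : C) : Hk := pgen dahaRel (GenXi xi).

(* Sh = C['X] with 'X = alpha^vee, and W acts on it by 'X |-> - 'X. *)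
Definition Sh_embed (p : {poly C}) : Hk :=
  \sum_(i < size p) pcst dahaRel p`_i * xiH 1 ^+ i.

(* The character of Sh^W (x) CW defining K_theta, for theta = W.lambda. *)
Inductive covariant_char (lambda : C) : Hk -> C -> Prop :=
| covariant_s : covariant_char lambda sH 1
| covariant_p (p : {poly C}) : p \Po (- 'X) = p ->
    covariant_char lambda (Sh_embed p) p.[lambda].

Definition Ktheta (lambda : C) : lmodType C := Ind (covariant_char lambda).

End Daha.

Section KZ.
Variables (k lambda : C).
Local Notation K := (Ktheta k lambda).

Definition s_act (v : K) : K := iact (sH k) v.
Definition xi_act (xi : C) (v : K) : K := iact (xiH k xi) v.

(* K is finite-dimensional without a preferred basis: f is complex
   differentiable at x if, near x, it is a finite combination of fixed vectors
   with coefficients that are differentiable at x. *)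
Definition is_deriv (f : C -> K) (x : C) (df : K) : Prop :=
  exists n (c : 'I_n -> Ctop -> Ctop) (dc : 'I_n -> Ctop) (v : 'I_n -> K),
    [/\ \forall y \near (x : Ctop), f y = \sum_i (c i y : C) *: v i,
        forall i, is_derive (x : Ctop) 1 (c i) (dc i)
      & df = \sum_i (dc i : C) *: v i].

Definition Hreg (x : C) : Prop := [/\ x != 0, x != 1 & x != - 1].

(* In the coordinate x = e^rho of H the translation-invariant vector field xi
   is rho(xi) x d/dx, and e^{-alpha} = x^-2. *)
Definition nabla (xi x : C) (fx dfx : K) : K :=
  (rho xi * x) *: dfx
  - (k * alpha xi / (1 - x ^- 2)) *: (fx - s_act fx)
  + (k / 2 * alpha xi) *: fx + xi_act xi fx.

Definition horizontal_at (f : C -> K) (x : C) : Prop :=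
  exists2 df, is_deriv f x df & forall xi, nabla xi x (f x) df = 0.

Definition horizontal_near (f : C -> K) (x : C) : Prop :=
  \forall y \near (x : Ctop), Hreg y /\ horizontal_at f y.

Definition eq_near (x : C) (f g : C -> K) : Prop :=
  \forall y \near (x : Ctop), f y = g y.

(* The germ of g at gamma(1) is the analytic continuation of the germ of f at
   gamma(0) along gamma : [0, 1] -> H_reg, through horizontal sections. *)
Definition continuation (gamma : R -> C) (f g : C -> K) : Prop :=
  {within `[0, 1], continuous (gamma : R -> Ctop)} /\
  exists F : R -> C -> K,
    [/\ forall t : R, 0 <= t <= 1 -> horizontal_near (F t) (gamma t),
        forall t : R, 0 <= t <= 1 -> \forall u \near t,
          0 <= u <= 1 -> eq_near (gamma u) (F u) (F t),
        eq_near (gamma 0) (F 0) f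
      & eq_near (gamma 1) (F 1) g].

(* The path from Z0 to its image Z0^-1 under s in the coordinate Z, straight
   except for the positively oriented half circle of radius eps around 1. *)
Definition pathZ (Z0 eps t : R) : C :=
  if t <= 3^-1 then (Z0 + 3 * t * (1 - eps - Z0))%:C%C
  else if t <= 2 / 3 then 1 + eps%:C%C * expC (piI * (3 * t)%:C%C)
  else (1 + eps + (3 * t - 2) * (Z0^-1 - (1 + eps)))%:C%C.

Variables (x0 eps : R).
Local Notation b := (x0%:C%C : C).

(* The path in T_reg is lifted to H_reg; s then sends a germ g at b^-1 to the
   germ s.g(y^-1) at b. *)
Definition T_monodromy (f h : C -> K) : Prop :=
  exists gamma g,
    [/\ forall t : R, 0 <= t <= 1 -> gamma t ^+ 2 = pathZ (x0 ^+ 2) eps t,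
        gamma 0 = b, gamma 1 = b^-1, continuation gamma f g
      & eq_near b h (fun y => s_act (g y^-1))].

Definition Omega_monodromy (f h : C -> K) : Prop :=
  exists2 g,
    continuation (fun a : R => expC (piI * a%:C%C) * b) f g
  & eq_near b h (fun y => expC (piI * k) *: g (- y)).

(* C-linear spaces with two operators, the actions of T and Y. *)
Record TYrep := {
  TYspace :> lmodType C;
  TYop_T : TYspace -> TYspace;
  TYop_Y : TYspace -> TYspace }.

(* V is isomorphic, through Phi, to the stalk at b of the local system of
   horizontal sections.  In the cross relation TY - Y^-1 T = (1 - q) Y the
   operator [Omega_monodromy] has to be taken as the action of Y^-1: on the
   quotient of K where s = 1 the constant sections are horizontal when
   lambda^2 = k^2, so that T = 1 and [Omega_monodromy] = e^{pi i k} there,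
   while T = 1 forces Y^2 = q^-1 = e^{- 2 pi i k}. *)
Definition monodromy_iso (V : TYrep) : Prop :=
  exists Phi : V -> C -> K,
    [/\ forall v, horizontal_near (Phi v) b,
        forall a u v, eq_near b (Phi (a *: u + v))
                                (fun y => a *: Phi u y + Phi v y),
        (forall v, eq_near b (Phi v) (fun=> 0) -> v = 0) /\
        (forall f, horizontal_near f b -> exists v, eq_near b (Phi v) f),
        forall v, T_monodromy (Phi v) (Phi (TYop_T v))
      & forall v, Omega_monodromy (Phi (TYop_Y v)) (Phi v)].

End KZ.

Inductive heckeGen := GT | GTi | GY | GYi.

Section Hecke.
Variable q : C.

Local Notation wd g := (Gen g : word C heckeGen).

Inductive heckeRel : word C heckeGen -> word C heckeGen -> Prop :=
| hecke_TTi : heckeRel (Mul (wd GT) (wd GTi)) (Cst 1)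
| hecke_TiT : heckeRel (Mul (wd GTi) (wd GT)) (Cst 1)
| hecke_YYi : heckeRel (Mul (wd GY) (wd GYi)) (Cst 1)
| hecke_YiY : heckeRel (Mul (wd GYi) (wd GY)) (Cst 1)
| hecke_quad :
    heckeRel (Mul (Add (wd GT) (Cst (- 1))) (Add (wd GT) (Cst q))) (Cst 0)
| hecke_cross :
    heckeRel (Mul (wd GT) (wd GY))
             (Add (Mul (wd GYi) (wd GT)) (Mul (Cst (1 - q)) (wd GY))).

Definition Hext := presented heckeRel.

Definition hT : Hext := pgen heckeRel GT.
Definition hY : Hext := pgen heckeRel GY.
Definition hYi : Hext := pgen heckeRel GYi.

Definition indTY (D : Hext -> C -> Prop) : TYrep :=
  {| TYspace := Ind D; TYop_T := iact hT; TYop_Y := iact hY |}.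

Inductive central_char (t Lambda : C) : Hext -> C -> Prop :=
| central_T : central_char t Lambda hT t
| central_Y : central_char t Lambda (hY + hYi) (Lambda + Lambda^-1).

Definition KTheta (Lambda : C) : TYrep := indTY (central_char 1 Lambda).
Definition KTheta_minus (Lambda : C) : TYrep :=
  indTY (central_char (- q) Lambda).

Inductive Y_char (mu : C) : Hext -> C -> Prop :=
| Y_char_Y : Y_char mu hY mu
| Y_char_Yi : Y_char mu hYi mu^-1.

Definition Iind (mu : C) : TYrep := indTY (Y_char mu).

End Hecke.

(* For Lambda = e^{pi i lambda} the point opposite to Lambda in the torus, i.e.
   its image e^{pi i (-lambda)} under s, is Lambda^-1; it differs from the
   negative of the complex number Lambda unless Lambda^2 = -1.  As Omega acts
   on the stalk with eigenvalues Lambda and Lambda^-1, it is the one that occurs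
   in the monodromy. *)
Definition onedim (y t : C) : TYrep :=
  {| TYspace := C^o; TYop_T := fun z : C^o => t *: z;
     TYop_Y := fun z : C^o => y *: z |}.

Definition dsum (V W : TYrep) : TYrep :=
  {| TYspace := (V * W)%type;
     TYop_T := fun z : V * W => (TYop_T z.1, TYop_T z.2);
     TYop_Y := fun z : V * W => (TYop_Y z.1, TYop_Y z.2) |}.

Definition is_int (z : C) : Prop := exists m : int, z = m%:~R.
Definition is_halfint (z : C) : Prop := exists m : int, z = 2^-1 + m%:~R.
Definition is_posint (z : C) : Prop := exists n : nat, z = n.+1%:R.

(* In cases 1 and 2 the numbers k and 1 - k are real, hence comparable in the
   partial order of R[i]. *)
Definition case1 (k lambda : C) : Prop :=
  [/\ is_int lambda, is_int k & Num.max k (1 - k) <= `|lambda|].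
Definition case2 (k lambda : C) : Prop :=
  [/\ is_halfint lambda, is_halfint k & Num.max k (1 - k) <= `|lambda|].
Definition case3 (k lambda : C) : Prop :=
  [/\ is_posint (k + lambda) \/ is_posint (k - lambda),
      ~ is_halfint lambda & ~ case1 k lambda].

End Rank1.

(* Main.v *)
Require Import Defs.
From mathcomp Require Import all_boot all_order all_algebra.
From mathcomp Require Import all_classical all_reals all_analysis.
From mathcomp Require Import complex ring lra zify.
Import Order.TTheory GRing.Theory Num.Theory numFieldNormedType.Exports.
Set Implicit Arguments. Unset Strict Implicit. Unset Printing Implicit Defensive.
Local Open Scope classical_set_scope.
Local Open Scope ring_scope.

(** In the basis u_+ = v, u_- = (alpha^vee + k s) v of the covariant
    representation and the coordinate z = log x, a section f = a u_+ + b u_-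
    is horizontal iff a' = - (lam^2 - k^2) b and b' = 2 k coth(z) b - a.  The
    equation is invariant under z |-> z + pi i and under z |-> - z (with b |->
    - b), so solutions on a cut strip, identified with their value at pi i /
    2, carry the half-turn matrix P, and T = diag(1, -1) P, Y = e^{- pi i k}
    P.  The Wronskian gives det P = q, a solution regular at z = 0 gives P_11
    - P_22 = 1 - q, and the Frobenius solution with leading exponent lam - k
    at z = - oo gives tr P = e^{pi i k} (Lambda + Lambda^{-1}).  The
    isomorphism class is therefore decided by the generator of the induced
    module: K(Theta), K(Theta)^- or I(Lambda^{-1}) occurs as soon as the
    matching eigenvector of T or Y is not a common eigenvector of T and Y.

    A common eigenvector with T = 1 that is regular at 0 forces k + lam or
    k - lam to be a positive integer.  For lam not an integer such a solution is a
    Frobenius solution whose boundary values on the circle |x| = 1 satisfy a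
    reflection symmetry incompatible with its Fourier frequencies; for lam an
    integer a monotone energy on the circle must vanish.  In the remaining
    cases the Frobenius series terminates, which makes P diagonal or scalar,
    or converges absolutely on |x| = 1, or one passes from k to 1 - k by a
    gauge transformation under which P is multiplied by - q. *)

(** * Complex differentiation, logarithm and power series *)

(** The class cannot be read off from q and Lambda: the scalar identities fix P_11, P_22 and the
    product P_12 P_21, and when this product is 0 it still matters which factor vanishes. Instead of
    connection coefficients with Gamma functions, the proof studies a hypothetical common
    eigenvector. It is symmetric up to sign under z |-> pi i - z and, at the same time, has a pure
    exponent at z = - oo. On the segment from 0 to pi i, that is on |x| = 1, this symmetry exchanges
    nonnegative and nonpositive frequencies, which is the source of the contradiction. When the
    exponents lam and - lam are an integer apart, an eigenvector of P need not be a Frobenius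
    solution, and for this reason the energy takes over there. The series regular at z = 0 breaks
    down for k = 3/2, 5/2, ...; passing to 1 - k closes this gap. Each induced module is spanned by
    two vectors, so a vector with the right eigenvalue gives an isomorphism as soon as it is
    independent of its image under the other generator. *)

Section ComplexDerivative.
Variable R : realType.
Local Notation C := (R[i]).
Local Notation N := (@ComplexField.Normc.normc R).
Local Notation "x %:CC" := (real_complex R x) (at level 2, format "x %:CC").
Implicit Types (f g : C -> C) (z d : C).

Lemma N0 : N 0 = 0. Proof. exact: ComplexField.Normc.normc0. Qed.
Lemma N1 : N 1 = 1. Proof. exact: ComplexField.Normc.normc1. Qed.
Lemma N_eq0 z : N z = 0 -> z = 0. Proof. exact: ComplexField.Normc.eq0_normc. Qed.
Lemma NM z d : N (z * d) = N z * N d. Proof. exact: ComplexField.Normc.normcM. Qed.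
Lemma NV z : N z^-1 = (N z)^-1. Proof. exact: ComplexField.Normc.normcV. Qed.
Lemma NN z : N (- z) = N z. Proof. exact: normcN. Qed.
Lemma ND z d : N (z + d) <= N z + N d. Proof. exact: le_normcD. Qed.
Lemma NB z d : N (z - d) <= N z + N d. Proof. by rewrite -(NN d) ND. Qed.
Lemma NBC z d : N (z - d) = N (d - z). Proof. by rewrite -opprB NN. Qed.
Lemma N_ge0 z : 0 <= N z. Proof. by case: z => a b /=; exact: sqrtr_ge0. Qed.
Lemma N_gt0 z : (0 < N z) = (z != 0).
Proof.
rewrite lt_neqAle N_ge0 andbT eq_sym; congr (~~ _).
by apply/eqP/eqP => [/N_eq0//|->]; exact: N0.
Qed.
Lemma Nreal (x : R) : N x%:CC = `|x|.
Proof. by rewrite /= expr0n addr0 sqrtr_sqr. Qed.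
Lemma Ni : N 'i%C = 1.
Proof. by rewrite /= expr0n expr1n add0r sqrtr1. Qed.
Lemma NX z n : N (z ^+ n) = N z ^+ n.
Proof. by elim: n => [|n IH]; rewrite ?expr0 ?N1// !exprS NM IH. Qed.
Lemma Re_le_N z : `|complex.Re z| <= N z.
Proof.
case: z => a b /=; rewrite -sqrtr_sqr ler_sqrt ?addr_ge0 ?sqr_ge0//.
by rewrite lerDl sqr_ge0.
Qed.
Lemma Im_le_N z : `|complex.Im z| <= N z.
Proof.
case: z => a b /=; rewrite -sqrtr_sqr ler_sqrt ?addr_ge0 ?sqr_ge0//.
by rewrite lerDr sqr_ge0.
Qed.
Lemma N_le z : N z <= `|complex.Re z| + `|complex.Im z|.
Proof.
rewrite {1}[z]complexE (le_trans (ND _ _))// NM Ni mul1r !Nreal//.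
Qed.
Lemma NBD z d : N z - N d <= N (z + d).
Proof. by rewrite lerBlDr; have := NB (z + d) d; rewrite addrK. Qed.
Lemma N_sum (I : Type) (r : seq I) (F : I -> C) :
  N (\sum_(i <- r) F i) <= \sum_(i <- r) N (F i).
Proof.
elim/big_ind2 : _ => [|x1 x2 y1 y2 h1 h2|//]; first by rewrite N0.
by rewrite (le_trans (ND _ _))// lerD.
Qed.
Lemma N2 z : N z ^+ 2 = complex.Re z ^+ 2 + complex.Im z ^+ 2.
Proof. by case: z => a b /=; rewrite sqr_sqrtr// addr_ge0 ?sqr_ge0. Qed.
(** Real epsilon and delta, because the norm of [R[i]] itself takes complex values; [nbhsCP] relates
    this form to the filters in the definition of the monodromy. *)
Definition cont f z := forall e : R, 0 < e ->
  exists2 d : R, 0 < d & forall y, N (y - z) < d -> N (f y - f z) < e.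

Lemma cont_local f g z (r : R) : 0 < r -> (forall y, N (y - z) < r -> f y = g y) ->
  cont f z -> cont g z.
Proof.
move=> r0 fg cf e e0; have [d d0 h] := cf e e0.
exists (Num.min d r); first by rewrite lt_min d0.
by move=> y; rewrite lt_min => /andP[y1 y2]; rewrite -!fg ?subrr ?N0 ?h.
Qed.

Lemma cont_cst c z : cont (fun=> c) z.
Proof. by move=> e e0; exists 1 => // y _; rewrite subrr N0. Qed.

Lemma cont_id z : cont id z.
Proof. by move=> e e0; exists e. Qed.

Lemma contD f g z : cont f z -> cont g z -> cont (fun y => f y + g y) z.
Proof.
move=> cf cg e e0; have e2 : 0 < e / 2 by rewrite divr_gt0.
have [d d0 hd] := cf _ e2; have [d' d0' hd'] := cg _ e2.
exists (Num.min d d'); first by rewrite lt_min d0.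
move=> y; rewrite lt_min => /andP[/hd h1 /hd' h2].
rewrite opprD addrACA (le_lt_trans (ND _ _))// (splitr e) ltrD//.
Qed.

Lemma contM f g z : cont f z -> cont g z -> cont (fun y => f y * g y) z.
Proof.
move=> cf cg e e0.
pose M := N (f z) + N (g z) + 1.
have M0 : 0 < M by rewrite ltr_wpDl// addr_ge0// N_ge0.
have e2 : 0 < Num.min 1 (e / 2 / M) by rewrite lt_min ltr01 !divr_gt0.
have [d d0 hd] := cf _ e2; have [d' d0' hd'] := cg _ e2.
exists (Num.min d d'); first by rewrite lt_min d0.
move=> y; rewrite lt_min => /andP[/hd h1 /hd' h2].
move: h1 h2; rewrite !lt_min => /andP[h1 h1'] /andP[h2 h2'].
have -> : f y * g y - f z * g z = (f y - f z) * g y + f z * (g y - g z) by ring.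
rewrite (le_lt_trans (ND _ _))// (splitr e) !NM.
have gy : N (g y) <= M.
  rewrite -[g y](subrK (g z)) (le_trans (ND _ _))// /M.
  have := N_ge0 (f z); lra.
have fz : N (f z) < M by have := N_ge0 (g z); rewrite /M; lra.
apply: ltr_leD.
  have [->|gy0] := eqVneq (N (g y)) 0; first by rewrite mulr0 divr_gt0.
  rewrite (@lt_le_trans _ _ (e / 2 / M * N (g y)))// ?ltr_pM2r//.
    by rewrite lt_neqAle eq_sym gy0 N_ge0.
  by rewrite -[leRHS](divfK (lt0r_neq0 M0)) ler_wpM2l// ltW// !divr_gt0.
rewrite -[leRHS](divfK (lt0r_neq0 M0)) mulrC ler_pM// ?N_ge0// ltW//.
Qed.

Lemma contN f z : cont f z -> cont (fun y => - f y) z.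
Proof.
move=> cf; have := contM (@cont_cst (-1) z) cf.
by apply: (@cont_local _ _ _ 1) => // y _; rewrite mulN1r.
Qed.

Lemma contB f g z : cont f z -> cont g z -> cont (fun y => f y - g y) z.
Proof. by move=> cf cg; apply: contD => //; exact: contN. Qed.

Lemma contV f z : f z != 0 -> cont f z -> cont (fun y => (f y)^-1) z.
Proof.
move=> fz cf e e0; set m := N (f z); have m0 : 0 < m by rewrite N_gt0.
have e2 : 0 < Num.min (m / 2) (e * (m / 2) * m) by rewrite lt_min !mulr_gt0 ?invr_gt0.
have [d d0 hd] := cf _ e2; exists d => // y /hd; rewrite lt_min => /andP[h1 h2].
have fy : m / 2 < N (f y).
  have := NBD (f z) (f y - f z); rewrite [f z + _]addrC subrK -/m; lra.
have fy0 : 0 < N (f y) by rewrite (lt_trans _ fy)// divr_gt0.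
have fyn : f y != 0 by rewrite -N_gt0.
have -> : (f y)^-1 - (f z)^-1 = - ((f y - f z) * ((f y)^-1 * (f z)^-1)).
  by field; rewrite fz fyn.
rewrite NN !NM !NV -/m -invfM ltr_pdivrMr ?mulr_gt0//.
rewrite (lt_le_trans h2)// -mulrA ler_pM2l// ler_pM2r// ltW//.
Qed.

Lemma cont_comp f g z : cont g z -> cont f (g z) -> cont (fun y => f (g y)) z.
Proof.
move=> cg cf e e0; have [d d0 hd] := cf _ e0; have [d' d0' hd'] := cg _ d0.
by exists d' => // y /hd'/hd.
Qed.

(* Caratheodory's form of differentiability, in terms of the real-valued norm N;
   it is compared with [is_derive] on [R[i]^o] in [is_derive_cder]. *)
Definition cder f z d := exists phi : C -> C,
  [/\ phi z = d, cont phi z & forall y, f y - f z = phi y * (y - z)].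

Lemma cder_eq f z d d' : cder f z d -> d = d' -> cder f z d'.
Proof. by move=> h <-. Qed.

Lemma cder_cont f z d : cder f z d -> cont f z.
Proof.
move=> [phi [_ cphi h]].
have : cont (fun y => f z + phi y * (y - z)) z.
  apply: contD; first exact: cont_cst.
  by apply: contM => //; apply: contB; [exact: cont_id|exact: cont_cst].
by apply: (@cont_local _ _ _ 1) => // y _; rewrite -h addrC subrK.
Qed.

Lemma cder_local f g z d (r : R) : 0 < r -> (forall y, N (y - z) < r -> f y = g y) ->
  cder f z d -> cder g z d.
Proof.
move=> r0 fg [phi [pz cphi h]].
exists (fun y => if y == z then d else (g y - g z) / (y - z)); split => //.
- by rewrite eqxx.
- apply: (@cont_local phi _ _ r) => // y yr; case: eqVneq => [->//|yz].
  by rewrite -!fg ?subrr ?N0// h mulfK// subr_eq0.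
- move=> y; case: eqVneq => [->|yz]; first by rewrite !subrr mulr0.
  by rewrite divfK// subr_eq0.
Qed.

Lemma cder_ext f g z d : (forall y, f y = g y) -> cder f z d -> cder g z d.
Proof. by move=> fg; apply: (@cder_local _ _ _ _ 1). Qed.

Lemma cder_cst c z : cder (fun=> c) z 0.
Proof.
by exists (fun=> 0); split => // [|y]; [exact: cont_cst|rewrite subrr mul0r].
Qed.

Lemma cder_id z : cder id z 1.
Proof. by exists (fun=> 1); split => // [|y]; [exact: cont_cst|rewrite mul1r]. Qed.

Lemma cderD f g z d d' : cder f z d -> cder g z d' ->
  cder (fun y => f y + g y) z (d + d').
Proof.
move=> [p [<- cp hp]] [p' [<- cp' hp']]; exists (fun y => p y + p' y); split => //.
  exact: contD.
by move=> y; rewrite mulrDl -hp -hp'; ring.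
Qed.

Lemma cderM f g z d d' : cder f z d -> cder g z d' ->
  cder (fun y => f y * g y) z (d * g z + f z * d').
Proof.
move=> [p [<- cp hp]] cg; have := cder_cont cg.
case: cg => [p' [<- cp' hp']] cg.
exists (fun y => p y * g y + f z * p' y); split => //.
  by apply: contD; apply: contM => //; exact: cont_cst.
by move=> y; rewrite mulrDl mulrAC -hp -mulrA -hp'; ring.
Qed.

Lemma cderZ c f z d : cder f z d -> cder (fun y => c * f y) z (c * d).
Proof.
by move=> h; apply: cder_eq (cderM (cder_cst c z) h) _; rewrite mul0r add0r.
Qed.

Lemma cderN f z d : cder f z d -> cder (fun y => - f y) z (- d).
Proof.
move=> h; apply: (@cder_ext (fun y => -1 * f y)) => [y|]; first by rewrite mulN1r.
by apply: cder_eq (cderZ (-1) h) _; rewrite mulN1r.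
Qed.

Lemma cderB f g z d d' : cder f z d -> cder g z d' ->
  cder (fun y => f y - g y) z (d - d').
Proof. by move=> cf cg; apply: cderD => //; exact: cderN. Qed.

Lemma cder_comp f g z d d' : cder f (g z) d -> cder g z d' ->
  cder (fun y => f (g y)) z (d * d').
Proof.
move=> [p [<- cp hp]] cg; have := cder_cont cg.
case: cg => [p' [<- cp' hp']] cg.
exists (fun y => p (g y) * p' y); split => //.
  by apply: contM => //; exact: cont_comp.
by move=> y; rewrite -mulrA -hp' hp.
Qed.

Lemma cderV f z d : f z != 0 -> cder f z d ->
  cder (fun y => (f y)^-1) z (- d / f z ^+ 2).
Proof.
move=> fz cf; have cfz := cder_cont cf.
have [r r0 hr] := cfz (N (f z)) (ltac:(by rewrite N_gt0)).
have fy0 y : N (y - z) < r -> f y != 0.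
  move=> /hr; apply: contraTneq => ->; by rewrite sub0r NN ltxx.
case: cf => [p [<- cp hp]].
have h0 : cder (fun y => if N (y - z) < r then (f y)^-1 else (f z)^-1 +
   - p y * (y - z) / f z / f y) z (- p z / f z ^+ 2).
  exists (fun y => - p y / f z / f y); split => //.
  - by rewrite expr2 invfM !mulrA.
  - apply: contM; last exact: contV.
    by apply: contM; [exact: contN|exact: cont_cst].
  - move=> y; rewrite subrr N0 r0; case: ifPn => yr; last by ring.
    have -> : - p y / f z / f y * (y - z) = - (p y * (y - z)) / f z / f y by ring.
    by rewrite -hp; field; rewrite fz fy0.
by apply: (cder_local r0) h0 => y ->.
Qed.

Lemma cder_div f g z d d' : g z != 0 -> cder f z d -> cder g z d' ->
  cder (fun y => f y / g y) z ((d * g z - f z * d') / g z ^+ 2).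
Proof.
move=> gz cf cg; apply: cder_eq (cderM cf (cderV gz cg)) _.
by field.
Qed.

Lemma cder_exprn f z d n : cder f z d ->
  cder (fun y => f y ^+ n) z (n%:R * f z ^+ n.-1 * d).
Proof.
move=> cf; elim: n => [|n IH].
  by rewrite !mul0r; apply: cder_ext (cder_cst 1 z) => y; rewrite expr0.
apply: (@cder_ext (fun y => f y * f y ^+ n)) => [y|]; first by rewrite exprS.
apply: cder_eq (cderM cf IH) _; rewrite /=.
case: n {IH} => [|n]; first by rewrite expr0; ring.
by rewrite /= -[n.+2]addn1 natrD exprS; ring.
Qed.

(** Componentwise, so that the real mean value theorem applies along segments. *)
Definition rder (g : R -> C) (t : R) (v : C) :=
  is_derive t 1 (fun u => complex.Re (g u)) (complex.Re v) /\
  is_derive t 1 (fun u => complex.Im (g u)) (complex.Im v).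

Lemma is_deriveP (f : R -> R) (x d : R) :
  is_derive x 1 f d <-> forall e : R, 0 < e -> exists2 r : R, 0 < r &
    forall h, h != 0 -> `|h| < r -> `|(f (x + h) - f x) / h - d| < e.
Proof.
split.
  case=> df fd e e0.
  move/cvgrPdist_lt : df => /(_ e e0); rewrite -[lim _]/('D_1 f x) fd.
  move=> [r /= r0 hr]; exists r => // h h0 hr'.
  have := hr h; rewrite /ball_ /= sub0r normrN => /(_ hr' h0).
  by rewrite distrC /GRing.scale /= mulr1 (addrC h) mulrC.
move=> H; have cv : (h^-1 *: (f (h *: 1 + x) - f x)) @[h --> 0^'] --> d.
  apply/cvgrPdist_lt => e e0; have [r r0 hr] := H e e0.
  exists r => //= h; rewrite /ball_ /= sub0r normrN => hr' h0.
  by rewrite distrC /GRing.scale /= mulr1 (addrC h) mulrC; exact: hr.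
apply: DeriveDef; first by apply/cvg_ex; exists d.
by rewrite /derive; apply/cvg_lim => //; exact: cv.
Qed.

Lemma cder_line f (p w d : C) (t : R) : cder f (p + t%:CC * w) d ->
  rder (fun u => f (p + u%:CC * w)) t (d * w).
Proof.
move=> [phi [<- cphi h]].
have key e : 0 < e -> exists2 r : R, 0 < r &
    forall h, h != 0 -> `|h| < r ->
    N ((f (p + (t + h)%:CC * w) - f (p + t%:CC * w)) * (h^-1)%:CC -
       phi (p + t%:CC * w) * w) < e.
  move=> e0; have [|r r0 hr] := cphi (e / (N w + 1)).
    by rewrite divr_gt0// ltr_wpDl// N_ge0.
  have w0 : 0 < N w + 1 by rewrite ltr_wpDl// N_ge0.
  exists (r / (N w + 1)); first by rewrite divr_gt0.
  move=> s s0 sr; rewrite h.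
  have E : p + (t + s)%:CC * w - (p + t%:CC * w) = s%:CC * w.
    by rewrite rmorphD/=; ring.
  rewrite E.
  have -> : forall a b : C, a * (s%:CC * w) * (s^-1)%:CC - b * w = (a - b) * w.
    move=> a b; have -> : a * (s%:CC * w) * (s^-1)%:CC = a * w * (s%:CC * (s^-1)%:CC) by ring.
    by rewrite -rmorphM/= divff// rmorph1 mulr1; ring.
  rewrite NM.
  have := hr (p + (t + s)%:CC * w); rewrite E NM Nreal.
  have h1 : `|s| * N w < r.
    rewrite (@le_lt_trans _ _ (`|s| * (N w + 1)))//.
      by rewrite ler_wpM2l// lerDl.
    by rewrite -ltr_pdivlMr.
  move=> /(_ h1) h2.
  rewrite (@le_lt_trans _ _ (e / (N w + 1) * N w))//.
    by rewrite ler_wpM2r ?N_ge0// ltW.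
  rewrite mulrAC ltr_pdivrMr// ltr_pM2l//; lra.
split; apply/is_deriveP => e e0; have [r r0 hr] := key e e0; exists r => // s s0 sr.
  apply: le_lt_trans (hr s s0 sr); apply: le_trans (Re_le_N _).
  rewrite le_eqVlt; apply/orP; left; apply/eqP; congr `|_|.
  case: (f (p + (t + s)%:CC * w)) => a b; case: (f (p + t%:CC * w)) => a' b'.
  case: (phi _ * w) => a'' b'' /=; ring.
apply: le_lt_trans (hr s s0 sr); apply: le_trans (Im_le_N _).
rewrite le_eqVlt; apply/orP; left; apply/eqP; congr `|_|.
case: (f (p + (t + s)%:CC * w)) => a b; case: (f (p + t%:CC * w)) => a' b'.
case: (phi _ * w) => a'' b'' /=; ring.
Qed.

End ComplexDerivative.

(** * The complex exponential *)

Section ComplexExponential.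
Variable R : realType.
Local Notation C := (R[i]).
Local Notation N := (@ComplexField.Normc.normc R).
Local Notation "x %:CC" := (real_complex R x) (at level 2, format "x %:CC").
Implicit Types (z w : C).

Lemma cder_intro_local (f phi : C -> C) z (r : R) : 0 < r -> cont phi z ->
  (forall y, N (y - z) < r -> f y - f z = phi y * (y - z)) -> cder f z (phi z).
Proof.
move=> r0 cphi h.
apply: (@cder_local _ (fun y => f z + phi y * (y - z)) _ _ _ r) => //.
  by move=> y /h <-; rewrite addrC subrK.
exists phi; split => // y; rewrite subrr mulr0; ring.
Qed.

Lemma expC0 : expC (0 : C) = 1.
Proof. by rewrite /expC /= expR0 cos0 sin0 mul1r. Qed.

Lemma expCD z w : expC (z + w) = expC z * expC w.
Proof.
case: z => a b; case: w => c d; rewrite /expC /= expRD cosD sinD.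
apply/eqP; rewrite eq_complex /=; apply/andP; split; apply/eqP; ring.
Qed.

Lemma N_expC z : N (expC z) = expR (complex.Re z).
Proof.
rewrite /expC NM Nreal ger0_norm ?expR_ge0// /=.
by rewrite cos2Dsin2 sqrtr1 mulr1.
Qed.

Lemma expC_neq0 z : expC z != 0.
Proof. by rewrite -N_gt0 N_expC expR_gt0. Qed.

Lemma expCN z : expC (- z) = (expC z)^-1.
Proof.
apply: (mulfI (expC_neq0 z)); rewrite -expCD subrr expC0 divff//.
exact: expC_neq0.
Qed.

Lemma expCB z w : expC (z - w) = expC z / expC w.
Proof. by rewrite expCD expCN. Qed.

Lemma expCMn z n : expC (n%:R * z) = expC z ^+ n.
Proof.
elim: n => [|n IH]; first by rewrite mul0r expC0 expr0.
by rewrite -natr1 mulrDl mul1r expCD IH exprSr.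
Qed.

Lemma expC_real (x : R) : expC x%:CC = (expR x)%:CC.
Proof. by rewrite /expC /= cos0 sin0 mulr1. Qed.

Lemma Re_expC z : complex.Re (expC z) = expR (complex.Re z) * cos (complex.Im z).
Proof. by rewrite /expC /=; ring. Qed.
Lemma Im_expC z : complex.Im (expC z) = expR (complex.Re z) * sin (complex.Im z).
Proof. by rewrite /expC /=; ring. Qed.

Lemma expC_piI : expC (piI R) = -1.
Proof.
rewrite /expC /piI /=.
rewrite !(mul0r, mul1r, mulr0, subr0, add0r, addr0, expR0, cospi, sinpi).
by apply/eqP; rewrite eq_complex /=; apply/andP; split; apply/eqP; rewrite ?oppr0 ?expR0; ring.
Qed.

Lemma expC_2piI : expC (2 * piI R) = 1.
Proof. by rewrite (expCMn _ 2) expC_piI sqrrN expr1n. Qed.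

Lemma expC_2piIn n : expC (2 * piI R * n%:R) = 1.
Proof. by rewrite mulrC expCMn expC_2piI expr1n. Qed.

Lemma expC_piIint (m : int) : expC (piI R * m%:~R) ^+ 2 = 1.
Proof.
rewrite -expCMn mulrA; case: m => n; first exact: expC_2piIn.
by rewrite NegzE mulrNz mulrN expCN (expC_2piIn n.+1) invr1.
Qed.

(** As cos x = 1 - 2 sin^2(x/2), the half angle has sine 0, while sin is positive on (0, pi). *)
Lemma cos_eq1 (x : R) : `|x| < 2 * pi -> cos x = 1 -> x = 0.
Proof.
wlog x0 : x / 0 <= x => [hw|].
  have [/hw//|/ltW x0] := leP 0 x; rewrite -normrN -cosN => h1 h2.
  by apply/eqP; rewrite -oppr_eq0; apply/eqP; apply: hw => //; rewrite oppr_ge0.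
rewrite ger0_norm// => xpi.
have := cosD (x / 2) (x / 2); rewrite -splitr => -> h.
have s0 : sin (x / 2) = 0.
  have := cos2Dsin2 (x / 2) => h'; apply/eqP; rewrite -sqrf_eq0; apply/eqP.
  by rewrite !expr2 in h' *; lra.
have [//|xn0] := eqVneq x 0.
have : 0 < sin (x / 2) by have xp : 0 < x; [rewrite lt_neqAle eq_sym xn0|apply: sin_gt0_pi; lra].
by rewrite s0 ltxx.
Qed.

Lemma expC_eq1 z : expC z = 1 -> `|complex.Im z| < 2 * pi -> z = 0.
Proof.
move=> h hz; have : complex.Re z = 0.
  have : N (expC z) = 1 by rewrite h N1.
  by rewrite N_expC => /(congr1 (@ln R)); rewrite expRK ln1.
move=> re0; have : cos (complex.Im z) = 1.
  by have := Re_expC z; rewrite h re0 expR0 mul1r.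
by move=> /(cos_eq1 hz); case: z re0 {h hz} => a b /= -> ->.
Qed.

Lemma expC_inj z w : expC z = expC w -> `|complex.Im z - complex.Im w| < 2 * pi -> z = w.
Proof.
move=> h hz; apply/eqP; rewrite -subr_eq0; apply/eqP; apply: expC_eq1.
  by rewrite expCB h divff// expC_neq0.
by case: z w hz {h} => a b [c d].
Qed.

(** The derivative at 0 comes from the difference quotients of [expR], [cos] and [sin] at 0; the
    functional equation moves it to z. *)
Lemma cder_expC z : cder (@expC R) z (expC z).
Proof.
pose q (f : R -> R) (x : R) (d : R) := if x == 0 then d else (f x - f 0) / x.
have qP (f : R -> R) (d : R) : is_derive (0 : R) (1 : R) f d -> forall e : R, 0 < e ->
   exists2 r : R, 0 < r & forall x, `|x| < r -> `|q f x d - d| < e.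
  move=> /is_deriveP fd e e0; have [r r0 hr] := fd e e0; exists r => // x xr.
  rewrite /q; case: eqVneq => [_|x0]; first by rewrite subrr normr0.
  by have := hr x x0 xr; rewrite add0r.
have qE (f : R -> R) d x : f x = f 0 + x * q f x d.
  rewrite /q; case: eqVneq => [->|x0]; first by rewrite mul0r addr0.
  by rewrite mulrC divfK// addrC subrK.
have hE := qP _ _ (is_derive_expR (0 : R)); rewrite expR0 in hE.
have hC := qP _ _ (is_derive_cos (0 : R)); rewrite sin0 oppr0 in hC.
have hS := qP _ _ (is_derive_sin (0 : R)); rewrite cos0 in hS.
have hx : forall e : R, 0 < e ->
   exists2 r : R, 0 < r & forall x, `|x| < r -> `|expR x - 1| < e.
  move=> e e0; have [|r r0 hr] := hE 1; first by [].
  exists (Num.min r (e / 2)); first by rewrite lt_min r0 divr_gt0.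
  move=> x; rewrite lt_min => /andP[/hr h1 h2].
  rewrite (qE expR 1 x) expR0 addrAC subrr add0r normrM.
  have : `|q expR x 1| <= 2 by have := ler_normD (q expR x 1 - 1) 1; rewrite subrK normr1; lra.
  move=> h3; rewrite (le_lt_trans (ler_pM (normr_ge0 _) (normr_ge0 _) (lexx _) h3))//.
  by rewrite -ltr_pdivlMr.
have key : cder (@expC R) 0 1.
  pose psi y := if y == 0 then 1 else (expC y - 1) / y : C.
  have -> : 1 = psi 0 by rewrite /psi eqxx.
  apply: (@cder_intro_local _ psi _ 1) => //; last first.
    move=> y _; rewrite expC0 subr0 /psi; case: eqVneq => [->|y0].
      by rewrite expC0 subrr mulr0.
    by rewrite divfK.
  (* With e/8 the bounds [B1], [B2], [B3] below add up to 3/4 of e times N y. *)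
  move=> e e0; have e4 : 0 < Num.min 1 (e / 8) by rewrite lt_min divr_gt0// ltr01.
  have [r1 r10 h1] := hE _ e4; have [r2 r20 h2] := hC _ e4.
  have [r3 r30 h3] := hS _ e4; have [r4 r40 h4] := hx _ e4.
  exists (Num.min (Num.min r1 r2) (Num.min r3 (Num.min r4 1))).
    by rewrite !lt_min r10 r20 r30 r40 ltr01.
  move=> y; rewrite subr0 !lt_min -!andbA => /and5P[y1 y2 y3 y4 y5].
  rewrite /psi eqxx; case: eqVneq => [_|y0]; first by rewrite subrr N0.
  set a := complex.Re y; set b := complex.Im y.
  have ay := Re_le_N y; have by' := Im_le_N y; rewrite -/a -/b in ay by'.
  have := h1 a (le_lt_trans ay y1); have := h2 b (le_lt_trans by' y2).
  have := h3 b (le_lt_trans by' y3); have := h4 a (le_lt_trans ay y4).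
  set E := q expR a 1; set c := q cos b 0; set s := q sin b 1.
  rewrite !lt_min subr0 => /andP[ea1 ea] /andP[s1 sa] /andP[c1 ca] /andP[E1 Ea].
  have -> : (expC y - 1) / y - 1 = (expC y - 1 - y) / y by field.
  rewrite NM NV ltr_pdivrMr ?N_gt0//.
  have -> : expC y - 1 - y = Complex (a * (E * cos b - 1) + b * c) (b * (expR a * s - 1)).
    have -> : y = Complex a b by rewrite /a /b; case: (y).
    rewrite /expC /= (qE expR 1 a) (qE cos 0 b) (qE sin 1 b) -/E -/c -/s expR0 cos0 sin0.
    apply/eqP; rewrite eq_complex /=; apply/andP; split; apply/eqP; ring.
  rewrite (le_lt_trans (N_le _))//=.
  have cosb : `|cos b| <= 1 by rewrite ler_norml cos_geN1 cos_le1.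
  have Ny : 0 < N y by rewrite N_gt0.
  have cb1 : `|cos b - 1| <= e / 8.
    rewrite (qE cos 0 b) -/c cos0 addrAC subrr add0r normrM.
    by rewrite -[leRHS]mul1r ler_pM// ltW// (le_lt_trans by').
  have A1 : `|E * cos b - 1| <= e / 4.
    have -> : E * cos b - 1 = (E - 1) * cos b + (cos b - 1) by ring.
    rewrite (le_trans (ler_normD _ _))// normrM.
    have : `|E - 1| * `|cos b| <= e / 8 * 1 by rewrite ler_pM// ltW.
    lra.
  have A2 : `|expR a * s - 1| <= 3 * e / 8.
    have -> : expR a * s - 1 = expR a * (s - 1) + (expR a - 1) by ring.
    rewrite (le_trans (ler_normD _ _))// normrM.
    have : `|expR a| <= 2 by have := ler_normD (expR a - 1) 1; rewrite subrK normr1; lra.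
    move=> e2; have : `|expR a| * `|s - 1| <= 2 * (e / 8) by rewrite ler_pM// ltW.
    lra.
  have B1 : `|a * (E * cos b - 1)| <= N y * (e / 4) by rewrite normrM ler_pM.
  have B2 : `|b * c| <= N y * (e / 8) by rewrite normrM ler_pM// ltW.
  have B3 : `|b * (expR a * s - 1)| <= N y * (3 * e / 8) by rewrite normrM ler_pM.
  have := ler_normD (a * (E * cos b - 1)) (b * c).
  have := mulr_gt0 e0 Ny; lra.
pose f (y : C) := expC z * expC (y - z).
have : cder f z (expC z).
  apply: cder_eq (cderZ (expC z) (cder_comp (d := 1) (d' := 1 - 0) _ _)) _.
  - by rewrite subrr.
  - by apply: cderB; [exact: cder_id|exact: cder_cst].
  - by rewrite subr0 !mulr1.
by apply: cder_ext => y; rewrite /f -expCD addrC subrK.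
Qed.

End ComplexExponential.

(** * The logarithm on the right half plane *)

Section ComplexLogarithm.
Variable R : realType.
Local Notation C := (R[i]).
Local Notation N := (@ComplexField.Normc.normc R).
Local Notation "x %:CC" := (real_complex R x) (at level 2, format "x %:CC").
Implicit Types (z w : C).

Definition rcont (f : C -> R) z := forall e : R, 0 < e ->
  exists2 d : R, 0 < d & forall y, N (y - z) < d -> `|f y - f z| < e.

Lemma rcont_comp (g : R -> R) (f : C -> R) z : rcont f z -> {for f z, continuous g} ->
  rcont (fun y => g (f y)) z.
Proof.
move=> cf cg e e0; move/cvgrPdist_lt : cg => /(_ e e0) [d /= d0 hd].
have [r r0 hr] := cf d d0; exists r => // y /hr h.
by rewrite distrC; apply: hd; rewrite /= distrC.
Qed.

Lemma rcont_Re z : rcont (@complex.Re R) z.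
Proof.
move=> e e0; exists e => // y; apply: le_lt_trans.
by have := Re_le_N (y - z); case: y z => a b [].
Qed.

Lemma rcont_Im z : rcont (@complex.Im R) z.
Proof.
move=> e e0; exists e => // y; apply: le_lt_trans.
by have := Im_le_N (y - z); case: y z => a b [].
Qed.

Lemma rcont_N z : rcont (fun y => N y) z.
Proof.
move=> e e0; exists e => // y; apply: le_lt_trans.
have := ND (y - z) z; have := ND (z - y) y; rewrite !subrK (NBC z) => h1 h2.
by rewrite ler_norml; lra.
Qed.

Lemma cont_complex (f g : C -> R) z : rcont f z -> rcont g z ->
  cont (fun y => Complex (f y) (g y)) z.
Proof.
move=> cf cg e e0; have e2 : 0 < e / 2 by rewrite divr_gt0.
have [d d0 hd] := cf _ e2; have [d' d0' hd'] := cg _ e2.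
exists (Num.min d d'); first by rewrite lt_min d0.
move=> y; rewrite lt_min => /andP[/hd h1 /hd' h2].
by rewrite (le_lt_trans (N_le _))//= (splitr e) ltrD.
Qed.

Lemma rcont_cont (f : C -> R) z : rcont f z -> cont (fun y => (f y)%:CC) z.
Proof. move=> cf; apply: cont_complex => // e e0; exists 1 => // y _; by rewrite subrr normr0. Qed.

Lemma cont_rcont_Re (f : C -> C) z : cont f z -> rcont (fun y => complex.Re (f y)) z.
Proof.
move=> cf e e0; have [d d0 h] := cf e e0; exists d => // y /h.
apply: le_lt_trans; have := Re_le_N (f y - f z).
by case: (f y) (f z) => a b [].
Qed.

(** The principal branch, correct only for Re z > 0, where the argument is the [atan] of the slope.
    Other branches are reached by rotating z first, as in [lift]. *)
Definition logC z : C := Complex (ln (N z)) (atan (complex.Im z / complex.Re z)).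

Lemma expC_logC z : 0 < complex.Re z -> expC (logC z) = z.
Proof.
case: z => a b /= a0.
have Nz : 0 < N (Complex a b) by rewrite N_gt0 eq_complex /= negb_and lt0r_neq0.
have sq : Num.sqrt (1 + (b / a) ^+ 2) = N (Complex a b) / a.
  rewrite /=; have -> : 1 + (b / a) ^+ 2 = (a ^+ 2 + b ^+ 2) / a ^+ 2.
    by field; rewrite lt0r_neq0.
  by rewrite sqrtrM ?addr_ge0 ?sqr_ge0// sqrtrV ?sqr_ge0// sqrtr_sqr gtr0_norm.
rewrite /expC -[complex.Re (logC _)]/(ln (N (Complex a b))) lnK//.
rewrite -[complex.Im (logC _)]/(atan (b / a)).
have c0 : cos (atan (b / a)) = a / N (Complex a b).
  by rewrite cos_atan sq invf_div.
have s0 : sin (atan (b / a)) = b / N (Complex a b).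
  have cn0 : cos (atan (b / a)) != 0 by rewrite c0 mulf_neq0// ?invr_eq0 lt0r_neq0.
  rewrite -[LHS](divfK cn0) -/(tan _) atanK c0.
  by move: Nz; set n := N _ => Nz; field; rewrite !lt0r_neq0.
rewrite c0 s0; move: Nz; set n := N _ => Nz.
by apply/eqP; rewrite eq_complex /=; apply/andP; split; apply/eqP; field; rewrite lt0r_neq0.
Qed.

Lemma Im_logC z : - (pi / 2) < complex.Im (logC z) < pi / 2.
Proof. by rewrite /= atan_gtNpi2 atan_ltpi2. Qed.

Lemma logC_expC z : `|complex.Im z| < pi / 2 -> logC (expC z) = z.
Proof.
move=> h; have h' : 0 < complex.Re (expC z).
  rewrite Re_expC mulr_gt0 ?expR_gt0// cos_gt0_pihalf//; move: h; rewrite ltr_norml; lra.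
apply: expC_inj; first exact: expC_logC.
have := Im_logC (expC z); move: h; rewrite ltr_norml ltr_norml; have := pi_gt0 R; lra.
Qed.

Lemma logC_real (x : R) : logC x%:CC = (ln `|x|)%:CC.
Proof. by rewrite /logC Nreal /= mul0r atan0. Qed.

Lemma cont_logC z : 0 < complex.Re z -> cont logC z.
Proof.
move=> z0; apply: cont_complex.
  apply: rcont_comp; first exact: rcont_N.
  by apply: continuous_ln; rewrite N_gt0; apply: contraTneq z0 => ->; rewrite ltxx.
have : rcont (fun y => complex.Re ((complex.Im y)%:CC / (complex.Re y)%:CC : C)) z.
  apply: cont_rcont_Re; apply: contM; first exact/rcont_cont/rcont_Im.
  apply: contV; last exact/rcont_cont/rcont_Re.
  by rewrite eq_complex /= eqxx andbT lt0r_neq0.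
move=> h; apply: rcont_comp; last exact: continuous_atan.
move=> e e0; have [d d0 hd] := h e e0; exists d => // y /hd.
by rewrite -!(fmorph_div (real_complex R)).
Qed.

(** The Caratheodory slope of [expC] at [logC z], composed with [logC] and inverted, is a slope of
    [logC]; its continuity is that of [logC]. *)
Lemma cder_logC z : 0 < complex.Re z -> cder logC z z^-1.
Proof.
move=> z0; have [phi [p0 cp hp]] := cder_expC (logC z).
rewrite expC_logC// in p0 hp.
have zn : z != 0 by apply: contraTneq z0 => ->; rewrite ltxx.
have cpl : cont (fun y => phi (logC y)) z by apply: cont_comp => //; exact: cont_logC.
have [r r0 hr] := cpl (N z) (ltac:(by rewrite N_gt0)).
have [r' r0' hr'] := @rcont_Re z _ z0.
have -> : z^-1 = (phi (logC z))^-1 by rewrite p0.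
apply: (@cder_intro_local _ _ (fun y => (phi (logC y))^-1) _ (Num.min r r')).
- by rewrite lt_min r0.
- by apply: contV => //; rewrite p0.
- move=> y; rewrite lt_min => /andP[/hr h1 /hr' h2].
  have phin : phi (logC y) != 0.
    by apply: contraTneq h1 => ->; rewrite p0 sub0r NN ltxx.
  have y0 : 0 < complex.Re y by move: h2; rewrite ltr_norml; lra.
  by have := hp (logC y); rewrite expC_logC// => ->; rewrite mulKf.
Qed.

End ComplexLogarithm.

#[global] Arguments ComplexField.Normc.normc {R} x : simpl never.

(** * Power series in the open unit disc *)

Section PowerSeries.
Variable R : realType.
Local Notation C := (R[i]).
Local Notation N := (@ComplexField.Normc.normc R).
Implicit Types (u v a b : nat -> C) (z w : C).

Definition summable u := exists M : R, forall n, \sum_(i < n) N (u i) <= M.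

Definition csum u : C := Complex (limn (series (fun n => complex.Re (u n))))
  (limn (series (fun n => complex.Im (u n)))).

Lemma Re_sum (I : Type) (r : seq I) (F : I -> C) :
  complex.Re (\sum_(i <- r) F i) = \sum_(i <- r) complex.Re (F i).
Proof. by apply: (big_morph (@complex.Re R)) => // -[? ?] []. Qed.

Lemma Im_sum (I : Type) (r : seq I) (F : I -> C) :
  complex.Im (\sum_(i <- r) F i) = \sum_(i <- r) complex.Im (F i).
Proof. by apply: (big_morph (@complex.Im R)) => // -[? ?] []. Qed.

Lemma dominated_series_cvg (x : R^nat) (y : nat -> R) M : (forall n, `|x n| <= y n) ->
  (forall n, \sum_(i < n) y i <= M) -> cvgn (series x).
Proof.
move=> xy yM; have y0 n : 0 <= y n by exact: le_trans (xy n).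
apply: normed_cvg; apply: nondecreasing_is_cvgn.
  by apply/nondecreasing_seqP => n; rewrite [leRHS]big_nat_recr//= lerDl.
exists M => _ [n _ <-]; rewrite -[leLHS]/(\sum_(0 <= i < n) `|x i|) big_mkord (le_trans _ (yM n))//.
by apply: ler_sum.
Qed.

Lemma csum_cvg u : summable u -> forall e : R, 0 < e ->
  exists n0, forall n, (n0 <= n)%N -> N (\sum_(i < n) u i - csum u) <= e.
Proof.
move=> [M hM] e e0.
have cR : cvgn (series (fun n => complex.Re (u n))).
  by apply: (dominated_series_cvg (y := N \o u)) => // n; exact: Re_le_N.
have cI : cvgn (series (fun n => complex.Im (u n))).
  by apply: (dominated_series_cvg (y := N \o u)) => // n; exact: Im_le_N.
have e2 : 0 < e / 2 by rewrite divr_gt0.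
move/cvgrPdist_le : cR => /(_ _ e2)[n1 _ h1].
move/cvgrPdist_le : cI => /(_ _ e2)[n2 _ h2].
exists (maxn n1 n2) => n; rewrite geq_max => /andP[/h1 /= k1 /h2 /= k2].
rewrite (le_trans (N_le _))// (splitr e) lerD//.
  rewrite distrC in k1; apply: le_trans k1.
  rewrite /series /= big_mkord -Re_sum /csum.
  by case: (\sum_(i < n) u i) => ? ?.
rewrite distrC in k2; apply: le_trans k2.
rewrite /series /= big_mkord -Im_sum /csum.
by case: (\sum_(i < n) u i) => ? ?.
Qed.

Lemma csum_unique u z : summable u -> (forall e : R, 0 < e ->
  exists n0, forall n, (n0 <= n)%N -> N (\sum_(i < n) u i - z) <= e) -> csum u = z.
Proof.
move=> su h; apply/eqP; rewrite -subr_eq0; apply/eqP/N_eq0/eqP.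
rewrite eq_le N_ge0 andbT leNgt; apply/negP => d0.
have d4 : 0 < N (csum u - z) / 4 by rewrite divr_gt0.
have [n1 h1] := csum_cvg su d4; have [n2 h2] := h _ d4.
have := h1 _ (leq_maxl n1 n2); have := h2 _ (leq_maxr n1 n2).
set S := \sum_(i < _) _ => k1 k2.
have := ND (csum u - S) (S - z); rewrite addrA subrK (NBC _ S); lra.
Qed.

Lemma summable_le u (y : nat -> R) M : (forall n, N (u n) <= y n) ->
  (forall n, \sum_(i < n) y i <= M) -> summable u.
Proof. by move=> uy yM; exists M => n; rewrite (le_trans _ (yM n))// ler_sum. Qed.

Lemma csum_le u M : (forall n, \sum_(i < n) N (u i) <= M) -> N (csum u) <= M.
Proof.
move=> h; have su : summable u by exists M.
apply/ler_addgt0Pr => e e0; have [n0 /(_ n0 (leqnn _)) hn] := csum_cvg su e0.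
have := ND (csum u - \sum_(i < n0) u i) (\sum_(i < n0) u i); rewrite subrK NBC.
have := N_sum (index_enum 'I_n0) u; have := h n0; lra.
Qed.

Lemma summableD u v : summable u -> summable v -> summable (fun n => u n + v n).
Proof.
move=> [M hM] [M' hM']; exists (M + M') => n.
rewrite (le_trans _ (lerD (hM n) (hM' n)))// -big_split/=.
by apply: ler_sum => i _; exact: ND.
Qed.

Lemma csumD u v : summable u -> summable v -> csum (fun n => u n + v n) = csum u + csum v.
Proof.
move=> su sv; apply: csum_unique; first exact: summableD.
move=> e e0; have e2 : 0 < e / 2 by rewrite divr_gt0.
have [n1 h1] := csum_cvg su e2; have [n2 h2] := csum_cvg sv e2.
exists (maxn n1 n2) => n; rewrite geq_max => /andP[/h1 k1 /h2 k2].
by rewrite big_split/= opprD addrACA (le_trans (ND _ _))// (splitr e) lerD.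
Qed.

Lemma summableZ c u : summable u -> summable (fun n => c * u n).
Proof.
move=> [M hM]; exists (N c * M) => n.
rewrite (eq_bigr (fun i : 'I_n => N c * N (u i))); last by move=> i _; rewrite NM.
rewrite -mulr_sumr; apply: ler_wpM2l (hM n); exact: N_ge0.
Qed.

Lemma csumZ c u : summable u -> csum (fun n => c * u n) = c * csum u.
Proof.
move=> su; apply: csum_unique; first exact: summableZ.
move=> e e0; have c1 : 0 < N c + 1 by rewrite ltr_wpDl ?N_ge0.
have e2 : 0 < e / (N c + 1) by rewrite divr_gt0.
have [n1 h1] := csum_cvg su e2; exists n1 => n /h1 k1.
rewrite -mulr_sumr -mulrBr NM.
apply: (le_trans (ler_wpM2l (N_ge0 c) k1)).
by rewrite mulrCA -[leRHS]mulr1 ler_wpM2l ?(ltW e0)// ler_pdivrMr// mul1r lerDl.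
Qed.

Lemma csum_shift u : summable u -> csum u = u 0%N + csum (fun n => u n.+1).
Proof.
move=> su; have sS : summable (fun n => u n.+1).
  case: su => M hM; exists M => n; apply: le_trans (hM n.+1).
  by rewrite [leRHS]big_ord_recl/= lerDr N_ge0.
apply: csum_unique => // e e0; have [n0 h0] := csum_cvg sS e0.
exists n0.+1 => -[//|n] /h0; rewrite big_ord_recl/=.
by rewrite opprD addrACA subrr add0r.
Qed.

Lemma eq_csum u v : (forall n, u n = v n) -> csum u = csum v.
Proof. by move=> h; congr csum; apply/funext. Qed.

(** Radius of convergence at least 1, in a form that is stable under shifts and under multiplication
    by n. *)
Definition subexp a := forall r : R, 0 < r < 1 -> exists M : R, forall n, N (a n) * r ^+ n <= M.

(** Bernoulli's inequality for 1/t = 1 + h gives n h t^n <= 1. *)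
Lemma expr_mul_bounded (t : R) : 0 < t < 1 -> exists M : R, forall n, n%:R * t ^+ n <= M.
Proof.
move=> /andP[t0 t1]; pose h := t^-1 - 1.
have h0 : 0 < h by rewrite subr_gt0 invf_gt1.
have key n : 1 + n%:R * h <= t^-1 ^+ n.
  elim: n => [|n IH]; first by rewrite mul0r addr0 expr0.
  rewrite exprS -[X in _ <= X * _](subrK 1) -/h -natr1 (le_trans _ (ler_wpM2l _ IH))//.
    have : 0 <= h * n%:R * h by rewrite !mulr_ge0// ltW.
    by nra.
  by rewrite addr_ge0// ltW.
exists h^-1 => n; have := key n; rewrite exprVn => k.
have tn : 0 < t ^+ n by rewrite exprn_gt0.
rewrite -(ler_pM2r h0) mulVf ?lt0r_neq0// mulrAC -ler_pdivlMr// mul1r.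
by apply: le_trans k; rewrite lerDr.
Qed.

(** The factor n is paid for by a larger radius s < 1, since n (r/s)^n is bounded. *)
Lemma subexp_nat a : subexp a -> subexp (fun n => n%:R * a n).
Proof.
move=> sa r /andP[r0 r1]; pose s := (r + 1) / 2.
have s0 : 0 < s by rewrite /s; lra. have s1 : s < 1 by rewrite /s; lra.
have [M hM] := sa s (ltac:(by rewrite s0)).
have rs : 0 < r / s < 1 by rewrite divr_gt0// ltr_pdivrMr// mul1r /s; lra.
have [M' hM'] := expr_mul_bounded rs.
exists (M * M') => n; rewrite NM -(rmorph_nat (real_complex R)) Nreal ger0_norm//.
have -> : n%:R * N (a n) * r ^+ n = (N (a n) * s ^+ n) * (n%:R * (r / s) ^+ n).
  rewrite [(r / s) ^+ n]expr_div_n; have := expf_neq0 n (lt0r_neq0 s0).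
  by move: (s ^+ n) (r ^+ n) => x y x0; field.
apply: ler_pM => //; rewrite mulr_ge0// ?N_ge0// exprn_ge0// ltW//.
by case/andP: rs.
Qed.

Lemma subexpD a b : subexp a -> subexp b -> subexp (fun n => a n + b n).
Proof.
move=> sa sb r rr; have [M hM] := sa r rr; have [M' hM'] := sb r rr.
exists (M + M') => n; apply: le_trans (lerD (hM n) (hM' n)).
by rewrite -mulrDl ler_wpM2r ?ND// exprn_ge0// ltW//; case/andP: rr.
Qed.

Lemma subexpZ c a : subexp a -> subexp (fun n => c * a n).
Proof.
move=> sa r rr; have [M hM] := sa r rr; exists (N c * M) => n.
by rewrite NM -mulrA ler_wpM2l ?N_ge0.
Qed.

Definition sh a : nat -> C := fun n => if n is m.+1 then a m else 0.

Lemma subexp_sh a : subexp a -> subexp (sh a).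
Proof.
move=> sa r /andP[r0 r1]; have [|M hM] := sa r; first by rewrite r0.
exists (Num.max 0 M) => -[|n] /=; first by rewrite N0 mul0r le_max lexx.
rewrite exprSr mulrA le_max (le_trans _ (hM n)) ?orbT//.
by rewrite ler_piMr ?mulr_ge0 ?N_ge0 ?exprn_ge0// ltW.
Qed.

Lemma subexp_shn k a : subexp a -> subexp (iter k sh a).
Proof. by move=> sa; elim: k => //= k IH; exact: subexp_sh. Qed.

Lemma subexp_S a : subexp a -> subexp (fun n => a n.+1).
Proof.
move=> sa r /andP[r0 r1]; have [|M hM] := sa r; first by rewrite r0.
exists (M / r) => n; rewrite ler_pdivlMr// -mulrA -exprSr; exact: hM.
Qed.

Lemma subexp_bound a (r : R) : subexp a -> 0 <= r < 1 ->
  exists M, forall n, \sum_(i < n) N (a i) * r ^+ i <= M.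
Proof.
move=> sa /andP[r0 r1]; pose s := (r + 1) / 2.
have s0 : 0 < s by rewrite /s; lra. have s1 : s < 1 by rewrite /s; lra.
have [M hM] := sa s (ltac:(by rewrite s0)).
have M0 : 0 <= M by apply: le_trans (hM 0%N); rewrite mulr_ge0// ?N_ge0// exprn_ge0// ltW.
pose t := r / s; have t0 : 0 <= t by rewrite divr_ge0// ltW.
have t1 : t < 1 by rewrite ltr_pdivrMr// mul1r /s; lra.
have gs n : \sum_(i < n) t ^+ i <= (1 - t)^-1.
  have h : (1 - t) * \sum_(i < n) t ^+ i = 1 - t ^+ n.
    by rewrite -opprB mulNr -subrX1 opprB.
  have t2 : 0 < 1 - t by rewrite subr_gt0.
  rewrite -(ler_pM2l t2) h divff ?lt0r_neq0// gerBl exprn_ge0//.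
exists (M * (1 - t)^-1) => n; apply: le_trans (ler_wpM2l M0 (gs n)).
rewrite mulr_sumr; apply: ler_sum => i _.
have -> : N (a i) * r ^+ i = (N (a i) * s ^+ i) * t ^+ i.
  rewrite /t [(r / s) ^+ i]expr_div_n; have := expf_neq0 i (lt0r_neq0 s0).
  by move: (s ^+ i) (r ^+ i) => x y x0; field.
by rewrite ler_wpM2r// exprn_ge0.
Qed.

Definition ps a z : C := csum (fun n => a n * z ^+ n).

Lemma summable_ps a z : subexp a -> N z < 1 -> summable (fun n => a n * z ^+ n).
Proof.
move=> sa z1; have [|M hM] := subexp_bound (r := N z) sa; first by rewrite N_ge0.
by exists M => n; rewrite (le_trans _ (hM n))// ler_sum// => i _; rewrite NM NX.
Qed.

Lemma psD a b z : subexp a -> subexp b -> N z < 1 ->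
  ps (fun n => a n + b n) z = ps a z + ps b z.
Proof.
move=> sa sb z1; rewrite /ps -csumD; try exact: summable_ps.
by apply: eq_csum => n; rewrite mulrDl.
Qed.

Lemma psZ c a z : subexp a -> N z < 1 -> ps (fun n => c * a n) z = c * ps a z.
Proof.
move=> sa z1; rewrite /ps -csumZ; try exact: summable_ps.
by apply: eq_csum => n; rewrite mulrA.
Qed.

Lemma ps_sh a z : subexp a -> N z < 1 -> ps (sh a) z = z * ps a z.
Proof.
move=> sa z1; rewrite /ps csum_shift; last exact: summable_ps (subexp_sh sa) z1.
rewrite /= mul0r add0r -csumZ; last exact: summable_ps.
by apply: eq_csum => n; rewrite exprS mulrCA.
Qed.

Lemma ps_shn k a z : subexp a -> N z < 1 -> ps (iter k sh a) z = z ^+ k * ps a z.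
Proof.
move=> sa z1; elim: k => [|k IH] /=; first by rewrite expr0 mul1r.
by rewrite ps_sh//; [rewrite IH exprS mulrA|exact: subexp_shn].
Qed.

Lemma eq_ps a b z : (forall n, a n = b n) -> ps a z = ps b z.
Proof. by move=> h; apply: eq_csum => n; rewrite h. Qed.

Lemma ps0 a : subexp a -> ps a 0 = a 0%N.
Proof.
move=> sa; rewrite /ps csum_shift; last by apply: summable_ps; rewrite ?N0.
rewrite expr0 mulr1 (eq_csum (v := fun=> 0 * 0)); last by move=> n; rewrite exprS mul0r !mulr0.
rewrite csumZ ?mul0r ?addr0//; exists 0 => n.
by rewrite big1// => i _; rewrite N0.
Qed.

Definition der a : nat -> C := fun n => n.+1%:R * a n.+1.

Lemma subexp_der a : subexp a -> subexp (der a).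
Proof. by move=> sa; exact: (subexp_S (subexp_nat sa)). Qed.

(** Division-free divided differences of the n-th power, of first and second order, so that they
    make sense at y = z as well. *)
Fixpoint dq z n y : C := if n is m.+1 then y * dq z m y + z ^+ m else 0.
Fixpoint dq2 z n y : C := if n is m.+1 then y * dq2 z m y + dq z m z else 0.

Lemma dqE z n y : y ^+ n - z ^+ n = dq z n y * (y - z).
Proof. by elim: n => [|n IH]/=; rewrite ?expr0 ?subrr ?mul0r// mulrDl -mulrA -IH !exprS; ring. Qed.

Lemma dq2E z n y : dq z n y - dq z n z = dq2 z n y * (y - z).
Proof. by elim: n => [|n IH]/=; rewrite ?subrr ?mul0r// mulrDl -mulrA -IH; ring. Qed.

Lemma dqz z n : dq z n.+1 z = n.+1%:R * z ^+ n.
Proof.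
elim: n => [|n IH]; first by rewrite /= expr0 mulr0 add0r mul1r.
by rewrite -[dq _ _.+2 _]/(z * dq z n.+1 z + _) IH -(natr1 n.+1) exprS; ring.
Qed.

(** The bound n r^(n-1), multiplied by r to avoid the exponent n - 1. *)
Lemma N_dq z n y (r : R) : 0 < r -> N z <= r -> N y <= r -> N (dq z n y) * r <= n%:R * r ^+ n.
Proof.
move=> r0 zr yr; elim: n => [|n IH]; first by rewrite N0 !mul0r.
rewrite -[dq _ _.+1 _]/(y * dq z n y + _) (le_trans (ler_wpM2r (ltW r0) (ND _ _)))//.
rewrite NM NX -natr1 exprS.
have h1 : N y * (N (dq z n y) * r) <= r * (n%:R * r ^+ n).
  by rewrite ler_pM// ?mulr_ge0 ?N_ge0// ltW.
have h2 : N z ^+ n <= r ^+ n by rewrite lerXn2r// ?nnegrE ?N_ge0// ltW.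
have := ler_wpM2r (ltW r0) h2; lra.
Qed.

Lemma N_dq2 z n y (r : R) : 0 < r -> N z <= r -> N y <= r ->
  N (dq2 z n y) * r ^+ 2 <= n%:R * (n%:R * r ^+ n).
Proof.
move=> r0 zr yr; elim: n => [|n IH]; first by rewrite N0 !mul0r.
rewrite -[dq2 _ _.+1 _]/(y * dq2 z n y + dq z n z).
rewrite (le_trans (ler_wpM2r (exprn_ge0 2 (ltW r0)) (ND _ _)))//.
rewrite NM -natr1 [r ^+ n.+1]exprS mulrDl.
have h1 : N y * (N (dq2 z n y) * r ^+ 2) <= r * (n%:R * (n%:R * r ^+ n)).
  by rewrite ler_pM// ?mulr_ge0 ?N_ge0 ?exprn_ge0// ltW.
have h2 := ler_wpM2r (ltW r0) (N_dq n r0 zr zr).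
have rn : 0 <= r * r ^+ n by rewrite mulr_ge0 ?exprn_ge0// ltW.
have : 0 <= n%:R * (r * r ^+ n) :> R by rewrite mulr_ge0.
lra.
Qed.

(** The series of the a_n [dq z n y] is a slope at z. Its own difference quotient is the series of
    the a_n [dq2 z n y], which is bounded uniformly for N y <= r by the sum of n^2 N(a_n) r^n, up to
    r^2; hence the slope is continuous. *)
Lemma cder_ps a z : subexp a -> N z < 1 -> cder (ps a) z (ps (der a) z).
Proof.
move=> sa z1; pose r := (N z + 1) / 2.
have zr : N z < r by rewrite /r; lra.
have r1 : r < 1 by rewrite /r; lra.
have r0 : 0 < r by exact: le_lt_trans (N_ge0 _) zr.
have [|M hM] := subexp_bound (r := r) (subexp_nat (subexp_nat sa)); first by rewrite r1 ltW.
have [|M' hM'] := subexp_bound (r := r) (subexp_nat sa); first by rewrite r1 ltW.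
have Nn (n : nat) : N n%:R = n%:R by rewrite -(rmorph_nat (real_complex R)) Nreal ger0_norm.
have sdq y : N y <= r -> summable (fun n => a n * dq z n y).
  move=> yr; exists (M' / r) => n; rewrite ler_pdivlMr// mulr_suml (le_trans _ (hM' n))//.
  apply: ler_sum => i _; rewrite !NM Nn.
  by have := ler_wpM2l (N_ge0 (a i)) (N_dq i r0 (ltW zr) yr); lra.
have sdq2 y : N y <= r -> forall n, \sum_(i < n) N (a i * dq2 z i y) <= M / r ^+ 2.
  move=> yr n; rewrite ler_pdivlMr ?exprn_gt0// mulr_suml (le_trans _ (hM n))//.
  apply: ler_sum => i _; rewrite !NM Nn.
  by have := ler_wpM2l (N_ge0 (a i)) (N_dq2 i r0 (ltW zr) yr); lra.
pose phi y := csum (fun n => a n * dq z n y).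
have yr y : N (y - z) < r - N z -> N y <= r.
  by have := ND (y - z) z; rewrite subrK; lra.
have -> : ps (der a) z = phi z.
  rewrite /phi csum_shift; last by apply: sdq; exact: ltW.
  by rewrite /= mulr0 add0r; apply: eq_csum => n; rewrite -/(dq z n.+1 z) dqz /der; ring.
apply: (@cder_intro_local _ _ _ _ (r - N z)); first by rewrite subr_gt0.
  move=> e e0; have M2 : 0 < M / r ^+ 2 + 1.
    rewrite ltr_wpDl// divr_ge0 ?exprn_ge0 ?(ltW r0)//.
    by apply: le_trans (hM 0%N); rewrite big_ord0.
  exists (Num.min (r - N z) (e / (M / r ^+ 2 + 1))).
    by rewrite lt_min subr_gt0 zr divr_gt0.
  move=> y; rewrite lt_min => /andP[/yr y1 y2].
  have -> : phi y - phi z = csum (fun n => a n * dq2 z n y) * (y - z).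
    rewrite mulrC -csumZ; last by exists (M / r ^+ 2); exact: sdq2.
    rewrite /phi -mulN1r -csumZ; last by apply: sdq; exact: ltW.
    rewrite -csumD; [|exact: sdq|by apply: summableZ; apply: sdq; exact: ltW].
    apply: eq_csum => n; transitivity (a n * (dq z n y - dq z n z)); first by ring.
    by rewrite dq2E; ring.
  rewrite NM; rewrite ltr_pdivlMr// in y2; rewrite mulrC in y2; apply: le_lt_trans y2.
  rewrite ler_wpM2r ?N_ge0// (le_trans (csum_le (sdq2 y y1)))// lerDl.
  exact: ler01.
move=> y /yr yr'; rewrite /ps -mulN1r -csumZ; last by exact: summable_ps.
rewrite -csumD.
- rewrite mulrC -csumZ; last exact: sdq.
  apply: eq_csum => n; transitivity (a n * (y ^+ n - z ^+ n)); first by ring.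
  by rewrite dqE; ring.
- by apply: summable_ps => //; exact: le_lt_trans yr' r1.
- by apply: summableZ; exact: summable_ps.
Qed.

End PowerSeries.

(** * Linear systems with polynomial coefficients after multiplication by 1 - z^4 *)

Section RegularSeries.
Variable R : realType.
Local Notation C := (R[i]).
Local Notation N := (@ComplexField.Normc.normc R).

(** Each step multiplies the running bound by at most 1 + K/(n+1), which is below s = 1/r once n + 1
    exceeds K/(s - 1). The finitely many earlier terms are absorbed in [D]. *)
Lemma growth (W : nat -> R) (K : R) : (forall n, 0 <= W n) -> 0 <= K ->
  (forall n B, (forall i, (i <= n)%N -> W i <= B) -> n.+1%:R * W n.+1 <= (n.+1%:R + K) * B) ->
  forall r : R, 0 < r < 1 -> exists M, forall n, W n * r ^+ n <= M.
Proof.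
move=> W0 K0 hW r /andP[r0 r1]; pose s := r^-1.
have s1 : 1 < s by rewrite invf_gt1.
have s0 : 0 < s by rewrite invr_gt0.
pose n0 := Num.truncn (K / (s - 1)).
have hn0 : K / (s - 1) < n0.+1%:R by apply: truncnS_gt.
pose D := \sum_(i < n0.+1) W i.
have D0 : 0 <= D by rewrite sumr_ge0.
have main n : W n <= D * s ^+ n.
  elim/ltn_ind: n => -[|n] IH.
    by rewrite expr0 mulr1 /D big_ord_recl lerDl sumr_ge0.
  have [nn|nn] := ltnP n.+1 n0.+1.
    apply: (@le_trans _ _ D); last by rewrite ler_peMr// exprn_ege1// ltW.
    by rewrite /D (bigD1 (Ordinal nn))//= lerDl sumr_ge0.
  have h : n.+1%:R * W n.+1 <= (n.+1%:R + K) * (D * s ^+ n).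
    apply: hW => i iln; apply: le_trans (IH i _) _; first by rewrite ltnS.
    by rewrite ler_wpM2l// ler_weXn2l// ltW.
  have n1 : (0 : R) < n.+1%:R by rewrite ltr0n.
  rewrite -(ler_pM2l n1) (le_trans h)//.
  have -> : n.+1%:R * (D * s ^+ n.+1) = (n.+1%:R * s) * (D * s ^+ n) by rewrite exprS; ring.
  rewrite ler_wpM2r ?mulr_ge0 ?exprn_ge0// ?(ltW s0)//.
  have s2 : 0 < s - 1 by rewrite subr_gt0.
  move: hn0; rewrite ltr_pdivrMr// => hK.
  have : n0.+1%:R * (s - 1) <= n.+1%:R * (s - 1).
    by rewrite ler_wpM2r// ?(ltW s2)// ler_nat.
  lra.
exists D => n; rewrite (le_trans (ler_wpM2r _ (main n)))// ?exprn_ge0// ?(ltW r0)//.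
by rewrite -mulrA -exprMn mulVf ?lt0r_neq0// expr1n mulr1.
Qed.

Lemma subexp_sum m (f : nat -> nat -> C) : (forall j, subexp (f j)) ->
  subexp (fun n => \sum_(j < m) f j n).
Proof.
move=> sf; elim: m => [|m IH].
  move=> r _; exists 0 => n; by rewrite big_ord0 N0 mul0r.
have := subexpD IH (sf m); congr subexp; apply/funext => n.
by rewrite big_ord_recr.
Qed.

Lemma ps_sum m (f : nat -> nat -> C) z : (forall j, subexp (f j)) -> N z < 1 ->
  ps (fun n => \sum_(j < m) f j n) z = \sum_(j < m) ps (f j) z.
Proof.
move=> sf z1; elim: m => [|m IH].
  rewrite big_ord0 (eq_ps (b := fun n => 0 * f 0%N n)) ?psZ ?mul0r// => n.
  by rewrite big_ord0 mul0r.
rewrite big_ord_recr/= -IH -psD//; last exact: subexp_sum.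
by apply: eq_ps => n; rewrite big_ord_recr.
Qed.

Lemma ps_rec (pp qq : nat -> C) (d x y : nat -> C) z : subexp x -> subexp y -> N z < 1 ->
  (forall n, der d n = iter 4 (@sh R) (der d) n +
    \sum_(j < 4) (pp j * iter j (@sh R) x n + qq j * iter j (@sh R) y n)) ->
  subexp d ->
  ps (der d) z = ps (iter 4 (@sh R) (der d)) z +
    \sum_(j < 4) (pp j * z ^+ j * ps x z + qq j * z ^+ j * ps y z).
Proof.
move=> sx sy z1 h sd; rewrite (eq_ps _ h).
have s1 j : subexp (fun n => pp j * iter j (@sh R) x n + qq j * iter j (@sh R) y n).
  by apply: subexpD; apply: subexpZ; exact: subexp_shn.
rewrite psD//; [|by apply: subexp_shn; exact: subexp_der|exact: (@subexp_sum 4 _ s1)].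
congr (_ + _); rewrite (ps_sum 4 s1 z1); apply: eq_bigr => j _.
by rewrite psD ?psZ ?ps_shn ?mulrA//; do ?[apply: subexpZ|exact: subexp_shn].
Qed.

Section Recursion.
Variables (p q r t : nat -> C) (a0 b0 : C).

(** The coefficient of z^n in the system solved by [ode4]. The history [h] lists the coefficients
    newest first, so that [a j] is a_(n-j), with default 0 before the start. The truncated
    [n.+1 - 4] is 0 for n < 4, as it should be. *)
Definition step (n : nat) (h : seq (C * C)) : C * C :=
  let a j := (nth (0, 0) h j).1 in let b j := (nth (0, 0) h j).2 in
  (n.+1%:R^-1 * ((n.+1 - 4)%N%:R * a 3%N + \sum_(j < 4) (p j * a j + q j * b j)),
   n.+1%:R^-1 * ((n.+1 - 4)%N%:R * b 3%N + \sum_(j < 4) (r j * a j + t j * b j))).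

Fixpoint hist (n : nat) : seq (C * C) :=
  if n is m.+1 then step m (hist m) :: hist m else [:: (a0, b0)].

Definition ra n := (head (0, 0) (hist n)).1.
Definition rb n := (head (0, 0) (hist n)).2.

Lemma hist_nth n j : nth (0, 0) (hist n) j = (iter j (@sh R) ra n, iter j (@sh R) rb n).
Proof.
elim: n j => [|n IH] [|j] //=; first by rewrite nth_nil.
Qed.

Lemma ra_rec n : der ra n = iter 4 (@sh R) (der ra) n +
  \sum_(j < 4) (p j * iter j (@sh R) ra n + q j * iter j (@sh R) rb n).
Proof.
rewrite {1}/der {1}/ra [hist _]/= [head _ _]/= /step !hist_nth [(_, _).1]/=.
rewrite mulVKf ?pnatr_eq0//; congr (_ + _); last first.
  by apply: eq_bigr => j _; rewrite !hist_nth.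
by case: n => [|[|[|[|n]]]] //=; rewrite ?mul0r ?mulr0// ?subSS ?subn0 /der.
Qed.

Lemma rb_rec n : der rb n = iter 4 (@sh R) (der rb) n +
  \sum_(j < 4) (r j * iter j (@sh R) ra n + t j * iter j (@sh R) rb n).
Proof.
rewrite {1}/der {1}/rb [hist _]/= [head _ _]/= /step !hist_nth [(_, _).2]/=.
rewrite mulVKf ?pnatr_eq0//; congr (_ + _); last first.
  by apply: eq_bigr => j _; rewrite !hist_nth.
by case: n => [|[|[|[|n]]]] //=; rewrite ?mul0r ?mulr0// ?subSS ?subn0 /der.
Qed.

Let W n := Num.max (N (ra n)) (N (rb n)).
Let K := \sum_(j < 4) (N (p j) + N (q j) + N (r j) + N (t j)).

Lemma N_nat n : N n%:R = n%:R.
Proof. by rewrite -(rmorph_nat (real_complex R)) Nreal ger0_norm. Qed.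

(** Both components satisfy a recursion of this shape; [K] adds up all coefficients so that one
    bound serves for both. *)
Lemma rec_bound n (B : R) (x y u : nat -> C) (pp qq : nat -> C) : 
  (forall j, N (pp j) + N (qq j) <= N (p j) + N (q j) + N (r j) + N (t j)) ->
  (forall i, (i <= n)%N -> N (x i) <= B /\ N (y i) <= B) -> 0 <= B ->
  (forall i, (i <= n)%N -> N (u i) <= B) ->
  der u n = iter 4 (@sh R) (der u) n +
    \sum_(j < 4) (pp j * iter j (@sh R) x n + qq j * iter j (@sh R) y n) ->
  n.+1%:R * N (u n.+1) <= (n.+1%:R + K) * B.
Proof.
move=> ppqq xy B0 uB hu.
have shB (w : nat -> C) : (forall i, (i <= n)%N -> N (w i) <= B) ->
   forall j i, (i <= n)%N -> N (iter j (@sh R) w i) <= B.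
  move=> wB; elim=> [|j IH] [|i] //= il; rewrite ?N0 ?wB//.
  by rewrite IH// ltnW.
have := congr1 N hu; rewrite {1}/der NM N_nat => ->.
rewrite (le_trans (ND _ _))// mulrDl lerD//.
  have [n4|n4] := ltnP n 4.
    have -> : iter 4 (@sh R) (der u) n = 0 by case: n n4 {xy uB hu shB} => [|[|[|[|n]]]].
    by rewrite N0 mulr_ge0.
  have -> : iter 4 (@sh R) (der u) n = der u (n - 4).
    by case: n n4 {xy uB hu shB} => [|[|[|[|n]]]]//= _; rewrite !subSS subn0.
  rewrite /der NM N_nat ler_pM ?N_ge0// ?ler_nat ?uB//; lia.
rewrite (le_trans (N_sum _ _))// /K mulr_suml ler_sum// => j _.
rewrite (le_trans (ND _ _))// !NM (le_trans _ (ler_wpM2r B0 (ppqq j)))// mulrDl.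
by rewrite lerD// ler_wpM2l ?N_ge0// shB// => i /xy[].
Qed.

Lemma rec_growth n (B : R) : (forall i, (i <= n)%N -> W i <= B) ->
  n.+1%:R * W n.+1 <= (n.+1%:R + K) * B.
Proof.
move=> WB; have h i : (i <= n)%N -> N (ra i) <= B /\ N (rb i) <= B.
  by move=> /WB; rewrite ge_max => /andP.
have B0 : 0 <= B by apply: le_trans (h 0%N _).1; rewrite ?N_ge0.
rewrite /W maxr_pMr ?ler0n// ge_max; apply/andP; split.
  apply: (@rec_bound n B ra rb ra p q _ h B0 _ (ra_rec n)) => [j|i /h[]//].
  by have := N_ge0 (r j); have := N_ge0 (t j); lra.
apply: (@rec_bound n B ra rb rb r t _ h B0 _ (rb_rec n)) => [j|i /h[]//].
by have := N_ge0 (p j); have := N_ge0 (q j); lra.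
Qed.

Lemma rec_subexp : subexp ra /\ subexp rb.
Proof.
have K0 : 0 <= K by apply: sumr_ge0 => j _; rewrite !addr_ge0 ?N_ge0.
have W0 n : 0 <= W n by rewrite le_max N_ge0.
split=> s ss; have [M hM] := growth W0 K0 rec_growth ss; exists M => n;
  apply: le_trans (hM n); rewrite ler_wpM2r ?exprn_ge0 ?(ltW (andP ss).1)//.
  by rewrite le_max lexx.
by rewrite le_max lexx orbT.
Qed.

(** One existence result for both coordinate charts used later: their singular points are mapped to
    fourth roots of unity, on the boundary of the disc. *)
Lemma ode4 : exists A B : C -> C, [/\ A 0 = a0, B 0 = b0 & forall z, N z < 1 ->
  exists dA dB, [/\ cder A z dA, cder B z dB,
   (1 - z ^+ 4) * dA = \sum_(j < 4) (p j * z ^+ j * A z + q j * z ^+ j * B z) &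
   (1 - z ^+ 4) * dB = \sum_(j < 4) (r j * z ^+ j * A z + t j * z ^+ j * B z)]].
Proof.
have [sa sb] := rec_subexp; exists (ps ra), (ps rb).
split; [by rewrite ps0|by rewrite ps0|move=> z z1].
exists (ps (der ra) z), (ps (der rb) z); split; [exact: cder_ps|exact: cder_ps| |].
  rewrite mulrBl mul1r -ps_shn//; last exact: subexp_der.
  by rewrite (ps_rec sa sb z1 ra_rec sa) addrC addKr.
rewrite mulrBl mul1r -ps_shn//; last exact: subexp_der.
by rewrite (ps_rec sa sb z1 rb_rec sb) addrC addKr.
Qed.

End Recursion.
End RegularSeries.

(** * The KZ equation in the logarithmic coordinate *)

Section Uniqueness.
Variable R : realType.
Local Notation C := (R[i]).
Local Notation N := (@ComplexField.Normc.normc R).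
Local Notation "x %:CC" := (real_complex R x) (at level 2, format "x %:CC").
Implicit Types (z w p : C) (U : C -> Prop).

Definition sh2 z : C := expC z - expC (- z).
Definition ch2 z : C := expC z + expC (- z).
Definition cothC z : C := ch2 z / sh2 z.

Lemma cder_expN z : cder (fun y => expC (- y)) z (- expC (- z) : C).
Proof.
apply: cder_eq (cder_comp (cder_expC (- z)) (cderN (cder_id z))) _.
by rewrite mulrN1.
Qed.

Lemma cder_sh2 z : cder sh2 z (ch2 z).
Proof. by apply: cder_eq (cderB (cder_expC z) (cder_expN z)) _; rewrite opprK. Qed.

Lemma cder_ch2 z : cder ch2 z (sh2 z).
Proof. by apply: cder_eq (cderD (cder_expC z) (cder_expN z)) _. Qed.

(* The KZ equation for f = a up + b um (see [up], [um] below) in the coordinate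
   z = log x, with m = lam^2 - k^2. *)
Definition Sol (k m : C) U (a b : C -> C) := forall z, U z ->
  cder a z (- m * b z) /\ cder b z (2 * k * cothC z * b z - a z).

Definition star U p := forall z, U z -> forall t : R, 0 <= t <= 1 -> U (p + t%:CC * (z - p)).

Lemma is_derive_cont (f : R -> R) (t d : R) : is_derive t 1 f d -> {for t, continuous f}.
Proof. by move=> [h _]; exact/differentiable_continuous/derivable1_diffP. Qed.

(** The function n(t) e^(- L t) has nonpositive derivative, and the mean value theorem compares its
    end values. *)
Lemma gronwall (n dn : R -> R) (L : R) : 
  (forall t : R, 0 <= t <= 1 -> is_derive t 1 n (dn t)) ->
  (forall t : R, 0 <= t <= 1 -> dn t <= L * n t) -> n 0 <= 0 -> n 1 <= 0.
Proof.
move=> hd hle n0; pose g := n * (fun t => expR (- L * t)).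
have gE t : g t = n t * expR (- L * t) by [].
have hg (t : R) : 0 <= t <= 1 -> is_derive t 1 g ((dn t - L * n t) * expR (- L * t)).
  move=> /hd ht.
  have h1 : is_derive t 1 (fun t => expR (- L * t)) (expR (- L * t) * (- L)).
    have h2 : is_derive t 1 (fun t => - L * t) (- L).
      by have := is_deriveZ (-L) (is_derive_id t (1 : R)); rewrite /GRing.scale /= mulr1.
    exact: is_derive1_comp.
  apply: is_derive_eq (is_deriveM _ _) _.
  by rewrite /GRing.scale /=; ring.
have [||c c01] := @MVT_segment R g (fun t => (dn t - L * n t) * expR (- L * t)) 0 1 ler01.
- by move=> x /[!in_itv]/= /andP[x0 x1]; apply: hg; rewrite !ltW.
- apply: continuous_in_subspaceT => x /[!inE]/=; rewrite in_itv/= => /hg.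
  exact: is_derive_cont.
rewrite subr0 mulr1 => h.
have : g 1 - g 0 <= 0.
  rewrite h mulr_le0_ge0 ?expR_ge0// subr_le0; apply: hle.
  by move: c01; rewrite in_itv.
rewrite !gE mulr0 expR0 mulr1 subr_le0 => h'.
have : n 1 * expR (- L * 1) <= 0 by exact: le_trans h' n0.
by rewrite pmulr_lle0 ?expR_gt0.
Qed.

Lemma rder_N2 (g : R -> C) (t : R) v : rder g t v ->
  is_derive t 1 (fun u => N (g u) ^+ 2)
    (2 * (complex.Re (g t) * complex.Re v + complex.Im (g t) * complex.Im v)).
Proof.
move=> [h1 h2]; have -> : (fun u => N (g u) ^+ 2) =
   (fun u => complex.Re (g u)) ^+ 2 + (fun u => complex.Im (g u)) ^+ 2.
  by apply/funext => u; rewrite N2.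
apply: is_derive_eq (is_deriveD _ _) _.
by rewrite /GRing.scale /= expr1; ring.
Qed.

(** Cauchy-Schwarz, read off from the real part of conj(g) v. *)
Lemma N2_bound (g v : C) :
  complex.Re g * complex.Re v + complex.Im g * complex.Im v <= N g * N v.
Proof.
have := Re_le_N (conjc g * v); rewrite NM.
have -> : N (conjc g) = N g by case: g => x y; rewrite /N /= sqrrN.
have -> : complex.Re (conjc g * v) = complex.Re g * complex.Re v + complex.Im g * complex.Im v.
  by case: g v => x y [x' y'] /=; ring.
exact: le_trans (ler_norm _).
Qed.

Lemma cont_line (f : C -> R) p w (t : R) : rcont f (p + t%:CC * w) ->
  {for t, continuous (fun u : R => f (p + u%:CC * w))}.
Proof.
move=> cf; apply/cvgrPdist_lt => e e0; have [d d0 hd] := cf e e0.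
have w1 : 0 < N w + 1 by rewrite ltr_wpDl// N_ge0.
exists (d / (N w + 1)); first by rewrite /= divr_gt0.
move=> s /= ts; rewrite distrC; apply: hd.
have -> : p + s%:CC * w - (p + t%:CC * w) = (s - t)%:CC * w by rewrite rmorphB/=; ring.
rewrite NM Nreal distrC; move: ts; rewrite ltr_pdivlMr// => ts.
by apply: le_lt_trans ts; rewrite ler_wpM2l// lerDl.
Qed.

Lemma cont_N_rcont (f : C -> C) z : cont f z -> rcont (fun y => N (f y)) z.
Proof.
move=> cf e e0; have [d d0 h] := cf e e0; exists d => // y /h; apply: le_lt_trans.
have := ND (f y - f z) (f z); have := ND (f z - f y) (f y); rewrite !subrK (NBC (f z)) => h1 h2.
by rewrite ler_norml; lra.
Qed.

Lemma cont_coth z : sh2 z != 0 -> cont cothC z.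
Proof.
move=> hz; apply: contM; first exact/cder_cont/cder_ch2.
by apply: contV => //; exact/cder_cont/cder_sh2.
Qed.

Lemma segment_bound (f : C -> C) p w :
  (forall t : R, 0 <= t <= 1 -> cont f (p + t%:CC * w)) ->
  exists2 M, 0 <= M & forall t : R, 0 <= t <= 1 -> N (f (p + t%:CC * w)) <= M.
Proof.
move=> cf; have [|c _ hc] := @EVT_max R (fun t => N (f (p + t%:CC * w))) 0 1 ler01.
  apply: continuous_in_subspaceT => x /[!inE]/=; rewrite in_itv/= => /cf h.
  by apply: (@cont_line (fun y => N (f y))); exact: cont_N_rcont.
exists (N (f (p + c%:CC * w))); first exact: N_ge0.
by move=> t t01; apply: hc; rewrite in_itv.
Qed.

(** Along the segment from p the function |a|^2 + |b|^2 starts at 0 and obeys Gronwall's inequality: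
    coth is bounded on the segment by compactness. *)
Lemma sol_uniq0 k m U a b p : star U p -> (forall z, U z -> sh2 z != 0) ->
  Sol k m U a b -> a p = 0 -> b p = 0 -> forall z, U z -> a z = 0 /\ b z = 0.
Proof.
move=> st sU sol ap bp z Uz; pose w := z - p.
have Ut (t : R) : 0 <= t <= 1 -> U (p + t%:CC * w) by exact: st.
have [M M0 hM] : exists2 M, 0 <= M & forall t : R, 0 <= t <= 1 -> N (cothC (p + t%:CC * w)) <= M.
  by apply: segment_bound => t t01; apply: cont_coth; apply: sU; exact: Ut.
pose A (t : R) := a (p + t%:CC * w); pose B (t : R) := b (p + t%:CC * w).
pose va (t : R) := - m * B t * w.
pose vb (t : R) := (2 * k * cothC (p + t%:CC * w) * B t - A t) * w.
have dA (t : R) : 0 <= t <= 1 -> rder A t (va t) by move=> /Ut/sol[h _]; exact: cder_line.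
have dB (t : R) : 0 <= t <= 1 -> rder B t (vb t) by move=> /Ut/sol[_ h]; exact: cder_line.
pose n (t : R) := N (A t) ^+ 2 + N (B t) ^+ 2.
pose L := N w * (N m + 1 + 4 * N k * M).
have n1 : n 1 <= 0.
  apply: (@gronwall n (fun t => 
   2 * (complex.Re (A t) * complex.Re (va t) + complex.Im (A t) * complex.Im (va t)) +
   2 * (complex.Re (B t) * complex.Re (vb t) + complex.Im (B t) * complex.Im (vb t))) L).
  - by move=> t t01; exact: (is_deriveD (rder_N2 (dA t t01)) (rder_N2 (dB t t01))).
  - move=> t t01; set x := N (A t); set y := N (B t).
    have x0 : 0 <= x := N_ge0 _. have y0 : 0 <= y := N_ge0 _.
    have h1 := N2_bound (A t) (va t); have h2 := N2_bound (B t) (vb t).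
    have v1 : N (va t) <= N m * y * N w by rewrite /va !NM NN.
    have v2 : N (vb t) <= (2 * N k * M * y + x) * N w.
      rewrite /vb NM ler_wpM2r ?N_ge0// (le_trans (NB _ _))// lerD// !NM.
      have -> : N 2 = 2 by exact: (N_nat R 2).
      by apply: ler_wpM2r => //; apply: ler_wpM2l; [rewrite mulr_ge0 ?N_ge0|rewrite -NM; exact: hM].
    have {}h1 : complex.Re (A t) * complex.Re (va t) + complex.Im (A t) * complex.Im (va t)
       <= x * (N m * y * N w) by apply: le_trans h1 _; rewrite ler_wpM2l.
    have {}h2 : complex.Re (B t) * complex.Re (vb t) + complex.Im (B t) * complex.Im (vb t)
       <= y * ((2 * N k * M * y + x) * N w) by apply: le_trans h2 _; rewrite ler_wpM2l.
    have xy : 2 * (x * y) <= x ^+ 2 + y ^+ 2.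
      by have := sqr_ge0 (x - y); rewrite sqrrB; lra.
    have w0 := N_ge0 w; have m0 := N_ge0 m; have k0 := N_ge0 k.
    have h3 : (N w * (N m + 1)) * (2 * (x * y)) <= (N w * (N m + 1)) * (x ^+ 2 + y ^+ 2).
      by rewrite ler_wpM2l// mulr_ge0// addr_ge0.
    have h4 : 0 <= N w * (4 * N k * M) * x ^+ 2 by rewrite !mulr_ge0// sqr_ge0.
    rewrite /n -/x -/y /L; lra.
  - by rewrite /n /A /B /= rmorph0 mul0r addr0 ap bp N0 expr0n addr0.
have E : p + 1%:CC * w = z by rewrite rmorph1 mul1r /w addrC subrK.
have := n1; rewrite /n /A /B E => h.
have h1 : N (a z) ^+ 2 = 0 by have := sqr_ge0 (N (a z)); have := sqr_ge0 (N (b z)); lra.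
have h2 : N (b z) ^+ 2 = 0 by have := sqr_ge0 (N (a z)); have := sqr_ge0 (N (b z)); lra.
by split; apply: N_eq0; apply/eqP; rewrite -sqrf_eq0; apply/eqP.
Qed.

Lemma const_on_star U (f : C -> C) p : star U p -> (forall z, U z -> cder f z 0) ->
  forall z, U z -> f z = f p.
Proof.
move=> st hf z Uz; pose w := z - p.
pose A (t : R) := f (p + t%:CC * w) - f p.
have dA (t : R) : 0 <= t <= 1 -> rder A t 0.
  move=> t01; have := @cder_line _ (fun y => f y - f p) p w (0 - 0) t.
  rewrite subr0 mul0r; apply; rewrite -[X in cder _ _ X](subrr 0); apply: cderB.
    by apply: hf; exact: st.
  exact: cder_cst.
have n1 : N (A 1) ^+ 2 <= 0.
  apply: (@gronwall (fun t => N (A t) ^+ 2) (fun=> 0) 0) => //.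
  - move=> t /dA /rder_N2; by rewrite !mulr0 addr0 mulr0.
  - by move=> t _; rewrite mul0r.
  - by rewrite /A rmorph0 mul0r addr0 subrr N0 expr0n.
have : N (A 1) ^+ 2 == 0 by rewrite eq_le n1 sqr_ge0.
have E : p + 1%:CC * w = z by rewrite rmorph1 mul1r /w addrC subrK.
by rewrite sqrf_eq0 /A E => /eqP/N_eq0/eqP; rewrite subr_eq0 => /eqP.
Qed.

Lemma cder_lin c d (f g : C -> C) z df dg : cder f z df -> cder g z dg ->
  cder (fun y => c * f y + d * g y) z (c * df + d * dg).
Proof. by move=> hf hg; apply: cderD; exact: cderZ. Qed.

Lemma sol_lin k m U a b a' b' c d : Sol k m U a b -> Sol k m U a' b' ->
  Sol k m U (fun z => c * a z + d * a' z) (fun z => c * b z + d * b' z).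
Proof.
move=> s s' z Uz; have [h1 h2] := s z Uz; have [h3 h4] := s' z Uz; split.
  by apply: cder_eq (cder_lin c d h1 h3) _; ring.
by apply: cder_eq (cder_lin c d h2 h4) _; ring.
Qed.

Lemma sol_sub k m U V a b : (forall z, V z -> U z) -> Sol k m U a b -> Sol k m V a b.
Proof. by move=> VU h z /VU/h. Qed.

Lemma sol_uniq k m U a b a' b' p : star U p -> (forall z, U z -> sh2 z != 0) ->
  Sol k m U a b -> Sol k m U a' b' -> a p = a' p -> b p = b' p ->
  forall z, U z -> a z = a' z /\ b z = b' z.
Proof.
move=> st sU s s' ap bp z Uz.
have [||h1 h2] := sol_uniq0 st sU (sol_lin 1 (-1) s s') _ _ Uz.
- by rewrite ap mul1r mulN1r subrr.
- by rewrite bp mul1r mulN1r subrr.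
by move: h1 h2; rewrite !mul1r !mulN1r => /eqP + /eqP; rewrite !subr_eq0 => /eqP + /eqP.
Qed.

(* Existence with arbitrary initial value at one point propagates to any other
   point, because evaluation is injective. *)
Lemma sol_transfer k m U p q : star U q -> U p -> (forall z, U z -> sh2 z != 0) ->
  (forall a0 b0, exists a b, [/\ Sol k m U a b, a p = a0 & b p = b0]) ->
  forall a0 b0, exists a b, [/\ Sol k m U a b, a q = a0 & b q = b0].
Proof.
move=> st Up sU ex.
have [a1 [b1 [s1 a1p b1p]]] := ex 1 0; have [a2 [b2 [s2 a2p b2p]]] := ex 0 1.
pose D := a1 q * b2 q - a2 q * b1 q.
have D0 : D != 0.
  apply/eqP => D0.
  have H c d : c * a1 q + d * a2 q = 0 -> c * b1 q + d * b2 q = 0 -> c = 0 /\ d = 0.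
    move=> h1 h2; have [] := sol_uniq0 st sU (sol_lin c d s1 s2) h1 h2 Up.
    by rewrite a1p a2p b1p b2p !mulr0 !mulr1 addr0 add0r.
  have [h1 h2] : b2 q = 0 /\ - b1 q = 0.
    by apply: H; [rewrite -D0 /D|]; ring.
  have [h3 h4] : a2 q = 0 /\ - a1 q = 0.
    by apply: H; [|rewrite -oppr0 -D0 /D]; ring.
  move/eqP: h2; rewrite oppr_eq0 => /eqP h2; move/eqP: h4; rewrite oppr_eq0 => /eqP h4.
  have [/eqP] : 1 = 0 :> C /\ 1 = 0 :> C by apply: H; rewrite ?h1 ?h2 ?h3 ?h4; ring.
  by rewrite oner_eq0.
move=> a0 b0; pose c := (a0 * b2 q - b0 * a2 q) / D; pose d := (a1 q * b0 - b1 q * a0) / D.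
exists (fun z => c * a1 z + d * a2 z), (fun z => c * b1 z + d * b2 z); split.
- exact: sol_lin.
- by rewrite /c /d; move: D0; rewrite /D => D0; field.
- by rewrite /c /d; move: D0; rewrite /D => D0; field.
Qed.

End Uniqueness.

(** * The cut strip, its pieces, and the symmetries of the equation *)

Section Domain.
Variable R : realType.
Local Notation C := (R[i]).
Local Notation N := (@ComplexField.Normc.normc R).
Local Notation "x %:CC" := (real_complex R x) (at level 2, format "x %:CC").
Local Notation Re := complex.Re.
Local Notation Im := complex.Im.
Implicit Types (z w p : C) (U : C -> Prop).

Lemma piIE : piI R = Complex 0 pi.
Proof. by rewrite /piI; apply/eqP; rewrite eq_complex /=; apply/andP; split; apply/eqP; ring. Qed.

Lemma expCDpi z : expC (z + piI R) = - expC z.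
Proof. by rewrite expCD expC_piI mulrN1. Qed.

Lemma expCNDpi z : expC (- (z + piI R)) = - expC (- z).
Proof. by rewrite opprD expCB expC_piI invrN invr1 mulrN1. Qed.

Lemma sh2Dpi z : sh2 (z + piI R) = - sh2 z.
Proof. by rewrite /sh2 expCDpi expCNDpi; ring. Qed.
Lemma ch2Dpi z : ch2 (z + piI R) = - ch2 z.
Proof. by rewrite /ch2 expCDpi expCNDpi; ring. Qed.
Lemma cothDpi z : cothC (z + piI R) = cothC z.
Proof. by rewrite /cothC sh2Dpi ch2Dpi invrN mulrNN. Qed.
Lemma sh2N z : sh2 (- z) = - sh2 z :> C.
Proof. by rewrite /sh2 opprK opprB. Qed.
Lemma ch2N z : ch2 (- z) = ch2 z :> C.
Proof. by rewrite /ch2 opprK addrC. Qed.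
Lemma cothN z : cothC (- z) = - cothC z :> C.
Proof. by rewrite /cothC sh2N ch2N invrN mulrN. Qed.

Lemma ReD z w : Re (z + w) = Re z + Re w. Proof. by case: z w => ? ? []. Qed.
Lemma ImD z w : Im (z + w) = Im z + Im w. Proof. by case: z w => ? ? []. Qed.
Lemma ReN z : Re (- z) = - Re z. Proof. by case: z. Qed.
Lemma ImN z : Im (- z) = - Im z. Proof. by case: z. Qed.
Lemma ReB z w : Re (z - w) = Re z - Re w. Proof. by rewrite ReD ReN. Qed.
Lemma ImB z w : Im (z - w) = Im z - Im w. Proof. by rewrite ImD ImN. Qed.
Lemma ReZ (t : R) z : Re (t%:CC * z) = t * Re z. Proof. by case: z => a b /=; ring. Qed.
Lemma ImZ (t : R) z : Im (t%:CC * z) = t * Im z. Proof. by case: z => a b /=; ring. Qed.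
Lemma Re_piI : Re (piI R) = 0. Proof. by rewrite piIE. Qed.
Lemma Im_piI : Im (piI R) = pi. Proof. by rewrite piIE. Qed.

Lemma Re_seg p z (t : R) : Re (p + t%:CC * (z - p)) = Re p + t * (Re z - Re p).
Proof. by rewrite ReD ReZ ReB. Qed.
Lemma Im_seg p z (t : R) : Im (p + t%:CC * (z - p)) = Im p + t * (Im z - Im p).
Proof. by rewrite ImD ImZ ImB. Qed.

Lemma seg_lt (x y c t : R) : 0 <= t <= 1 -> x < c -> y < c -> x + t * (y - x) < c.
Proof.
move=> /andP[t0 t1] xc yc; have [->|tn] := eqVneq t 1; first by rewrite mul1r addrC subrK.
have t1' : 0 < 1 - t by rewrite subr_gt0 lt_neqAle tn.
have := mulr_gt0 t1' (ltac:(by rewrite subr_gt0; exact: xc) : 0 < c - x).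
have := mulr_ge0 t0 (ltac:(by rewrite subr_ge0 ltW) : 0 <= c - y); lra.
Qed.

Lemma seg_gt (x y c t : R) : 0 <= t <= 1 -> c < x -> c < y -> c < x + t * (y - x).
Proof.
move=> h xc yc; have := @seg_lt (- x) (- y) (- c) t h; rewrite !ltrN2 => /(_ xc yc); lra.
Qed.

Definition Sig0 z := 0 < Im z < pi.
(** The strip |Im z| < pi cut along [0, +oo). It contains both pi i / 2 and - pi i / 2, and its two
    halves meet only to the left of the singular point 0, so values at these two points are compared
    by continuation on that side. *)
Definition Dom z := `|Im z| < pi /\ (Im z != 0 \/ Re z < 0).
(** A neighbourhood of the negative real axis, across which the two half strips are glued. Its shape
    makes 2 e^(2z) - 1 smaller than 1 in modulus, see [wedge_ineq]. *)
Definition Wedge z := [/\ - 2^-1 < Im z, Im z < 2^-1, Re z < Im z & Re z < - Im z].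
Definition Left z := Re z < 0.

Lemma sh2_eq0 z : sh2 z = 0 -> expC (2 * z) = 1 :> C.
Proof.
rewrite /sh2 => /eqP; rewrite subr_eq0 => /eqP h.
have -> : 2 * z = z + z by ring.
by rewrite expCD {1}h -expCD addNr expC0.
Qed.

Lemma two_CC : 2 = 2%:CC :> C. Proof. by rewrite rmorphD/= rmorph1. Qed.

Lemma Re2 z : Re (2 * z) = 2 * Re z. Proof. by rewrite two_CC ReZ. Qed.
Lemma Im2 z : Im (2 * z) = 2 * Im z. Proof. by rewrite two_CC ImZ. Qed.

Lemma sh2_Left z : Left z -> sh2 z != 0.
Proof.
move=> z0; apply/eqP => /sh2_eq0 /(congr1 N); rewrite N_expC N1 => h.
have : expR (Re (2 * z)) < 1.
  by rewrite expR_lt1 Re2; move: z0; rewrite /Left; lra.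
by rewrite h ltxx.
Qed.

Lemma sh2_Dom z : Dom z -> sh2 z != 0.
Proof.
move=> [zpi z0]; apply/eqP => /sh2_eq0 /expC_eq1; rewrite Im2.
have -> : `|2 * Im z| < 2 * pi by rewrite normrM ger0_norm// ltr_pM2l.
move=> /(_ isT)/eqP; rewrite mulf_eq0 pnatr_eq0/= => /eqP zz.
by move: z0; rewrite zz /= eqxx ltxx => -[].
Qed.

Lemma Sig0_Dom z : Sig0 z -> Dom z.
Proof.
move=> /andP[h1 h2]; split; first by rewrite ger0_norm// ltW.
by left; rewrite lt0r_neq0.
Qed.

Lemma sh2_Sig0 z : Sig0 z -> sh2 z != 0. Proof. by move=> /Sig0_Dom/sh2_Dom. Qed.

Lemma Sig0_star p : Sig0 p -> star Sig0 p.
Proof.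
move=> /andP[p0 p1] z /andP[z0 z1] t t01.
by rewrite /Sig0 Im_seg seg_gt// seg_lt.
Qed.

Lemma Wedge_star p : Wedge p -> star Wedge p.
Proof.
move=> [p1 p2 p3 p4] z [z1 z2 z3 z4] t t01; rewrite /Wedge Im_seg Re_seg; split.
- exact: seg_gt.
- exact: seg_lt.
- have := @seg_lt (Re p - Im p) (Re z - Im z) 0 t t01; rewrite !subr_lt0 => /(_ p3 z3); lra.
- have := @seg_lt (Re p + Im p) (Re z + Im z) 0 t t01; lra.
Qed.

Lemma Left_star p : Left p -> star Left p.
Proof. by move=> p0 z z0 t t01; rewrite /Left Re_seg; exact: seg_lt. Qed.

Lemma Dom_star p : Im p = 0 -> Re p < 0 -> star Dom p.
Proof.
move=> p0 p1 z [z1 z2] t t01; rewrite /Dom Im_seg Re_seg p0 subr0 add0r; split.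
  case/andP: t01 => t0 t1; rewrite normrM (ger0_norm t0).
  by apply: le_lt_trans z1; rewrite ler_piMl.
have [->|tn0] := eqVneq t 0; first by right; rewrite mul0r addr0.
case: z2 => z2; first by left; rewrite mulf_neq0.
by right; exact: seg_lt.
Qed.

Lemma sol_shift k m U a b : Sol k m U a b ->
  Sol k m (fun z => U (z + piI R)) (fun z => a (z + piI R)) (fun z => b (z + piI R)).
Proof.
move=> s z /s[h1 h2].
have hp : cder (fun y => y + piI R) z 1.
  by rewrite -[1]addr0; apply: cderD; [exact: cder_id|exact: cder_cst].
split; first by apply: cder_eq (cder_comp (g := fun y => y + piI R) h1 hp) _; rewrite mulr1.
by apply: cder_eq (cder_comp (g := fun y => y + piI R) h2 hp) _; rewrite mulr1 cothDpi.
Qed.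

Lemma sol_unshift k m U a b : Sol k m U a b ->
  Sol k m (fun z => U (z - piI R)) (fun z => a (z - piI R)) (fun z => b (z - piI R)).
Proof.
move=> s z /s[h1 h2].
have hp : cder (fun y => y - piI R) z 1.
  by rewrite -[1]addr0; apply: cderD; [exact: cder_id|exact: cder_cst].
split; first by apply: cder_eq (cder_comp (g := fun y => y - piI R) h1 hp) _; rewrite mulr1.
by apply: cder_eq (cder_comp (g := fun y => y - piI R) h2 hp) _; rewrite mulr1 -(cothDpi (z - piI R)) subrK.
Qed.

Lemma sol_refl k m U a b : Sol k m U a b ->
  Sol k m (fun z => U (- z)) (fun z => a (- z)) (fun z => - b (- z)).
Proof.
move=> s z /s[h1 h2].
have hp : cder (fun y => - y) z (-1) by apply: cderN; exact: cder_id.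
split; first by apply: cder_eq (cder_comp (g := fun y => - y) h1 hp) _; ring.
by apply: cder_eq (cderN (cder_comp (g := fun y => - y) h2 hp)) _; rewrite cothN; ring.
Qed.

Lemma sol_scale k m U a b c : Sol k m U a b -> Sol k m U (fun z => c * a z) (fun z => c * b z).
Proof.
move=> s z /s[h1 h2]; split; first by apply: cder_eq (cderZ c h1) _; ring.
by apply: cder_eq (cderZ c h2) _; ring.
Qed.

Lemma cder_expCmul c z : cder (fun y => expC (c * y)) z (c * expC (c * z) : C).
Proof. by apply: cder_eq (cder_comp (g := fun y => c * y) (cder_expC (c * z)) (cderZ c (cder_id z))) _; rewrite mulr1 mulrC. Qed.

Lemma one_sub4_neq0 z : N z < 1 -> 1 - z ^+ 4 != 0.
Proof.
move=> z1; rewrite subr_eq0; apply/eqP => h; have := NX z 4; rewrite -h N1.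
have : N z ^+ 4 < 1 by rewrite exprn_ilt1// N_ge0.
by move=> + E; rewrite -E ltxx.
Qed.

Lemma expC_hpi : expC (piI R / 2) = 'i%C.
Proof.
have -> : piI R / 2 = Complex 0 (pi / 2).
  have -> : piI R / 2 = 2^-1 * piI R by rewrite mulrC.
  have -> : 2^-1 = (2^-1)%:CC :> C by rewrite fmorphV/= -two_CC.
  by rewrite piIE; apply/eqP; rewrite eq_complex /=; apply/andP; split; apply/eqP; ring.
rewrite /expC /= expR0 cos_pihalf sin_pihalf.
by apply/eqP; rewrite eq_complex /=; apply/andP; split; apply/eqP; ring.
Qed.

Lemma Im_hpi : Im (piI R / 2) = pi / 2.
Proof.
have -> : piI R / 2 = (2^-1)%:CC * piI R by rewrite mulrC fmorphV/= -two_CC.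
by rewrite ImZ Im_piI mulrC.
Qed.
Lemma Re_hpi : Re (piI R / 2) = 0.
Proof.
have -> : piI R / 2 = (2^-1)%:CC * piI R by rewrite mulrC fmorphV/= -two_CC.
by rewrite ReZ Re_piI mulr0.
Qed.

Lemma Sig0_hpi : Sig0 (piI R / 2).
Proof. by rewrite /Sig0 Im_hpi; have := pi_gt0 R; lra. Qed.

(* In the conformal coordinate v = tanh ((z - pi i / 2) / 2), which maps the
   strip onto the unit disc, multiplication by 1 - v^4 makes the coefficients
   of the equation polynomial. *)
Lemma strip_chart k m a0 b0 : exists a b, [/\ Sol k m Sig0 a b, a (piI R / 2) = a0
  & b (piI R / 2) = b0].
Proof.
(* With dv/dz = (1 - v^2)/2 and coth z = 2v/(1 + v^2) the system in v, multiplied by 1 - v^4, has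
   these coefficients. *)
pose q j : C := if (j == 0%N) || (j == 2%N) then -2 * m else 0.
pose r j : C := if (j == 0%N) || (j == 2%N) then -2 else 0.
pose t j : C := if j == 1%N then 8 * k else 0.
have [A [B [A0 B0 AB]]] := ode4 (fun=> 0) q r t a0 b0.
(* Here y = e^(z - pi i / 2) lies in the right half plane, and v is its Cayley transform. *)
pose y : C -> C := fun z => - 'i%C * expC z; pose v : C -> C := fun z => (y z - 1) / (y z + 1).
have i2 : 'i%C * 'i%C = -1 :> C by rewrite -expr2 sqr_i.
have Rey z : Re (y z) = expR (Re z) * sin (Im z).
  by rewrite /y -Im_expC; case: (expC z) => ? ? /=; ring.
have y1 z : Sig0 z -> y z + 1 != 0.
  move=> zS; apply/eqP => h; have := Rey z.
  have -> : y z = -1 by apply/eqP; rewrite -addr_eq0 h.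
  have /andP[_] : 0 <= (0 : R) < expR (Re z) * sin (Im z) by rewrite lexx mulr_gt0 ?expR_gt0 ?sin_gt0_pi.
  by move=> /= + E; rewrite -E; lra.
have Nv z : Sig0 z -> N (v z) < 1.
  move=> zS; rewrite /v NM NV ltr_pdivrMr ?N_gt0 ?y1// mul1r.
  rewrite -(@ltr_pXn2r _ 2)// ?nnegrE ?N_ge0// !N2.
  have : 0 < Re (y z) by rewrite Rey mulr_gt0 ?expR_gt0 ?sin_gt0_pi.
  case: (y z) => x x' /= ; rewrite ?oppr0 ?addr0 ?subr0; nra.
have dy z : cder y z (y z) by exact: cderZ (cder_expC z).
have dv z : Sig0 z -> cder v z ((1 - v z ^+ 2) / 2).
  move=> zS; have h := @cder_div _ (fun z => y z - 1) (fun z => y z + 1) z _ _ (y1 z zS) (cderB (dy z) (cder_cst 1 z)) (cderD (dy z) (cder_cst 1 z)).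
  by apply: cder_eq h _; rewrite /v; field; rewrite y1.
have yN0 z : y z != 0 by rewrite /y mulf_neq0 ?expC_neq0// oppr_eq0 eq_complex /= oner_eq0 andbF.
have coth_v z : Sig0 z -> cothC z = 2 * v z / (1 + v z ^+ 2).
  move=> zS; have E1 : expC z = 'i%C * y z by rewrite /y mulrA mulrN i2 opprK mul1r.
  have E2 : expC (- z) = - 'i%C / y z.
    rewrite expCN E1 invfM; congr (_ / _); apply: (mulfI (x := 'i%C)).
      by rewrite eq_complex /= oner_eq0 andbF.
    by rewrite divff ?mulrN ?i2 ?opprK// eq_complex /= oner_eq0 andbF.
  have s0 := sh2_Sig0 zS.
  have i0 : 'i%C != 0 :> C by rewrite eq_complex /= oner_eq0 andbF.
  have sE : sh2 z = 'i%C * (y z ^+ 2 + 1) / y z by rewrite /sh2 E1 E2; field; rewrite yN0.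
  have y20 : y z ^+ 2 + 1 != 0 by apply: contraNneq s0 => h; rewrite sE h mulr0 mul0r.
  have v20 : 1 + v z ^+ 2 != 0.
    have -> : 1 + v z ^+ 2 = 2 * (y z ^+ 2 + 1) / (y z + 1) ^+ 2 by rewrite /v; field; rewrite y1.
    by rewrite !mulf_neq0 ?pnatr_eq0 ?invr_eq0 ?expf_neq0 ?y1.
  have -> : cothC z = (y z ^+ 2 - 1) / (y z ^+ 2 + 1).
    by rewrite /cothC sE /ch2 E1 E2; field; rewrite yN0 i0 y20.
  have v2E : 1 + v z ^+ 2 = 2 * (y z ^+ 2 + 1) / (y z + 1) ^+ 2 by rewrite /v; field; rewrite y1.
  by rewrite v2E /v; field; rewrite y1// y20.
exists (fun z => A (v z)), (fun z => B (v z)).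
have v0 : v (piI R / 2) = 0 by rewrite /v /y expC_hpi mulNr i2 opprK subrr mul0r.
split; last first; [by rewrite v0|by rewrite v0|].
move=> z zS; have [dA [dB [cA cB EA EB]]] := AB (v z) (Nv z zS).
have h4 := one_sub4_neq0 (Nv z zS).
move: EA EB; rewrite !big_ord_recl !big_ord0 /q /r /t /= => EA EB.
have f4 : 1 - v z ^+ 4 = (1 - v z ^+ 2) * (1 + v z ^+ 2) by ring.
have v2 : 1 - v z ^+ 2 != 0 by move: h4; rewrite f4 mulf_eq0 negb_or => /andP[].
have v2' : 1 + v z ^+ 2 != 0 by move: h4; rewrite f4 mulf_eq0 negb_or => /andP[].
split.
  apply: cder_eq (@cder_comp _ A v z _ _ cA (dv z zS)) _.
  apply: (mulfI h4); rewrite mulrA EA f4. by field.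
apply: cder_eq (@cder_comp _ B v z _ _ cB (dv z zS)) _.
apply: (mulfI h4); rewrite mulrA EB f4 coth_v//; by field; rewrite v2'.
Qed.

End Domain.

(** * Existence of solutions on the cut strip *)

Section SolutionSpace.
Variable R : realType.
Local Notation C := (R[i]).
Local Notation N := (@ComplexField.Normc.normc R).
Local Notation "x %:CC" := (real_complex R x) (at level 2, format "x %:CC").
Local Notation Re := complex.Re.
Local Notation Im := complex.Im.
Local Notation piI := (piI R).
Local Notation hpi := (piI / 2).
Implicit Types (z w p : C) (U : C -> Prop) (k m : C).

(** Serves to pass to a point p on the boundary of the region where an identity is known. *)
Lemma cont_eq_dir (f g : C -> C) p w : cont f p -> cont g p ->
  (forall t : R, 0 < t < 1 -> f (p + t%:CC * w) = g (p + t%:CC * w)) -> f p = g p.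
Proof.
move=> cf cg h; have cfg := contB cf cg.
apply/eqP; rewrite -subr_eq0; apply/eqP/N_eq0/eqP; rewrite eq_le N_ge0 andbT leNgt.
apply/negP => d0; have [d dd hd] := cfg _ d0.
have w1 : 0 < N w + 1 by rewrite ltr_wpDl// N_ge0.
pose t := Num.min (1 / 2) (d / (N w + 1) / 2).
have t0 : 0 < t by rewrite lt_min !divr_gt0.
have t1 : t < 1 by rewrite gt_min ltr_pdivrMr// mul1r ltrDl ltr01.
have td : t * (N w + 1) < d.
  rewrite -ltr_pdivlMr// gt_min; apply/orP; right.
  have : 0 < d / (N w + 1) by rewrite divr_gt0.
  lra.
have := hd (p + t%:CC * w); rewrite addrAC subrr add0r NM Nreal (gtr0_norm t0).
have : t * N w < d by apply: le_lt_trans td; rewrite ler_wpM2l// ?(ltW t0)// lerDl.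
by move=> + H => /H; rewrite h ?t0// subrr sub0r NN ltxx.
Qed.

Lemma sin_le (x : R) : 0 <= x -> sin x <= x.
Proof.
move=> x0; have [|c _] := @MVT_segment R sin cos 0 x x0.
  by apply: continuous_subspaceT => y; exact: continuous_sin.
rewrite sin0 !subr0 => ->; rewrite -[leRHS]mul1r ler_wpM2r// cos_le1//.
Qed.

(** With w = e^(2z), the disc |2w - 1| < 1 is |w|^2 < Re w, which is this inequality for z = r + it.
    It follows from e^(-2t) <= 1/(1 + 2t) <= 1 - 2 t^2 <= cos 2t for 0 <= t < 1/2. *)
Lemma wedge_ineq (r t : R) : `|t| < 2^-1 -> r < - `|t| -> expR (2 * r) < cos (2 * t).
Proof.
wlog t0 : t / 0 <= t => [hw|].
  have [/hw//|/ltW t0] := leP 0 t; rewrite -normrN => h1 h2.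
  by have := hw (- t); rewrite oppr_ge0 => /(_ t0 h1 h2); rewrite mulrN cosN.
rewrite ger0_norm// => t1 rt.
have h1 : expR (2 * r) < expR (- (2 * t)) by rewrite ltr_expR; lra.
have h2 : expR (- (2 * t)) <= (1 + 2 * t)^-1.
  rewrite expRN lef_pV2 ?posrE ?expR_gt0 ?expR_ge1Dx//; lra.
have h3 : cos (2 * t) = 1 - 2 * sin t ^+ 2.
  have -> : 2 * t = t + t by ring.
  by rewrite cosD; have := cos2Dsin2 t; rewrite !expr2; lra.
have s0 : 0 <= sin t by apply: sin_ge0_pi; have := pi_ge2 R; lra.
have h4 : sin t ^+ 2 <= t ^+ 2 by rewrite lerXn2r ?nnegrE// sin_le.
apply: (lt_le_trans h1); apply: (le_trans h2); rewrite h3.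
have t2 : 0 < 1 + 2 * t by lra.
apply: (@le_trans _ _ (1 - 2 * t ^+ 2)); last by lra.
rewrite -(ler_pM2r t2) mulVf ?lt0r_neq0//.
have : 0 <= t * ((1 - 2 * t) * (1 + t)) by rewrite !mulr_ge0//; lra.
rewrite !expr2; lra.
Qed.

(** The zero of 2 e^(2z) - 1, that is the centre of the disc in [wedge_chart]. *)
Definition wcenter : C := (- (ln 2 / 2))%:CC.

Lemma ln2_gt0 : 0 < ln (2 : R). Proof. by rewrite ln_gt0// ltr1n. Qed.

Lemma Wedge_wcenter : Wedge wcenter.
Proof. by have := ln2_gt0; rewrite /Wedge /=; split; lra. Qed.

(** The coordinate u = 2 e^(2z) - 1 satisfies du/dz = 2 (1 + u) and coth z = (u + 3)/(u - 1); it
    places the singular points z = - oo and z = 0 at u = -1 and u = 1. Multiplication by 1 - u^4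
    instead of 1 - u^2 fits the shape of [ode4]. *)
Lemma wedge_chart k m a0 b0 : exists a b, [/\ Sol k m (@Wedge R) a b, a wcenter = a0
  & b wcenter = b0].
Proof.
pose q j : C := if (j == 0%N) || (j == 2%N) then - (m / 2) else (m / 2).
pose r j : C := if (j == 0%N) || (j == 2%N) then - (1 / 2) else (1 / 2).
pose t j : C := if (j == 0%N) || (j == 2%N) then - (3 * k) else - k.
have [A [B [A0 B0 AB]]] := ode4 (fun=> 0) q r t a0 b0.
pose u : C -> C := fun z => 2 * expC (2 * z) - 1.
have Nu z : Wedge z -> N (u z) < 1.
  move=> [z1 z2 z3 z4]; rewrite -(@ltr_pXn2r _ 2)// ?nnegrE ?N_ge0// N2.
  have E : Re (u z) = 2 * (expR (2 * Re z) * cos (2 * Im z)) - 1.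
    by rewrite /u ReB Re2 Re_expC Re2 Im2.
  have F : Im (u z) = 2 * (expR (2 * Re z) * sin (2 * Im z)).
    by rewrite /u ImB Im2 Im_expC Re2 Im2 subr0.
  have h : expR (2 * Re z) < cos (2 * Im z).
    apply: wedge_ineq; first by rewrite ltr_norml; lra.
    by case: (lerP 0 (Im z)) => hz; rewrite ?(ger0_norm hz) ?(ltr0_norm hz); lra.
  have h0 := expR_gt0 (2 * Re z).
  rewrite E F; have cs := cos2Dsin2 (2 * Im z).
  move: h h0 cs; move: (expR _) (cos _) (sin _) => e c s ec e0 cs.
  have : 4 * (e * (e * (c ^+ 2 + s ^+ 2) - c)) < 0.
    by rewrite cs mulr1 pmulr_rlt0// pmulr_rlt0// subr_lt0.
  rewrite !expr2; lra.
have du z : cder u z (2 * (1 + u z)).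
  apply: cder_eq (cderB (cderZ 2 (cder_expCmul 2 z)) (cder_cst 1 z)) _.
  by rewrite /u; ring.
have coth_u z : Wedge z -> cothC z = (u z + 3) / (u z - 1).
  move=> zW; have zL : Left z by case: zW => *; rewrite /Left; lra.
  have s0 := sh2_Left zL; have e0 := expC_neq0 z.
  have E : expC (2 * z) = expC z ^+ 2 by rewrite (expCMn z 2).
  have sE : sh2 z = (expC z ^+ 2 - 1) / expC z by rewrite /sh2 expCN; field.
  have h : expC z ^+ 2 - 1 != 0 by apply: contraNneq s0 => h; rewrite sE h mul0r.
  rewrite /cothC sE /ch2 expCN /u E; field; rewrite e0 h /=.
  have -> : 2 * expC z ^+ 2 - 1 - 1 = 2 * (expC z ^+ 2 - 1) by ring.
  by rewrite mulf_neq0// pnatr_eq0.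
exists (fun z => A (u z)), (fun z => B (u z)).
have u0 : u wcenter = 0.
  have E2 : 2 * wcenter = (- ln 2)%:CC by rewrite two_CC -rmorphM/=; congr (_%:CC); lra.
  rewrite /u E2 expC_real expRN lnK ?posrE// fmorphV/= -two_CC divff ?pnatr_eq0// subrr//.
split; last first; [by rewrite u0|by rewrite u0|].
move=> z zW; have [dA [dB [cA cB EA EB]]] := AB (u z) (Nu z zW).
have h4 := one_sub4_neq0 (Nu z zW).
move: EA EB; rewrite !big_ord_recl !big_ord0 /q /r /t /= => EA EB.
have f4 : 1 - u z ^+ 4 = (1 - u z) * (1 + u z ^+ 2) * (1 + u z) by ring.
have u3 : (1 - u z) * (1 + u z ^+ 2) != 0 by move: h4; rewrite f4 mulf_eq0 negb_or => /andP[].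
have u1 : 1 - u z != 0 by move: u3; rewrite mulf_eq0 negb_or => /andP[].
have u1' : u z - 1 != 0 by rewrite -opprB oppr_eq0.
split.
  apply: cder_eq (@cder_comp _ A u z _ _ cA (du z)) _.
  apply: (mulfI h4); rewrite [LHS]mulrA EA f4; by field.
apply: cder_eq (@cder_comp _ B u z _ _ cB (du z)) _.
apply: (mulfI h4); rewrite [LHS]mulrA EB f4 coth_u//; by field.
Qed.

Lemma Dom_real p : Im p = 0 -> Re p < 0 -> Dom p.
Proof. by move=> h1 h2; split; [rewrite h1 normr0 pi_gt0|right]. Qed.

Lemma sol_piece k m U V a b a' b' : (forall z, U z -> exists2 r : R, 0 < r &
    (forall y, N (y - z) < r -> V y /\ (a' y = a y /\ b' y = b y))) ->
  Sol k m V a b -> Sol k m U a' b'.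
Proof.
move=> h s z /h[r r0 hr]; have [|Vz [az bz]] := hr z; first by rewrite subrr N0.
have [h1 h2] := s z Vz; rewrite az bz; split.
  by apply: (cder_local r0) h1 => y /hr[_ []].
by apply: (cder_local r0) h2 => y /hr[_ []].
Qed.

(** The solution on the upper half strip is continued at [p1] into the wedge and from there at [p2]
    into the lower half strip, a translate of the upper one. The overlaps are star-shaped about [p1]
    and [p2], so uniqueness makes the pieces agree there. *)
Lemma dom_exists k m a0 b0 : exists a b, [/\ Sol k m (@Dom R) a b, a hpi = a0 & b hpi = b0].
Proof.
have [ap [bp [sp ap0 bp0]]] := strip_chart k m a0 b0.
pose p1 : C := Complex (-1) (1 / 10); pose p2 : C := Complex (-1) (- (1 / 10)).
have W1 : Wedge p1 by split => /=; lra.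
have W2 : Wedge p2 by split => /=; lra.
have pi2 := pi_ge2 R.
have S1 : Sig0 p1 by rewrite /Sig0 /=; lra.
have S2 : Sig0 (p2 + piI) by rewrite /Sig0 ImD Im_piI /=; lra.
have shW z : Wedge z -> sh2 z != 0.
  by move=> [? ? ? ?]; apply: sh2_Left; rewrite /Left; lra.
have [aD [bD [sD aD1 bD1]]] := sol_transfer (Wedge_star W1) Wedge_wcenter shW
  (wedge_chart k m) (ap p1) (bp p1).
have [an [bn [sn an2 bn2]]] := sol_transfer (Sig0_star S2) (Sig0_hpi R) (@sh2_Sig0 R)
  (strip_chart k m) (aD p2) (bD p2).
pose am z := an (z + piI); pose bm z := bn (z + piI).
have sm : Sol k m (fun z => Sig0 (z + piI)) am bm := sol_shift sn.
have starI (U V : C -> Prop) p : star U p -> star V p -> star (fun z => U z /\ V z) p.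
  by move=> sU sV z [Uz Vz] t t01; split; [exact: sU|exact: sV].
have eqp z : Wedge z -> Sig0 z -> ap z = aD z /\ bp z = bD z.
  move=> zW zS; apply: (@sol_uniq _ k m (fun z => Wedge z /\ Sig0 z) _ _ _ _ p1); rewrite ?aD1 ?bD1//.
  - by apply: starI; [exact: Wedge_star|exact: Sig0_star].
  - by move=> y [/shW].
  - by apply: sol_sub sp => y [].
  - by apply: sol_sub sD => y [].
have eqm z : Wedge z -> Sig0 (z + piI) -> am z = aD z /\ bm z = bD z.
  move=> zW zS; apply: (@sol_uniq _ k m (fun z => Wedge z /\ Sig0 (z + piI)) _ _ _ _ p2) => //.
  - apply: starI; first exact: Wedge_star.
    move=> y yS t t01; have := Sig0_star S2 yS t01; congr Sig0; ring.
  - by move=> y [/shW].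
  - by apply: sol_sub sm => y [].
  - by apply: sol_sub sD => y [].
pose a z := if 0 < Im z then ap z else if Im z < 0 then am z else aD z.
pose b z := if 0 < Im z then bp z else if Im z < 0 then bm z else bD z.
have Imh : 0 < Im hpi by rewrite Im_hpi; lra.
exists a, b; split; [|by rewrite /a Imh|by rewrite /b Imh].
have ImN' y z (r : R) : N (y - z) < r -> `|Im y - Im z| < r.
  by rewrite -ImB; exact: le_lt_trans (Im_le_N _).
have ReN' y z (r : R) : N (y - z) < r -> `|Re y - Re z| < r.
  by rewrite -ReB; exact: le_lt_trans (Re_le_N _).
move=> z [zpi z0]; case: (ltrgt0P (Im z)) => [zp|zn|ze].
- apply: (@sol_piece _ _ (fun y => y = z) _ ap bp a b _ sp z erefl) => _ ->.
  exists (Num.min (Im z) (pi - Im z)).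
    by rewrite lt_min zp/= subr_gt0; move: zpi; rewrite ger0_norm// ltW.
  move=> y /ImN'; rewrite lt_min !ltr_norml => /andP[/andP[h1 h2] /andP[h3 h4]].
  have y0 : 0 < Im y by lra.
  by rewrite /a /b y0 /Sig0 y0; split => //=; lra.
- apply: (@sol_piece _ _ (fun y => y = z) _ am bm a b _ sm z erefl) => _ ->.
  exists (Num.min (- Im z) (pi + Im z)).
    by rewrite lt_min oppr_gt0 zn/=; move: zpi; rewrite ltr0_norm//; lra.
  move=> y /ImN'; rewrite lt_min !ltr_norml => /andP[/andP[h1 h2] /andP[h3 h4]].
  have y0 : Im y < 0 by lra.
  have y1 : (0 < Im y) = false by apply/negbTE; rewrite -leNgt ltW.
  by rewrite /a /b y0 y1 /Sig0 ImD Im_piI; split => //=; lra.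
have zr : Re z < 0 by move: z0; rewrite ze eqxx; case.
apply: (@sol_piece _ _ (fun y => y = z) _ aD bD a b _ sD z erefl) => _ ->.
exists (Num.min 2^-1 (- Re z / 2)); first by rewrite lt_min invr_gt0; lra.
move=> y yz; have := ImN' _ _ _ yz; have := ReN' _ _ _ yz.
rewrite !lt_min !ltr_norml ze => /andP[/andP[h1 h2] /andP[h3 h4]] /andP[/andP[h5 h6] /andP[h7 h8]].
have yW : Wedge y by split; lra.
split => //; rewrite /a /b; case: (ltrgt0P (Im y)) => [yp|yn|//].
  by apply: eqp => //; rewrite /Sig0 yp; lra.
by apply: eqm => //; rewrite /Sig0 ImD Im_piI; lra.
Qed.

End SolutionSpace.

(** * The half-turn matrix, its determinant, and the passage from k to 1 - k *)

Section Monodromy.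
Variable R : realType.
Local Notation C := (R[i]).
Local Notation N := (@ComplexField.Normc.normc R).
Local Notation "x %:CC" := (real_complex R x) (at level 2, format "x %:CC").
Local Notation Re := complex.Re.
Local Notation Im := complex.Im.
Local Notation piI := (piI R).
Local Notation hpi := (piI / 2).
Local Notation DomR := (@Dom R).
Implicit Types (z w p : C) (U : C -> Prop) (k lam : C) (v : C * C).

Definition par k lam : C := lam ^+ 2 - k ^+ 2.

Definition sol_spec k lam v : {f : (C -> C) * (C -> C) |
  [/\ Sol k (par k lam) DomR f.1 f.2, f.1 hpi = v.1 & f.2 hpi = v.2]}.
Proof. by apply: cid; have [a [b h]] := dom_exists k (par k lam) v.1 v.2; exists (a, b). Qed.

Definition solA k lam v : C -> C := (projT1 (sol_spec k lam v)).1.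
Definition solB k lam v : C -> C := (projT1 (sol_spec k lam v)).2.

Lemma solAB k lam v : Sol k (par k lam) DomR (solA k lam v) (solB k lam v).
Proof. by rewrite /solA /solB; case: (projT2 (sol_spec k lam v)). Qed.
Lemma solA_mid k lam v : solA k lam v hpi = v.1.
Proof. by rewrite /solA; case: (projT2 (sol_spec k lam v)). Qed.
Lemma solB_mid k lam v : solB k lam v hpi = v.2.
Proof. by rewrite /solB; case: (projT2 (sol_spec k lam v)). Qed.

Definition mone : C := (-1)%:CC.
Lemma mone_real : Im mone = 0. Proof. by []. Qed.
Lemma mone_neg : Re mone < 0. Proof. by rewrite /mone /=; lra. Qed.

(** [Dom] is star-shaped about negative real points only. From a point off the real axis, uniqueness
    holds first on the half [U] of [Dom] on its side, and continuity carries the equality to -1 on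
    the boundary of [U], from where the whole domain is reached. *)
Lemma Dom_uniq k m a b a' b' p : Dom p -> Sol k m DomR a b -> Sol k m DomR a' b' ->
  a p = a' p -> b p = b' p -> forall z, Dom z -> a z = a' z /\ b z = b' z.
Proof.
suff main q : Dom q -> Im q != 0 -> Sol k m DomR a b -> Sol k m DomR a' b' ->
    a q = a' q -> b q = b' q -> a mone = a' mone /\ b mone = b' mone.
  move=> Dp s s' ap bp; have [p0|p0] := eqVneq (Im p) 0.
    apply: (sol_uniq (p := p)) s s' ap bp; last exact: sh2_Dom.
    by apply: Dom_star => //; case: Dp => _; rewrite p0 eqxx => -[].
  have [h1 h2] := main p Dp p0 s s' ap bp.
  apply: (sol_uniq (p := mone)) s s' h1 h2; last exact: sh2_Dom.
  exact: Dom_star mone_real mone_neg.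
move=> Dq q0 s s' aq bq.
pose U z := Dom z /\ 0 < Im q * Im z.
have sU : star U q.
  move=> z [Dz z0] t t01; have [q1 _] := Dq; have [z1 _] := Dz.
  have h : 0 < Im q * Im (q + t%:CC * (z - q)).
    rewrite Im_seg mulrDr mulrCA mulrBr.
    by apply: (@seg_gt _ (Im q * Im q)) => //; rewrite -expr2 exprn_even_gt0.
  split => //; split; last first.
    by left; apply: contraTneq h => ->; rewrite mulr0 ltxx.
  move: q1 z1; rewrite Im_seg !ltr_norml => /andP[q1 q2] /andP[z1 z2].
  by rewrite seg_gt// seg_lt.
have eqU z : U z -> a z = a' z /\ b z = b' z.
  apply: (sol_uniq sU); [by move=> y [/sh2_Dom]|by apply: sol_sub s => y []|
    by apply: sol_sub s' => y []|by []|by []].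
have cab z : Dom z -> [/\ cont a z, cont b z, cont a' z & cont b' z].
  by move=> Dz; have [/cder_cont ? /cder_cont ?] := s z Dz; have [/cder_cont ? /cder_cont ?] := s' z Dz.
have Dm : Dom mone by apply: Dom_real; [exact: mone_real|exact: mone_neg].
have [c1 c2 c3 c4] := cab _ Dm.
pose w : C := Complex 0 (Num.sg (Im q)).
have Uw (t : R) : 0 < t < 1 -> U (mone + t%:CC * w).
  move=> /andP[t0 t1]; have E : Im (mone + t%:CC * w) = t * Num.sg (Im q).
    by rewrite ImD ImZ /= add0r.
  have pp := pi_ge2 R.
  rewrite /U /Dom E; split; last by rewrite mulrCA mulr_gt0// mulrC -normrEsg normr_gt0.
  split; last by left; apply: mulf_neq0; [exact: lt0r_neq0|rewrite sgr_eq0].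
  by rewrite normrM normr_sg q0 mulr1 gtr0_norm//; lra.
split; [apply: (@cont_eq_dir _ _ _ _ w c1 c3)|apply: (@cont_eq_dir _ _ _ _ w c2 c4)];
  by move=> t /Uw/eqU[].
Qed.

Lemma Dom_hpi : Dom hpi. Proof. exact/Sig0_Dom/Sig0_hpi. Qed.

Lemma sol_eq k lam v a b : Sol k (par k lam) DomR a b -> a hpi = v.1 -> b hpi = v.2 ->
  forall z, Dom z -> solA k lam v z = a z /\ solB k lam v z = b z.
Proof.
move=> s h1 h2; apply: (Dom_uniq Dom_hpi (@solAB k lam v) s).
  by rewrite solA_mid h1.
by rewrite solB_mid h2.
Qed.

Lemma sol_linE k lam (c d : C) (u w : C * C) v z : v = (c * u.1 + d * w.1, c * u.2 + d * w.2) -> Dom z ->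
  solA k lam v z = c * solA k lam u z + d * solA k lam w z /\
  solB k lam v z = c * solB k lam u z + d * solB k lam w z.
Proof.
move=> -> Dz; apply: (@sol_eq k lam _ (fun z => c * solA k lam u z + d * solA k lam w z)
  (fun z => c * solB k lam u z + d * solB k lam w z)) => //.
- exact: sol_lin (@solAB k lam u) (@solAB k lam w).
- by rewrite !solA_mid.
- by rewrite !solB_mid.
Qed.

Lemma DomN z : Sig0 z -> Dom (- z).
Proof.
move=> /andP[z0 z1]; rewrite /Dom ImN normrN oppr_eq0 gtr0_norm//.
by split=> //; left; rewrite lt0r_neq0.
Qed.

Lemma Dom_sub_pi z : Sig0 z -> Dom (z - piI).
Proof.
move=> /andP[z0 z1]; rewrite /Dom ImB Im_piI ltr0_norm ?subr_lt0//.
split; first lra.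
by left; rewrite lt_eqF// subr_lt0.
Qed.

Lemma hpiN : - hpi = hpi - piI. Proof. by field. Qed.

Lemma Dom_Nhpi : Dom (- hpi). Proof. exact/DomN/Sig0_hpi. Qed.

(* Solutions on Dom are identified with their value at pi i / 2.  Since the
   equation is invariant under z |-> z + pi i and, up to the sign of b, under
   z |-> - z, both generators are expressed through Pm: T is Tm, and Y is
   e^{- pi i k} Pm. *)
Definition Pm k lam v : C * C := (solA k lam v (- hpi), solB k lam v (- hpi)).
Definition Tm k lam v : C * C := ((Pm k lam v).1, - (Pm k lam v).2).

Lemma sol_ext_Sig0 k lam v a b p : Sol k (par k lam) (@Sig0 R) a b -> Sig0 p ->
  solA k lam v p = a p -> solB k lam v p = b p ->
  forall z, Sig0 z -> solA k lam v z = a z /\ solB k lam v z = b z.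
Proof.
move=> s p0 h1 h2; apply: (sol_uniq (Sig0_star p0) (@sh2_Sig0 R) _ s h1 h2).
exact: sol_sub (@Sig0_Dom R) (@solAB k lam v).
Qed.

Lemma sol_Pm k lam v z : Sig0 z -> solA k lam (Pm k lam v) z = solA k lam v (z - piI) /\
  solB k lam (Pm k lam v) z = solB k lam v (z - piI).
Proof.
apply: (@sol_ext_Sig0 _ _ _ (fun z => solA k lam v (z - piI)) (fun z => solB k lam v (z - piI)) hpi).
- have := sol_unshift (@solAB k lam v); apply: sol_sub => y; exact: Dom_sub_pi.
- exact: Sig0_hpi.
- by rewrite solA_mid -hpiN.
- by rewrite solB_mid -hpiN.
Qed.

Lemma sol_Tm k lam v z : Sig0 z -> solA k lam (Tm k lam v) z = solA k lam v (- z) /\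
  solB k lam (Tm k lam v) z = - solB k lam v (- z).
Proof.
apply: (@sol_ext_Sig0 _ _ _ (fun z => solA k lam v (- z)) (fun z => - solB k lam v (- z)) hpi).
- have := sol_refl (@solAB k lam v); apply: sol_sub => y; exact: DomN.
- exact: Sig0_hpi.
- by rewrite solA_mid.
- by rewrite solB_mid.
Qed.

Definition e1 : C * C := (1, 0).
Definition e2 : C * C := (0, 1).
Definition P11 k lam := (Pm k lam e1).1.
Definition P21 k lam := (Pm k lam e1).2.
Definition P12 k lam := (Pm k lam e2).1.
Definition P22 k lam := (Pm k lam e2).2.

Lemma PmE k lam v : Pm k lam v = (P11 k lam * v.1 + P12 k lam * v.2, P21 k lam * v.1 + P22 k lam * v.2).
Proof.
have [|h1 h2] := @sol_linE k lam v.1 v.2 e1 e2 v (- hpi) _ Dom_Nhpi.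
  by case: v => x y /=; rewrite !mulr1 !mulr0 addr0 add0r.
by rewrite /Pm h1 h2 /P11 /P12 /P21 /P22 /Pm /=; congr (_, _); ring.
Qed.

Definition wr k lam z := solA k lam e1 z * solB k lam e2 z - solA k lam e2 z * solB k lam e1 z.

Lemma wr_mid k lam : wr k lam hpi = 1.
Proof. by rewrite /wr !solA_mid !solB_mid /=; ring. Qed.

Definition detP k lam := P11 k lam * P22 k lam - P12 k lam * P21 k lam.

Lemma wr_Nmid k lam : wr k lam (- hpi) = detP k lam.
Proof. by []. Qed.

(** Abel's identity: the coefficient matrix has trace 2 k coth z. *)
Lemma cder_wr k lam z : Dom z -> cder (wr k lam) z (2 * k * cothC z * wr k lam z).
Proof.
move=> Dz; have [h1 h2] := @solAB k lam e1 z Dz; have [h3 h4] := @solAB k lam e2 z Dz.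
by apply: cder_eq (cderB (cderM h1 h4) (cderM h3 h2)) _; rewrite /wr; ring.
Qed.

Lemma wr_sub_pi k lam z : Sig0 z -> wr k lam (z - piI) = detP k lam * wr k lam z.
Proof.
move=> zS; have [h1 h2] := @sol_Pm k lam e1 z zS; have [h3 h4] := @sol_Pm k lam e2 z zS.
have Dz := Sig0_Dom zS.
have H v : solA k lam (Pm k lam v) z = (Pm k lam v).1 * solA k lam e1 z + (Pm k lam v).2 * solA k lam e2 z
  /\ solB k lam (Pm k lam v) z = (Pm k lam v).1 * solB k lam e1 z + (Pm k lam v).2 * solB k lam e2 z.
  apply: sol_linE => //; case: (Pm k lam v) => x y /=; by rewrite !mulr1 !mulr0 addr0 add0r.
rewrite /wr -h1 -h2 -h3 -h4; have [-> ->] := H e1; have [-> ->] := H e2.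
by rewrite /detP /P11 /P12 /P21 /P22; ring.
Qed.

(** A branch of (- [sh2] z)^(2k) on the left half plane: the factor e^(- 2 k z) is explicit, and the
    remaining base 1 - e^(2z) has positive real part and period pi i. *)
Definition wr0 k z : C := expC (- 2 * k * z + 2 * k * logC (1 - expC (2 * z))).

Lemma N_expC2_Left z : Left z -> N (expC (2 * z)) < 1.
Proof. by move=> zL; rewrite N_expC expR_lt1 Re2; move: zL; rewrite /Left; lra. Qed.

Lemma Re_1_sub z : N z < 1 -> 0 < Re (1 - z).
Proof. by move=> z1; rewrite ReB /=; have := Re_le_N z; rewrite ler_norml; lra. Qed.

Lemma coth_exp z : sh2 z != 0 -> cothC z = (expC (2 * z) + 1) / (expC (2 * z) - 1).
Proof.
move=> s0; have e0 := expC_neq0 z.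
have E : expC (2 * z) = expC z ^+ 2 by rewrite (expCMn z 2).
have sE : sh2 z = (expC z ^+ 2 - 1) / expC z by rewrite /sh2 expCN; field.
have h : expC z ^+ 2 - 1 != 0 by apply: contraNneq s0 => h; rewrite sE h mul0r.
by rewrite /cothC sE /ch2 expCN E; field; rewrite e0 h.
Qed.

Lemma cder_wr0 k z : Left z -> cder (wr0 k) z (2 * k * cothC z * wr0 k z).
Proof.
move=> zL; have h1 := Re_1_sub (N_expC2_Left zL).
have d1 : cder (fun y => 1 - expC (2 * y)) z (0 - 2 * expC (2 * z)).
  by apply: cderB; [exact: cder_cst|exact: cder_expCmul].
have d2 := cderZ (2 * k) (@cder_comp _ (@logC R) _ z _ _ (cder_logC h1) d1).
have d3 := cderD (cderZ (- 2 * k) (cder_id z)) d2.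
apply: cder_eq (@cder_comp _ _ _ z _ _ (cder_expC _) d3) _.
have e0 : 1 - expC (2 * z) != 0 by apply: contraTneq h1 => ->; rewrite ltxx.
have e1' : expC (2 * z) - 1 != 0 by rewrite -opprB oppr_eq0.
by rewrite coth_exp ?sh2_Left// /wr0; field; rewrite e0 e1'.
Qed.

Lemma wr0_pi k z : wr0 k (z + piI) = expC (- (2 * piI * k)) * wr0 k z.
Proof.
have E : expC (2 * (z + piI)) = expC (2 * z) by rewrite mulrDr expCD expC_2piI mulr1.
rewrite /wr0 E -expCD; congr expC; ring.
Qed.

Lemma star_DomLeft : star (fun z => Dom z /\ Left z) mone.
Proof.
move=> z [Dz Lz] t t01; split; first exact: (Dom_star mone_real mone_neg).
exact: (Left_star mone_neg).
Qed.

Lemma wr_wr0 k lam z : Dom z -> Left z -> wr k lam z = wr k lam mone / wr0 k mone * wr0 k z.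
Proof.
move=> Dz Lz.
have w0 y : wr0 k y != 0 by exact: expC_neq0.
have dq y : Dom y /\ Left y -> cder (fun z => wr k lam z / wr0 k z) y 0.
  move=> [Dy Ly].
  apply: cder_eq (@cder_div _ (wr k lam) (wr0 k) y _ _ (w0 y) (cder_wr k lam Dy) (cder_wr0 k Ly)) _.
  by field.
by rewrite -(const_on_star star_DomLeft dq (conj Dz Lz)) divfK.
Qed.

Lemma Left_sub_pi z : Left z -> Left (z - piI).
Proof. by rewrite /Left ReB Re_piI subr0. Qed.

Lemma wr_left_pi k lam z : Sig0 z -> Left z -> wr k lam z = expC (- (2 * piI * k)) * wr k lam (z - piI).
Proof.
move=> zS zL; rewrite (wr_wr0 k lam (Sig0_Dom zS) zL) (wr_wr0 k lam (Dom_sub_pi zS) (Left_sub_pi zL)).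
by rewrite -{1}(subrK piI z) wr0_pi; ring.
Qed.

Lemma Sig0_mid (r : R) : Sig0 (r%:CC + hpi).
Proof. by rewrite /Sig0 ImD Im_hpi /= add0r; have := pi_gt0 R; lra. Qed.

(** Being a constant multiple of [wr0] on the left, a zero would make it vanish there identically,
    and by continuity also at pi i / 2, where it is 1. *)
Lemma wr_neq0 k lam z : Dom z -> Left z -> wr k lam z != 0.
Proof.
move=> Dz Lz; rewrite wr_wr0// mulf_neq0// ?expC_neq0// mulf_neq0 ?invr_eq0 ?expC_neq0//.
apply/eqP => h.
have z0 y : Dom y -> Left y -> wr k lam y = 0 by move=> Dy Ly; rewrite wr_wr0// h !mul0r.
have : wr k lam hpi = 0.
  apply: (@cont_eq_dir _ (wr k lam) (fun=> 0) hpi (-1)).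
  - exact/cder_cont/cder_wr/Dom_hpi.
  - exact: cont_cst.
  - move=> t /andP[t0 t1]; have -> : hpi + t%:CC * -1 = (- t)%:CC + hpi by rewrite rmorphN/=; ring.
    apply: z0; first exact/Sig0_Dom/Sig0_mid.
    by rewrite /Left ReD Re_hpi /=; lra.
by rewrite wr_mid => /eqP; rewrite oner_eq0.
Qed.

(** The quotient of the Wronskian at z - pi i by that at z is det P by linear algebra, and e^(2 pi i
    k) by the quasi-periodicity of [wr0]. *)
Lemma detPE k lam : detP k lam = expC (2 * piI * k).
Proof.
pose z : C := (-1)%:CC + hpi.
have zS : Sig0 z by exact: Sig0_mid.
have zL : Left z by rewrite /z /Left ReD Re_hpi /=; lra.
have := wr_left_pi k lam zS zL; rewrite wr_sub_pi// mulrA => /esym h.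
have := wr_neq0 k lam (Sig0_Dom zS) zL => w0.
have /(congr1 (fun x => x / wr k lam z)) := h; rewrite mulfK// divff// expCN => h'.
by apply: (mulfI (x := (expC (2 * piI * k))^-1)); rewrite ?invr_eq0 ?expC_neq0// h' mulVf// expC_neq0.
Qed.

(** [Pm] translates by - pi i, hence the factor c stands on its side: the eigenvalue of P is
    c^-1. *)
Lemma left_eigen k lam a b c : Sol k (par k lam) (@Left R) a b ->
  (forall z, Left z -> a (z + piI) = c * a z /\ b (z + piI) = c * b z) ->
  exists v, (forall z, Dom z -> Left z -> solA k lam v z = a z /\ solB k lam v z = b z) /\
    v = (c * (Pm k lam v).1, c * (Pm k lam v).2).
Proof.
move=> s per.
have Dm : Dom mone := Dom_real mone_real mone_neg.
have [a' [b' [s' am bm]]] := sol_transfer (Dom_star mone_real mone_neg) Dom_hpi (@sh2_Dom R)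
  (dom_exists k (par k lam)) (a mone) (b mone).
pose v := (a' hpi, b' hpi).
have E0 z : Dom z -> solA k lam v z = a' z /\ solB k lam v z = b' z by exact: sol_eq.
have E1 z : Dom z -> Left z -> solA k lam v z = a z /\ solB k lam v z = b z.
  move=> Dz Lz; have [-> ->] := E0 z Dz.
  apply: (@sol_uniq _ k (par k lam) (fun z => Dom z /\ Left z) _ _ _ _ mone) => //.
  - exact: star_DomLeft.
  - by move=> y [/sh2_Dom].
  - by apply: sol_sub s' => y [].
  - by apply: sol_sub s => y [].
exists v; split=> //.
(* For this z both z and z - pi i lie in [Dom] and to the left, where v is known to represent the
   given solution. *)
pose z : C := (-1)%:CC + hpi.
have zS : Sig0 z by exact: Sig0_mid.
have zL : Left z by rewrite /z /Left ReD Re_hpi /=; lra.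
have [h1 h2] := E1 z (Sig0_Dom zS) zL.
have [h3 h4] := E1 _ (Dom_sub_pi zS) (Left_sub_pi zL).
have [h5 h6] := per _ (Left_sub_pi zL); rewrite subrK in h5 h6.
have [h7 h8] := @sol_Pm k lam v z zS.
pose w := (c * (Pm k lam v).1, c * (Pm k lam v).2).
have Ew y : Dom y -> solA k lam w y = c * solA k lam (Pm k lam v) y /\ solB k lam w y = c * solB k lam (Pm k lam v) y.
  move=> Dy; apply: (@sol_eq k lam _ (fun y => c * solA k lam (Pm k lam v) y)
    (fun y => c * solB k lam (Pm k lam v) y)) => //.
  - exact: sol_scale (@solAB k lam (Pm k lam v)).
  - by rewrite solA_mid.
  - by rewrite solB_mid.
have [h9 h10] := Ew _ (Sig0_Dom zS).
have [||k1 k2] := Dom_uniq (Sig0_Dom zS) (@solAB k lam v) (@solAB k lam w) _ _ Dom_hpi.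
- by rewrite h1 h5 -h3 -h7 h9.
- by rewrite h2 h6 -h4 -h8 h10.
by rewrite -/w; move: k1 k2; rewrite !solA_mid !solB_mid; case: (w) => x y /= <- <-.
Qed.

(** The reflection z |-> - z exchanges the two halves of the cut disc, so a solution with a even and
    b odd around 0 is its own continuation along the path of T. *)
Lemma refl_eigen k lam a b (r : R) : 0 < r <= 1 ->
  Sol k (par k lam) (fun z => 0 < N z < r) a b ->
  (forall z, N z < r -> a (- z) = a z /\ b (- z) = - b z) ->
  exists v, (forall z, Dom z -> N z < r -> solA k lam v z = a z /\ solB k lam v z = b z) /\
    Tm k lam v = v.
Proof.
move=> /andP[r0 r1] s ev.
pose q : C := (- (r / 2))%:CC.
have q0 : Im q = 0 by []. have q1 : Re q < 0 by rewrite /q /=; lra.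
have Nq : N q < r by rewrite Nreal normrN gtr0_norm ?divr_gt0//; lra.
have Dq : Dom q := Dom_real q0 q1.
have [a' [b' [s' am bm]]] := sol_transfer (Dom_star q0 q1) Dom_hpi (@sh2_Dom R)
  (dom_exists k (par k lam)) (a q) (b q).
pose v := (a' hpi, b' hpi).
have E0 z : Dom z -> solA k lam v z = a' z /\ solB k lam v z = b' z by exact: sol_eq.
have Dom_N z : Dom z -> 0 < N z.
  by move=> [_ Dz]; rewrite N_gt0; apply: contraPneq Dz => ->; rewrite /= eqxx ltxx; case.
have E1 z : Dom z -> N z < r -> solA k lam v z = a z /\ solB k lam v z = b z.
  move=> Dz Lz; have [-> ->] := E0 z Dz.
  apply: (@sol_uniq _ k (par k lam) (fun z => Dom z /\ N z < r) _ _ _ _ q) => //.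
  - move=> y [Dy Ny] t t01; split; first exact: (Dom_star q0 q1).
    have -> : q + t%:CC * (y - q) = (1 - t)%:CC * q + t%:CC * y by rewrite rmorphB rmorph1; ring.
    case/andP: t01 => t0 t1; rewrite (le_lt_trans (ND _ _))// [X in X + _]NM [X in _ + X]NM (Nreal (1 - t)) (Nreal t) ger0_norm ?subr_ge0// ger0_norm//.
    have := @seg_lt _ (N q) (N y) r t; rewrite t0 t1 => /(_ isT Nq Ny); lra.
  - by move=> y [/sh2_Dom].
  - by apply: sol_sub s' => y [].
  - by apply: sol_sub s => y [Dy ->]; rewrite Dom_N.
exists v; split=> //.
pose z : C := Complex 0 (r / 2).
have pp := pi_ge2 R.
have zS : Sig0 z by rewrite /Sig0 /=; lra.
have Nz : N z < r by rewrite (le_lt_trans (N_le _))//= normr0 gtr0_norm ?divr_gt0//; lra.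
have [h1 h2] := E1 z (Sig0_Dom zS) Nz.
have [h3 h4] := E1 _ (DomN zS) (ltac:(by rewrite NN)).
have [h5 h6] := ev _ Nz.
have [h7 h8] := @sol_Tm k lam v z zS.
have [||k1 k2] := Dom_uniq (Sig0_Dom zS) (@solAB k lam (Tm k lam v)) (@solAB k lam v) _ _ Dom_hpi.
- by rewrite h7 h3 h5 -h1.
- by rewrite h8 h4 h6 opprK -h2.
by move: k1 k2; rewrite !solA_mid !solB_mid; case: (Tm k lam v) => x y /= -> ->.
Qed.

Lemma cder_coth z : sh2 z != 0 -> cder (@cothC R) z (1 - cothC z ^+ 2).
Proof.
move=> s0; apply: cder_eq (@cder_div _ (@ch2 R) (@sh2 R) z _ _ s0 (cder_ch2 z) (cder_sh2 z)) _.
by rewrite /cothC; field.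
Qed.

Lemma sh2_hpi : sh2 hpi = 2 * 'i%C.
Proof.
rewrite /sh2 expCN expC_hpi.
have -> : ('i%C)^-1 = - 'i%C :> C.
  apply: (mulfI (x := 'i%C)); first by rewrite eq_complex /= oner_eq0 andbF.
  by rewrite divff ?mulrN -?expr2 ?sqr_i ?opprK// eq_complex /= oner_eq0 andbF.
ring.
Qed.

Lemma coth_hpi : cothC hpi = 0 :> C.
Proof.
have := cothN hpi; rewrite hpiN -(cothDpi (hpi - piI)) subrK => /eqP.
by rewrite -subr_eq0 opprK -mulr2n mulrn_eq0/= => /eqP.
Qed.

(* For h a multiple of the Wronskian for k divided by sh2, the gauge
   transformation (a, b) |-> h (a + (2 k - 1) coth b, b) carries the solutions
   for 1 - k to the solutions for k. *)
Lemma gauge k lam v : Pm k lam v =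
  (- expC (2 * piI * k) * (Pm (1 - k) lam v).1, - expC (2 * piI * k) * (Pm (1 - k) lam v).2).
Proof.
pose h z := 2 * 'i%C * (wr k lam z / sh2 z).
pose a := solA (1 - k) lam v; pose b := solB (1 - k) lam v.
have s : Sol k (par k lam) DomR (fun z => h z * (a z + (2 * k - 1) * cothC z * b z)) (fun z => h z * b z).
  move=> z Dz; have s0 := sh2_Dom Dz; have [da db] := @solAB (1 - k) lam v z Dz.
  have dh : cder h z ((2 * k - 1) * cothC z * h z).
    apply: cder_eq (cderZ _ (@cder_div _ (wr k lam) (@sh2 R) z _ _ s0 (cder_wr k lam Dz) (cder_sh2 z))) _.
    by rewrite /h /cothC; field.
  split.
    apply: cder_eq (cderM dh (cderD da (cderM (cderZ (2 * k - 1) (cder_coth s0)) db))) _.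
    by rewrite -/a -/b /par; ring.
  by apply: cder_eq (cderM dh db) _; rewrite -/a -/b; ring.
have i0 : 2 * 'i%C != 0 :> C by rewrite -sh2_hpi sh2_Dom//; exact: Dom_hpi.
(* At pi i / 2 and - pi i / 2 coth vanishes, so there the gauge transformation is multiplication by
   h, which equals 1 at the first point and - q at the second. *)
have h1 : h hpi = 1 by rewrite /h wr_mid sh2_hpi mul1r divff.
have h2 : h (- hpi) = - expC (2 * piI * k).
  by rewrite /h wr_Nmid detPE sh2N sh2_hpi invrN mulrN mulrN mulrCA divff// mulr1.
have [||e3 e4] := @sol_eq k lam v _ _ s _ _ (- hpi) Dom_Nhpi.
- by rewrite h1 coth_hpi /a solA_mid mulr0 mul0r addr0 mul1r.
- by rewrite h1 /b solB_mid mul1r.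
by rewrite /Pm e3 e4 h2 cothN coth_hpi oppr0 mulr0 mul0r addr0.
Qed.

End Monodromy.

(** * Frobenius series at infinity and the symmetric solution at zero *)

Section Hypergeometric.
Variable R : realType.
Local Notation C := (R[i]).
Local Notation N := (@ComplexField.Normc.normc R).
Local Notation "x %:CC" := (real_complex R x) (at level 2, format "x %:CC").
Local Notation piI := (piI R).
Local Notation hpi := (piI / 2).
Implicit Types (z w p : C) (k lam : C) (v : C * C).

(** The coefficients of Gauss's series 2F1(al, be; ga). *)
Fixpoint hyp (al be ga : C) (n : nat) : C :=
  if n is m.+1 then hyp al be ga m * ((m%:R + al) * (m%:R + be) / (m.+1%:R * (m%:R + ga))) else 1.

Lemma inv_bound (ga : C) : exists2 M, 0 <= M & forall n, (N (n%:R + ga))^-1 <= M.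
Proof.
pose n0 := (Num.truncn (N ga + 1)).+1.
pose S := \sum_(i < n0) (N (i%:R + ga))^-1.
have S0 : 0 <= S by apply: sumr_ge0 => i _; rewrite invr_ge0 N_ge0.
exists (1 + S) => [|n]; first by rewrite addr_ge0.
have [nn|nn] := ltnP n n0.
  rewrite /S (bigD1 (Ordinal nn))//= addrCA lerDl addr_ge0//.
  by apply: sumr_ge0 => i _; rewrite invr_ge0 N_ge0.
have h1 : N ga + 1 < n%:R.
  have : N ga + 1 < n0%:R by apply: truncnS_gt.
  by move=> h; apply: lt_le_trans h _; rewrite ler_nat.
have h2 : 1 <= N (n%:R + ga).
  by have := NBD (n%:R) ga; rewrite N_nat; lra.
have : (N (n%:R + ga))^-1 <= 1 by rewrite invf_le1// (lt_le_trans _ h2).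
lra.
Qed.

(** Since (n+al)(n+be)/(n+ga) = n + (al+be-ga) + (ga-al)(ga-be)/(n+ga) is n plus a bounded term,
    [growth] applies. *)
Lemma subexp_hyp al be ga : (forall n, n%:R + ga != 0 :> C) -> subexp (hyp al be ga).
Proof.
move=> gn; have [M M0 hM] := inv_bound ga.
pose K := N (al + be - ga) + N ((ga - al) * (ga - be)) * M.
have K0 : 0 <= K by rewrite addr_ge0 ?mulr_ge0 ?N_ge0.
apply: (@growth _ (fun n => N (hyp al be ga n)) K) => // [n|n B hB]; first exact: N_ge0.
have B0 : 0 <= B by apply: le_trans (hB 0%N _); rewrite ?N_ge0.
rewrite /= NM.
have E : n.+1%:R * N ((n%:R + al) * (n%:R + be) / (n.+1%:R * (n%:R + ga))) =
   N ((n%:R + al) * (n%:R + be) / (n%:R + ga)).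
  by rewrite -[X in X * _](N_nat R) -NM; congr N; field; rewrite gn nat1r pnatr_eq0.
rewrite mulrCA E mulrC; apply: ler_pM; rewrite ?N_ge0 ?hB//.
have -> : (n%:R + al) * (n%:R + be) / (n%:R + ga) =
   n%:R + ((al + be - ga) + (ga - al) * (ga - be) * (n%:R + ga)^-1) by field; rewrite gn.
apply: (le_trans (ND _ _)); rewrite N_nat.
have h1 := ND (al + be - ga) ((ga - al) * (ga - be) * (n%:R + ga)^-1).
have h2 : N ((ga - al) * (ga - be) * (n%:R + ga)^-1) <= N ((ga - al) * (ga - be)) * M.
  by rewrite NM ler_wpM2l ?N_ge0// NV.
by rewrite /K -natr1; lra.
Qed.

Lemma hypS al be ga n : n%:R + ga != 0 ->
  n.+1%:R * (n%:R + ga) * hyp al be ga n.+1 = (n%:R + al) * (n%:R + be) * hyp al be ga n.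
Proof. by move=> gn; rewrite /=; field; rewrite gn nat1r pnatr_eq0. Qed.

Definition Ex (rho : C) (x : nat -> C) z : C := expC (rho * z) * ps x (expC (2 * z)).

Lemma cder_Ex rho x z : subexp x -> Left z ->
  cder (Ex rho x) z (Ex rho (fun n => (rho + 2 * n%:R) * x n) z).
Proof.
move=> sx zL; have Z1 := N_expC2_Left zL.
have d := cderM (cder_expCmul rho z)
  (@cder_comp _ (ps x) (fun z => expC (2 * z)) z _ _ (cder_ps sx Z1) (cder_expCmul 2 z)).
apply: cder_eq d _; rewrite /Ex.
have -> : ps (fun n => (rho + 2 * n%:R) * x n) (expC (2 * z)) =
    rho * ps x (expC (2 * z)) + 2 * (expC (2 * z) * ps (der x) (expC (2 * z))).
  rewrite -ps_sh//; last exact: subexp_der.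
  rewrite -!psZ//; last by apply: subexp_sh; exact: subexp_der.
  rewrite -psD//; [|exact: subexpZ|by apply: subexpZ; apply: subexp_sh; exact: subexp_der].
  by apply: eq_ps => -[|n] /=; rewrite /der; ring.
by ring.
Qed.

Lemma subexp_lin (rho : C) x : subexp x -> subexp (fun n => (rho + 2 * n%:R) * x n).
Proof.
move=> sx; have := subexpD (subexpZ rho sx) (subexpZ 2 (subexp_nat sx)).
by congr subexp; apply/funext => n; ring.
Qed.

(* The last hypothesis is the Gegenbauer equation for [be], with parameter
   1 - k. *)
Lemma beta_sol k lam (be be1 : C -> C) z d2 : sh2 z != 0 ->
  cder be z (be1 z) -> cder be1 z d2 ->
  sh2 z * d2 + 2 * (1 - k) * ch2 z * be1 z = (lam ^+ 2 - (1 - k) ^+ 2) * sh2 z * be z ->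
  cder (fun z => - (sh2 z * be1 z) + (2 * k - 1) * (ch2 z * be z)) z
    (- par k lam * (sh2 z * be z)) /\
  cder (fun z => sh2 z * be z) z
    (2 * k * cothC z * (sh2 z * be z) - (- (sh2 z * be1 z) + (2 * k - 1) * (ch2 z * be z))).
Proof.
move=> s0 h1 h2 E; split.
  apply: cder_eq (cderD (cderN (cderM (cder_sh2 z) h2)) (cderZ (2 * k - 1) (cderM (cder_ch2 z) h1))) _.
  have -> : sh2 z * d2 = (lam ^+ 2 - (1 - k) ^+ 2) * sh2 z * be z - 2 * (1 - k) * ch2 z * be1 z.
    by rewrite -E addrK.
  by rewrite /par; ring.
by apply: cder_eq (cderM (cder_sh2 z) h1) _; rewrite /cothC; field.
Qed.

Section FrobeniusAtZero.
Variables (k lam lp : C) (g : nat -> C).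
Hypothesis lp2 : lp ^+ 2 = lam ^+ 2.
Hypothesis grec : forall n, n.+1%:R * (n.+1%:R + lp) * g n.+1 =
  (n%:R + (1 - k)) * (n%:R + (1 - k) + lp) * g n.

(** Inserting be = sum of g_n e^(rho_n z) into the Gegenbauer equation gives e^z (sum of xs_n
    e^(rho_n z)) - e^(-z) (sum of ys_n e^(rho_n z)). As rho_(n+1) = rho_n + 2, this vanishes when ys
    is the shift of xs, which is the recursion for g. *)
Let ka := 1 - k.
Let rho n : C := ka + lp + 2 * n%:R.
Let xs n := (rho n ^+ 2 + 2 * ka * rho n - (lam ^+ 2 - ka ^+ 2)) * g n.
Let ys n := (rho n ^+ 2 - 2 * ka * rho n - (lam ^+ 2 - ka ^+ 2)) * g n.

Lemma sh_xs n : sh xs n = ys n.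
Proof.
case: n => [|n] /=; rewrite /xs /ys -lp2.
  by rewrite /rho; ring.
transitivity (4 * ((n%:R + (1 - k)) * (n%:R + (1 - k) + lp) * g n)).
  by rewrite /rho /ka; ring.
by rewrite -grec /rho /ka -natr1; ring.
Qed.

(** The component b = [sh2] be with its leading exponent lp - k split off; [sh g n - g n] are the
    coefficients of (w - 1) times the series of g in w = e^(2z). *)
Definition Eb z := expC ((lp - k) * z) * ps (fun n => sh g n - g n) (expC (2 * z)).

Lemma exp_ZM z : expC z * expC (- z) = 1 :> C.
Proof. by rewrite -expCD subrr expC0. Qed.

(** Translation by pi i multiplies every e^(rho_n z) by the same factor and changes the sign of
    [sh2] and [ch2]; together this gives e^(pi i (lp - k)). *)
Lemma frobenius_eigen : subexp g -> g 0%N = 1 -> exists v,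
  [/\ forall z, Dom z -> Left z -> solB k lam v z = Eb z,
      v = (expC ((lp - k) * piI) * (Pm k lam v).1, expC ((lp - k) * piI) * (Pm k lam v).2)
    & v <> (0, 0)].
Proof.
move=> sg g0.
pose r0 := ka + lp.
pose g1 n := rho n * g n; pose g2 n := rho n * g1 n.
have s1 : subexp g1 by exact: subexp_lin.
have s2 : subexp g2 by exact: (subexp_lin r0 s1).
pose be := Ex r0 g; pose be1 := Ex r0 g1.
pose a z := - (sh2 z * be1 z) + (2 * k - 1) * (ch2 z * be z).
pose b z := sh2 z * be z.
have s : Sol k (par k lam) (@Left R) a b.
  move=> z zL; apply: (@beta_sol k lam be be1 z (Ex r0 g2 z)); first exact: sh2_Left.
  - exact: cder_Ex.
  - exact: cder_Ex.
  have Z1 := N_expC2_Left zL.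
  have key : expC (2 * z) * ps xs (expC (2 * z)) = ps ys (expC (2 * z)).
    rewrite -ps_sh//; first by exact: (@eq_ps R (sh xs) ys _ sh_xs).
    have := subexpD (subexpD s2 (subexpZ (2 * ka) s1)) (subexpZ (- (lam ^+ 2 - ka ^+ 2)) sg).
    by congr subexp; apply/funext => n; rewrite /xs /g2 /g1; ring.
  have lin3 (c d : C) : ps (fun n => g2 n + c * g1 n + d * g n) (expC (2 * z)) =
     ps g2 (expC (2 * z)) + c * ps g1 (expC (2 * z)) + d * ps g (expC (2 * z)).
    have sc := subexpZ c s1; have sd := subexpZ d sg.
    by rewrite psD// ?psD// ?psZ//; exact: subexpD.
  have Ex1 (c : C) : ps (fun n => (rho n ^+ 2 + c * rho n - (lam ^+ 2 - ka ^+ 2)) * g n) (expC (2 * z)) =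
     ps g2 (expC (2 * z)) + c * ps g1 (expC (2 * z)) - (lam ^+ 2 - ka ^+ 2) * ps g (expC (2 * z)).
    rewrite -[- (_ * ps g _)]mulNr -lin3.
    by apply: eq_ps => n; rewrite /g2 /g1; ring.
  have xsE : ps xs (expC (2 * z)) = _ := Ex1 (2 * ka).
  have ysE : ps ys (expC (2 * z)) = ps g2 (expC (2 * z)) - 2 * ka * ps g1 (expC (2 * z)) -
     (lam ^+ 2 - ka ^+ 2) * ps g (expC (2 * z)).
    by rewrite -[- (2 * ka * ps g1 _)]mulNr -Ex1; apply: eq_ps => n; rewrite /ys mulNr.
  move: key; rewrite xsE ysE.
  have E2 : expC (2 * z) = expC z * expC z by rewrite -expCD; congr expC; ring.
  rewrite /be /be1 /Ex /sh2 /ch2 -/ka.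
  move: (ps g2 _) (ps g1 _) (ps g _) (exp_ZM z); rewrite E2 => G2 G1 G0 zm key.
  set e := expC z in zm key *; set e' := expC (- z) in zm *; set f := expC (r0 * z).
  have K : e' * (e * e) = e by rewrite mulrA (mulrC e') zm mul1r.
  apply/eqP; rewrite -subr_eq0; apply/eqP.
  transitivity (f * (e' * (e * e) * (G2 + 2 * ka * G1 - (lam ^+ 2 - ka ^+ 2) * G0) -
     e' * (G2 - 2 * ka * G1 - (lam ^+ 2 - ka ^+ 2) * G0))); first by rewrite K; ring.
  transitivity (f * (e' * (e * e * (G2 + 2 * ka * G1 - (lam ^+ 2 - ka ^+ 2) * G0) -
     (G2 - 2 * ka * G1 - (lam ^+ 2 - ka ^+ 2) * G0)))); first by ring.
  by rewrite key subrr !mulr0.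
have E1 z : Ex r0 g (z + piI) = expC (r0 * piI) * Ex r0 g z /\
            Ex r0 g1 (z + piI) = expC (r0 * piI) * Ex r0 g1 z.
  have E : expC (2 * (z + piI)) = expC (2 * z) by rewrite mulrDr expCD expC_2piI mulr1.
  by rewrite /Ex E mulrDr expCD; split; ring.
have c0 : expC ((lp - k) * piI) = - expC (r0 * piI).
  have -> : r0 * piI = (lp - k) * piI + piI by rewrite /r0 /ka; ring.
  by rewrite expCDpi opprK.
have per z : Left z -> a (z + piI) = expC ((lp - k) * piI) * a z /\
    b (z + piI) = expC ((lp - k) * piI) * b z.
  move=> _; have [h1 h2] := E1 z.
  by rewrite /a /b /be /be1 h1 h2 sh2Dpi ch2Dpi c0; split; ring.
have [v [hv vP]] := left_eigen s per.
have bE z : Left z -> b z = Eb z.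
  move=> zL; rewrite /b /be /Ex /Eb.
  have Z1 := N_expC2_Left zL.
  have -> : ps (fun n => sh g n - g n) (expC (2 * z)) = expC (2 * z) * ps g (expC (2 * z)) - ps g (expC (2 * z)).
    rewrite -ps_sh// -[X in _ + X]mulN1r -psZ// -psD//; [|exact: subexp_sh|exact: subexpZ].
    by apply: eq_ps => n; ring.
  have E2 : expC (2 * z) = expC z * expC z by rewrite -expCD; congr expC; ring.
  have -> : (lp - k) * z = r0 * z + - z by rewrite /r0 /ka; ring.
  rewrite expCD {2}E2 /sh2; have zm := exp_ZM z.
  transitivity (expC (r0 * z) * (expC z * (expC z * expC (- z)) - expC (- z)) * ps g (expC (2 * z))).
    by rewrite zm; ring.
  ring.
exists v; split => //.
  by move=> z Dz zL; rewrite (hv z Dz zL).2 bE.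
(* A zero solution would make the power series of b vanish on (0, 1), hence also at 0, where it has
   the value - g_0 = -1. *)
move=> v0; have z0 z : Dom z -> solA k lam v z = 0 /\ solB k lam v z = 0.
  move=> Dz; have [|||h1 h2] := @sol_eq R k lam v (fun=> 0) (fun=> 0) _ _ _ z Dz => //.
  - move=> y _; split; apply: cder_eq (cder_cst 0 y) _; ring.
  - by rewrite v0.
  - by rewrite v0.
pose f := ps (fun n => sh g n - g n) : C -> C.
have sf : subexp (fun n => sh g n - g n).
  have := subexpD (subexp_sh sg) (subexpZ (-1) sg).
  by congr subexp; apply/funext => n; ring.
have : f 0 = 0.
  apply: (@cont_eq_dir R f (fun=> 0) 0 1).
  - by apply: cder_cont; apply: cder_ps; rewrite ?N0.
  - exact: cont_cst.
  move=> t /andP[t0 t1]; rewrite add0r mulr1.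
  pose z : C := (ln t / 2)%:CC.
  have zL : Left z by rewrite /Left /z /= pmulr_llt0 ?invr_gt0// ln_lt0// t0.
  have Dz : Dom z by exact: Dom_real.
  have := (z0 z Dz).2; rewrite (hv z Dz zL).2 bE// /Eb => /eqP.
  rewrite mulf_eq0 (negbTE (expC_neq0 _)) /= => /eqP.
  rewrite -/(f _); congr (f _ = 0).
  rewrite /z two_CC -rmorphM/= mulrC divfK// expC_real lnK//.
by rewrite /f ps0//= g0 sub0r => /eqP; rewrite oppr_eq0 oner_eq0.
Qed.

(* When the Frobenius series terminates the solution is a Laurent polynomial
   in e^z, so that no monodromy arises at z = 0 either. *)
Lemma frobenius_finite J : (forall n, (J <= n)%N -> g n = 0) -> g 0%N = 1 ->
  (0 < J)%N -> exists v,
  [/\ v = (expC ((lp - k) * piI) * (Pm k lam v).1, expC ((lp - k) * piI) * (Pm k lam v).2),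
      (v.1, - v.2) = (expC (- ((lp - k) * piI)) * (Pm k lam (v.1, - v.2)).1,
                      expC (- ((lp - k) * piI)) * (Pm k lam (v.1, - v.2)).2)
    & v <> (0, 0)].
Proof.
move=> gJ g0 J0.
pose be z := \sum_(j < J) g j * expC (rho j * z).
pose be1 z := \sum_(j < J) g j * (rho j * expC (rho j * z)).
pose be2 z := \sum_(j < J) g j * (rho j * (rho j * expC (rho j * z))).
have dsum (f f' : nat -> C -> C) z n : (forall j, cder (f j) z (f' j z)) ->
   cder (fun z => \sum_(j < n) f j z) z (\sum_(j < n) f' j z).
  move=> h; elim: n => [|n IH].
    rewrite big_ord0; apply: cder_ext (cder_cst 0 z) => y; by rewrite big_ord0.
  rewrite big_ord_recr/=; apply: cder_ext (cderD IH (h n)) => y.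
  by rewrite big_ord_recr.
have d1 z : cder be z (be1 z).
  apply: (dsum (fun j z => g j * expC (rho j * z)) (fun j z => g j * (rho j * expC (rho j * z)))) => j.
  by apply: cderZ; exact: cder_expCmul.
have d2 z : cder be1 z (be2 z).
  apply: (dsum (fun j z => g j * (rho j * expC (rho j * z)))
     (fun j z => g j * (rho j * (rho j * expC (rho j * z))))) => j.
  by apply: cderZ; apply: cderZ; exact: cder_expCmul.
pose a z := - (sh2 z * be1 z) + (2 * k - 1) * (ch2 z * be z).
pose b z := sh2 z * be z.
have s U : (forall z, U z -> sh2 z != 0) -> Sol k (par k lam) U a b.
  move=> hU z /hU s0; apply: (@beta_sol k lam be be1 z (be2 z)) => //.
  rewrite -/ka.
  (* The partial sums telescope because ys is the shift of xs; the surviving boundary term contains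
     g_J = 0. *)
  have tel n : expC z * (\sum_(j < n) xs j * expC (rho j * z)) -
      expC (- z) * (\sum_(j < n) ys j * expC (rho j * z)) = ys n * expC ((rho n - 1) * z).
    elim: n => [|n IH]; first by rewrite !big_ord0 -sh_xs /=; ring.
    rewrite !big_ord_recr/= !mulrDr opprD addrACA IH.
    have -> : ys n * expC ((rho n - 1) * z) = expC (- z) * (ys n * expC (rho n * z)).
      have -> : (rho n - 1) * z = rho n * z + - z by ring.
      by rewrite expCD; ring.
    have -> : (rho n.+1 - 1) * z = rho n * z + z by rewrite /rho -natr1; ring.
    by rewrite expCD -[ys n.+1]sh_xs /=; ring.
  have := tel J; rewrite [X in _ = X](_ : _ = 0); last by rewrite /ys gJ// mulr0 mul0r.
  have -> : \sum_(j < J) xs j * expC (rho j * z) = be2 z + 2 * ka * be1 z - (lam ^+ 2 - ka ^+ 2) * be z.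
    transitivity (be2 z + 2 * ka * be1 z + (- (lam ^+ 2 - ka ^+ 2)) * be z); last by ring.
    rewrite /be2 /be1 /be !mulr_sumr -!big_split/=.
    by apply: eq_bigr => j _; rewrite /xs; ring.
  have -> : \sum_(j < J) ys j * expC (rho j * z) = be2 z - 2 * ka * be1 z - (lam ^+ 2 - ka ^+ 2) * be z.
    transitivity (be2 z + (- (2 * ka)) * be1 z + (- (lam ^+ 2 - ka ^+ 2)) * be z); last by ring.
    rewrite /be2 /be1 /be !mulr_sumr -!big_split/=.
    by apply: eq_bigr => j _; rewrite /ys; ring.
  move=> h; apply/eqP; rewrite -subr_eq0 -h; apply/eqP; rewrite /sh2 /ch2; ring.
have per z : a (z + piI) = expC ((lp - k) * piI) * a z /\
    b (z + piI) = expC ((lp - k) * piI) * b z.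
  have c0 : expC ((lp - k) * piI) = - expC ((ka + lp) * piI).
    have -> : (ka + lp) * piI = (lp - k) * piI + piI by rewrite /ka; ring.
    by rewrite expCDpi opprK.
  have Er j : expC (rho j * (z + piI)) = expC ((ka + lp) * piI) * expC (rho j * z).
    have -> : rho j * (z + piI) = (ka + lp) * piI + rho j * z + 2 * piI * j%:R by rewrite /rho; ring.
    by rewrite !expCD expC_2piIn mulr1.
  have h1 : be (z + piI) = expC ((ka + lp) * piI) * be z.
    by rewrite /be mulr_sumr; apply: eq_bigr => j _; rewrite Er; ring.
  have h2 : be1 (z + piI) = expC ((ka + lp) * piI) * be1 z.
    by rewrite /be1 mulr_sumr; apply: eq_bigr => j _; rewrite Er; ring.
  by rewrite /a /b h1 h2 sh2Dpi ch2Dpi c0; split; ring.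
have sD := s _ (@sh2_Dom R).
pose v := (a hpi, b hpi); exists v.
have hv z : Dom z -> solA k lam v z = a z /\ solB k lam v z = b z by exact: sol_eq.
have [h1 h2] := hv _ (Dom_Nhpi R).
have [p1 p2] := per (- hpi); rewrite hpiN subrK in p1 p2.
split.
- by rewrite /Pm h1 h2 hpiN -p1 -p2.
- pose u := (v.1, - v.2).
  (* A Laurent polynomial is a solution wherever [sh2] is nonzero, so its mirror image under z |-> -
     z is one too; scaled by the quasi-period it takes the value (v.1, - v.2) at pi i / 2. *)
  have sR := sol_scale (expC ((lp - k) * piI)) (sol_refl (s (fun z => sh2 z != 0) (fun _ => id))).
  have sR' : Sol k (par k lam) (@Dom R) (fun z => expC ((lp - k) * piI) * a (- z))
     (fun z => expC ((lp - k) * piI) * - b (- z)).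
    by apply: sol_sub sR => z Dz; rewrite sh2N oppr_eq0 sh2_Dom.
  have [||h3 h4] := @sol_eq R k lam u _ _ sR' _ _ (- hpi) (Dom_Nhpi R).
  + by rewrite hpiN -p1.
  + by rewrite mulrN hpiN -p2.
  have Pu : Pm k lam u = (expC ((lp - k) * piI) * a hpi, expC ((lp - k) * piI) * - b hpi).
    by rewrite /Pm h3 h4 opprK.
  have cN : expC (- ((lp - k) * piI)) * expC ((lp - k) * piI) = 1 by rewrite -expCD addNr expC0.
  have KN x : expC (- ((lp - k) * piI)) * (expC ((lp - k) * piI) * x) = x by rewrite mulrA cN mul1r.
  by rewrite -/u Pu !KN.
- move=> v0.
  have z0 z : Dom z -> b z = 0.
    move=> Dz; have [_ <-] := hv z Dz.
    have [|||_ ->] := @sol_eq R k lam v (fun=> 0) (fun=> 0) _ _ _ z Dz => //.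
    + move=> y _; split; apply: cder_eq (cder_cst 0 y) _; ring.
    + by rewrite v0.
    + by rewrite v0.
  pose f z : C := \sum_(j < J) g j * z ^+ j.
  have : f 0 = 0.
    apply: (@cont_eq_dir R f (fun=> 0) 0 1).
    + have := dsum (fun j z => g j * z ^+ j) (fun j z => g j * (j%:R * z ^+ j.-1 * 1)) 0 J.
      by move=> h; apply: cder_cont (h _) => j; apply: cderZ; apply: cder_exprn; exact: cder_id.
    + exact: cont_cst.
    move=> t /andP[t0 t1]; rewrite add0r mulr1.
    pose z : C := (ln t / 2)%:CC.
    have zL : Left z by rewrite /Left /z /= pmulr_llt0 ?invr_gt0// ln_lt0// t0.
    have Dz : Dom z by exact: Dom_real.
    have := z0 z Dz; rewrite /b => /eqP; rewrite mulf_eq0 (negbTE (sh2_Left zL)) /=.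
    have -> : be z = expC ((ka + lp) * z) * f t%:CC.
      rewrite /be /f mulr_sumr; apply: eq_bigr => j _.
      have -> : rho j * z = (ka + lp) * z + j%:R * (2 * z) by rewrite /rho; ring.
      have -> : t%:CC = expC (2 * z).
        by rewrite /z two_CC -rmorphM/= mulrC divfK// expC_real lnK.
      by rewrite expCD expCMn; ring.
    by rewrite mulf_eq0 (negbTE (expC_neq0 _)) /= => /eqP.
  rewrite /f -(prednK J0) big_ord_recl/= g0 expr0 mulr1 big1 ?addr0.
    by move/eqP; rewrite oner_eq0.
  by move=> i _; rewrite expr0n /= mulr0.
Qed.

End FrobeniusAtZero.
End Hypergeometric.

(** * The solution regular at z = 0 *)

Section SymmetricSolution.
Variable R : realType.
Local Notation C := (R[i]).
Local Notation N := (@ComplexField.Normc.normc R).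
Local Notation "x %:CC" := (real_complex R x) (at level 2, format "x %:CC").
Local Notation Im := complex.Im.
Implicit Types (z w p : C) (k lam : C) (v : C * C).

Lemma sh2_punctured z : 0 < N z <= 1 -> sh2 z != 0.
Proof.
move=> /andP[z0 z1]; apply/eqP => /sh2_eq0 /expC_eq1; rewrite Im2.
have -> : `|2 * Im z| < 2 * pi.
  rewrite normrM ger0_norm// ltr_pM2l// (le_lt_trans (Im_le_N z))//.
  by have := pi_ge2 R; lra.
move=> /(_ isT)/eqP; rewrite mulf_eq0 pnatr_eq0/= => /eqP zz.
by rewrite zz N0 ltxx in z0.
Qed.

(** This is - sinh^2(z/2), even in z, the coordinate that turns the Gegenbauer equation into Gauss's
    equation. *)
Definition hz z : C := 2^-1 - ch2 z / 4.

Lemma cder_hz z : cder hz z (- (sh2 z / 4)).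
Proof.
apply: cder_eq (cderB (cder_cst 2^-1 z) (cderM (cder_ch2 z) (cder_cst 4^-1 z))) _.
by ring.
Qed.

Lemma hz0 : hz 0 = 0.
Proof. by rewrite /hz /ch2 oppr0 expC0; field. Qed.

Lemma sh2_0 : sh2 0 = 0 :> C.
Proof. by rewrite /sh2 oppr0 expC0 subrr. Qed.
Lemma ch2_0 : ch2 0 = 2 :> C.
Proof. by rewrite /ch2 oppr0 expC0. Qed.

(** be = 2F1(1 - k + lam, 1 - k - lam; 3/2 - k; - sinh^2(z/2)) is even in z, so a is even and b is
    odd, as [refl_eigen] requires. The hypothesis keeps the third parameter away from 0, -1, -2,
    ... *)
Lemma sym_solution k lam : (forall n, n%:R + (3 / 2 - k) != 0 :> C) ->
  exists v, [/\ v <> (0, 0), Tm k lam v = v &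
   exists r : R, exists a b : C -> C, [/\ 0 < r, cont a 0 /\ cont b 0, a 0 = 2 * (2 * k - 1), b 0 = 0 &
     forall z, Dom z -> N z < r -> solA k lam v z = a z /\ solB k lam v z = b z]].
Proof.
move=> kn; pose ka := 1 - k.
have gn n : n%:R + (ka + 1 / 2) != 0 by have := kn n; congr (_ != 0); rewrite /ka; field.
pose g := hyp (ka + lam) (ka - lam) (ka + 1 / 2).
have sg : subexp g by exact: subexp_hyp.
have sg1 := subexp_der sg; have sg2 := subexp_der sg1.
have [r0 r00 hr0] := cder_cont (cder_hz 0) (ltr01 : 0 < (1 : R)).
pose r := Num.min r0 1.
have r1 : 0 < r <= 1 by rewrite lt_min r00 ltr01 ge_min lexx orbT.
have hzr z : N z < r -> N (hz z) < 1.
  rewrite lt_min => /andP[h _]; have := hr0 z; rewrite hz0 !subr0; exact.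
pose be z := ps g (hz z); pose be1 z := - (sh2 z / 4) * ps (der g) (hz z).
pose a z := - (sh2 z * be1 z) + (2 * k - 1) * (ch2 z * be z).
pose b z := sh2 z * be z.
have dG x z : subexp x -> N z < r -> cder (fun z => ps x (hz z)) z (ps (der x) (hz z) * - (sh2 z / 4)).
  by move=> sx zr; exact: (@cder_comp _ (ps x) hz z _ _ (cder_ps sx (hzr z zr)) (cder_hz z)).
pose d2 z := - (ch2 z / 4) * ps (der g) (hz z) + - (sh2 z / 4) * (ps (der (der g)) (hz z) * - (sh2 z / 4)).
have db z : N z < r -> cder be z (be1 z).
  by move=> zr; apply: cder_eq (dG _ _ sg zr) _; rewrite /be1 mulrC.
have db1 z : N z < r -> cder be1 z (d2 z).
  move=> zr; apply: cderM; last exact: dG.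
  by apply: cderN; apply: cder_eq (cderM (cder_sh2 z) (cder_cst 4^-1 z)) _; ring.
have s : Sol k (par k lam) (fun z => 0 < N z < r) a b.
  move=> z /andP[z0 zr].
  have z1 : N z <= 1 by move: zr; rewrite lt_min => /andP[_ /ltW].
  apply: (@beta_sol R k lam be be1 z (d2 z)).
  - by apply: sh2_punctured; rewrite z0.
  - exact: db.
  - exact: db1.
  have X1 := hzr z zr; set x := hz z in X1 *.
  (* Gauss's equation for the series of g, up to sign, checked coefficient by coefficient. *)
  have key : x * (x * ps (der (der g)) x) - x * ps (der (der g)) x - (ka + 1 / 2) * ps (der g) x
     + (2 * ka + 1) * (x * ps (der g) x) - (lam ^+ 2 - ka ^+ 2) * ps g x = 0.
    have ss1 := subexp_sh sg1; have ss2 := subexp_sh sg2; have ss3 := subexp_sh ss2.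
    rewrite -(ps_sh sg2 X1) -(ps_sh ss2 X1) -(ps_sh sg1 X1).
    have t1 := subexpZ (-1) ss2; have t2 := subexpZ (- (ka + 1 / 2)) sg1.
    have t3 := subexpZ (2 * ka + 1) ss1; have t4 := subexpZ (- (lam ^+ 2 - ka ^+ 2)) sg.
    have u3 := subexpD t3 t4; have u2 := subexpD t2 u3; have u1 := subexpD t1 u2.
    transitivity (ps (fun n => sh (sh (der (der g))) n + (-1 * sh (der (der g)) n +
       (- (ka + 1 / 2) * der g n + ((2 * ka + 1) * sh (der g) n + - (lam ^+ 2 - ka ^+ 2) * g n)))) x).
      rewrite (psD ss3 u1 X1) (psD t1 u2 X1) (psD t2 u3 X1) (psD t3 t4 X1).
      rewrite (psZ (-1) ss2 X1) (psZ _ sg1 X1) (psZ _ ss1 X1) (psZ _ sg X1).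
      move: (ps _ x) (ps _ x) (ps _ x) (ps _ x) (ps _ x) => *; ring.
    transitivity (ps (fun n => 0 * g n) x); last by rewrite (psZ 0 sg X1) mul0r.
    apply: eq_ps => n; rewrite mul0r.
    have := @hypS R (ka + lam) (ka - lam) (ka + 1 / 2) n (gn n); rewrite -/g => h.
    have -> : sh (sh (der (der g))) n = n%:R * (n%:R - 1) * g n.
      by case: n {h} => [|[|n]] /=; rewrite /der; [ring|ring|rewrite -!natr1; ring].
    have -> : sh (der (der g)) n = n%:R * n.+1%:R * g n.+1.
      by case: n {h} => [|n] /=; rewrite /der; ring.
    have -> : sh (der g) n = n%:R * g n by case: n {h} => [|n] /=; rewrite /der; ring.
    rewrite /der.
    transitivity ((n%:R + (ka + lam)) * (n%:R + (ka - lam)) * g n - n.+1%:R * (n%:R + (ka + 1 / 2)) * g n.+1).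
      by rewrite -natr1; field.
    by rewrite h subrr.
  have chx : ch2 z = 2 * (1 - 2 * x) by rewrite /x /hz; field.
  have shx : sh2 z * sh2 z = 16 * (x * x - x).
    have -> : sh2 z * sh2 z = ch2 z * ch2 z - 4 * (expC z * expC (- z)) by rewrite /sh2 /ch2; ring.
    by rewrite exp_ZM chx; ring.
  rewrite /d2 /be1 /be -/x -/ka.
  apply/eqP; rewrite -subr_eq0; apply/eqP.
  transitivity (sh2 z * (ps (der (der g)) x * (sh2 z * sh2 z) / 16 - ch2 z / 4 * (1 + 2 * ka) * ps (der g) x -
     (lam ^+ 2 - ka ^+ 2) * ps g x)); first by field.
  rewrite shx chx; rewrite -[RHS](mulr0 (sh2 z)) -key; by congr (_ * _); field.
have ev z : N z < r -> a (- z) = a z /\ b (- z) = - b z.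
  move=> _; have hN : hz (- z) = hz z by rewrite /hz ch2N.
  by rewrite /a /b /be /be1 hN sh2N ch2N; split; ring.
have [v [hv vT]] := refl_eigen r1 s ev.
have /andP[r2 _] := r1.
have N00 : N 0 < r by rewrite N0.
have be0 : be 0 = 1 by rewrite /be hz0 ps0.
have cbe : cont be 0 by apply: cder_cont (db 0 N00).
have csh : cont (@sh2 R) 0 := cder_cont (cder_sh2 0).
have cch : cont (@ch2 R) 0 := cder_cont (cder_ch2 0).
have cbe1 : cont be1 0 by apply: cder_cont (db1 0 N00).
exists v; split => //; last first.
  exists r, a, b; split => //.
  - split; last exact: contM.
    apply: contD; first by apply: contN; exact: contM.
    by apply: contM; [exact: cont_cst|exact: contM].
  - by rewrite /a be0 sh2_0 ch2_0; ring.
  - by rewrite /b sh2_0 mul0r.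
move=> v0.
have : be 0 = 0.
  pose w : C := (- r)%:CC.
  apply: (@cont_eq_dir R be (fun=> 0) 0 w cbe (cont_cst 0 0)) => t /andP[t0 t1].
  set z := 0 + _; have zE : z = (- (t * r))%:CC by rewrite /z /w add0r -rmorphM/= mulrN.
  have tr : 0 < t * r by rewrite mulr_gt0.
  have Dz : Dom z by apply: Dom_real; rewrite zE //= oppr_lt0.
  have zr : N z < r by rewrite zE Nreal normrN gtr0_norm// gtr_pMl.
  have := (hv z Dz zr).2.
  have [|||_ ->] := @sol_eq R k lam v (fun=> 0) (fun=> 0) _ _ _ z Dz.
  - move=> y _; split; apply: cder_eq (cder_cst 0 y) _; ring.
  - by rewrite v0.
  - by rewrite v0.
  by move=> /esym/eqP; rewrite /b mulf_eq0 (negbTE (sh2_Dom Dz)) => /eqP.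
by rewrite be0 => /eqP; rewrite oner_eq0.
Qed.

End SymmetricSolution.

(** * Fourier coefficients by averaging over roots of unity *)

Section Averaging.
Variable R : realType.
Local Notation C := (R[i]).
Local Notation N := (@ComplexField.Normc.normc R).
Local Notation "x %:CC" := (real_complex R x) (at level 2, format "x %:CC").
Local Notation piI := (piI R).
Implicit Types (z w p : C) (k lam : C) (v : C * C).

(** Otherwise every index is followed by a block of terms of sum above e, and disjoint blocks add up
    beyond M. *)
Lemma tail_small (w : nat -> R) (M : R) : (forall n, 0 <= w n) ->
  (forall n, \sum_(i < n) w i <= M) -> forall e : R, 0 < e ->
  exists K, forall n, \sum_(i < n) w (K + i)%N <= e.
Proof.
move=> w0 wM e e0; apply: contrapT => /forallNP H.
have step m : exists K, m%:R * e <= \sum_(i < K) w i.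
  elim: m => [|m [K hK]]; first by exists 0%N; rewrite mul0r big_ord0.
  have /existsNP[n /negP] := H K; rewrite -ltNge => hn.
  exists (K + n)%N; rewrite big_split_ord/= -natr1 mulrDl mul1r lerD// ltW//.
have [K hK] := step (Num.truncn (M / e)).+1.
have := truncnS_gt (M / e); rewrite ltr_pdivrMr// => h.
by have := le_trans hK (wM K); rewrite leNgt h.
Qed.

Lemma csum_tail (u : nat -> C) (K : nat) (B : R) : summable u ->
  (forall n, \sum_(i < n) N (u (K + i)%N) <= B) -> N (csum u - \sum_(i < K) u i) <= B.
Proof.
elim: K u => [|K IH] u su h; first by rewrite big_ord0 subr0; exact: csum_le.
have sS : summable (fun n => u n.+1).
  by case: su => M hM; exists M => n; apply: le_trans (hM n.+1); rewrite [leRHS]big_ord_recl/= lerDr N_ge0.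
rewrite csum_shift// big_ord_recl/= opprD addrACA subrr add0r.
by apply: IH => // n; apply: le_trans (h n); rewrite le_eqVlt; apply/orP; left; apply/eqP; apply: eq_bigr.
Qed.

Lemma ord_absurd (K : nat) (i : 'I_K) : K = 0%N -> False.
Proof. by move=> K0; case: i => i; rewrite K0. Qed.

Lemma node_range (K j i : nat) : (i < K)%N -> (0 < j + i)%N -> (0 < j + i < (K + j).+1)%N.
Proof. lia. Qed.

Lemma triangle4 (x y x' y' s : C) (e : R) : N s = 1 -> N (x - s * y) <= e ->
  N (x - x') <= e -> N (y - y') <= e -> N (x' - s * y') <= 3 * e.
Proof.
move=> s1 h h1 h2.
have -> : x' - s * y' = (x - s * y) - (x - x') + s * (y - y') by ring.
have := ND ((x - s * y) - (x - x')) (s * (y - y')).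
by have := NB (x - s * y) (x - x'); rewrite NM s1; lra.
Qed.

Lemma sum_roots (om : C) M : om != 1 -> om ^+ M = 1 -> \sum_(l < M) om ^+ l = 0.
Proof.
move=> o1 oM; have := subrX1 om M; rewrite oM subrr => /esym/eqP.
by rewrite mulf_eq0 subr_eq0 (negbTE o1) => /eqP.
Qed.

(** The factor e^(2 node) runs through M equally spaced points of the circle. The shift by 1/2 keeps
    the nodes strictly between 0 and pi i, where the boundary comparison is available. *)
Definition node (M l : nat) : C := piI * ((l%:R + 1 / 2) / M%:R).

Lemma expC_2pi_frac_neq1 (n M : nat) : (0 < n < M)%N -> expC (2 * piI * (n%:R / M%:R)) != 1 :> C.
Proof.
move=> /andP[n0 nM]; apply/eqP => /expC_eq1.
have -> : 2 * piI * (n%:R / M%:R) = (2 * (n%:R / M%:R))%:CC * piI.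
  by rewrite !rmorphM/= fmorphV/= !rmorph_nat; ring.
have M0 : (0 : R) < M%:R by rewrite ltr0n (leq_trans _ nM).
have nM1 : (n%:R / M%:R : R) < 1 by rewrite ltr_pdivrMr// mul1r ltr_nat.
have nM0 : 0 < (n%:R / M%:R : R) by rewrite divr_gt0// ltr0n.
have pp := pi_gt0 R.
rewrite ImZ Im_piI ger0_norm; last by rewrite !mulr_ge0// ltW.
rewrite -mulrA ltr_pM2l// gtr_pMl// => /(_ nM1)/(congr1 (@complex.Im R)); rewrite ImZ Im_piI /= => /eqP.
by rewrite !mulf_eq0 !invr_eq0 (gt_eqF M0) (gt_eqF pp) pnatr_eq0/= pnatr_eq0 orbF eqn0Ngt n0.
Qed.

Lemma sum_node (s : bool) (n M : nat) : (0 < n < M)%N ->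
  \sum_(l < M) expC ((-1) ^+ s * (2 * n%:R * node M l)) = 0.
Proof.
move=> nM; pose om : C := expC ((-1) ^+ s * (2 * piI * (n%:R / M%:R))).
have M0 : M%:R != 0 :> C by rewrite pnatr_eq0 -lt0n; case/andP: nM => ? /(leq_trans _) ->.
have o1 : om != 1.
  have h := expC_2pi_frac_neq1 nM.
  rewrite /om; case: (s); rewrite ?expr1 ?expr0 ?mul1r ?mulN1r// expCN.
  by apply: contra h => /eqP h; rewrite -[expC _]invrK h invr1.
have oM : om ^+ M = 1.
  rewrite /om -expCMn.
  have -> : M%:R * ((-1) ^+ s * (2 * piI * (n%:R / M%:R))) = (-1) ^+ s * (2 * piI * n%:R) :> C by field.
  case: (s); rewrite ?expr1 ?expr0 ?mul1r ?mulN1r ?expCN expC_2piIn ?invr1//.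
rewrite (eq_bigr (fun l : 'I_M => expC ((-1) ^+ s * (2 * piI * (n%:R / M%:R)) / 2) * om ^+ l)).
  by rewrite -mulr_sumr sum_roots// mulr0.
move=> l _; rewrite /om -expCMn -expCD; congr expC; rewrite /node; by field.
Qed.

Lemma sum_nodeP (n M : nat) : (0 < n < M)%N -> \sum_(l < M) expC (2 * n%:R * node M l) = 0.
Proof.
move=> nM; rewrite -[RHS](sum_node false nM); apply: eq_bigr => l _.
by rewrite mul1r.
Qed.

Lemma sum_node0 (M : nat) : \sum_(l < M) expC (0 : C) = M%:R.
Proof. by rewrite expC0 sumr_const card_ord. Qed.

(* Comparing the Fourier coefficients of x^j times a power series in x^2 on the
   circles |x| = e^{-r} with those of its mirror image under x |-> 1/x: the
   frequencies are >= j on one side and <= -j on the other.  The coefficients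
   are extracted by averaging over M-th roots of unity. *)
Lemma averaging (b : nat -> C) (j : nat) (sg : C) : subexp b -> N sg = 1 ->
  (j = 0%N -> sg = -1) ->
  (forall e : R, 0 < e -> exists2 r : R, 0 < r < e & forall t : R, 0 < t < pi ->
    N (expC (j%:R * Complex (- r) t) * ps b (expC (2 * Complex (- r) t)) -
       sg * (expC (j%:R * Complex (- r) (pi - t)) * ps b (expC (2 * Complex (- r) (pi - t))))) <= e) ->
  b 0%N = 0.
Proof.
move=> sb sg1 sgj H; apply: N_eq0; apply/eqP; rewrite eq_le N_ge0 andbT leNgt; apply/negP => b0.
(* As r < 1, this bounds the modulus of b_0 e^(- j r) from below; taking e <= c0/8 makes the total
   error 3e too small to hide this term. *)
pose c0 := N (b 0%N) * expR (- j%:R).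
have c00 : 0 < c0 by rewrite mulr_gt0 ?expR_gt0.
have e0 : 0 < Num.min 1 (c0 / 8) by rewrite lt_min ltr01 divr_gt0.
have [r] := H _ e0; rewrite lt_min => /andP[r0 /andP[r1 rc]] hr.
set e := Num.min 1 (c0 / 8) in e0 hr *.
have ec : e <= c0 / 8 by rewrite ge_min lexx orbT.
pose q := expR (- (2 * r)).
have q1 : 0 <= q < 1 by rewrite expR_ge0 expR_lt1; lra.
have [B hB] := subexp_bound sb q1.
have [K hK] := tail_small (fun n => mulr_ge0 (N_ge0 (b n)) (exprn_ge0 n (expR_ge0 (- (2 * r))))) hB e0.
have Zn t : N (expC (2 * Complex (- r) t)) = q.
  by rewrite N_expC Re2 /q; congr expR; rewrite /=; ring.
pose FK t := expC (j%:R * Complex (- r) t) * \sum_(i < K) b i * expC (2 * Complex (- r) t) ^+ i.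
have FKe t : N (expC (j%:R * Complex (- r) t) * ps b (expC (2 * Complex (- r) t)) - FK t) <= e.
  rewrite /FK -mulrBr NM N_expC -[leRHS]mul1r; apply: ler_pM; rewrite ?expR_ge0 ?N_ge0//.
    rewrite -[leRHS]expR0 ler_expR; have -> : j%:R = (j%:R : R)%:CC :> C by rewrite rmorph_nat.
    by rewrite ReZ /= mulrN oppr_le0 mulr_ge0// ltW.
  apply: csum_tail; first by apply: summable_ps => //; rewrite Zn; case/andP: q1.
  move=> n; apply: le_trans (hK n); apply: ler_sum => i _.
  by rewrite NM NX Zn.
(* M exceeds all the frequencies i and j + i with i < K, so that none of them is aliased to 0. *)
pose M := (K + j).+1.
have M0 : M%:R != 0 :> C by rewrite pnatr_eq0.
pose tl (l : nat) : R := pi * ((l%:R + 1 / 2) / M%:R).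
have MR : (0 : R) < M%:R by rewrite ltr0n.
have tlpi (l : 'I_M) : 0 < tl l < pi.
  have lM : l.+1%:R <= M%:R :> R by rewrite ler_nat.
  have pp := pi_gt0 R.
  have h : 0 < (l%:R + 1 / 2) / M%:R :> R by rewrite divr_gt0// ltr_wpDl// divr_gt0.
  have h' : (l%:R + 1 / 2) / M%:R < 1 :> R by rewrite ltr_pdivrMr// mul1r; move: lM; rewrite -natr1; lra.
  by rewrite /tl mulr_gt0//= gtr_pMr.
pose eK (i : nat) : C := b i * expC (- ((j%:R + 2 * i%:R) * r%:CC)).
have ctE (t : R) : Complex (- r) t = - r%:CC + 'i%C * t%:CC.
  by apply/eqP; rewrite eq_complex /=; apply/andP; split; apply/eqP; ring.
have itl l : 'i%C * (tl l)%:CC = node M l.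
  by rewrite /tl /node /Defs.piI !(rmorphM, rmorphD, fmorphV, rmorph_nat, rmorph1); ring.
have FKE t : FK t = \sum_(i < K) eK i * expC ((j%:R + 2 * i%:R) * ('i%C * t%:CC)).
  rewrite /FK mulr_sumr; apply: eq_bigr => i _; rewrite -expCMn mulrCA -expCD /eK -mulrA -expCD.
  by congr (_ * expC _); rewrite ctE; ring.
(* Multiplied by e^(- i j t), the direct side has frequencies 2i >= 0, and only i = 0 survives. *)
have avg1 : \sum_(l < M) expC (- (j%:R * node M l)) * FK (tl l) = M%:R * (if (0 < K)%N then eK 0%N else 0).
  under eq_bigr => l _ do rewrite FKE mulr_sumr.
  rewrite exchange_big/= (eq_bigr (fun i : 'I_K => eK i * \sum_(l < M) expC (2 * i%:R * node M l))).
    case: (posnP K) => [K0|K0].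
      by rewrite big1 ?mulr0// => i _; case: (ord_absurd i K0).
    rewrite (bigD1 (Ordinal K0))//= [X in _ + X]big1 ?addr0.
      rewrite (eq_bigr (fun=> expC 0)) ?sum_node0 1?mulrC// => l _; by congr expC; rewrite /=; ring.
    move=> i i0; rewrite sum_nodeP ?mulr0// lt0n; apply/andP; split.
      by apply: contra i0 => /eqP i0; apply/eqP/val_inj.
    exact: leq_trans (ltn_ord i) (leqW (leq_addr _ _)).
  move=> i _; rewrite mulr_sumr; apply: eq_bigr => l _.
  rewrite itl mulrCA -expCD; congr (_ * expC _); ring.
have FKpi t : FK (pi - t) = \sum_(i < K) eK i * (expC (piI * j%:R) * expC (- (j%:R + 2 * i%:R) * ('i%C * t%:CC))).
  rewrite FKE; apply: eq_bigr => i _; congr (_ * _).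
  have -> : (j%:R + 2 * i%:R) * ('i%C * (pi - t)%:CC) =
     piI * j%:R + (- (j%:R + 2 * i%:R) * ('i%C * t%:CC)) + 2 * piI * i%:R :> C.
    by rewrite rmorphB/= /Defs.piI; ring.
  by rewrite expCD expC_2piIn mulr1 expCD.
(* On the mirrored side the frequencies become - 2 (j + i), which is 0 only for i = j = 0. In that
   case sg = -1, so the two contributions add up instead of cancelling. *)
have avg2 : \sum_(l < M) expC (- (j%:R * node M l)) * FK (pi - tl l) =
   M%:R * (if (0 < K)%N && (j == 0%N) then eK 0%N else 0).
  under eq_bigr => l _ do rewrite FKpi mulr_sumr.
  rewrite exchange_big/= (eq_bigr (fun i : 'I_K => eK i * expC (piI * j%:R) * 
       \sum_(l < M) expC ((-1) ^+ true * (2 * (j + i)%N%:R * node M l)))); last first.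
    move=> i _; rewrite mulr_sumr; apply: eq_bigr => l _.
    have -> : expC ((-1) ^+ true * (2 * (j + i)%N%:R * node M l)) =
        expC (- (j%:R * node M l)) * expC (- (j%:R + 2 * i%:R) * node M l).
      by rewrite -expCD; congr expC; rewrite expr1 natrD; ring.
    by rewrite itl; ring.
  case: (posnP K) => [K0|K0].
    by rewrite big1 ?mulr0// => i _; case: (ord_absurd i K0).
  have z0 (i : 'I_K) : (0 < j + i)%N -> \sum_(l < M) expC ((-1) ^+ true * (2 * (j + i)%N%:R * node M l)) = 0.
    by move=> ji; apply: sum_node; exact: node_range.
  case: eqP => [j0|/eqP j0] /=.
    rewrite (bigD1 (Ordinal K0))//= [X in _ + X]big1 ?addr0.
      rewrite j0 !mulr0 expC0 mulr1 (eq_bigr (fun=> expC 0)) ?sum_node0 1?mulrC// => l _.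
      by congr expC; rewrite /=; ring.
    move=> i i0; rewrite z0 ?mulr0// j0 add0n lt0n; apply: contra i0 => /eqP i0.
    by apply/eqP/val_inj.
  by rewrite big1 ?mulr0// => i _; rewrite z0 ?mulr0// addn_gt0 lt0n j0.
have Ne l : N (expC (- (j%:R * node M l))) = 1.
  rewrite N_expC -itl; have -> : j%:R = (j%:R : R)%:CC :> C by rewrite rmorph_nat.
  have -> : - ((j%:R : R)%:CC * ('i%C * (tl l)%:CC)) = (- (j%:R * tl l))%:CC * 'i%C :> C.
    by apply/eqP; rewrite eq_complex /=; apply/andP; split; apply/eqP; ring.
  by rewrite ReZ /= mulr0 expR0.
have main : N (M%:R * ((if (0 < K)%N then eK 0%N else 0) -
    sg * (if (0 < K)%N && (j == 0%N) then eK 0%N else 0))) <= M%:R * (3 * e).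
  rewrite mulrBr mulrCA -avg1 -avg2 mulr_sumr -sumrB (le_trans (N_sum _ _))//.
  apply: (@le_trans _ _ (\sum_(l < M) 3 * e)); last first.
    rewrite sumr_const card_ord. by rewrite -[leLHS]mulr_natl.
  apply: ler_sum => l _; rewrite [sg * _]mulrCA -mulrBr NM Ne mul1r.
  have := hr _ (tlpi l); have := FKe (tl l); have := FKe (pi - tl l).
  by move=> h2 h1 h; exact: (triangle4 sg1 h h1 h2).
have {}main : N ((if (0 < K)%N then eK 0%N else 0) -
    sg * (if (0 < K)%N && (j == 0%N) then eK 0%N else 0)) <= 3 * e.
  by rewrite -(ler_pM2l MR) (le_trans _ main)// NM N_nat.
have eK0 : c0 <= N (eK 0%N).
  rewrite /eK mulr0 addr0 NM /c0 ler_wpM2l ?N_ge0// N_expC ler_expR ReN lerN2.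
  have -> : j%:R * r%:CC = (j%:R * r)%:CC :> C by rewrite rmorphM/= rmorph_nat.
  by rewrite /= ler_piMr// ltW.
case: (posnP K) main => [K0|K0] /=.
  move=> _; have := hK 1%N; rewrite K0 big_ord1 expr0 mulr1 addn0 => h.
  have : c0 <= N (b 0%N) by rewrite /c0 ler_piMr ?N_ge0// expR_le1 oppr_le0.
  lra.
case: eqP => [/sgj ->|_]; last by rewrite mulr0 subr0; lra.
have -> : eK 0%N - -1 * eK 0%N = 2%:R * eK 0%N by ring.
rewrite NM N_nat; lra.
Qed.

End Averaging.

(** * Reducibility of the monodromy matrices *)

Section ReducibilityCriterion.
Variable R : realType.
Local Notation C := (R[i]).
Local Notation N := (@ComplexField.Normc.normc R).
Local Notation "x %:CC" := (real_complex R x) (at level 2, format "x %:CC").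
Local Notation Re := complex.Re.
Local Notation Im := complex.Im.
Local Notation piI := (piI R).
Implicit Types (z p : C) (k lam : C) (u v w : C * C).

Definition sc (c : C) v : C * C := (c * v.1, c * v.2).

Lemma is_int_exp (x : C) : expC (2 * piI * x) = 1 -> is_int x.
Proof.
move=> h; have pp := pi_gt0 R.
have E y : 2 * piI * y = (2 * pi)%:CC * Complex (- Im y) (Re y).
  rewrite piIE two_CC; case: y => a b.
  by apply/eqP; rewrite eq_complex /=; apply/andP; split; apply/eqP; ring.
have i0 : Im x = 0.
  have : N (expC (2 * piI * x)) = 1 by rewrite h N1.
  rewrite N_expC E ReZ => /(congr1 (@ln R)); rewrite expRK ln1 /= => /eqP.
  by rewrite mulrN oppr_eq0 mulf_eq0 gt_eqF ?mulr_gt0//= => /eqP.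
pose m := Num.floor (Re x).
have /andP[m1 m2] := floor_itv (Re x); rewrite -/m intrD in m1 m2.
pose y := x - m%:~R.
have hy : expC (2 * piI * y) = 1.
  rewrite /y mulrBr expCB h div1r; apply/eqP; rewrite invr_eq1; apply/eqP.
  by rewrite -[2 * piI * _]mulrA (expCMn _ 2) expC_piIint.
have mE : m%:~R = (m%:~R)%:CC :> C by rewrite rmorph_int.
have yR : Re y = Re x - m%:~R by rewrite /y mE ReB.
have := expC_eq1 hy; rewrite E ImZ /= yR.
have -> : `|2 * pi * (Re x - m%:~R)| < 2 * pi.
  by rewrite normrM ger0_norm ?mulr_ge0 ?ltW// gtr_pMr ?mulr_gt0// ger0_norm; lra.
move=> /(_ isT) /eqP; rewrite mulf_eq0 eq_complex /= gt_eqF ?mulr_gt0//= eq_complex /= => /andP[_ /eqP r0].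
exists m; rewrite mE; apply/eqP; rewrite eq_complex /= i0 eqxx andbT; apply/eqP; lra.
Qed.

Lemma pair_neq0 v : v <> (0, 0) -> v.1 != 0 \/ v.2 != 0.
Proof.
case: v => x y /= h; have [x0|] := eqVneq x 0; last by left.
by right; apply: contra_not_neq h => ->; rewrite x0.
Qed.

Lemma det2_eq0 (a b c d : C) v : v <> (0, 0) -> a * v.1 + b * v.2 = 0 ->
  c * v.1 + d * v.2 = 0 -> a * d - b * c = 0.
Proof.
move=> /pair_neq0 v0 h1 h2; case: v0 => v0; apply: (mulIf v0); rewrite mul0r.
  transitivity (d * (a * v.1 + b * v.2) - b * (c * v.1 + d * v.2)); first by ring.
  by rewrite h1 h2; ring.
transitivity (a * (c * v.1 + d * v.2) - c * (a * v.1 + b * v.2)); first by ring.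
by rewrite h1 h2; ring.
Qed.

Lemma eig_char k lam v c : v <> (0, 0) -> Pm k lam v = sc c v ->
  c ^+ 2 - (P11 k lam + P22 k lam) * c + expC (2 * piI * k) = 0.
Proof.
move=> v0; rewrite PmE /sc => -[h1 h2].
have := @det2_eq0 (P11 k lam - c) (P12 k lam) (P21 k lam) (P22 k lam - c) v v0.
have -> : (P11 k lam - c) * v.1 + P12 k lam * v.2 = 0 by rewrite mulrBl -h1; ring.
have -> : P21 k lam * v.1 + (P22 k lam - c) * v.2 = 0 by rewrite mulrBl -h2; ring.
move=> /(_ erefl erefl) <-; rewrite -(detPE k lam) /detP; ring.
Qed.

Definition indep u w := u.1 * w.2 - u.2 * w.1 != 0.

Lemma indep_or_scaled u w : u <> (0, 0) -> indep u w \/ exists c, w = sc c u.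
Proof.
move=> u0; have [D0|D0] := eqVneq (u.1 * w.2 - u.2 * w.1) 0; [right|by left].
have D1 : u.1 * w.2 = u.2 * w.1 by exact: subr0_eq.
have wE : w = (w.1, w.2) by case: (w).
case: (pair_neq0 u0) => un; [exists (w.1 / u.1)|exists (w.2 / u.2)]; rewrite wE /sc /= divfK//; congr (_, _).
  by rewrite mulrAC (mulrC _ u.2) -D1 mulrAC divff// mul1r.
by rewrite mulrAC (mulrC _ u.1) D1 mulrAC divff// mul1r.
Qed.

Lemma scaled_inv c d v w : c * d = 1 -> v = (d * w.1, d * w.2) -> w = sc c v.
Proof.
move=> cd vE; have E x : c * (d * x) = x by rewrite mulrA cd mul1r.
by rewrite vE /sc !E -surjective_pairing.
Qed.

Lemma eig2_scalar k lam u v c : indep u v -> Pm k lam u = sc c u -> Pm k lam v = sc c v ->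
  [/\ P11 k lam = c, P12 k lam = 0, P21 k lam = 0 & P22 k lam = c].
Proof.
move=> D; rewrite !PmE /sc => -[h1 h2] [h3 h4]; split; apply: (mulIf D).
- transitivity ((P11 k lam * u.1 + P12 k lam * u.2) * v.2 - (P11 k lam * v.1 + P12 k lam * v.2) * u.2); first by ring.
  by rewrite h1 h3; ring.
- transitivity (u.1 * (P11 k lam * v.1 + P12 k lam * v.2) - v.1 * (P11 k lam * u.1 + P12 k lam * u.2)); first by ring.
  by rewrite h1 h3; ring.
- transitivity ((P21 k lam * u.1 + P22 k lam * u.2) * v.2 - (P21 k lam * v.1 + P22 k lam * v.2) * u.2); first by ring.
  by rewrite h2 h4; ring.
transitivity (u.1 * (P21 k lam * v.1 + P22 k lam * v.2) - v.1 * (P21 k lam * u.1 + P22 k lam * u.2)); first by ring.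
by rewrite h2 h4; ring.
Qed.

(** Two independent eigenvectors for c would make P the scalar c, leaving no eigenvector for c'. *)
Lemma eig_line k lam u v w (c c' : C) : Pm k lam u = sc c u -> Pm k lam v = sc c v ->
  Pm k lam w = sc c' w -> c != c' -> u <> (0, 0) -> w <> (0, 0) -> exists t, v = sc t u.
Proof.
move=> Pu Pv Pw cc u0 w0; have [D|//] := indep_or_scaled v u0; exfalso.
have [e11 e12 e21 e22] := eig2_scalar D Pu Pv.
move: Pw; rewrite PmE /sc e11 e12 e21 e22 !mul0r addr0 add0r => -[h5 h6].
have cc0 : c - c' != 0 by rewrite subr_eq0.
have z1 : (c - c') * w.1 = 0 by rewrite mulrBl h5 subrr.
have z2 : (c - c') * w.2 = 0 by rewrite mulrBl h6 subrr.
have w1 := mulfI cc0 (etrans z1 (esym (mulr0 _))).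
have w2 := mulfI cc0 (etrans z2 (esym (mulr0 _))).
by apply: w0; rewrite [w]surjective_pairing w1 w2.
Qed.

Lemma frob_vec k lam lp : (forall n, n.+1%:R + lp != 0) -> lp ^+ 2 = lam ^+ 2 -> exists v g,
  [/\ v <> (0, 0), Pm k lam v = sc (expC ((k - lp) * piI)) v, subexp g, g 0%N = 1 &
   forall z, Dom z -> Left z -> solB k lam v z = Eb k lp g z].
Proof.
move=> hn lp2; pose g := hyp (1 - k) (1 - k + lp) (1 + lp).
have hn' n : n%:R + (1 + lp) != 0 by rewrite addrA natr1.
have sg : subexp g by exact: subexp_hyp.
have [|v [h1 h2 h3]] := @frobenius_eigen R k lam lp g lp2 _ sg erefl.
  move=> n; have := hypS (1 - k) (1 - k + lp) (hn' n).
  by rewrite (addrA _ 1 lp) natr1 (addrA _ (1 - k) lp).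
exists v, g; split => //; apply: scaled_inv h2.
by rewrite -expCD -mulrDl addrA subrK subrr mul0r expC0.
Qed.

Lemma natr_Re (lam : C) n : 0 <= Re lam -> n.+1%:R + lam != 0.
Proof.
move=> l0; apply/eqP => h0; have := congr1 (fun x : C => Re x) h0; rewrite /= ReD.
have -> : (n.+1%:R : C) = (n.+1%:R)%:CC by rewrite rmorph_nat.
by move=> /= h; have : 0 < n.+1%:R :> R by []; lra.
Qed.

(** One eigenvalue is known from the Frobenius solution and the product of both is q. The condition
    Re lam >= 0 keeps n + 1 + lam away from 0 in the recursion. *)
Lemma trP k lam : 0 <= Re lam ->
  P11 k lam + P22 k lam = expC ((k - lam) * piI) + expC ((k + lam) * piI).
Proof.
move=> l0; have [v [g [v0 Pv _ _ _]]] := frob_vec k (fun n => natr_Re n l0) (erefl (lam ^+ 2)).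
have := eig_char v0 Pv; have c0 := expC_neq0 ((k - lam) * piI).
have -> : expC (2 * piI * k) = expC ((k - lam) * piI) * expC ((k + lam) * piI).
  by rewrite -expCD; congr expC; ring.
set c := expC _ in c0 *; set d := expC _ => h.
apply: (mulfI c0); apply: subr0_eq; transitivity (- 0 : C); last by rewrite oppr0.
by rewrite -h; ring.
Qed.

(** T = diag(1, -1) P has trace P_11 - P_22 and determinant - q; an eigenvalue 1 leaves - q for the
    other one. *)
Lemma difP_sym k lam v : v <> (0, 0) -> Tm k lam v = v ->
  P11 k lam - P22 k lam = 1 - expC (2 * piI * k).
Proof.
move=> v0; rewrite /Tm PmE => hv; have h1 := congr1 fst hv; have h2 := congr1 snd hv.
rewrite /= in h1 h2; clear hv.
have := @det2_eq0 (P11 k lam - 1) (P12 k lam) (P21 k lam) (P22 k lam + 1) v v0.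
have -> : (P11 k lam - 1) * v.1 + P12 k lam * v.2 = 0 by rewrite mulrBl -{2}h1; ring.
have -> : P21 k lam * v.1 + (P22 k lam + 1) * v.2 = 0 by rewrite mulrDl mul1r -{2}h2; ring.
rewrite -(detPE k lam) /detP => /(_ erefl erefl) h.
by apply: subr0_eq; rewrite -h; ring.
Qed.

(** If 3/2 - k is a nonpositive integer, the regular solution is taken for 1 - k. There q is
    replaced by 1/q, and the factor - q of [gauge] turns 1 - 1/q into 1 - q. *)
Lemma difP k lam : P11 k lam - P22 k lam = 1 - expC (2 * piI * k).
Proof.
have [kn|] := pselect (forall n, n%:R + (3 / 2 - k) != 0 :> C).
  by have [v [v0 Tv _]] := sym_solution lam kn; exact: difP_sym v0 Tv.
move=> /existsNP [n /negP/negPn/eqP hk].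
have kn i : i%:R + (3 / 2 - (1 - k)) != 0 :> C.
  have -> : k = n%:R + 3 / 2 by apply/esym/subr0_eq; rewrite -hk; ring.
  have -> : i%:R + (3 / 2 - (1 - (n%:R + 3 / 2))) = (i + n + 2)%:R :> C by rewrite !natrD; field.
  by rewrite pnatr_eq0 addn_eq0 andbF.
have [v [v0 Tv _]] := sym_solution lam kn; have := difP_sym v0 Tv.
have E : expC (2 * piI * (1 - k)) = (expC (2 * piI * k))^-1.
  by rewrite mulrBr mulr1 expCB expC_2piI div1r.
have q0 := expC_neq0 (2 * piI * k).
have -> : P11 k lam = - expC (2 * piI * k) * P11 (1 - k) lam by rewrite /P11 gauge.
have -> : P22 k lam = - expC (2 * piI * k) * P22 (1 - k) lam by rewrite /P22 gauge.
by rewrite E -mulrBr => ->; field.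
Qed.

(** From v = diag(1, -1) P v = diag(c, - c) v one gets c = 1 or c = -1. Composing the two symmetries
    of the equation gives the reflection z |-> pi i - z, which preserves the strip. *)
Lemma sym_eig k lam v c : v <> (0, 0) -> Tm k lam v = v -> Pm k lam v = sc c v ->
  [/\ c ^+ 2 = 1 & forall z, Sig0 z -> solA k lam v (piI - z) = c * solA k lam v z /\
     solB k lam v (piI - z) = - c * solB k lam v z].
Proof.
move=> v0 Tv Pv; split.
  move: Tv; rewrite /Tm Pv /sc /= => hv; have h1 := congr1 fst hv; have h2 := congr1 snd hv.
  rewrite /= in h1 h2; case: (pair_neq0 v0) => vn.
    by rewrite (_ : c = 1) ?expr1n//; apply: (mulIf vn); rewrite h1 mul1r.
  rewrite (_ : c = -1) ?sqrrN ?expr1n//; apply: (mulIf vn).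
  by rewrite -[c * _]opprK h2 mulN1r.
move=> z zS; have zS' : Sig0 (piI - z).
  by move: zS; rewrite /Sig0 ImB Im_piI; lra.
have [h1 h2] := @sol_Tm R k lam v _ zS'; rewrite Tv opprB in h1 h2.
have [h3 h4] := @sol_Pm R k lam v z zS; rewrite Pv in h3 h4.
have [|h5 h6] := @sol_linE R k lam c 0 v v (sc c v) z _ (Sig0_Dom zS).
  by rewrite /sc !mul0r !addr0.
rewrite h1 h2 -h3 -h4 h5 h6; split; ring.
Qed.

End ReducibilityCriterion.

(** * Boundary symmetry of a common eigenvector *)

Section ReducibilityNecessary.
Variable R : realType.
Local Notation C := (R[i]).
Local Notation N := (@ComplexField.Normc.normc R).
Local Notation Re := complex.Re.
Local Notation piI := (piI R).
Implicit Types (z p : C) (k lam : C) (v : C * C).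

(** Compactness of [a, b] turns local bounds on r into a uniform one. *)
Lemma unif_near (P : R -> R -> Prop) (a b : R) :
  (forall t, a <= t <= b -> exists2 d, 0 < d & forall s r, `|s - t| < d -> 0 < r < d -> P s r) ->
  exists2 d : R, 0 < d & forall s r, a <= s <= b -> 0 < r < d -> P s r.
Proof.
move=> h.
have := (compact_near_coveringP `[a, b]).1 (@segment_compact R a b).
move=> /(_ R (nbhs (0 : R)) (fun r s => 0 < r -> P s r) _) H.
have /nbhs_ballP[d d0 hd] : nbhs (0 : R) (fun r => `[a, b] `<=` (fun s => 0 < r -> P s r)).
  apply: H => t; rewrite /= in_itv /= => /h[d d0 hd].
  exists (ball t d, ball (0 : R) d); first by split; exact: nbhsx_ballx.
  move=> [s r] [/= sb rb] r0; apply: hd; first by rewrite distrC.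
  by move: rb; rewrite /ball /= sub0r normrN gtr0_norm// r0.
exists d => // s r sab /andP[r0 rd]; apply: hd => //.
by rewrite /ball /= sub0r normrN gtr0_norm.
Qed.

(** Continuity up to 0 in the cut disc. The solution of [sym_solution] has a(0) = 2 (2k - 1), hence
    the exception k = 1/2. *)
Definition reg0 k lam v := exists (r : R) (a b : C -> C),
  [/\ 0 < r, cont a 0 /\ cont b 0, 2 * k != 1 -> a 0 != 0, b 0 = 0 &
    forall z, Dom z -> N z < r -> solA k lam v z = a z /\ solB k lam v z = b z].

Lemma sigE (r s : R) : 0 < s < pi -> Sig0 (Complex r s).
Proof. by []. Qed.

Lemma piI_sub (r s : R) : piI - Complex r s = Complex (- r) (pi - s).
Proof.
by rewrite piIE; apply/eqP; rewrite eq_complex /=; apply/andP; split; apply/eqP; ring.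
Qed.

Lemma pi_sub_itv (s : R) : 0 < s < pi -> 0 < pi - s < pi.
Proof. by move=> /andP[h1 h2]; rewrite subr_gt0 h2 gtrBl h1. Qed.

Lemma N_Complex_lt (r s d : R) : `|r| < d / 2 -> `|s| < d / 2 -> N (Complex r s) < d.
Proof. by move=> h1 h2; have := N_le (Complex r s); rewrite /=; lra. Qed.

Lemma sym_close0 k lam v : reg0 k lam v -> forall e : R, 0 < e -> exists2 d : R, 0 < d &
  forall s r : R, 0 < s < pi -> s < d -> 0 < r < d ->
    N (solB k lam v (Complex (- r) s) - solB k lam v (Complex r s)) < e.
Proof.
move=> [r0 [a [b [r00 [_ cb] _ b0 hb]]]] e e0; have e2 : 0 < e / 2 by lra.
have [d d0 hd] := cb _ e2; pose m := Num.min r0 d.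
have m0 : 0 < m by rewrite lt_min r00.
exists (m / 2) => [|s r s0 sm /andP[rr rm]]; first by lra.
have s1 : `|s| < m / 2 by case/andP: s0 => s0 _; rewrite gtr0_norm.
have H t : `|t| < m / 2 -> N (solB k lam v (Complex t s)) < e / 2.
  move=> tm; have := N_Complex_lt tm s1; rewrite lt_min => /andP[N1 N2].
  have [_ ->] := hb _ (Sig0_Dom (sigE t s0)) N1.
  by have := hd (Complex t s); rewrite b0 !subr0; apply.
have h1 : N (solB k lam v (Complex (- r) s)) < e / 2 by apply: H; rewrite normrN gtr0_norm.
have h2 : N (solB k lam v (Complex r s)) < e / 2 by apply: H; rewrite gtr0_norm.
apply: le_lt_trans (NB _ _) _; lra.
Qed.

(** The two values are close by continuity at interior points of the segment, near 0 because b tends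
    to 0, and near pi i because the reflection carries this end to 0; compactness makes the estimate
    uniform. *)
Lemma sym_close k lam v c : v <> (0, 0) -> Tm k lam v = v -> Pm k lam v = sc c v ->
  reg0 k lam v -> forall e : R, 0 < e -> exists2 d : R, 0 < d & forall s r : R, 0 < s < pi -> 0 < r < d ->
    N (solB k lam v (Complex (- r) s) - solB k lam v (Complex r s)) < e.
Proof.
move=> v0 Tv Pv rv e e0; have [d d0 hd] := sym_close0 rv e0.
have [c2 hc] := sym_eig v0 Tv Pv.
have Nc : N c = 1.
  by move/eqP: c2; rewrite sqrf_eq1 => /orP[]/eqP ->; rewrite ?NN N1.
suff [d' d'0 hd'] : exists2 d : R, 0 < d & forall s r, 0 <= s <= pi -> 0 < r < d -> 0 < s < pi ->
   N (solB k lam v (Complex (- r) s) - solB k lam v (Complex r s)) < e.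
  exists d' => // s r s0 rd; apply: hd' => //; case/andP: s0 => s0 s1; by rewrite !ltW.
apply: unif_near => t /andP[t0 t1].
have [tz|tz] := eqVneq t 0.
  exists d => // s r; rewrite tz subr0 => sd rd s0; apply: hd => //.
  by move: sd; rewrite gtr0_norm//; case/andP: s0.
have [tp|tp] := eqVneq t pi.
  exists d => // s r; rewrite tp => sd rd s0.
  have s0' := pi_sub_itv s0.
  have h1 := piI_sub (- r) (pi - s); have h2 := piI_sub r (pi - s).
  rewrite opprK subKr in h1; rewrite subKr in h2.
  rewrite -h1 -h2 (hc _ (sigE _ s0')).2 (hc _ (sigE _ s0')).2 -mulrBr NM NN Nc mul1r NBC.
  have p0 : 0 < pi - s by case/andP: s0'.
  by apply: hd => //; move: sd; rewrite distrC gtr0_norm.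
have tS : Sig0 (Complex 0 t) by rewrite /Sig0 /= !lt_neqAle eq_sym tz tp t0 t1.
have [_ /cder_cont cb] := @solAB R k lam v _ (Sig0_Dom tS).
have e2 : 0 < e / 2 by lra.
have [d1 d10 hd1] := cb _ e2; exists (d1 / 2); first lra.
move=> s r sd /andP[r0 rd] s0.
have H x : `|x| < d1 / 2 -> N (solB k lam v (Complex x s) - solB k lam v (Complex 0 t)) < e / 2.
  move=> xd; apply: hd1.
  have -> : Complex x s - Complex 0 t = Complex x (s - t).
    by apply/eqP; rewrite eq_complex /= subr0 !eqxx.
  exact: N_Complex_lt.
have h1 : N (solB k lam v (Complex (- r) s) - solB k lam v (Complex 0 t)) < e / 2.
  by apply: H; rewrite normrN gtr0_norm.
have h2 : N (solB k lam v (Complex r s) - solB k lam v (Complex 0 t)) < e / 2.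
  by apply: H; rewrite gtr0_norm.
have := NB (solB k lam v (Complex (- r) s) - solB k lam v (Complex 0 t)) (solB k lam v (Complex r s) - solB k lam v (Complex 0 t)).
by rewrite opprB addrA subrK; lra.
Qed.

Lemma eig_values k lam v c : 0 <= Re lam -> v <> (0, 0) -> Pm k lam v = sc c v ->
  c = expC ((k - lam) * piI) \/ c = expC ((k + lam) * piI).
Proof.
move=> l0 v0 Pv; have := eig_char v0 Pv; rewrite trP//.
have -> : expC (2 * piI * k) = expC ((k - lam) * piI) * expC ((k + lam) * piI).
  by rewrite -expCD; congr expC; ring.
set x := expC _; set y := expC _ => h.
have : (c - x) * (c - y) = 0 by rewrite -h; ring.
by move/eqP; rewrite mulf_eq0 !subr_eq0 => /orP[]/eqP ->; [left|right].
Qed.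

Lemma sq_int (x : C) : expC (x * piI) ^+ 2 = 1 -> is_int x.
Proof. by rewrite -(expCMn _ 2) => h; apply: is_int_exp; apply: etrans h; congr expC; ring. Qed.

(** By [line], v is proportional to the Frobenius solution, and c^2 = 1 makes k - lp an integer. If
    it is not positive, b is x^j times a power series in x^2 with j = lp - k >= 0, and [sym_close]
    supplies the mirror relation with sign - c. For j = 0 one has c = 1, as [averaging] demands, and
    the leading coefficient -1 would have to vanish. *)
Lemma core_frob k lam lp v : (forall n, n.+1%:R + lp != 0) -> lp ^+ 2 = lam ^+ 2 ->
  (forall u w, u <> (0, 0) -> Pm k lam u = sc (expC ((k - lp) * piI)) u ->
     Pm k lam w = sc (expC ((k - lp) * piI)) w -> exists t, w = sc t u) ->
  v <> (0, 0) -> Tm k lam v = v -> Pm k lam v = sc (expC ((k - lp) * piI)) v -> reg0 k lam v ->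
  is_posint (k - lp).
Proof.
move=> hn lp2 line v0 Tv Pv rv; set c := expC _ in Pv.
have [c2 hc] := sym_eig v0 Tv Pv.
have [m hm] : is_int (k - lp) by exact: sq_int.
have [[j hj]|] : (exists j : nat, lp - k = j%:R) \/ is_posint (k - lp); last exact: id.
  case: m hm => [[|n]|n] hm; last first.
  - by left; exists n.+1; rewrite -opprB hm NegzE mulrNz opprK.
  - by right; exists n.
  - by left; exists 0%N; rewrite -opprB hm oppr0.
exfalso; have [w [g [w0 Pw sg g0 hw]]] := frob_vec k hn lp2.
have [t wE] := line _ _ v0 Pv Pw.
have bw z : Dom z -> solB k lam w z = t * solB k lam v z.
  move=> Dz; have [|_ ->] := @sol_linE R k lam t 0 v v w z _ Dz; last by ring.
  by rewrite wE /sc !mul0r !addr0.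
have cs : c = 1 \/ c = -1 by move/eqP: c2; rewrite sqrf_eq1 => /orP[]/eqP ->; [left|right].
have := @averaging R (fun n => sh g n - g n) j (- c).
rewrite /= g0 sub0r => H; suff /eqP : (-1 : C) = 0 by rewrite oppr_eq0 oner_eq0.
apply: H.
- by apply: subexpD; [exact: subexp_sh|have := subexpZ (-1) sg; congr subexp; apply/funext => n; rewrite mulN1r].
- by rewrite NN; case: cs => ->; rewrite ?NN N1.
- by move=> j0; rewrite /c -opprB hj j0 oppr0 mul0r expC0.
move=> e e0; have e1 : 0 < e / (N t + 1) by rewrite divr_gt0// ltr_wpDl// N_ge0.
have [d d0 hd] := sym_close v0 Tv Pv rv e1.
pose r := Num.min d e / 2; have m0 : 0 < Num.min d e by rewrite lt_min d0.
have [md me] : Num.min d e <= d /\ Num.min d e <= e by rewrite !ge_min !lexx orbT.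
have r0 : 0 < r by rewrite /r; lra.
have rd : r < d by rewrite /r; lra.
have re : r < e by rewrite /r; lra.
exists r; first by rewrite r0.
move=> s s0; have s0' := pi_sub_itv s0.
have E x : 0 < x < pi -> expC (j%:R * Complex (- r) x) * ps (fun n => sh g n - g n) (expC (2 * Complex (- r) x)) =
    solB k lam w (Complex (- r) x).
  move=> x0; rewrite hw ?/Eb ?hj//; first exact/Sig0_Dom/sigE.
  by rewrite /Left /= oppr_lt0.
rewrite !E// !bw; [|exact/Sig0_Dom/sigE..].
rewrite -(piI_sub r s) (hc _ (sigE r s0)).2.
have -> : t * solB k lam v (Complex (- r) s) - - c * (t * (- c * solB k lam v (Complex r s))) =
  t * (solB k lam v (Complex (- r) s) - c ^+ 2 * solB k lam v (Complex r s)) by ring.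
rewrite c2 mul1r NM; have := hd s r s0; rewrite r0 rd => /(_ isT) h.
apply: (@le_trans _ _ ((N t + 1) * (e / (N t + 1)))).
  by apply: ler_pM; rewrite ?N_ge0 ?lerDl// ltW.
by rewrite mulrC divfK// gt_eqF// ltr_wpDl// N_ge0.
Qed.

End ReducibilityNecessary.

(** * An energy on the imaginary segment, for integral parameters *)

Section Energy.
Variable R : realType.
Local Notation C := (R[i]).
Local Notation N := (@ComplexField.Normc.normc R).
Local Notation "x %:CC" := (real_complex R x) (at level 2, format "x %:CC").
Local Notation Re := complex.Re.
Local Notation Im := complex.Im.
Local Notation piI := (piI R).
Implicit Types (z p : C) (k lam : C) (v : C * C).

Lemma mul_i (t : R) : 0 + t%:CC * 'i%C = Complex 0 t :> C.
Proof. by apply/eqP; rewrite eq_complex /=; apply/andP; split; apply/eqP; ring. Qed.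

Lemma i_coth (t : R) : sin t != 0 -> 'i%C * cothC (Complex 0 t) = (cos t / sin t)%:CC :> C.
Proof.
move=> s0; have e1 : expC (Complex 0 t) = Complex (cos t) (sin t) :> C.
  by rewrite /expC /= expR0 mul1r.
have e2 : expC (- Complex 0 t) = Complex (cos t) (- sin t) :> C.
  by rewrite /expC /= oppr0 expR0 mul1r cosN sinN.
have sE : sh2 (Complex 0 t) = 2 * (sin t)%:CC * 'i%C :> C.
  rewrite /sh2 e1 e2 two_CC; apply/eqP; rewrite eq_complex /=; apply/andP; split; apply/eqP; ring.
have cE : ch2 (Complex 0 t) = 2 * (cos t)%:CC :> C.
  rewrite /ch2 e1 e2 two_CC; apply/eqP; rewrite eq_complex /=; apply/andP; split; apply/eqP; ring.
rewrite /cothC sE cE rmorphM fmorphV /=; field.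
by rewrite !eq_complex /= eqxx andbT s0 oner_eq0 andbF.
Qed.

Lemma rder_imag k m (a b : C -> C) (t : R) : Sol k m (@Sig0 R) a b -> 0 < t < pi ->
  rder (fun u => a (Complex 0 u)) t (- m * b (Complex 0 t) * 'i%C) /\
  rder (fun u => b (Complex 0 u)) t
   (2 * k * (cos t / sin t)%:CC * b (Complex 0 t) - a (Complex 0 t) * 'i%C).
Proof.
move=> s t0; have s0 : sin t != 0 by rewrite gt_eqF// sin_gt0_pi.
have [h1 h2] := s _ (sigE 0 t0); rewrite -mul_i in h1 h2.
have := cder_line h1; have := cder_line h2.
have E (f : C -> C) : (fun u : R => f (0 + u%:CC * 'i%C)) = (fun u => f (Complex 0 u)).
  by apply/funext => u; rewrite mul_i.
rewrite !E mul_i => h3 h4; split=> //; move: h3; congr rder.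
by rewrite mulrBl -(i_coth s0); ring.
Qed.

Lemma pow_pred_div (n : nat) (s c : R) : s != 0 -> n%:R * s ^+ n.-1 * c = n%:R * (c / s) * s ^+ n.
Proof. by move=> s0; case: n => [|n] /=; rewrite ?mul0r ?exprS//; field. Qed.

Section Monotone.
Variables (k lam : C) (v : C * C) (p m : nat).
Hypotheses (hk : 2 * k = - p%:R) (hm : par k lam = - m%:R).
Let a (t : R) := solA k lam v (Complex 0 t).
Let b (t : R) := solB k lam v (Complex 0 t).
Let E t : R := Im (a t) * Re (b t) - Re (a t) * Im (b t).

(* On z = it this is sin^{- 2 k} Im (a conj b).  It is nondecreasing when
   m <= 0, while the symmetry t |-> pi - t of a common eigenvector makes it
   vanish at pi / 2 and regularity makes it vanish at 0. *)
Definition energy (t : R) : R := sin t ^+ p * E t.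

(** The derivative of sin^p with p = - 2k cancels the cot term of the equation for b; what is left
    is |a|^2 + m |b|^2. *)
Lemma energy_derive t : 0 < t < pi ->
  is_derive t 1 energy (sin t ^+ p * (N (a t) ^+ 2 + m%:R * N (b t) ^+ 2)).
Proof.
move=> t0; have s0 : sin t != 0 by rewrite gt_eqF// sin_gt0_pi.
have [[a1 a2] [b1 b2]] := rder_imag (sol_sub (@Sig0_Dom R) (@solAB R k lam v)) t0.
rewrite hm opprK in a1 a2; rewrite hk in b1 b2.
have dE := is_deriveB (is_deriveM a2 b1) (is_deriveM a1 b2).
have dS := is_deriveX p (is_derive_sin t).
have dg := is_deriveM dS dE.
have -> : energy = (sin : R -> R) ^+ p * ((fun u => Im (a u)) * (fun u => Re (b u)) - (fun u => Re (a u)) * (fun u => Im (b u))).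
  by rewrite exprfctE; apply/funext => u.
apply: is_derive_eq dg _; rewrite exprfctE.
rewrite (_ : ((fun u => Im (a u)) * (fun u => Re (b u)) - (fun u => Re (a u)) * (fun u => Im (b u))) t = E t)// /E.
rewrite /GRing.scale /= !N2.
have mE : (m%:R : C) = (m%:R)%:CC by rewrite rmorph_nat.
have pE : (p%:R : C) = (p%:R)%:CC by rewrite rmorph_nat.
rewrite -/(a t) -/(b t) mE pE.
case: (a t) => x y; case: (b t) => z w /=.
have -> : p%:R * sin t ^+ p.-1 * cos t = p%:R * (cos t / sin t) * sin t ^+ p.
  exact: pow_pred_div.
by field.
Qed.

Lemma energy_MVT (s t : R) : 0 < s -> s < t -> t < pi -> exists2 x : R, s < x < t &
  energy t - energy s = sin x ^+ p * (N (a x) ^+ 2 + m%:R * N (b x) ^+ 2) * (t - s).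
Proof.
move=> s0 st tp.
have itv x : s <= x <= t -> 0 < x < pi by lra.
have [||x] := MVT (f := energy) (df := fun x => sin x ^+ p * (N (a x) ^+ 2 + m%:R * N (b x) ^+ 2)) st.
- by move=> x; rewrite in_itv /= => /andP[x1 x2]; apply: energy_derive; apply: itv; rewrite !ltW.
- apply: derivable_within_continuous => x; rewrite in_itv /= => /itv x0.
  by have [] := energy_derive x0.
by rewrite in_itv /= => xst ->; exists x.
Qed.

Lemma energy_pos x : 0 < x < pi -> a x != 0 -> 0 < sin x ^+ p * (N (a x) ^+ 2 + m%:R * N (b x) ^+ 2).
Proof.
move=> x0 ax; rewrite mulr_gt0 ?exprn_gt0 ?sin_gt0_pi//.
by rewrite ltr_wpDr ?exprn_gt0 ?N_gt0// mulr_ge0 ?exprn_ge0 ?N_ge0.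
Qed.

Lemma energy_mono (s t : R) : 0 < s -> s <= t -> t < pi -> energy s <= energy t.
Proof.
rewrite le_eqVlt => s0 /orP[/eqP ->//|st tp]; have [x /andP[x1 x2] h] := energy_MVT s0 st tp.
rewrite -subr_ge0 h; apply: mulr_ge0; last by rewrite subr_ge0 ltW.
apply: mulr_ge0; last by rewrite addr_ge0 ?mulr_ge0 ?exprn_ge0 ?N_ge0.
by rewrite exprn_ge0// ltW// sin_gt0_pi// (lt_trans s0 x1) (lt_trans x2 tp).
Qed.

(** pi i / 2 is fixed by z |-> pi i - z, so b vanishes there if c = 1 and a does if c = -1. *)
Lemma energy_anti c : v <> (0, 0) -> Tm k lam v = v -> Pm k lam v = sc c v ->
  energy (pi / 2) = 0.
Proof.
move=> v0 Tv Pv; have [c2 hc] := sym_eig v0 Tv Pv.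
have p2 : 0 < (pi / 2 : R) < pi by have := pi_gt0 R; lra.
have [h1 h2] := hc _ (sigE 0 p2).
have h : piI - Complex 0 (pi / 2) = Complex 0 (pi / 2).
  by rewrite piI_sub; apply/eqP; rewrite eq_complex /=; apply/andP; split; apply/eqP; field.
rewrite h -/(a _) in h1; rewrite h -/(b _) in h2; rewrite /energy /E.
suff : Im (a (pi / 2)) * Re (b (pi / 2)) - Re (a (pi / 2)) * Im (b (pi / 2)) = 0 by move=> ->; rewrite mulr0.
move/eqP: c2; rewrite sqrf_eq1 => /orP[]/eqP cE; rewrite cE in h1 h2.
  suff -> : b (pi / 2) = 0 by rewrite /=; ring.
  by move: h2; rewrite mulN1r; move: (b _) => [x y] [/= hx hy]; apply/eqP; rewrite eq_complex /=; apply/andP; split; apply/eqP; lra.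
suff -> : a (pi / 2) = 0 by rewrite /=; ring.
by move: h1; rewrite mulN1r; move: (a _) => [x y] [/= hx hy]; apply/eqP; rewrite eq_complex /=; apply/andP; split; apply/eqP; lra.
Qed.

(** Near 0 the function a is bounded, b tends to 0 and sin^p stays bounded because p >= 0. Since 2k
    = - p differs from 1, a(0) is nonzero. *)
Lemma energy_small : reg0 k lam v -> forall e : R, 0 < e -> exists2 d : R, 0 < d &
  forall t, 0 < t < pi -> t < d -> `|energy t| <= e /\ a t != 0.
Proof.
move=> [r [f [g [r0 [cf cg] f0 g0 hfg]]]] e e0.
have Nf : 0 < N (f 0).
  rewrite N_gt0 f0// hk; apply/eqP => h; have := congr1 (fun x : C => Re x) h.
  have -> : (p%:R : C) = (p%:R)%:CC by rewrite rmorph_nat.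
  by rewrite /=; have : 0 <= p%:R :> R by []; lra.
have [d1 d10 h1] := cf _ Nf.
have e1 : 0 < e / (4 * N (f 0)) by rewrite divr_gt0// mulr_gt0.
have [d2 d20 h2] := cg _ e1.
exists (Num.min r (Num.min d1 d2)); first by rewrite !lt_min r0 d10.
move=> t t0; rewrite !lt_min => /andP[tr /andP[t1 t2]].
have Nt : N (Complex 0 t - 0) = t.
  by rewrite subr0 -mul_i add0r NM Nreal Ni mulr1 gtr0_norm//; case/andP: t0.
have [|fa gb] := hfg _ (Sig0_Dom (sigE 0 t0)); first by rewrite -[Complex _ _]subr0 Nt.
have := h1 (Complex 0 t); have := h2 (Complex 0 t); rewrite Nt g0 subr0 -fa -gb -/(a t) -/(b t).
move=> /(_ t2) hb /(_ t1) ha; split; last first.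
  by apply: contraTneq ha => ->; rewrite sub0r NN ltxx.
have Na : N (a t) <= 2 * N (f 0) by have := NBD (a t) (- f 0); rewrite NN; lra.
have EB : `|E t| <= 2 * (N (a t) * N (b t)).
  rewrite /E (le_trans (ler_normB _ _))// !normrM.
  have := ler_pM (normr_ge0 _) (normr_ge0 _) (Im_le_N (a t)) (Re_le_N (b t)).
  have := ler_pM (normr_ge0 _) (normr_ge0 _) (Re_le_N (a t)) (Im_le_N (b t)); lra.
rewrite /energy normrM normrX; apply: (@le_trans _ _ (1 * e)); last by rewrite mul1r.
apply: ler_pM; rewrite ?exprn_ge0 ?normr_ge0//.
  by rewrite exprn_ile1// ler_norml sin_geN1 sin_le1.
apply: le_trans EB _.
have : N (a t) * N (b t) <= (2 * N (f 0)) * (e / (4 * N (f 0))) by apply: ler_pM; rewrite ?N_ge0// ltW.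
have -> : 2 * N (f 0) * (e / (4 * N (f 0))) = e / 2 by field; rewrite gt_eqF.
lra.
Qed.

(** Zero limits at both ends would still allow a constant energy. As a is nonzero near 0, the energy
    increases strictly there: its gain [eta] from t/2 to t makes it positive at t, against its value
    0 at pi / 2. *)
Lemma energy_contra c : v <> (0, 0) -> Tm k lam v = v -> Pm k lam v = sc c v ->
  reg0 k lam v -> False.
Proof.
move=> v0 Tv Pv rv; have e2 := energy_anti v0 Tv Pv; have p2 := pi_ge2 R.
have [d d0 hd] := energy_small rv (ltr01 : 0 < 1 :> R).
pose t := Num.min d 1 / 2; have m0 : 0 < Num.min d 1 by rewrite lt_min d0 ltr01.
have [md m1] : Num.min d 1 <= d /\ Num.min d 1 <= 1 by rewrite !ge_min !lexx orbT.
have t0 : 0 < t by rewrite /t; lra.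
have t1 : t < d by rewrite /t; lra.
have t2 : t <= pi / 2 by rewrite /t; lra.
have t3 : t < pi by lra.
have h2 : 0 < t / 2 by lra.
have h3 : t / 2 < t by lra.
have [x /andP[x1 x2] hx] := energy_MVT h2 h3 t3.
have x0 : 0 < x < pi by rewrite (lt_trans h2 x1) (lt_trans x2 t3).
have [_ ax] := hd x x0 (lt_trans x2 t1).
have et : energy t <= 0 by rewrite -e2; apply: energy_mono => //; lra.
have eta : 0 < energy t - energy (t / 2) by rewrite hx mulr_gt0 ?energy_pos// subr_gt0.
have [d' d'0 hd'] := energy_small rv eta.
pose s := Num.min d' (t / 2) / 2; have m0' : 0 < Num.min d' (t / 2) by rewrite lt_min d'0 h2.
have [md' m1'] : Num.min d' (t / 2) <= d' /\ Num.min d' (t / 2) <= t / 2 by rewrite !ge_min !lexx orbT.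
have s0 : 0 < s by rewrite /s; lra.
have s1 : s < t / 2 by rewrite /s; lra.
have [s2 s3] : s < d' /\ t / 2 < pi by rewrite /s; split; lra.
have sp : 0 < s < pi by rewrite s0 (lt_trans s1 s3).
have [es _] := hd' s sp s2; move: es; rewrite ler_norml => /andP[es _].
have [y /andP[y1 y2] hy] := energy_MVT s0 s1 s3.
have y0 : 0 < y < pi by rewrite (lt_trans s0 y1) (lt_trans y2 s3).
have [_ ay] := hd y y0 (lt_trans y2 (lt_trans h3 t1)).
have : 0 < energy (t / 2) - energy s by rewrite hy mulr_gt0 ?energy_pos// subr_gt0.
lra.
Qed.

End Monotone.

End Energy.

(** * A regular common eigenvector forces a positive integer *)

Section Core.
Variable R : realType.
Local Notation C := (R[i]).
Local Notation N := (@ComplexField.Normc.normc R).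
Local Notation "x %:CC" := (real_complex R x) (at level 2, format "x %:CC").
Local Notation Re := complex.Re.
Local Notation piI := (piI R).
Implicit Types (z p : C) (k lam : C) (v : C * C).

Lemma is_intD (x y : C) : is_int x -> is_int y -> is_int (x + y).
Proof. by move=> [m ->] [n ->]; exists (m + n); rewrite rmorphD. Qed.
Lemma is_intN (x : C) : is_int x -> is_int (- x).
Proof. by move=> [m ->]; exists (- m); rewrite rmorphN. Qed.
Lemma is_intB (x y : C) : is_int x -> is_int y -> is_int (x - y).
Proof. by move=> hx /is_intN; exact: is_intD. Qed.
Lemma is_int_nat n : is_int (n%:R : C).
Proof. by exists n. Qed.

Lemma not_posint (x : C) : is_int x -> ~ is_posint x -> exists n : nat, x = - n%:R.
Proof.
move=> [[[|n]|n] ->] hx; first by exists 0%N; rewrite oppr0.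
  by case: hx; exists n.
by exists n.+1; rewrite NegzE mulrNz.
Qed.

Lemma int_shift_neq0 (lam : C) n : ~ is_int lam -> n%:R + lam != 0.
Proof.
move=> hl; apply/eqP => h; apply: hl.
have -> : lam = - n%:R by apply: subr0_eq; rewrite opprK addrC.
exact/is_intN/is_int_nat.
Qed.

(** For lp not an integer the exponents lp and - lp belong to distinct eigenvalues of P, so each
    eigenspace is a line. *)
Lemma frob_line k lam lp u w : ~ is_int lp -> lp ^+ 2 = lam ^+ 2 -> u <> (0, 0) ->
  Pm k lam u = sc (expC ((k - lp) * piI)) u ->
  Pm k lam w = sc (expC ((k - lp) * piI)) w -> exists t, w = sc t u.
Proof.
move=> li lp2 u0 Pu Pw.
have li' : ~ is_int (- lp) by move=> /is_intN; rewrite opprK.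
have [|x [g [x0 Px _ _ _]]] := @frob_vec R k lam (- lp) (fun n => int_shift_neq0 n.+1 li').
  by rewrite sqrrN.
apply: (eig_line Pu Pw Px _ u0 x0); rewrite opprK; apply/eqP => h; apply/li/is_int_exp.
have e0 := expC_neq0 ((k - lp) * piI); apply: (mulfI e0); rewrite mulr1 -expCD h.
by congr expC; ring.
Qed.

(** For lam not an integer, [core_frob] applies to whichever of lam and - lam gives the eigenvalue
    c. For lam an integer, c^2 = 1 makes k one too; if k + lam = - i and k - lam = - j with i, j >=
    0, then - 2k = i + j and k^2 - lam^2 = i j have the signs required by the energy. *)
Lemma core k lam v c : 0 <= Re lam -> v <> (0, 0) -> Tm k lam v = v -> Pm k lam v = sc c v ->
  reg0 k lam v -> is_posint (k + lam) \/ is_posint (k - lam).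
Proof.
move=> l0 v0 Tv Pv rv; have [c2 _] := sym_eig v0 Tv Pv.
have [li|li] := pselect (is_int lam); last first.
  have li' : ~ is_int (- lam) by move=> /is_intN; rewrite opprK.
  have lN : (- lam) ^+ 2 = lam ^+ 2 by rewrite sqrrN.
  case: (eig_values l0 v0 Pv) => cE; rewrite cE in Pv; [right|left].
    apply: (core_frob (fun n => int_shift_neq0 n.+1 li) (erefl _) _ v0 Tv Pv rv).
    by move=> u w u0 Pu Pw; exact: frob_line li (erefl _) u0 Pu Pw.
  have E : k + lam = k - - lam by rewrite opprK.
  rewrite E in Pv *.
  apply: (core_frob (fun n => int_shift_neq0 n.+1 li') lN _ v0 Tv Pv rv).
  by move=> u w u0 Pu Pw; exact: frob_line li' lN u0 Pu Pw.
have ki : is_int k.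
  case: (eig_values l0 v0 Pv) => cE; rewrite cE in c2.
    by rewrite -(subrK lam k); exact/is_intD/li/sq_int.
  by rewrite -(addrK lam k); exact/is_intB/li/sq_int.
apply: contrapT => /not_orP[/not_posint h1 /not_posint h2].
have [i hi] := h1 (is_intD ki li); have [j hj] := h2 (is_intB ki li).
apply: (@energy_contra R k lam v (i + j) (i * j) _ _ c v0 Tv Pv rv).
  by rewrite natrD opprD -hi -hj; ring.
have -> : (i * j)%:R = (k + lam) * (k - lam) by rewrite hi hj natrM mulrNN.
by rewrite /par; ring.
Qed.

Lemma expR_diff (m r r' : R) : 0 <= m -> 0 < r' -> r' < r ->
  `|expR (- (m * r)) - expR (- (m * r'))| <= m * r.
Proof.
move=> m0 r'0 rr'; rewrite distrC ger0_norm; last first.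
  by rewrite subr_ge0 ler_expR lerN2 ler_wpM2l// ltW.
have h1 := expR_ge1Dx (- (m * r)).
have h2 : expR (- (m * r')) <= 1 by rewrite -expR0 ler_expR oppr_le0 mulr_ge0// ltW.
lra.
Qed.

Lemma N_expC_diff (m : nat) (r r' s : R) : 0 < r' -> r' < r ->
  N (expC (m%:R * Complex (- r) s) - expC (m%:R * Complex (- r') s)) <= m%:R * r.
Proof.
move=> r'0 rr'; have mE : (m%:R : C) = (m%:R)%:CC by rewrite rmorph_nat.
have E (x : R) : expC (m%:R * Complex (- x) s) = (expR (- (m%:R * x)))%:CC * expC (Complex 0 (m%:R * s)).
  rewrite -expC_real -expCD; congr expC; rewrite mE.
  by apply/eqP; rewrite eq_complex /=; apply/andP; split; apply/eqP; ring.
rewrite !E -mulrBl NM N_expC /= expR0 mulr1 -[_ - _]/(_ - _).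
have -> : (expR (- (m%:R * r)))%:CC - (expR (- (m%:R * r')))%:CC = (expR (- (m%:R * r)) - expR (- (m%:R * r')))%:CC :> C.
  by rewrite rmorphB.
by rewrite Nreal; exact: expR_diff.
Qed.

Lemma quarter3 (e : R) : 0 < e -> e / 4 + e / 4 + e / 4 <= e. Proof. lra. Qed.
Lemma quarter2 (e : R) : e / 4 + e / 4 <= e / 2. Proof. lra. Qed.
Lemma half2 (e : R) : e / 2 + e / 2 <= e. Proof. lra. Qed.

Lemma N_tri2 (X Y Z : C) (e : R) : N (X - Y) <= e -> N (Y - Z) <= e -> N (X - Z) <= e + e.
Proof. by move=> h1 h2; rewrite -(subrKA Y X) (le_trans (ND _ _))// lerD. Qed.

Lemma N_tri3 (X Y A B : C) (e : R) : N (X - A) <= e -> N (Y - B) <= e -> N (A - B) <= e ->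
  N (X - Y) <= e + e + e.
Proof.
move=> h1 h2 h3; rewrite -(subrKA B X) (le_trans (ND _ _))// lerD//; last by rewrite NBC.
exact: N_tri2 h1 h3.
Qed.

Lemma N_tri_sgn (X Y Z c : C) (e : R) : c ^+ 2 = 1 -> N c = 1 -> N (Y - Z) <= e ->
  N (X - - c * Z) <= e -> N (Y - - c * X) <= e + e.
Proof.
move=> c2 Nc h1 h2; have -> : Y - - c * X = (Y - Z) + c * (X - - c * Z).
  by transitivity (Y + c * X - (1 - c ^+ 2) * Z); [rewrite c2; ring|ring].
by rewrite (le_trans (ND _ _))// lerD// NM Nc mul1r.
Qed.

(** The tail beyond K costs e/4 at each radius, and the truncated sum varies by at most M (j + 2K) r
    between the two radii, uniformly in the angle. *)
Lemma ps_boundary (b : nat -> C) (j : nat) (M : R) : (forall n, \sum_(i < n) N (b i) <= M) ->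
  forall e : R, 0 < e -> exists2 d : R, 0 < d & forall r r' s : R, 0 < r' -> r' < r -> r < d ->
   N (expC (j%:R * Complex (- r) s) * ps b (expC (2 * Complex (- r) s)) -
      expC (j%:R * Complex (- r') s) * ps b (expC (2 * Complex (- r') s))) <= e.
Proof.
move=> hM e e0; have e4 : 0 < e / 4 by lra.
have [K hK] := tail_small (fun n => N_ge0 (b n)) hM e4.
have M0 : 0 <= M by have := hM 0%N; rewrite big_ord0.
pose FK (x s : R) := expC (j%:R * Complex (- x) s) * \sum_(i < K) b i * expC (2 * Complex (- x) s) ^+ i.
have FKe (x s : R) : 0 < x -> N (expC (j%:R * Complex (- x) s) * ps b (expC (2 * Complex (- x) s)) - FK x s) <= e / 4.
  move=> x0; rewrite /FK -mulrBr NM N_expC -[leRHS]mul1r.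
  have q1 : N (expC (2 * Complex (- x) s)) <= 1 by rewrite N_expC expR_le1 Re2 /=; lra.
  apply: ler_pM; rewrite ?expR_ge0 ?N_ge0//.
    rewrite expR_le1; have -> : j%:R = (j%:R : R)%:CC :> C by rewrite rmorph_nat.
    by rewrite ReZ /= mulrN oppr_le0 mulr_ge0// ltW.
  have le i : N (b i * expC (2 * Complex (- x) s) ^+ i) <= N (b i).
    by rewrite NM NX -[leRHS]mulr1; apply: ler_pM; rewrite ?exprn_ge0 ?N_ge0// exprn_ile1// N_ge0.
  apply: csum_tail; first exact: (@summable_le _ _ (fun i => N (b i)) M).
  by move=> n; apply: le_trans (hK n); apply: ler_sum => i _; exact: le.
have FKE x s : FK x s = \sum_(i < K) b i * expC ((j + 2 * i)%N%:R * Complex (- x) s).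
  rewrite /FK mulr_sumr; apply: eq_bigr => i _; rewrite -expCMn mulrCA -expCD; congr (_ * expC _).
  by rewrite natrD natrM; ring.
pose L : R := M * (j + 2 * K)%N%:R + 1; have L0 : 0 < L by rewrite ltr_wpDl// mulr_ge0.
exists (e / (4 * L)) => [|r r' s r'0 rr' rd]; first by rewrite divr_gt0// mulr_gt0.
have r0 : 0 < r by exact: lt_trans rr'.
have FKd : N (FK r s - FK r' s) <= e / 4.
  rewrite !FKE -sumrB; apply: le_trans (N_sum _ _) _.
  apply: (@le_trans _ _ (\sum_(i < K) N (b i) * ((j + 2 * K)%N%:R * r))).
    apply: ler_sum => i _; rewrite -mulrBr NM; apply: ler_wpM2l; first exact: N_ge0.
    apply: le_trans (N_expC_diff _ _ r'0 rr') _.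
    by rewrite ler_pM2r// ler_nat leq_add2l leq_mul2l/= ltnW.
  rewrite -mulr_suml; apply: (@le_trans _ _ (M * ((j + 2 * K)%N%:R * r))).
    by rewrite ler_wpM2r ?mulr_ge0// ltW.
  apply: (@le_trans _ _ (L * r)); first by rewrite mulrA ler_pM2r// lerDl.
  have : L * r <= L * (e / (4 * L)) by rewrite ler_pM2l// ltW.
  by have -> : L * (e / (4 * L)) = e / 4 by field; rewrite gt_eqF.
have := FKe r s r0; have := FKe r' s r'0; move: FKd.
move=> h1 h2 h3; apply: le_trans (N_tri3 h3 h2 h1) _; exact: quarter3.
Qed.

(** The contradiction of [core_frob], with absolute convergence of the series of b on |x| = 1 in
    place of regularity at 0. *)
Lemma core_summable k lam g v j (M : R) : subexp g -> g 0%N = 1 -> v <> (0, 0) -> Tm k lam v = v ->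
  Pm k lam v = sc (expC ((k - lam) * piI)) v ->
  (forall z, Dom z -> Left z -> solB k lam v z = Eb k lam g z) -> lam - k = j%:R ->
  (forall n, \sum_(i < n) N (sh g i - g i) <= M) -> False.
Proof.
move=> sg g0 v0 Tv Pv hv hj hM; set c := expC _ in Pv.
have [c2 hc] := sym_eig v0 Tv Pv.
have cs : c = 1 \/ c = -1 by move/eqP: c2; rewrite sqrf_eq1 => /orP[]/eqP ->; [left|right].
have Nc : N c = 1 by case: cs => ->; rewrite ?NN N1.
have := @averaging R (fun n => sh g n - g n) j (- c).
rewrite /= g0 sub0r => H; suff /eqP : (-1 : C) = 0 by rewrite oppr_eq0 oner_eq0.
apply: H.
- by apply: subexpD; [exact: subexp_sh|have := subexpZ (-1) sg; congr subexp; apply/funext => n; rewrite mulN1r].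
- by rewrite NN.
- by move=> j0; rewrite /c -opprB hj j0 oppr0 mul0r expC0.
move=> e e0; have e2 : 0 < e / 4 by lra.
have [d d0 hd] := @ps_boundary (fun n => sh g n - g n) j M hM _ e2.
pose r := Num.min d e / 2; have m0 : 0 < Num.min d e by rewrite lt_min d0.
have [md me] : Num.min d e <= d /\ Num.min d e <= e by rewrite !ge_min !lexx orbT.
have r0 : 0 < r by rewrite /r; lra.
have rd : r < d by rewrite /r; lra.
have re : r < e by rewrite /r; lra.
exists r; first by rewrite r0.
(* The radius [r] serves for all s; only the auxiliary [r'] depends on s, and there the series is
   compared with the value of the solution itself on the imaginary axis. *)
have key s : 0 < s < pi -> N (expC (j%:R * Complex (- r) s) * ps (fun n => sh g n - g n) (expC (2 * Complex (- r) s))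
    - solB k lam v (Complex 0 s)) <= e / 2.
  move=> s0; have [_ /cder_cont cb] := @solAB R k lam v _ (Sig0_Dom (sigE 0 s0)).
  have [d1 d10 hd1] := cb _ e2; pose r' := Num.min d1 r / 2; have m0' : 0 < Num.min d1 r by rewrite lt_min d10.
  have [md1 mr] : Num.min d1 r <= d1 /\ Num.min d1 r <= r by rewrite !ge_min !lexx orbT.
  have r'0 : 0 < r' by rewrite /r'; lra.
  have r'd : r' < d1 by rewrite /r'; lra.
  have r'r : r' < r by rewrite /r'; lra.
  have := hd r r' s r'0 r'r rd.
  have -> : expC (j%:R * Complex (- r') s) * ps (fun n => sh g n - g n) (expC (2 * Complex (- r') s)) =
      solB k lam v (Complex (- r') s).
    rewrite hv ?/Eb ?hj//; first exact/Sig0_Dom/sigE.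
    by rewrite /Left /= oppr_lt0.
  have : N (solB k lam v (Complex (- r') s) - solB k lam v (Complex 0 s)) < e / 4.
    apply: hd1; have -> : Complex (- r') s - Complex 0 s = (- r')%:CC.
      by apply/eqP; rewrite eq_complex /= subr0 subrr !eqxx.
    by rewrite Nreal normrN gtr0_norm.
  move=> /ltW h1 h2; apply: le_trans (N_tri2 h2 h1) _; exact: quarter2.
move=> s s0; have s0' := pi_sub_itv s0.
have := key _ s0; have := key _ s0'.
have -> : Complex 0 (pi - s) = piI - Complex 0 s.
  by rewrite piI_sub; apply/eqP; rewrite eq_complex /= oppr0 !eqxx.
rewrite (hc _ (sigE 0 s0)).2 => h1 h2; apply: le_trans (N_tri_sgn c2 Nc h2 h1) _; exact: half2.
Qed.

(* Eventual monotonicity makes sum |g_{n-1} - g_n| telescope; the Frobenius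
   series of b then converges absolutely up to the circle |x| = 1. *)
Lemma telescope_bound (g : nat -> C) n0 :
  (forall n, (n0 <= n)%N -> exists2 x : R, 0 <= x <= 1 & g n.+1 = x%:CC * g n) ->
  exists M : R, forall n, \sum_(i < n) N (sh g i - g i) <= M.
Proof.
move=> h; exists (\sum_(i < n0.+1) N (sh g i - g i) + N (g n0)) => n.
have H m : \sum_(i < n0.+1 + m) N (sh g i - g i) + N (g (n0 + m)%N) <=
    \sum_(i < n0.+1) N (sh g i - g i) + N (g n0).
  elim: m => [|m IH]; first by rewrite !addn0.
  apply: le_trans IH; rewrite !addnS big_ord_recr/= -addrA lerD2l.
  have [|x /andP[x0 x1] ->] := h (n0 + m)%N; first exact: leq_addr.
  have -> : g (n0 + m)%N - x%:CC * g (n0 + m)%N = (1 - x)%:CC * g (n0 + m)%N by rewrite rmorphB rmorph1; ring.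
  by rewrite !NM !Nreal !ger0_norm ?subr_ge0// -mulrDl subrK mul1r.
apply: le_trans (le_trans _ (H n)); rewrite ?lexx//.
rewrite -(big_mkord xpredT (fun i => N (sh g i - g i))) -(big_mkord xpredT (fun i => N (sh g i - g i))).
rewrite [leRHS](_ : _ = \sum_(0 <= i < n) N (sh g i - g i) + (\sum_(n <= i < n0.+1 + n) N (sh g i - g i) + N (g (n0 + n)%N))).
  by rewrite lerDl addr_ge0 ?N_ge0// sumr_ge0// => i _; exact: N_ge0.
by rewrite addrA -big_cat_nat ?leq_addl.
Qed.

End Core.

(** * Eigenvectors of T, and terminating series *)

Section MonodromyMatrix.
Variable R : realType.
Local Notation C := (R[i]).
Local Notation N := (@ComplexField.Normc.normc R).
Local Notation "x %:CC" := (real_complex R x) (at level 2, format "x %:CC").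
Local Notation Re := complex.Re.
Local Notation piI := (piI R).
Implicit Types (z p : C) (k lam : C) (u v w : C * C).

Lemma ker2 (a b c d : C) : a * d - b * c = 0 ->
  exists v, [/\ v <> (0, 0), a * v.1 + b * v.2 = 0 & c * v.1 + d * v.2 = 0].
Proof.
move=> D; have [h|h] := pselect ((b, - a) = (0, 0) :> C * C); last first.
  exists (b, - a); split => //=; first by ring.
  by transitivity (- (a * d - b * c)); [ring|rewrite D oppr0].
have [h'|h'] := pselect ((d, - c) = (0, 0) :> C * C); last first.
  exists (d, - c); split => //=; last by ring.
  by transitivity (a * d - b * c); [ring|].
move: h h' => [-> /eqP a0] [-> /eqP c0]; move: a0 c0; rewrite !oppr_eq0 => /eqP -> /eqP ->.
by exists (1, 0); split => /=; [move=> [/eqP]; rewrite oner_eq0|ring|ring].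
Qed.

(** That 1 is an eigenvalue of T follows in general from [difP] and [detPE]; the second alternative
    is needed when the hypergeometric solution is undefined, and then regularity is not claimed. *)
Lemma T_fixed k lam : exists v, [/\ v <> (0, 0), Tm k lam v = v &
  (forall n, n%:R + (3 / 2 - k) != 0) -> reg0 k lam v].
Proof.
have [kn|kn] := pselect (forall n, n%:R + (3 / 2 - k) != 0 :> C).
  have [v [v0 Tv [r [a [b [r0 cab a0 b0 h]]]]]] := sym_solution lam kn.
  exists v; split => // _; exists r, a, b; split => // k1.
  by rewrite a0 mulf_neq0 ?pnatr_eq0// subr_eq0.
have [|v [v0 h1 h2]] := @ker2 (P11 k lam - 1) (P12 k lam) (P21 k lam) (P22 k lam + 1).
  have := difP k lam; rewrite -(detPE k lam) /detP => h.
  by apply/eqP; rewrite -subr_eq0; apply/eqP; transitivity (P11 k lam - P22 k lam - (1 - (P11 k lam * P22 k lam - P12 k lam * P21 k lam))); [ring|rewrite -h subrr].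
exists v; split => //; rewrite /Tm PmE /=.
have -> : P11 k lam * v.1 + P12 k lam * v.2 = v.1.
  by transitivity ((P11 k lam - 1) * v.1 + P12 k lam * v.2 + v.1); [ring|rewrite h1 add0r].
have -> : - (P21 k lam * v.1 + P22 k lam * v.2) = v.2.
  by transitivity (v.2 - (P21 k lam * v.1 + (P22 k lam + 1) * v.2)); [ring|rewrite h2 subr0].
by rewrite -surjective_pairing.
Qed.

Lemma T_eig k lam v t : v <> (0, 0) -> Tm k lam v = sc t v ->
  t = 1 \/ t = - expC (2 * piI * k).
Proof.
move=> v0; rewrite /Tm PmE /sc => hv; have h1 := congr1 fst hv; have h2 := congr1 snd hv.
rewrite /= in h1 h2.
have := @det2_eq0 R (P11 k lam - t) (P12 k lam) (P21 k lam) (P22 k lam + t) v v0.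
have -> : (P11 k lam - t) * v.1 + P12 k lam * v.2 = 0 by rewrite mulrBl -h1; ring.
have -> : P21 k lam * v.1 + (P22 k lam + t) * v.2 = 0 by rewrite mulrDl -h2; ring.
move=> /(_ erefl erefl) h; have dP := difP k lam; have dt := detPE k lam.
have : (t - 1) * (t + expC (2 * piI * k)) = 0.
  transitivity (- ((P11 k lam - t) * (P22 k lam + t) - P12 k lam * P21 k lam) +
    t * ((P11 k lam - P22 k lam) - (1 - expC (2 * piI * k))) + (detP k lam - expC (2 * piI * k))).
    by rewrite /detP; ring.
  by rewrite h dP dt !subrr oppr0 mulr0 !addr0.
by move/eqP; rewrite mulf_eq0 subr_eq0 addr_eq0 => /orP[]/eqP; [left|right].
Qed.

Lemma is_int_real (x : C) : is_int x -> x = (Re x)%:CC.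
Proof. by move=> [m ->]; have -> : m%:~R = (m%:~R)%:CC :> C by rewrite rmorph_int. Qed.
Lemma is_halfint_real (x : C) : is_halfint x -> x = (Re x)%:CC.
Proof.
move=> [m ->]; have -> : 2^-1 + m%:~R = (2^-1 + m%:~R)%:CC :> C.
  by rewrite rmorphD fmorphV rmorph_nat rmorph_int.
by [].
Qed.

Lemma max_le (x l : R) : 0 <= l ->
  Num.max (x%:CC) (1 - x%:CC) <= `|l%:CC| = (x <= l) && (1 - x <= l) :> bool.
Proof.
move=> l0; have -> : `|l%:CC| = l%:CC :> C by rewrite ger0_norm// lecR.
have -> : 1 - x%:CC = (1 - x)%:CC :> C by rewrite rmorphB rmorph1.
rewrite /Order.max ltcR; case: ltP => h; rewrite lecR; apply/idP/andP; lra.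
Qed.

Lemma halfint_exp (x : C) : is_halfint x -> expC (2 * piI * x) = -1.
Proof.
move=> [m ->]; rewrite mulrDr expCD.
have -> : 2 * piI / 2 = piI by field.
by rewrite expC_piI -mulrA (expCMn _ 2) expC_piIint mulr1.
Qed.

Lemma int_exp (x : C) : is_int x -> expC (2 * piI * x) = 1.
Proof. by move=> [m ->]; rewrite -mulrA (expCMn _ 2) expC_piIint. Qed.

Lemma halfint_not_int (x : C) : is_halfint x -> ~ is_int x.
Proof.
move=> hx /int_exp; rewrite (halfint_exp hx) => /esym/eqP.
by rewrite -subr_eq0 opprK (_ : 1 + 1 = 2%:R)// pnatr_eq0.
Qed.

Lemma halfint_nat_neq0 (x : C) n : is_halfint x -> n%:R + x != 0.
Proof.
move=> /halfint_exp hx; apply/eqP => h.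
have xn : is_int x by rewrite (_ : x = - n%:R); [exact/is_intN/is_int_nat|apply: subr0_eq; rewrite opprK addrC].
have : (1 : C) + 1 = 0 by rewrite -{2}(int_exp xn) hx subrr.
by move/eqP; rewrite (_ : 1 + 1 = 2%:R)// pnatr_eq0.
Qed.

Lemma is_halfintN (x : C) : is_halfint x -> is_halfint (- x).
Proof.
move=> [m ->]; exists (- 1 - m); rewrite intrB rmorphN rmorph1; by field.
Qed.

Lemma hyp_vanish (al be ga : C) J : J%:R + be = 0 -> forall n, (J < n)%N -> hyp al be ga n = 0.
Proof.
move=> h; elim=> // n IH; rewrite ltnS leq_eqVlt => /orP[/eqP <-|/IH /= ->].
  by rewrite /= h !(mulr0, mul0r).
by rewrite !(mulr0, mul0r).
Qed.

(** The second Gauss parameter 1 - k + lp equals - J, so the series stops. The mirror image has the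
    inverse eigenvalue, which is the same one because k - lp is an integer. *)
Lemma finite_axis k lam lp J : (forall n, n.+1%:R + lp != 0) -> lp ^+ 2 = lam ^+ 2 ->
  k - lp = J.+1%:R -> exists v, [/\ v <> (0, 0), Pm k lam v = sc (expC ((k - lp) * piI)) v &
    Pm k lam (v.1, - v.2) = sc (expC ((k - lp) * piI)) (v.1, - v.2)].
Proof.
move=> hn lp2 hJ; pose g := hyp (1 - k) (1 - k + lp) (1 + lp).
have hn' n : n%:R + (1 + lp) != 0 by rewrite addrA natr1.
have be0 : J%:R + (1 - k + lp) = 0.
  by transitivity (J.+1%:R - (k - lp)); [rewrite -natr1; ring|rewrite hJ subrr].
have [|v [h1 h2 h3]] := @frobenius_finite R k lam lp g lp2 _ J.+1 (hyp_vanish _ _ be0) erefl isT.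
  move=> n; have := hypS (1 - k) (1 - k + lp) (hn' n).
  by rewrite (addrA _ 1 lp) natr1 (addrA _ (1 - k) lp).
exists v; split => //; [apply: scaled_inv h1|apply: scaled_inv h2]; rewrite -expCD.
  by rewrite -mulrDl addrA subrK subrr mul0r expC0.
have -> : (k - lp) * piI + - ((lp - k) * piI) = 2 * piI * (k - lp) by ring.
by rewrite int_exp// hJ; exact: is_int_nat.
Qed.

(** If v is proportional to its mirror image, one of its coordinates vanishes; the eigenvector is a
    coordinate axis and P is triangular. *)
Lemma axis k lam v c : v <> (0, 0) -> Pm k lam v = sc c v ->
  (exists t, (v.1, - v.2) = sc t v) ->
  (P21 k lam = 0 /\ P11 k lam = c) \/ (P12 k lam = 0 /\ P22 k lam = c).
Proof.
move=> v0; rewrite PmE /sc => hv [t ht].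
have h1 := congr1 fst hv; have h2 := congr1 snd hv; have t1 := congr1 fst ht; have t2 := congr1 snd ht.
rewrite /= in h1 h2 t1 t2.
have [x0|x0] := eqVneq v.1 0.
  have y0 : v.2 != 0 by case: (pair_neq0 v0) => //; rewrite x0 eqxx.
  rewrite x0 !mulr0 !add0r in h1 h2; right; split; last exact: (mulIf y0).
  by apply: (mulIf y0); rewrite mul0r.
have te : t = 1 by apply: (mulIf x0); rewrite -t1 mul1r.
have y0 : v.2 = 0.
  rewrite te mul1r in t2; have /eqP : v.2 + v.2 = 0 by rewrite -{1}t2 addNr.
  by rewrite -mulr2n mulrn_eq0 => /eqP.
rewrite y0 !mulr0 !addr0 in h1 h2; left; split; last exact: (mulIf x0).
by apply: (mulIf x0); rewrite mul0r.
Qed.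

End MonodromyMatrix.

(** * Cyclic vectors in the generic and in the terminating situation *)

Section Classification.
Variable R : realType.
Local Notation C := (R[i]).
Local Notation N := (@ComplexField.Normc.normc R).
Local Notation "x %:CC" := (real_complex R x) (at level 2, format "x %:CC").
Local Notation Re := complex.Re.
Local Notation piI := (piI R).
Implicit Types (z p : C) (k lam : C) (u v w : C * C).

Lemma Re_nat n : Re (n%:R : C) = n%:R.
Proof. by rewrite -(rmorph_nat (real_complex R)). Qed.
Lemma Re_int (m : int) : Re (m%:~R : C) = m%:~R.
Proof. by rewrite -(rmorph_int (real_complex R)). Qed.

Lemma int_pos_posint (x : C) : is_int x -> 0 < Re x -> is_posint x.
Proof.
move=> xi x0; apply: contrapT => /(not_posint xi) [n hn].
by move: x0; rewrite hn ReN Re_nat oppr_gt0 ltNge ler0n.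
Qed.

(** If the vector fixed by T is regular at 0, [core] excludes that it is an eigenvector of P. In the
    remaining case k = n + 3/2, and a common eigenvector makes k - lam or k + lam an integer; since
    2k is an integer, k + lam is one in both cases, with positive real part, which the hypothesis
    forbids. *)
Lemma cyclic_generic k lam : 0 <= Re lam -> ~ is_posint (k + lam) -> ~ is_posint (k - lam) ->
  exists u, Tm k lam u = u /\ indep u (Pm k lam u).
Proof.
move=> l0 h1 h2; have [u [u0 Tu ru]] := T_fixed k lam.
exists u; split => //; have [//|[c Pu]] := indep_or_scaled (Pm k lam u) u0; exfalso.
have [kn|] := pselect (forall n, n%:R + (3 / 2 - k) != 0 :> C).
  by have [] := core l0 u0 Tu Pu (ru kn).
move=> /existsNP [n /negP/negPn/eqP hk].
have kE : k = n%:R + 3 / 2 by apply/esym/subr0_eq; rewrite -hk; ring.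
have [c2 _] := sym_eig u0 Tu Pu.
have rk : 0 < Re k.
  rewrite kE ReD Re_nat; have -> : (3 / 2 : C) = (3 / 2)%:CC by rewrite rmorphM fmorphV !rmorph_nat.
  by rewrite /=; have : 0 <= n%:R :> R by []; lra.
apply: h1; apply: int_pos_posint; last by rewrite ReD; lra.
case: (eig_values l0 u0 Pu) => cE; rewrite cE in c2; have ki := sq_int c2; last by [].
have -> : k + lam = (2 * n + 3)%N%:R - (k - lam) by rewrite kE natrD natrM; field.
by apply: is_intB => //; exact: is_int_nat.
Qed.

(** Both exponents give terminating series, so both coordinate axes are eigenlines, with opposite
    eigenvalues. As q = -1, the matrix P has trace 0 and P_11 - P_22 = 2, hence P = diag(1, -1) and
    T = 1; any vector with two nonzero coordinates will do. *)
Lemma cyclic_laurent k lam i j : is_halfint lam -> is_halfint k -> 0 <= Re lam ->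
  k - lam = i.+1%:R -> k + lam = j.+1%:R -> exists u, Tm k lam u = u /\ indep u (Pm k lam u).
Proof.
move=> lh kh l0 hi hj; have lN := is_halfintN lh; have l2 : (- lam) ^+ 2 = lam ^+ 2 by rewrite sqrrN.
have hj' : k - - lam = j.+1%:R by rewrite opprK.
have [v [v0 Pv Pv']] := finite_axis (fun n => halfint_nat_neq0 n.+1 lh) (erefl _) hi.
have [w [w0 Pw Pw']] := finite_axis (fun n => halfint_nat_neq0 n.+1 lN) l2 hj'.
have av := axis v0 Pv (frob_line (halfint_not_int lh) (erefl _) v0 Pv Pv').
have aw := axis w0 Pw (frob_line (halfint_not_int lN) l2 w0 Pw Pw').
have cN : expC ((k - - lam) * piI) = - expC ((k - lam) * piI).
  have -> : (k - - lam) * piI = (k - lam) * piI + 2 * piI * lam by ring.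
  by rewrite expCD halfint_exp// mulrN1.
have c0 := expC_neq0 ((k - lam) * piI).
have cc : expC ((k - lam) * piI) <> - expC ((k - lam) * piI).
  by move/eqP; rewrite -subr_eq0 opprK -mulr2n mulrn_eq0 (negbTE c0).
have := difP k lam; rewrite (halfint_exp kh) opprK => dP.
have tr : P11 k lam + P22 k lam = 0.
  by have := cN; rewrite (trP k l0) opprK => ->; rewrite subrr.
have p11 : P11 k lam = 1.
  apply: (mulfI (x := 2)); first by rewrite pnatr_eq0.
  by transitivity ((P11 k lam + P22 k lam) + (P11 k lam - P22 k lam)); [ring|rewrite tr dP; ring].
have p22 : P22 k lam = -1.
  by transitivity ((P11 k lam + P22 k lam) - P11 k lam); [ring|rewrite tr p11 sub0r].
have [p12 p21] : P12 k lam = 0 /\ P21 k lam = 0.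
  rewrite cN in aw; case: av => -[av1 av2]; case: aw => -[aw1 aw2]; split=> //.
  - by case: cc; rewrite -{1}av2 aw2.
  - by case: cc; rewrite -{1}av2 aw2.
exists (1, 1); rewrite /Tm /indep PmE p11 p12 p21 p22 /=; split; first by congr (_, _); ring.
have -> : 1 * (0 * 1 + -1 * 1) - 1 * (1 * 1 + 0 * 1) = - 2%:R :> C by ring.
by rewrite oppr_eq0 pnatr_eq0.
Qed.

(* The exponents lam and - lam differ by an integer: the recursion for - lam
   breaks down at n = lam, but its solution has already terminated there. *)
Lemma frob_truncated k lam J (L : nat) : lam = L%:R -> (0 < J)%N -> (J <= L)%N ->
  (J.-1%:R + (1 - k)) * (J.-1%:R + (1 - k) - lam) = 0 ->
  exists v g, [/\ v <> (0, 0), Pm k lam v = sc (expC ((k + lam) * piI)) v, subexp g, g 0%N = 1 &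
   forall z, Dom z -> Left z -> solB k lam v z = Eb k (- lam) g z].
Proof.
move=> lE J0 JL Jz; pose h := hyp (1 - k) (1 - k - lam) (1 - lam).
pose g n := if (n < J)%N then h n else 0.
have hr n : n.+1%:R * (n.+1%:R + - lam) * g n.+1 = (n%:R + (1 - k)) * (n%:R + (1 - k) + - lam) * g n.
  rewrite /g; have [nJ|nJ] := ltnP n.+1 J.
    rewrite (ltnW nJ); have n1 : n%:R + (1 - lam) != 0.
      rewrite addrA natr1 lE subr_eq0 eqr_nat; lia.
    by have := hypS (1 - k) (1 - k - lam) n1; rewrite (addrA _ 1) natr1 (addrA _ (1 - k)).
  rewrite mulr0; case: ltnP => nJ'; last by rewrite mulr0.
  have -> : n = J.-1 by lia.
  by rewrite Jz mul0r.
have g0 : g 0%N = 1 by rewrite /g J0.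
have sg : subexp g.
  move=> r r01; exists (\sum_(i < J) N (h i)) => n; rewrite /g; case: ltnP => nJ; last first.
    by rewrite N0 mul0r sumr_ge0// => i _; exact: N_ge0.
  rewrite (bigD1 (Ordinal nJ))//= -[leLHS]addr0 lerD//; last by apply: sumr_ge0 => i _; exact: N_ge0.
  case/andP: r01 => r0 r1; rewrite -[leRHS]mulr1 ler_wpM2l ?N_ge0// exprn_ile1 ?ltW//.
have l2 : (- lam) ^+ 2 = lam ^+ 2 by rewrite sqrrN.
have [v [h1 h2 h3]] := frobenius_eigen l2 hr sg g0.
exists v, g; split => //; apply: scaled_inv h2; rewrite -expCD.
by have -> : (k + lam) * piI + (- lam - k) * piI = 0 by [ring]; rewrite expC0.
Qed.

(** A proportionality, divided by the lower leading power of x, would at x = 0 read -1 = 0, since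
    the other solution starts L > 0 powers of x^2 later. *)
Lemma frob_indep k L v w g h : (0 < L)%N -> v <> (0, 0) -> w <> (0, 0) -> subexp g -> subexp h ->
  g 0%N = 1 -> h 0%N = 1 ->
  (forall z, Dom z -> Left z -> solB k L%:R v z = Eb k L%:R g z) ->
  (forall z, Dom z -> Left z -> solB k L%:R w z = Eb k (- L%:R) h z) -> indep v w.
Proof.
move=> L0 v0 w0 sbg sbh g0 h0 hv hw; have [//|[t wE]] := indep_or_scaled w v0; exfalso.
have sb (a : nat -> C) : subexp a -> subexp (fun n => sh a n - a n).
  by move=> sa; apply: subexpD; [exact: subexp_sh|have := subexpZ (-1) sa; congr subexp; apply/funext => n; rewrite mulN1r].
pose F x := ps (fun n => sh h n - h n) x - t * (x ^+ L * ps (fun n => sh g n - g n) x).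
have z1 : N (0 : C) < 1 by rewrite N0.
have cF : cont F 0.
  have c1 := cder_cont (cder_ps (sb _ sbh) z1); have c2 := cder_cont (cder_ps (sb _ sbg) z1).
  apply: contB c1 _; apply: contM; first exact: cont_cst.
  by apply: contM c2; exact: cder_cont (cder_exprn L (cder_id 0)).
have F0 : F 0 = -1.
  by rewrite /F (ps0 (sb _ sbh)) (ps0 (sb _ sbg)) /= h0 g0 expr0n gtn_eqF//=; ring.
have e1 : 0 < 1 / 2 :> R by lra.
have [d d0 hd] := cF _ e1.
pose m := Num.min d 1 / 2; have m0' : 0 < Num.min d 1 by rewrite lt_min d0 ltr01.
have [md m1] : Num.min d 1 <= d /\ Num.min d 1 <= 1 by rewrite !ge_min !lexx orbT.
have m0 : 0 < m by rewrite /m; lra.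
have md' : m < d by rewrite /m; lra.
have m1' : m < 1 by rewrite /m; lra.
pose z : C := (ln m / 2)%:CC.
have zL : Left z by rewrite /Left /=; have := ln_lt0 (x := m); rewrite m0 m1' => /(_ isT); lra.
have zD : Dom z.
  by split; [rewrite /= normr0 pi_gt0|right].
have ez : expC (2 * z) = m%:CC.
  have -> : 2 * z = (ln m)%:CC by rewrite /z two_CC -rmorphM; congr (_%:CC); field.
  by rewrite expC_real lnK.
have : F m%:CC = 0.
  have := hw z zD zL; have [|_ ->] := @sol_linE R k L%:R t 0 v v w z _ zD.
    by rewrite wE /sc !mul0r !addr0.
  rewrite mul0r addr0 hv// /Eb ez => hh.
  have e0 := expC_neq0 ((- L%:R - k) * z); apply: (mulfI e0); rewrite mulr0 /F mulrBr -hh.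
  have -> : expC ((L%:R - k) * z) = expC ((- L%:R - k) * z) * m%:CC ^+ L.
    by rewrite -ez -expCMn -expCD; congr expC; ring.
  ring.
have := hd m%:CC; rewrite subr0 Nreal gtr0_norm// => /(_ md') h1 h2.
by move: h1; rewrite h2 F0 sub0r opprK N1; lra.
Qed.

End Classification.

(** * The four cases of the theorem at the level of matrices *)

Section Cases.
Variable R : realType.
Local Notation C := (R[i]).
Local Notation N := (@ComplexField.Normc.normc R).
Local Notation "x %:CC" := (real_complex R x) (at level 2, format "x %:CC").
Local Notation Re := complex.Re.
Local Notation piI := (piI R).
Implicit Types (z p : C) (k lam : C) (u v w : C * C).

Lemma max_leP k lam : k = (Re k)%:CC -> lam = (Re lam)%:CC -> 0 <= Re lam ->
  Num.max k (1 - k) <= `|lam| = (Re k <= Re lam) && (1 - Re k <= Re lam) :> bool.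
Proof. by move=> kE lE l0; rewrite {1 2}kE {1}lE max_le. Qed.

Lemma posint_Re (x : C) : is_posint x -> 1 <= Re x.
Proof. by move=> [n ->]; rewrite Re_nat ler1n. Qed.
Lemma posint_int (x : C) : is_posint x -> is_int x.
Proof. by move=> [n ->]; exact: is_int_nat. Qed.

Lemma halfint_sub_int (x y : C) : is_halfint x -> is_int y -> is_halfint (x + y).
Proof. by move=> [m ->] [n ->]; exists (m + n); rewrite intrD addrA. Qed.
Lemma halfintB (x y : C) : is_halfint x -> is_halfint y -> is_int (x - y).
Proof. by move=> [m ->] [n ->]; exists (m - n); rewrite intrB; ring. Qed.
(** If k + lam or k - lam is a positive integer, the failure of case 3 makes lam, and then k,
    half-integral; the failure of case 2 gives k > lam, so that both k + lam and k - lam are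
    positive integers and [cyclic_laurent] applies. *)
Lemma cyclic_T1 k lam : 0 <= Re lam -> ~ case1 k lam -> ~ case2 k lam -> ~ case3 k lam ->
  exists u, Tm k lam u = u /\ indep u (Pm k lam u).
Proof.
move=> l0 c1 c2 c3.
have [pp|/not_orP[]] := pselect (is_posint (k + lam) \/ is_posint (k - lam)); last exact: cyclic_generic.
have lh : is_halfint lam by apply: contrapT => h; exact: c3.
have kh : is_halfint k.
  case: pp => /posint_int hi.
    by rewrite -(addrK lam k) addrC; apply: halfint_sub_int => //; exact: is_halfintN.
  by rewrite -(subrK lam k) addrC; exact: halfint_sub_int.
have kE := is_halfint_real kh; have lE := is_halfint_real lh.
have kl : Re lam < Re k.
  rewrite ltNge; apply/negP => kl; apply: c2; split => //; rewrite max_leP// kl /=.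
  by case: pp => /posint_Re; rewrite ?ReD ?ReB; lra.
have [i hi] : is_posint (k - lam).
  by apply: int_pos_posint; [exact: halfintB|rewrite ReB; lra].
have [j hj] : is_posint (k + lam).
  apply: int_pos_posint; last by rewrite ReD; lra.
  by rewrite -[lam]opprK; apply: halfintB => //; exact: is_halfintN.
exact: cyclic_laurent lh kh l0 hi hj.
Qed.

(** Both exponents lam and - lam have Frobenius solutions without logarithms. They are independent,
    and their eigenvalues coincide because lam is an integer, so P is scalar. *)
Lemma scalar_case1 k lam : 0 <= Re lam -> case1 k lam ->
  expC ((k - lam) * piI) ^+ 2 = 1 /\ forall v, Pm k lam v = sc (expC ((k - lam) * piI)) v.
Proof.
move=> l0 [li ki]; rewrite max_leP//; [|exact: is_int_real..] => /andP[kl kl1].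
have kli : is_int (k - lam) by exact: is_intB.
split; first by rewrite -(expCMn _ 2); apply: etrans (int_exp kli); congr expC; ring.
have [L hL] : exists n : nat, - lam = - n%:R.
  apply: not_posint; first exact: is_intN.
  by move=> /posint_Re; rewrite ReN; lra.
have {}hL : lam = L%:R by apply: oppr_inj.
(* J = k for k >= 1 and J = lam + k for k <= 0 make the numerator of the recursion vanish; |lam| >=
   max(k, 1 - k) is what places J between 1 and lam. *)
have [J [J0 JL Jz]] : exists J, [/\ (0 < J)%N, (J <= L)%N &
    (J.-1%:R + (1 - k)) * (J.-1%:R + (1 - k) - lam) = 0].
  case: ki => m kE; case: m kE => [[|p]|p] kE.
  - exists L; rewrite leqnn kE hL.
    have : 1 - 0 <= L%:R :> R by move: kl1; rewrite kE hL Re_nat /=.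
    rewrite subr0 ler1n => L1; split => //.
    have E : L.-1%:R + 1 = L%:R :> C by rewrite natr1 prednK.
    by rewrite -[0%:~R]/(0 : C) subr0 E subrr mulr0.
  - exists p.+1; split => //.
      by move: kl; rewrite kE hL Re_nat Re_int -[_%:~R]/(p.+1%:R) ler_nat.
    have E : p%:R + (1 - p.+1%:R) = 0 :> C by rewrite -(natr1 p); ring.
    by rewrite /= kE -[p.+1%:~R]/(p.+1%:R) E mul0r.
  - have h : (p.+2 <= L)%N.
      move: kl1; rewrite kE hL Re_nat Re_int NegzE mulrNz opprK -[p.+1%:~R]/(p.+1%:R).
      by rewrite addrC natr1 ler_nat.
    exists (L - p.+1)%N; split; [lia|lia|].
    have -> : (L - p.+1).-1%:R = L%:R - p.+2%:R :> C by rewrite -natrB//; congr (_%:R); lia.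
    have E : L%:R - p.+2%:R + (1 - - p.+1%:R) - L%:R = 0 :> C by rewrite -(natr1 p.+1); ring.
    by rewrite kE hL NegzE mulrNz -[p.+1%:~R]/(p.+1%:R) E mulr0.
have L0 : (0 < L)%N by exact: leq_trans JL.
have [w [h [w0 Pw sh' h0 hw]]] := frob_truncated hL J0 JL Jz.
have [v [g [v0 Pv sg g0 hv]]] := frob_vec k (fun n => natr_Re n l0) (erefl (lam ^+ 2)).
have iw : indep v w by rewrite hL in hv hw; exact: frob_indep hv hw.
have cE : expC ((k + lam) * piI) = expC ((k - lam) * piI).
  have -> : (k + lam) * piI = (k - lam) * piI + 2 * piI * lam by ring.
  by rewrite expCD int_exp// mulr1.
rewrite cE in Pw => x; have [e11 e12 e21 e22] := eig2_scalar iw Pv Pw.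
by rewrite PmE e11 e12 e21 e22 !mul0r addr0 add0r.
Qed.

Lemma hyp_ratio_real n (a b : R) :
  ((n%:R + (1 - a)) * (n%:R + (1 - a + b)) / (n.+1%:R * (n%:R + (1 + b))))%:CC =
  (n%:R + (1 - a%:CC)) * (n%:R + (1 - a%:CC + b%:CC)) / (n.+1%:R * (n%:R + (1 + b%:CC))) :> C.
Proof. by rewrite !(rmorphM, rmorphD, rmorphN, fmorphV, rmorph_nat, rmorph1). Qed.

(** T has eigenvalues 1 and - q, and here q = -1, so an eigenvector of T is fixed by T. For k >= 1/2
    the ratios of consecutive coefficients eventually lie in [0, 1]; this gives the summability that
    [core_summable] needs. *)
Lemma case2_indep k lam u : 0 <= Re lam -> case2 k lam -> 2^-1 <= Re k -> u <> (0, 0) ->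
  (exists g, [/\ subexp g, g 0%N = 1, Pm k lam u = sc (expC ((k - lam) * piI)) u,
     forall z, Dom z -> Left z -> solB k lam u z = Eb k lam g z &
     g = hyp (1 - k) (1 - k + lam) (1 + lam)]) -> indep u (Tm k lam u).
Proof.
move=> l0 [lh kh]; have kE := is_halfint_real kh; have lE := is_halfint_real lh.
rewrite max_leP// => /andP[kl kl1] k2 u0 [g [sg g0 Pu hu gE]].
have [//|[t Tu]] := indep_or_scaled (Tm k lam u) u0; exfalso.
have t1 : t = 1 by case: (T_eig u0 Tu) => //; rewrite (halfint_exp kh) opprK.
have {}Tu : Tm k lam u = u by rewrite Tu t1 /sc !mul1r -surjective_pairing.
have [j hj] : exists j : nat, k - lam = - j%:R.
  by apply: not_posint; [exact: halfintB|move=> /posint_Re; rewrite ReB; lra].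
have [|M hM] := @telescope_bound R g (Num.truncn (Re k)).+1; last first.
  apply: (core_summable sg g0 u0 Tu Pu hu _ hM (j := j)).
  by rewrite -opprB hj opprK.
move=> n nk; have kn : Re k <= n%:R.
  apply: ltW; apply: lt_le_trans (truncnS_gt _) _; by rewrite ler_nat.
have n1 : 0 < n%:R + 1 + Re lam :> R by lra.
have n2 : 0 < n.+1%:R :> R by [].
exists ((n%:R + (1 - Re k)) * (n%:R + (1 - Re k + Re lam)) / (n.+1%:R * (n%:R + (1 + Re lam)))).
  have q0 : 0 < n.+1%:R * (n%:R + (1 + Re lam)) :> R by rewrite mulr_gt0// addrA.
  rewrite divr_ge0 ?(ltW q0)//=; last by rewrite mulr_ge0//; lra.
  rewrite ler_pdivrMr// mul1r; apply: ler_pM; rewrite -?natr1; lra.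
by rewrite gE /= mulrC hyp_ratio_real -kE -lE.
Qed.

(** For k < 1/2 one passes to 1 - k, which still satisfies case 2: the factor - q of [gauge] is 1
    and P does not change. *)
Lemma cyclic_case2 k lam : 0 <= Re lam -> case2 k lam ->
  exists u, Pm k lam u = sc (expC ((k - lam) * piI)) u /\ indep u (Tm k lam u).
Proof.
move=> l0 c2; have [lh kh hm] := c2; have kE := is_halfint_real kh; have lE := is_halfint_real lh.
have key k' : case2 k' lam -> 2^-1 <= Re k' ->
    exists u, Pm k' lam u = sc (expC ((k' - lam) * piI)) u /\ indep u (Tm k' lam u).
  move=> c2' k2; pose g := hyp (1 - k') (1 - k' + lam) (1 + lam).
  have hn' n : n%:R + (1 + lam) != 0 by rewrite addrA natr1 natr_Re.
  have sg : subexp g by exact: subexp_hyp.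
  have [|u [h1 h2 u0]] := @frobenius_eigen R k' lam lam g (erefl _) _ sg erefl.
    move=> n; have := hypS (1 - k') (1 - k' + lam) (hn' n).
    by rewrite (addrA _ 1 lam) natr1 (addrA _ (1 - k') lam).
  have Pu : Pm k' lam u = sc (expC ((k' - lam) * piI)) u.
    by apply: scaled_inv h2; rewrite -expCD -mulrDl addrA subrK subrr mul0r expC0.
  by exists u; split => //; apply: (case2_indep l0 c2' k2 u0); exists g.
have [k2|k2] := lerP 2^-1 (Re k); first exact: key.
have kh' : is_halfint (1 - k).
  by rewrite addrC; apply: halfint_sub_int; [exact: is_halfintN|by exists 1].
have Rk' : Re (1 - k) = 1 - Re k by rewrite ReB.
have [||u [Pu Tu]] := key (1 - k).
- split => //; move: hm; rewrite !max_leP//; last exact: is_halfint_real.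
  have E : 1 - (1 - Re k) = Re k by ring.
  by rewrite Rk' E => /andP[-> ->].
- by rewrite Rk'; move: k2; lra.
have PE v : Pm k lam v = Pm (1 - k) lam v.
  by rewrite gauge (halfint_exp kh) opprK !mul1r -surjective_pairing.
exists u; split; last by rewrite /Tm PE.
rewrite PE Pu; congr sc.
have -> : (1 - k - lam) * piI = (k - lam) * piI + (piI - 2 * piI * k) by ring.
by rewrite expCD expCB expC_piI (halfint_exp kh) divff ?mulr1// oppr_eq0 oner_eq0.
Qed.

(** By [gauge], the vector fixed by T for the parameter 1 - k has T-eigenvalue - q for k. If it were
    a common eigenvector, [core] for 1 - k would give a second positive integer, and both together
    lead into an excluded case. *)
Lemma cyclic_case3 k lam : 0 <= Re lam -> case3 k lam ->
  exists u, Tm k lam u = sc (- expC (2 * piI * k)) u /\ indep u (Pm k lam u).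
Proof.
move=> l0 [pp lh c1]; have [u [u0 Tu ru]] := T_fixed (1 - k) lam.
have q0 : - expC (2 * piI * k) != 0 by rewrite oppr_eq0 expC_neq0.
have PE v : Pm k lam v = sc (- expC (2 * piI * k)) (Pm (1 - k) lam v) by rewrite gauge.
exists u; split.
  by rewrite -{2}Tu /Tm PE /sc /= mulrN.
have [//|[c Pu]] := indep_or_scaled (Pm k lam u) u0; exfalso.
(* This ensures that the regular solution exists for 1 - k. *)
have kh : ~ is_halfint k.
  move=> kh; apply: lh; case: pp => /posint_int hi.
    by rewrite (_ : lam = - k + (k + lam)); [apply: halfint_sub_int => //; exact: is_halfintN|ring].
  by rewrite (_ : lam = k + - (k - lam)); [apply: halfint_sub_int => //; exact: is_intN|ring].
have kn n : n%:R + (3 / 2 - (1 - k)) != 0.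
  apply/eqP => h; apply: kh; exists (- n.+1%:Z).
  rewrite rmorphN /= -[n.+1%:~R]/(n.+1%:R) -natr1; apply: subr0_eq; rewrite -h; by field.
have Pu' : Pm (1 - k) lam u = sc (c / - expC (2 * piI * k)) u.
  move: Pu; rewrite PE /sc; case: (Pm (1 - k) lam u) => x y [h1 h2].
  by congr (_, _); apply: (mulfI q0); rewrite ?h1 ?h2 mulrA [_ * (c / _)]mulrC divfK.
have := core l0 u0 Tu Pu' (ru kn) => pp'.
have R1 : Re (1 : C) = 1 by [].
(* The two positive integers sum to 1 + 2 lam, 1, 1 or 1 - 2 lam, and the sum is at least 2. So they
   are k + lam and 1 - k + lam, and 2 lam is an integer. *)
case: pp => pk; case: pp' => pk'; have := posint_Re pk; have := posint_Re pk';
  rewrite ?(ReD, ReB, R1); try lra.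
move=> r1 r2; have [a ha] := pk; have [b hb] := pk'.
have l2 : lam + lam = (a + b.+1)%N%:R.
  transitivity ((k + lam) + (1 - k + lam) - 1); first by ring.
  by rewrite ha hb natrD -natr1; ring.
set s := (a + b.+1)%N in l2; have sE := odd_double_half s.
have n2 : 2 != 0 :> C by rewrite pnatr_eq0.
have [e|e] := boolP (odd s).
  apply: lh; exists (s./2 : nat); apply: (mulfI n2); transitivity (lam + lam); first by ring.
  by rewrite l2 -{1}sE e -mul2n natrD natrM mulrDr divff.
have li : is_int lam.
  exists (s./2 : nat); apply: (mulfI n2); transitivity (lam + lam); first by ring.
  by rewrite l2 -{1}sE (negbTE e) -mul2n add0n natrM.
have ki : is_int k by rewrite -(addrK lam k); exact/is_intB/li/posint_int.
apply: c1; split => //; rewrite max_leP//; [|exact: is_int_real..].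
by apply/andP; split; lra.
Qed.

End Cases.

(** * Modules given by generators and relations *)

Section Evaluation.
Variables (F : fieldType) (X : Type) (rel : word F X -> word F X -> Prop).
Variables (V : lmodType F) (E : X -> V -> V).
Hypothesis E_linear : forall x a u v, E x (a *: u + v) = a *: E x u + E x v.

Fixpoint evw (w : word F X) (v : V) : V :=
  match w with
  | Gen x => E x v
  | Cst c => c *: v
  | Add a b => evw a v + evw b v
  | Mul a b => evw a (evw b v)
  end.

Lemma evw_linear w a u v : evw w (a *: u + v) = a *: evw w u + evw w v.
Proof.
elim: w a u v => [x|c|b IHb d IHd|b IHb d IHd] a u v /=; first exact: E_linear.
- by rewrite scalerDr !scalerA mulrC.
- by rewrite IHb IHd scalerDr addrACA.
- by rewrite IHd IHb.
Qed.

Lemma evwD w u v : evw w (u + v) = evw w u + evw w v.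
Proof. by have := evw_linear w 1 u v; rewrite !scale1r. Qed.
Lemma evw0 w : evw w 0 = 0.
Proof. by apply: (addIr (evw w 0)); rewrite -evwD !add0r. Qed.
Lemma evwZ w a v : evw w (a *: v) = a *: evw w v.
Proof. by rewrite -[a *: v]addr0 evw_linear evw0 addr0. Qed.

Hypothesis E_rel : forall a b, rel a b -> forall v, evw a v = evw b v.

(** The universal property of the presentation: operators satisfying the relations define an
    action. *)
Lemma evw_wcong a b : wcong rel a b -> forall v, evw a v = evw b v.
Proof.
elim=> {a b} /=.
- exact: E_rel.
- by [].
- by move=> a b _ IH v; rewrite IH.
- by move=> b a c _ IH _ IH' v; rewrite IH IH'.
- by move=> a a' b b' _ IH _ IH' v; rewrite IH IH'.
- by move=> a a' b b' _ IH _ IH' v; rewrite IH' IH.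
- by move=> a b c v; rewrite addrA.
- by move=> a b v; rewrite addrC.
- by move=> a v; rewrite scale0r add0r.
- by move=> a v; rewrite scaleN1r addNr scale0r.
- by [].
- by move=> a v; rewrite scale1r.
- by [].
- by move=> a b c v; rewrite evwD.
- by move=> x y v; rewrite scalerDl.
- by move=> x y v; rewrite scalerA.
- by move=> x a v; rewrite evwZ.
Qed.

Definition evp (a : presented rel) : V -> V := evw (repr a).

Lemma evpE w v : evp (pcl rel w) v = evw w v.
Proof. by apply: evw_wcong; exact: wcong_repr. Qed.
Lemma evp_add a b v : evp (a + b) v = evp a v + evp b v.
Proof. by rewrite -(pcl_repr a) -(pcl_repr b) -pcl_add !evpE. Qed.
Lemma evp_mul a b v : evp (a * b) v = evp a (evp b v).
Proof. by rewrite -(pcl_repr a) -(pcl_repr b) -pcl_mul !evpE. Qed.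
Lemma evp0 a : evp a 0 = 0. Proof. exact: evw0. Qed.
Lemma evp_cst c v : evp (pcst rel c) v = c *: v. Proof. by rewrite evpE. Qed.
Lemma evp_gen x v : evp (pgen rel x) v = E x v. Proof. by rewrite evpE. Qed.
Lemma evp_1 v : evp 1 v = v. Proof. by rewrite -pcst1 evp_cst scale1r. Qed.
Lemma evp_zero v : evp 0 v = 0.
Proof. by rewrite -[0]/(pcst rel 0) evp_cst scale0r. Qed.
Lemma evp_opp a v : evp (- a) v = - evp a v.
Proof. by apply: (addIr (evp a v)); rewrite -evp_add !addNr evp_zero. Qed.

Variables (D : presented rel -> F -> Prop) (u : V).
Hypothesis u_char : forall b c, D b c -> evp b u = c *: u.

Lemma evp_left_ideal a : left_ideal D a -> evp a u = 0.
Proof.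
elim=> {a} [b c /u_char h||a b _ ha _ hb|a b _ hb].
- by rewrite evp_add evp_opp h evp_cst subrr.
- exact: evp_zero.
- by rewrite evp_add ha hb addr0.
- by rewrite evp_mul hb evp0.
Qed.

(** Frobenius reciprocity: a vector u on which the subalgebra acts by its character extends to a
    module map that sends the generator to u. *)
Definition ind_map (v : Ind D) : V := evp (irepr v) u.

Lemma ind_map_icl a : ind_map (icl D a) = evp a u.
Proof.
apply/eqP; rewrite -subr_eq0 -evp_opp -evp_add; apply/eqP/evp_left_ideal.
by apply/iclP; exact: icl_repr.
Qed.

Lemma ind_map_act a v : ind_map (iact a v) = evp a (ind_map v).
Proof. by rewrite -(icl_repr v) iactE !ind_map_icl evp_mul. Qed.

Lemma ind_map_linear c v w : ind_map (c *: v + w) = c *: ind_map v + ind_map w.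
Proof.
have -> : c *: v + w = icl D (pcst rel c * irepr v + irepr w).
  by rewrite icl_add icl_repr -iactE icl_repr.
by rewrite ind_map_icl evp_add evp_mul evp_cst.
Qed.

End Evaluation.

(** An induction principle that bounds an induced module from above: a subspace containing the
    generator and stable under the algebra generators is everything. *)
Lemma ind_span (F : fieldType) (X : Type) (rel : word F X -> word F X -> Prop)
    (D : presented rel -> F -> Prop) (S : Ind D -> Prop) :
  S (icl D 1) -> (forall c v w, S v -> S w -> S (c *: v + w)) ->
  (forall x v, S v -> S (iact (pgen rel x) v)) -> forall v, S v.
Proof.
move=> S1 SL SG v.
have S0 : S 0 by have := SL (-1) _ _ S1 S1; rewrite scaleN1r addNr.
suff H w x : S x -> S (iact (pcl rel w) x).
  by rewrite -(icl_repr v) -[irepr v]mulr1 -iactE -(pcl_repr (irepr v)); exact: H.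
elim: w x => [y|c|a IHa b IHb|a IHa b IHb] x Sx; first exact: SG.
- by rewrite -[iact _ _]/(c *: x) -[c *: x]addr0; exact: SL.
- by rewrite pcl_add iactDl -[iact _ x]scale1r; apply: SL; [exact: IHa|exact: IHb].
- by rewrite pcl_mul iactM; apply/IHa/IHb.
Qed.

(** * Two-dimensional models of the induced modules of the affine Hecke algebra *)

Section HeckeModel.
Variable R : realType.
Local Notation C := (R[i]).
Variables (q Lambda : C) (V : lmodType C) (T Y : V -> V).
Hypothesis q0 : q != 0.
Hypothesis T_linear : forall a u v, T (a *: u + v) = a *: T u + T v.
Hypothesis Y_linear : forall a u v, Y (a *: u + v) = a *: Y u + Y v.
Let s := Lambda + Lambda^-1.
Hypothesis T_quad : forall v, T (T v) = (1 - q) *: T v + q *: v.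
Hypothesis Y_quad : forall v, Y (Y v) = s *: Y v - v.
Hypothesis TY_cross : forall v, T (Y v) = s *: T v - Y (T v) + (1 - q) *: Y v.

Local Notation wd g := (Gen g : word C heckeGen).

(** The inverses of T and Y are expressed by T and Y through their quadratic equations. *)
Definition hecke_gen (g : heckeGen) : V -> V :=
  match g with
  | GT => T
  | GTi => fun v => q^-1 *: (T v - (1 - q) *: v)
  | GY => Y
  | GYi => fun v => s *: v - Y v
  end.

Lemma hecke_gen_linear g a u v : hecke_gen g (a *: u + v) = a *: hecke_gen g u + hecke_gen g v.
Proof.
case: g => /=; rewrite ?T_linear ?Y_linear//.
  rewrite [(1 - q) *: (_ + _)]scalerDr opprD addrACA scalerDr; congr (_ + _).
  by rewrite (scalerA (1 - q)) (mulrC (1 - q)) -scalerA -scalerBr !scalerA mulrC.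
by rewrite scalerDr opprD addrACA (scalerA s) (mulrC s) -scalerA -scalerBr.
Qed.

Lemma lin0 (f : V -> V) : (forall a u v, f (a *: u + v) = a *: f u + f v) -> 
  [/\ f 0 = 0, forall u v, f (u + v) = f u + f v, forall a v, f (a *: v) = a *: f v & forall v, f (- v) = - f v].
Proof.
move=> h; have f0 : f 0 = 0.
  by have := h (-1) 0 0; rewrite scaler0 addr0 scaleN1r addNr.
have fZ a v : f (a *: v) = a *: f v by rewrite -[a *: v]addr0 h f0 addr0.
split; [exact: f0| |exact: fZ|].
  by move=> u v; have := h 1 u v; rewrite !scale1r.
by move=> v; have := fZ (-1) v; rewrite !scaleN1r.
Qed.

Lemma hecke_gen_rel a b : heckeRel q a b -> forall v, evw hecke_gen a v = evw hecke_gen b v.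
Proof.
have [T0 TD TZ TN] := lin0 T_linear; have [Y0 YD YZ YN] := lin0 Y_linear.
case=> v /=.
- by rewrite !(TZ, TD, TN) T_quad addrAC subrr add0r scalerA mulVf//.
- by rewrite T_quad addrAC subrr add0r scale1r scalerA mulVf// scale1r.
- by rewrite !(YZ, YD, YN) Y_quad opprB addrC subrK scale1r.
- by rewrite Y_quad opprB addrC subrK scale1r.
- rewrite TD TZ T_quad scale0r scaleN1r opprD scalerBl scale1r.
  set A := T v; set B := q *: A; set D := q *: v.
  by rewrite [A - B + D + B]addrAC subrK addrACA !subrr addr0.
- by rewrite TY_cross.
Qed.

Lemma Hext_actions (D : Hext q -> C -> Prop) (v : Ind D) :
  [/\ iact (hT q) (iact (hT q) v) = (1 - q) *: iact (hT q) v + q *: v,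
      iact (pgen (heckeRel q) GTi) v = q^-1 *: (iact (hT q) v - (1 - q) *: v),
      iact (hY q) (iact (hYi q) v) = v, iact (hYi q) (iact (hY q) v) = v &
      iact (hT q) (iact (hY q) v) = iact (hYi q) (iact (hT q) v) + (1 - q) *: iact (hY q) v].
Proof.
have rl a b : heckeRel q a b -> pcl (heckeRel q) a = pcl (heckeRel q) b.
  by move=> h; apply/pclP; exact: wcong_rel.
have c1 c (x : Ind D) : iact (pcl (heckeRel q) (Cst c)) x = c *: x by [].
have := rl _ _ (hecke_quad q); have := rl _ _ (hecke_TTi q).
have := rl _ _ (hecke_YYi q); have := rl _ _ (hecke_YiY q); have := rl _ _ (hecke_cross q).
rewrite !(pcl_mul, pcl_add) => cr h1 h2 h3 h4.
have H (x y : Hext q) (w : Ind D) : x = y -> iact x w = iact y w by move=> ->.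
have Tq (x : Ind D) : iact (hT q) (iact (hT q) x) = (1 - q) *: iact (hT q) x + q *: x.
  have := H _ _ x h4; rewrite iactM !iactDl !c1 iactD iactZ scale0r scaleN1r => /eqP.
  rewrite subr_eq0 => /eqP h; apply: (addIr (q *: iact (hT q) x)).
  by rewrite [LHS]h scalerBl scale1r addrAC subrK.
split.
- exact: Tq.
- have := H _ _ v h3; rewrite iactM c1 scale1r; set x := iact _ v => hx.
  have := Tq x; rewrite -/(iact (hT q) x) -[iact (hT q) x]/(iact (pcl _ (Gen GT)) x) hx => ->.
  by rewrite addrAC subrr add0r scalerA mulVf// scale1r.
- by have := H _ _ v h2; rewrite iactM c1 scale1r.
- by have := H _ _ v h1; rewrite iactM c1 scale1r.
by have := H _ _ v cr; rewrite iactDl !iactM c1.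
Qed.

Definition basis (W : lmodType C) (u w : W) :=
  (forall v, exists a b, v = a *: u + b *: w) /\ forall a b, a *: u + b *: w = 0 -> a = 0 /\ b = 0.

Definition model_iso (M : TYrep R) (f : M -> V) :=
  [/\ forall a u v, f (a *: u + v) = a *: f u + f v, forall v, f v = 0 -> v = 0,
      forall v, exists w, f w = v, forall v, f (TYop_T v) = T (f v) & forall v, f (TYop_Y v) = Y (f v)].

Lemma span2_closed (W : lmodType C) (e1 e2 v w : W) c :
  (exists a b, v = a *: e1 + b *: e2) -> (exists a b, w = a *: e1 + b *: e2) ->
  exists a b, c *: v + w = a *: e1 + b *: e2.
Proof.
move=> [a [b ->]] [a' [b' ->]]; exists (c * a + a'), (c * b + b').
by rewrite scalerDr !scalerA addrACA !scalerDl.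
Qed.

(** Two vectors span the induced module and their images form a basis of V, so the map is bijective.
    Independence in the induced module comes from V, without a basis theorem for the algebra. *)
Lemma ind_model (D : Hext q -> C -> Prop) (u w : V) (e2 : Ind D) :
  (forall b c, D b c -> evp hecke_gen b u = c *: u) ->
  ind_map hecke_gen u e2 = w -> basis u w ->
  (forall v : Ind D, exists a b, v = a *: icl D 1 + b *: e2) ->
  exists f : indTY D -> V, model_iso f.
Proof.
move=> hu e2w [bs bf] sp.
have fl := ind_map_linear hecke_gen_linear hecke_gen_rel hu.
have [f0 fD fZ] : [/\ ind_map hecke_gen u (0 : Ind D) = 0, (forall x y : Ind D, ind_map hecke_gen u (x + y) = ind_map hecke_gen u x + ind_map hecke_gen u y)
    & forall c (x : Ind D), ind_map hecke_gen u (c *: x) = c *: ind_map hecke_gen u x].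
  have f0 : ind_map hecke_gen u (0 : Ind D) = 0.
    by have := fl (-1) 0 0; rewrite scaler0 addr0 scaleN1r addNr.
  split; [exact: f0| |].
    by move=> x y; have := fl 1 x y; rewrite !scale1r.
  by move=> c x; have := fl c x 0; rewrite !addr0 f0 addr0.
have f1 : ind_map hecke_gen u (icl D 1) = u.
  by rewrite (ind_map_icl hecke_gen_linear hecke_gen_rel hu) (evp_1 hecke_gen_linear hecke_gen_rel).
have fE a b : ind_map hecke_gen u (a *: icl D 1 + b *: e2) = a *: u + b *: w.
  by rewrite fD !fZ f1 e2w.
exists (ind_map hecke_gen u); split => //.
- move=> v; have [a [b ->]] := sp v; rewrite fE => /bf[-> ->].
  by rewrite !scale0r addr0.
- by move=> v; have [a [b ->]] := bs v; exists (a *: icl D 1 + b *: e2); rewrite fE.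
- move=> v; rewrite /= (ind_map_act hecke_gen_linear hecke_gen_rel hu).
  by rewrite (evp_gen hecke_gen_linear hecke_gen_rel).
- move=> v; rewrite /= (ind_map_act hecke_gen_linear hecke_gen_rel hu).
  by rewrite (evp_gen hecke_gen_linear hecke_gen_rel).
Qed.

(** The generator and its image under Y span: Y + Y^-1 is a scalar on the generator, so Y^2 reduces,
    and the cross relation expresses T Y by T and Y^-1 T. *)
Lemma central_model t u : T u = t *: u -> basis u (Y u) ->
  exists f : indTY (@central_char R q t Lambda) -> V, model_iso f.
Proof.
move=> Tu bu; pose D := @central_char R q t Lambda; pose e1 := icl D 1.
pose e2 := iact (hY q) e1.
have hu b c : D b c -> evp hecke_gen b u = c *: u.
  case; first by rewrite (evp_gen hecke_gen_linear hecke_gen_rel).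
  rewrite (evp_add hecke_gen_linear hecke_gen_rel) !(evp_gen hecke_gen_linear hecke_gen_rel) /=.
  by rewrite addrC subrK.
have act b c : D b c -> iact b e1 = c *: e1.
  move=> h; rewrite /e1 iactE mulr1 -[c *: _]/(iact (pcst _ c) _) iactE mulr1.
  by apply/iclP; exact: left_ideal_gen.
have Te1 : iact (hT q) e1 = t *: e1 by apply: act; exact: central_T.
have Ys : iact (hY q) e1 + iact (hYi q) e1 = s *: e1 by rewrite -iactDl; apply: act; exact: central_Y.
have Yi1 : iact (hYi q) e1 = s *: e1 - e2 by rewrite -Ys /e2 addrAC subrr add0r.
have Yi2 : iact (hYi q) e2 = e1 by have [] := Hext_actions e1.
have Y2 : iact (hY q) e2 = s *: e2 - e1.
  have [_ _ h _ _] := Hext_actions e1; move: h; rewrite Yi1 iactD iactZ.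
  rewrite -scaleN1r iactZ scaleN1r -/e2 => <-; by rewrite opprB addrC subrK.
have T2 : iact (hT q) e2 = t *: (s *: e1 - e2) + (1 - q) *: e2.
  by have [_ _ _ _ ->] := Hext_actions e1; rewrite Te1 iactZ Yi1.
apply: (@ind_model D u (Y u) e2) => //.
  by rewrite /e2 /e1 iactE mulr1 (ind_map_icl hecke_gen_linear hecke_gen_rel hu) (evp_gen hecke_gen_linear hecke_gen_rel).
have E1 : exists a b, e1 = a *: e1 + b *: e2 by exists 1, 0; rewrite scale1r scale0r addr0.
have E2 : exists a b, e2 = a *: e1 + b *: e2 by exists 0, 1; rewrite scale1r scale0r add0r.
have E0 : exists a b, 0 = a *: e1 + b *: e2 by exists 0, 0; rewrite !scale0r addr0.
have EZ c x : (exists a b, x = a *: e1 + b *: e2) -> exists a b, c *: x = a *: e1 + b *: e2.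
  by move=> hx; rewrite -[c *: x]addr0; exact: span2_closed.
have ED x y : (exists a b, x = a *: e1 + b *: e2) -> (exists a b, y = a *: e1 + b *: e2) ->
   exists a b, x + y = a *: e1 + b *: e2.
  by move=> hx hy; rewrite -[x]scale1r; exact: span2_closed.
have EN x : (exists a b, x = a *: e1 + b *: e2) -> exists a b, - x = a *: e1 + b *: e2.
  by move=> hx; rewrite -scaleN1r; exact: (EZ).
apply: ind_span => //; first by move=> c v w; exact: span2_closed.
have key g : (exists a b, iact (pgen (heckeRel q) g) e1 = a *: e1 + b *: e2) ->
   (exists a b, iact (pgen (heckeRel q) g) e2 = a *: e1 + b *: e2) ->
   forall v, (exists a b, v = a *: e1 + b *: e2) -> exists a b, iact (pgen (heckeRel q) g) v = a *: e1 + b *: e2.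
  by move=> h1 h2 v [a [b ->]]; rewrite iactD !iactZ; apply: (ED); exact: (EZ).
have kT := key GT; have kY := key GY; have kYi := key GYi.
have {kT}HT v : (exists a b, v = a *: e1 + b *: e2) -> exists a b, iact (hT q) v = a *: e1 + b *: e2.
  apply: kT; first by rewrite -/(hT q) Te1; exact: (EZ).
  by rewrite -/(hT q) T2; apply: (ED); [apply: (EZ); apply: (ED); [exact: (EZ)|exact: (EN)]|exact: (EZ)].
case=> v hv; first exact: (HT).
- have [_ -> _ _ _] := Hext_actions v; apply: (EZ); apply: (ED); first exact: (HT).
  by apply: (EN); exact: (EZ).
- apply: kY hv; first exact: E2.
  by rewrite -/(hY q) Y2; apply: (ED); [exact: (EZ)|exact: (EN)].
- apply: kYi hv; first by rewrite -/(hYi q) Yi1; apply: (ED); [exact: (EZ)|exact: (EN)].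
  by rewrite -/(hYi q) Yi2.
Qed.

(** Here the generator and its image under T span: the quadratic relation reduces T^2, and the cross
    relation, read backwards, gives Y^-1 T on the generator. *)
Lemma principal_model mu u : mu != 0 -> s = mu + mu^-1 -> Y u = mu *: u -> basis u (T u) ->
  exists f : Iind q mu -> V, model_iso f.
Proof.
move=> mu0 sE Yu bu; pose D := @Y_char R q mu; pose e1 := icl D 1.
pose e2 := iact (hT q) e1.
have hu b c : D b c -> evp hecke_gen b u = c *: u.
  case; rewrite (evp_gen hecke_gen_linear hecke_gen_rel) //= Yu sE -scalerBl.
  by rewrite addrAC subrr add0r.
have act b c : D b c -> iact b e1 = c *: e1.
  move=> h; rewrite /e1 iactE mulr1 -[c *: _]/(iact (pcst _ c) _) iactE mulr1.
  by apply/iclP; exact: left_ideal_gen.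
have Ye1 : iact (hY q) e1 = mu *: e1 by apply: act; exact: Y_char_Y.
have Yie1 : iact (hYi q) e1 = mu^-1 *: e1 by apply: act; exact: Y_char_Yi.
have T2 : iact (hT q) e2 = (1 - q) *: e2 + q *: e1 by have [] := Hext_actions e1.
have Yi2 : iact (hYi q) e2 = mu *: e2 - ((1 - q) * mu) *: e1.
  have [_ _ _ _] := Hext_actions e1; rewrite Ye1 iactZ -/e2 => ->.
  by rewrite scalerA addrK.
have Y2 : iact (hY q) e2 = mu^-1 *: (e2 + ((1 - q) * mu * mu) *: e1).
  have [_ _ h _ _] := Hext_actions e2; move: h; rewrite Yi2 iactD iactZ.
  rewrite -scaleN1r !iactZ Ye1 => h; apply: (scalerI mu0); rewrite scalerA divff// scale1r -[in RHS]h.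
  by rewrite scaleN1r !scalerA subrK.
apply: (@ind_model D u (T u) e2) => //.
  by rewrite /e2 /e1 iactE mulr1 (ind_map_icl hecke_gen_linear hecke_gen_rel hu) (evp_gen hecke_gen_linear hecke_gen_rel).
have E1 : exists a b, e1 = a *: e1 + b *: e2 by exists 1, 0; rewrite scale1r scale0r addr0.
have E2 : exists a b, e2 = a *: e1 + b *: e2 by exists 0, 1; rewrite scale1r scale0r add0r.
have E0 : exists a b, 0 = a *: e1 + b *: e2 by exists 0, 0; rewrite !scale0r addr0.
have EZ c x : (exists a b, x = a *: e1 + b *: e2) -> exists a b, c *: x = a *: e1 + b *: e2.
  by move=> hx; rewrite -[c *: x]addr0; exact: span2_closed.
have ED x y : (exists a b, x = a *: e1 + b *: e2) -> (exists a b, y = a *: e1 + b *: e2) ->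
   exists a b, x + y = a *: e1 + b *: e2.
  by move=> hx hy; rewrite -[x]scale1r; exact: span2_closed.
have EN x : (exists a b, x = a *: e1 + b *: e2) -> exists a b, - x = a *: e1 + b *: e2.
  by move=> hx; rewrite -scaleN1r; exact: (EZ).
apply: ind_span => //; first by move=> c v w; exact: span2_closed.
have key g : (exists a b, iact (pgen (heckeRel q) g) e1 = a *: e1 + b *: e2) ->
   (exists a b, iact (pgen (heckeRel q) g) e2 = a *: e1 + b *: e2) ->
   forall v, (exists a b, v = a *: e1 + b *: e2) -> exists a b, iact (pgen (heckeRel q) g) v = a *: e1 + b *: e2.
  by move=> h1 h2 v [a [b ->]]; rewrite iactD !iactZ; apply: (ED); exact: (EZ).
have kT := key GT; have kY := key GY; have kYi := key GYi.
have {kT}HT v : (exists a b, v = a *: e1 + b *: e2) -> exists a b, iact (hT q) v = a *: e1 + b *: e2.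
  apply: kT; first exact: E2.
  by rewrite -/(hT q) T2; apply: (ED); exact: (EZ).
case=> v hv; first exact: (HT).
- have [_ -> _ _ _] := Hext_actions v; apply: (EZ); apply: (ED); first exact: (HT).
  by apply: (EN); exact: (EZ).
- apply: kY hv; first by rewrite -/(hY q) Ye1; exact: (EZ).
  by rewrite -/(hY q) Y2; apply: (EZ); apply: (ED) => //; exact: (EZ).
- apply: kYi hv; first by rewrite -/(hYi q) Yie1; exact: (EZ).
  by rewrite -/(hYi q) Yi2; apply: (ED); [exact: (EZ)|apply: (EN); exact: (EZ)].
Qed.

End HeckeModel.

(** * Horizontal sections and their analytic continuation *)

Section ComplexTopology.
Variable R : realType.
Local Notation C := (R[i]).
Local Notation Ctop := (R[i]^o).
Local Notation N := (@ComplexField.Normc.normc R).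
Local Notation "x %:CC" := (real_complex R x) (at level 2, format "x %:CC").
Local Notation Re := complex.Re.

Lemma normE (z : Ctop) : `|z| = (N z)%:CC.
Proof. by []. Qed.

Lemma pos_real (e : C) : 0 < e -> e = (Re e)%:CC /\ 0 < Re e.
Proof.
case: e => a b; rewrite ltcE /= => /andP[/eqP b0 a0]; split => //.
by rewrite b0.
Qed.

Lemma nbhsCP (x : C) (P : C -> Prop) : (\forall y \near (x : Ctop), P y) <->
  exists2 d : R, 0 < d & forall y, N (y - x) < d -> P y.
Proof.
split=> [/nbhs_ballP[e /= e0 he]|[d d0 hd]].
  have [eE e0'] := pos_real e0; exists (Re e) => // y yx; apply: he.
  by rewrite /ball /= normE eE ltcR NBC.
apply/nbhs_ballP; exists d%:CC => /=; first by rewrite ltcR.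
by move=> y; rewrite /ball /= normE ltcR NBC; exact: hd.
Qed.

Lemma is_derive_cder (c : Ctop -> Ctop) (x d : Ctop) : is_derive x 1 c d <-> cder c x d.
Proof.
split=> [[dv <-]|].
  have h : (fun h : Ctop => h^-1 *: (c (h *: 1 + x) - c x)) @ (0 : Ctop)^' --> 'D_1 c x by exact: dv.
  pose phi (y : C) := if y == x then 'D_1 c x else (c y - c x) / (y - x).
  exists phi; split; first by rewrite /phi eqxx.
    move=> e e0; have e0' : 0 < (e%:CC : C) by rewrite ltcR.
    move/cvgrPdist_lt : h => /(_ _ e0') /nbhs_ballP[r /= r0 hr].
    have [rE r0'] := pos_real r0; exists (Re r) => // y yx.
    rewrite {2}/phi eqxx /phi; case: eqVneq => [_|yn]; first by rewrite subrr N0.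
    have := hr (y - x); rewrite /ball /= sub0r normrN normE rE ltcR => /(_ yx).
    rewrite subr_eq0 => /(_ yn); rewrite normE ltcR NBC; congr (N (_ - _) < _).
    by rewrite /GRing.scale /= mulr1 subrK mulrC.
  move=> y; rewrite /phi; case: eqVneq => [->|yn]; first by rewrite !subrr mulr0.
  by rewrite divfK// subr_eq0.
move=> [phi [p1 p2 p3]].
have h : (fun h : Ctop => h^-1 *: (c (h *: 1 + x) - c x)) @ (0 : Ctop)^' --> d.
  apply/cvgrPdist_lt => e e0; have [eE e0'] := pos_real e0.
  have [r r0 hr] := p2 _ e0'; apply/nbhs_ballP; exists r%:CC => /=; first by rewrite ltcR.
  move=> h; rewrite /ball /= sub0r normrN normE ltcR => hr' h0.
  rewrite normE eE ltcR NBC /GRing.scale /= mulr1 p3 addrK mulrC mulfK// -p1.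
  by apply: hr; rewrite addrK.
have dv : derivable c x 1 by apply/cvg_ex; exists d.
split; first exact: dv.
exact: (cvg_lim (@norm_hausdorff _ Ctop) h).
Qed.

End ComplexTopology.

(** * The two-dimensional covariant representation *)

Section CovariantBasis.
Variable R : realType.
Local Notation C := (R[i]).
Variables (k lam : C).
Local Notation K := (Ktheta k lam).
Local Notation V := (C^o * C^o)%type.
Local Notation rel := (@dahaRel R k).
Let m := par k lam.

(** The matrices of s and xi in the basis [up], [um]. Acting on pairs, they show that these two
    spanning vectors are independent. *)
Definition cov_gen (g : dahaGen R) (v : V) : V :=
  match g with
  | GenS => (v.1, - v.2)
  | GenXi xi => (xi * (- k * v.1 + m * v.2), xi * (v.1 + k * v.2))
  end.

Lemma pairZD (a x y z w : C) : a *: ((x, y) : V) + (z, w) = (a * x + z, a * y + w).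
Proof. by []. Qed.
Lemma pairZ (a x y : C) : a *: ((x, y) : V) = (a * x, a * y).
Proof. by []. Qed.
Lemma pairD (x y z w : C) : ((x, y) : V) + (z, w) = (x + z, y + w).
Proof. by []. Qed.

Lemma cov_gen_linear g a u v : cov_gen g (a *: u + v) = a *: cov_gen g u + cov_gen g v.
Proof.
by case: u v => [x y] [z w]; case: g => [|xi]; rewrite pairZD /cov_gen pairZD /=; congr (_, _); ring.
Qed.

Lemma cov_gen_rel a b : rel a b -> forall v, evw cov_gen a v = evw cov_gen b v.
Proof.
by case=> [|c xi eta|xi eta|xi] [x y]; rewrite /= ?pairZ ?pairD ?pairZ /alpha; congr (_, _); ring.
Qed.

Local Notation ev := (evp cov_gen).
Let evg := evp_gen cov_gen_linear cov_gen_rel.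
Let evM := evp_mul cov_gen_linear cov_gen_rel.
Let evD := evp_add cov_gen_linear cov_gen_rel.

Lemma xi1_sq (v : V) : ev (xiH k 1) (ev (xiH k 1) v) = (lam ^+ 2) *: v.
Proof.
by rewrite !evg /=; case: v => x y; rewrite pairZ /m /par /=; congr (_, _); ring.
Qed.

Lemma even_coef (p : {poly C}) i : p \Po (- 'X) = p -> odd i -> p`_i = 0.
Proof.
move=> pe oi; have pE : p = \poly_(i < size p) (p`_i * (-1) ^+ i).
  rewrite -{1}pe comp_polyE poly_def; apply: eq_bigr => j _.
  by rewrite (exprNn 'X) -scalerA; congr (_ *: _); rewrite -!(signr_odd _ j); case: (odd j); rewrite ?expr1 ?expr0 ?mulN1r ?scaleN1r ?mul1r ?scale1r.
have [ip|/leq_sizeP ->//] := ltnP i (size p).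
have : p`_i = - p`_i by rewrite {1}pE coef_poly ip -signr_odd oi mulrN1.
by move/eqP; rewrite -addr_eq0 -mulr2n mulrn_eq0 => /eqP.
Qed.

Lemma cov_xi_pow i (v : V) : ~~ odd i -> ev (xiH k 1 ^+ i) v = lam ^+ i *: v.
Proof.
move=> oi; have -> : i = (i./2).*2 by rewrite -[LHS]odd_double_half (negbTE oi).
elim: (i./2) => [|n IH]; first by rewrite !expr0 scale1r (evp_1 cov_gen_linear cov_gen_rel).
by rewrite doubleS !exprS !evM IH xi1_sq scalerA expr2 -mulrA.
Qed.

Lemma cov_char b c : @covariant_char R k lam b c -> ev b ((1, 0) : V) = c *: ((1, 0) : V).
Proof.
case=> [|p pe]; first by rewrite evg /= pairZ !mulr0 mul1r oppr0.
rewrite /Sh_embed horner_coef scaler_suml.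
have evs (I : Type) (r : seq I) (F : I -> Hk k) v : ev (\sum_(i <- r) F i) v = \sum_(i <- r) ev (F i) v.
  elim: r => [|a r IH]; first by rewrite !big_nil (evp_zero cov_gen_linear cov_gen_rel).
  by rewrite !big_cons evD IH.
rewrite evs; apply: eq_bigr => i _.
rewrite evM (evp_cst cov_gen_linear cov_gen_rel).
have [oi|oi] := boolP (odd i); first by rewrite even_coef// mul0r !scale0r.
by rewrite cov_xi_pow// scalerA.
Qed.

Definition coords (v : K) : V := ind_map cov_gen ((1, 0) : V) v.

Definition up : K := icl (@covariant_char R k lam) 1.
Definition um : K := iact (xiH k 1) up + k *: up.

Lemma coords_linear c v w : coords (c *: v + w) = c *: coords v + coords w.
Proof. exact: (ind_map_linear cov_gen_linear cov_gen_rel cov_char). Qed.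
Lemma coordsD v w : coords (v + w) = coords v + coords w.
Proof. by have := coords_linear 1 v w; rewrite !scale1r. Qed.
Lemma coords0 : coords 0 = 0.
Proof. by have := coords_linear (-1) 0 0; rewrite scaler0 addr0 scaleN1r addNr. Qed.
Lemma coordsZ c v : coords (c *: v) = c *: coords v.
Proof. by have := coords_linear c v 0; rewrite !addr0 coords0 addr0. Qed.
Lemma coords_act a v : coords (iact a v) = ev a (coords v).
Proof. exact: (ind_map_act cov_gen_linear cov_gen_rel cov_char). Qed.
Lemma coords_s v : coords (s_act v) = ((coords v).1, - (coords v).2).
Proof. by rewrite coords_act evg. Qed.
Lemma coords_xi xi v : coords (xi_act xi v) =
  (xi * (- k * (coords v).1 + m * (coords v).2), xi * ((coords v).1 + k * (coords v).2)).
Proof. by rewrite coords_act evg. Qed.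

Lemma coords_up : coords up = (1, 0).
Proof.
by rewrite /coords (ind_map_icl cov_gen_linear cov_gen_rel cov_char) (evp_1 cov_gen_linear cov_gen_rel).
Qed.
Lemma coords_um : coords um = (0, 1).
Proof.
rewrite coordsD coordsZ coords_act coords_up evg /= pairZ pairD; congr (_, _); ring.
Qed.

Lemma coords_comb a b : coords (a *: up + b *: um) = (a, b).
Proof.
by rewrite coordsD !coordsZ coords_up coords_um !pairZ pairD !mulr1 !mulr0 addr0 add0r.
Qed.

Let act_rl (a b : word C (dahaGen R)) (v : K) : rel a b -> iact (pcl rel a) v = iact (pcl rel b) v.
Proof. by move=> h; congr (iact _ v); apply/pclP; exact: wcong_rel. Qed.
Let act_cst c (v : K) : iact (pcl rel (Cst c)) v = c *: v. Proof. by []. Qed.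

Lemma xi_scale xi (v : K) : xi_act xi v = xi *: xi_act 1 v.
Proof.
have z (w : K) : xi_act 0 w = 0.
  have := act_rl w (daha_linear k (-1) 1 1); rewrite mulr1 addNr pcl_add pcl_mul iactDl iactM act_cst scaleN1r addNr.
  exact.
have := act_rl v (daha_linear k xi 1 0); rewrite mulr1 addr0 pcl_add pcl_mul iactDl iactM act_cst => h.
by rewrite /xi_act h -[iact (pcl _ (Gen (GenXi 0))) v]/(xi_act 0 v) z addr0.
Qed.

Lemma s_xi (v : K) : s_act (xi_act 1 v) = - xi_act 1 (s_act v) - (2 * k) *: v.
Proof.
have := act_rl v (daha_cross k 1); rewrite pcl_add !pcl_mul iactDl !iactM act_cst => h.
rewrite /s_act /xi_act [LHS]h; congr (_ + _).
  by rewrite -[LHS]/(xi_act (-1) (s_act v)) xi_scale scaleN1r.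
by rewrite -[RHS]scaleNr; congr (_ *: _); rewrite /alpha; ring.
Qed.

Lemma cov_act b c : @covariant_char R k lam b c -> iact b up = c *: up.
Proof.
move=> h; rewrite /up iactE mulr1 -[c *: _]/(iact (pcst _ c) _) iactE mulr1.
by apply/iclP; exact: left_ideal_gen.
Qed.

Lemma s_up : s_act up = up.
Proof. by rewrite /s_act (cov_act (@covariant_s R k lam)) scale1r. Qed.

Lemma xi_up : xi_act 1 up = um - k *: up.
Proof. by rewrite /um addrK. Qed.

Lemma xi_xi_up : xi_act 1 (xi_act 1 up) = lam ^+ 2 *: up.
Proof.
have hp : ('X^2 : {poly C}) \Po (- 'X) = 'X^2 by rewrite comp_Xn_poly sqrrN.
have := cov_act (covariant_p k lam hp); rewrite hornerXn /Sh_embed size_polyXn.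
rewrite !big_ord_recr big_ord0 /= !coefXn /= add0r.
have E0 : pcst rel 0 = 0 by [].
by rewrite E0 !mul0r !add0r -[pcst rel 1]/(1 : Hk k) mul1r expr2 iactM.
Qed.

Lemma s_um : s_act um = - um.
Proof.
rewrite /um /s_act iactD iactZ -/(s_act _) -/(s_act _) s_up -[iact (xiH k 1) up]/(xi_act 1 up).
rewrite s_xi s_up mulr_natl mulr2n scalerDl opprD opprD -addrA; congr (_ + _).
by rewrite -addrA addNr addr0.
Qed.

Lemma xi_um : xi_act 1 um = m *: up + k *: um.
Proof.
rewrite {1}/um /xi_act iactD iactZ -/(xi_act _ _) xi_xi_up.
rewrite -[iact (xiH k 1) up]/(xi_act 1 up) xi_up scalerBr scalerA addrCA addrC; congr (_ + _).
by rewrite -scalerBl /m /par expr2 [k ^+ 2]expr2.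
Qed.

Lemma xi_comb (W : lmodType C) (p u : W) (a b c d : C) :
  a *: (u - c *: p) + b *: (d *: p + c *: u) = (- c * a + d * b) *: p + (a + c * b) *: u.
Proof.
rewrite scalerBr scalerDr !scalerA scalerDl (scalerDl u) mulNr scaleNr.
by rewrite (addrC (a *: u)) addrACA (mulrC a c) (mulrC b d) (mulrC b c).
Qed.

Lemma coordsK (v : K) : v = (coords v).1 *: up + (coords v).2 *: um.
Proof.
suff [a [b ->]] : exists a b, v = a *: up + b *: um by rewrite coords_comb.
move: v; apply: ind_span; first by exists 1, 0; rewrite scale1r scale0r addr0.
  by move=> c v w; exact: span2_closed.
case=> [|xi] v [a [b ->]].
  exists a, (- b); rewrite -[LHS]/(s_act _) /s_act iactD !iactZ -/(s_act _) s_up.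
  by rewrite -[iact (sH k) um]/(s_act um) s_um scalerN scaleNr.
rewrite -[iact _ _]/(xi_act xi _) xi_scale /xi_act iactD !iactZ.
rewrite -[iact (xiH k 1) up]/(xi_act 1 up) -[iact (xiH k 1) um]/(xi_act 1 um) xi_up xi_um.
exists (xi * (- k * a + m * b)), (xi * (a + k * b)).
rewrite xi_comb; move: up um => p u.
by rewrite scalerDr !scalerA.
Qed.

End CovariantBasis.

(** * Horizontal sections in coordinates *)

Section HorizontalSections.
Variable R : realType.
Local Notation C := (R[i]).
Local Notation N := (@ComplexField.Normc.normc R).
Variables (k lam : C).
Local Notation K := (Ktheta k lam).
Local Notation up := (up k lam).
Local Notation um := (um k lam).
Local Notation coords := (@coords R k lam).
Local Notation m := (par k lam).

Lemma cder_sum n (c : 'I_n -> C -> C) (dc w : 'I_n -> C) z :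
  (forall i, cder (c i) z (dc i)) -> cder (fun y => \sum_i c i y * w i) z (\sum_i dc i * w i).
Proof.
elim: n c dc w => [|n IH] c dc w h.
  rewrite big_ord0; have -> : (fun y => \sum_(i < 0) c i y * w i) = fun=> 0 by apply/funext => y; rewrite big_ord0.
  exact: cder_cst.
rewrite big_ord_recr /=.
have -> : (fun y => \sum_(i < n.+1) c i y * w i) =
    fun y => \sum_(i < n) c (widen_ord (leqnSn n) i) y * w (widen_ord (leqnSn n) i) + c ord_max y * w ord_max.
  by apply/funext => y; rewrite big_ord_recr.
apply: cderD; first by apply: IH => i; exact: h.
by apply: cder_eq (cderM (h ord_max) (cder_cst (w ord_max) z)) _; rewrite mulr0 addr0.
Qed.

Lemma coords_sum n (c : 'I_n -> C) (v : 'I_n -> K) :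
  coords (\sum_i c i *: v i) = (\sum_i c i * (coords (v i)).1, \sum_i c i * (coords (v i)).2).
Proof.
elim: n c v => [|n IH] c v; first by rewrite !big_ord0 coords0.
by rewrite !big_ord_recr /= coordsD coordsZ IH; case: (coords (v ord_max)).
Qed.

Lemma is_deriv_coords (f : C -> K) x df : is_deriv f x df ->
  cder (fun y => (coords (f y)).1) x (coords df).1 /\ cder (fun y => (coords (f y)).2) x (coords df).2.
Proof.
move=> [n [c [dc [v [/nbhsCP[d d0 hf] hd ->]]]]]; rewrite coords_sum /=.
have hc i : cder (c i) x (dc i) by exact/is_derive_cder.
split; [have h := cder_sum (fun i => (coords (v i)).1) hc|have h := cder_sum (fun i => (coords (v i)).2) hc];
  by apply: cder_local h; [exact: d0|move=> y /hf ->; rewrite coords_sum].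
Qed.

Lemma is_deriv_comb (f : C -> K) (a b : C -> C) x da db (d : R) : 0 < d ->
  (forall y, N (y - x) < d -> f y = a y *: up + b y *: um) -> cder a x da -> cder b x db ->
  is_deriv f x (da *: up + db *: um).
Proof.
move=> d0 hf ha hb; exists 2, (fun i => if i == 0 then a else b), (fun i => if i == 0 then da else db),
  (fun i => if i == 0 then up else um); split.
- by apply/nbhsCP; exists d => // y /hf ->; rewrite big_ord_recl big_ord1.
- by move=> i; apply/is_derive_cder; case: ifP.
- by rewrite big_ord_recl big_ord1.
Qed.

(** On [up] the shift by k cancels the - k from xi. On [um], where 1 - s acts as 2, the terms -
    4k/(1 - x^-2) + 2k combine to - 2k (x^2 + 1)/(x^2 - 1). *)
Lemma coords_nabla xi x (f df : K) : Hreg x ->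
  coords (nabla xi x f df) =
  (xi * (x * (coords df).1 + m * (coords f).2),
   xi * (x * (coords df).2 - 2 * k * ((x ^+ 2 + 1) / (x ^+ 2 - 1)) * (coords f).2 + (coords f).1)).
Proof.
move=> [x0 x1 xm]; have x2 : x ^+ 2 - 1 != 0 by rewrite subr_eq0 sqrf_eq1 (negbTE x1) (negbTE xm).
have x3 : 1 - x ^- 2 != 0.
  apply: contra x2 => /eqP h; have : x ^+ 2 * (1 - x ^- 2) = 0 by rewrite h mulr0.
  by rewrite mulrBr mulr1 divff ?expf_neq0// => ->.
rewrite /nabla -scaleNr !coordsD !coordsZ coordsD -scaleN1r coordsZ coords_s coords_xi.
move: (coords f) (coords df) => [a b] [da db].
rewrite !pairZ !(pairD, pairZ) /= /rho /alpha; congr (_, _); field.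
all: by rewrite ?x0 ?x2 ?x3 ?pnatr_eq0.
Qed.

Definition hode (a b : C -> C) x := exists da db, [/\ cder a x da, cder b x db,
  x * da = - m * b x & x * db = 2 * k * ((x ^+ 2 + 1) / (x ^+ 2 - 1)) * b x - a x].

Lemma horizontal_hode f x : Hreg x -> horizontal_at f x ->
  hode (fun y => (coords (f y)).1) (fun y => (coords (f y)).2) x.
Proof.
move=> hx [df hd h0]; have [h1 h2] := is_deriv_coords hd.
have := congr1 coords (h0 1); rewrite coords_nabla// coords0 !mul1r => -[e1 e2].
exists (coords df).1, (coords df).2; split => //.
  by rewrite mulNr; apply/eqP; rewrite -addr_eq0 e1.
by apply: subr0_eq; rewrite -[RHS]e2; ring.
Qed.

Lemma hode_horizontal f (a b : C -> C) x (d : R) : 0 < d ->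
  (forall y, N (y - x) < d -> f y = a y *: up + b y *: um) -> Hreg x -> hode a b x ->
  horizontal_at f x.
Proof.
move=> d0 hf hx [da [db [ha hb e1 e2]]]; exists (da *: up + db *: um).
  exact: is_deriv_comb hf ha hb.
move=> xi; have fx : f x = a x *: up + b x *: um by apply: hf; rewrite subrr N0.
rewrite [LHS]coordsK coords_nabla// fx !coords_comb /= e1 e2.
have -> : xi * (- m * b x + m * b x) = 0 by ring.
rewrite [X in _ + X *: _](_ : _ = 0) ?scale0r ?addr0//; ring.
Qed.

Definition section_of (a b L : C -> C) (x : C) : K := a (L x) *: up + b (L x) *: um.

Lemma section_horizontal (U : C -> Prop) a b L x : Sol k m U a b -> (forall z, U z -> sh2 z != 0) ->
  (exists2 d : R, 0 < d & forall y, N (y - x) < d -> [/\ U (L y), expC (L y) = y & cder L y y^-1]) ->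
  horizontal_near (section_of a b L) x.
Proof.
move=> s sU [d d0 hL]; apply/nbhsCP; exists d => // y /hL[UL eL dL].
have y0 : y != 0 by rewrite -eL expC_neq0.
have s0 := sU _ UL; have e2 : expC (2 * L y) = y ^+ 2 by rewrite (expCMn _ 2) eL.
have y2 : y ^+ 2 != 1.
  apply: contra s0 => /eqP h; rewrite /sh2 expCN eL; apply/eqP.
  by apply: (mulfI y0); rewrite mulrBr divff// -expr2 h subrr mulr0.
have hy : Hreg y by split => //; apply: contra y2 => /eqP ->; rewrite ?sqrrN expr1n.
split => //; have [ha hb] := s _ UL.
apply: (@hode_horizontal _ (fun y => a (L y)) (fun y => b (L y)) y 1) => //.
exists (- m * b (L y) * y^-1), ((2 * k * cothC (L y) * b (L y) - a (L y)) * y^-1); split.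
- exact: (@cder_comp _ a L y _ _ ha dL).
- exact: (@cder_comp _ b L y _ _ hb dL).
- by rewrite mulrC divfK.
- by rewrite mulrC divfK// coth_exp// e2.
Qed.

Lemma horizontal_germ f x z0 : horizontal_near f x -> expC z0 = x ->
  exists2 d : R, 0 < d & Sol k m (fun z => N (z - z0) < d)
    (fun z => (coords (f (expC z))).1) (fun z => (coords (f (expC z))).2).
Proof.
move=> /nbhsCP[r r0 hf] ez; have [d d0 hd] := cder_cont (cder_expC z0) r0.
exists d => // z /hd; rewrite ez => /hf[hx /(horizontal_hode hx)[da [db [ha hb e1 e2]]]].
have x0 := expC_neq0 z; have [_ x1 xm] := hx.
have s0 : sh2 z != 0.
  apply: contra x1 => /eqP h; apply: contraR xm => xm1; rewrite -[_ == -1]negbK.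
  have := sh2_eq0 h; rewrite (expCMn _ 2) => /eqP; rewrite sqrf_eq1 (negbTE xm1)/= => ->.
  by [].
split.
  apply: cder_eq (@cder_comp _ (fun x => (coords (f x)).1) (@expC R) z _ _ ha (cder_expC z)) _.
  by rewrite mulrC e1.
apply: cder_eq (@cder_comp _ (fun x => (coords (f x)).2) (@expC R) z _ _ hb (cder_expC z)) _.
by rewrite mulrC e2 coth_exp// (expCMn _ 2).
Qed.

End HorizontalSections.

(** * The stalk at the base point *)

Section Stalk.
Variable R : realType.
Local Notation C := (R[i]).
Local Notation N := (@ComplexField.Normc.normc R).
Local Notation "x %:CC" := (real_complex R x) (at level 2, format "x %:CC").
Local Notation Re := complex.Re.
Local Notation Im := complex.Im.
Local Notation piI := (piI R).
Local Notation hpi := (piI / 2).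
Variables (k lam : C).
Local Notation K := (Ktheta k lam).
Local Notation coords := (@coords R k lam).
Local Notation m := (par k lam).

Lemma Dom_open z : Dom z -> exists2 d : R, 0 < d & forall y, N (y - z) < d -> Dom y.
Proof.
move=> [h1 h2].
have bnd y (d : R) : N (y - z) < d -> `|Re y - Re z| < d /\ `|Im y - Im z| < d.
  move=> yd; have := Re_le_N (y - z); have := Im_le_N (y - z); rewrite ReB ImB => i1 i2.
  by split; [exact: le_lt_trans i2 yd|exact: le_lt_trans i1 yd].
have [d [d0 hd]] : exists d : R, 0 < d /\ forall y, N (y - z) < d -> Im y != 0 \/ Re y < 0.
  case: h2 => h2.
    exists `|Im z|; split; first by rewrite normr_gt0.
    move=> y /bnd[_ h]; left; apply: contraTneq h => ->; by rewrite sub0r normrN ltxx.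
  exists (- Re z); split; first by rewrite oppr_gt0.
  by move=> y /bnd[h _]; right; move: h; rewrite ltr_norml; lra.
exists (Num.min d (pi - `|Im z|)); first by rewrite lt_min d0 subr_gt0.
move=> y; rewrite lt_min => /andP[/hd h3 /bnd[_ h4]]; split => //.
have := ler_normD (Im y - Im z) (Im z); rewrite subrK => h5.
by apply: le_lt_trans h5 _; rewrite -ltrBrDr.
Qed.

(** A branch of the logarithm with values near d, used with c e^d = 1: multiplication by c rotates y
    into the right half plane, where [logC] is a logarithm. *)
Definition lift (c d : C) (y : C) : C := logC (y * c) + d.

Lemma Re_pos_near x c : 0 < Re (x * c) -> exists2 d : R, 0 < d & forall y, N (y - x) < d -> 0 < Re (y * c).
Proof.
move=> h; have ch : cont (fun y => y * c) x by apply: contM; [exact: cont_id|exact: cont_cst].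
have [d d0 hd] := ch _ h; exists d => // y /hd; have := Re_le_N (y * c - x * c); rewrite ReB ler_norml => /andP[h1 _] h2; lra.
Qed.

Lemma lift_spec c d y : c * expC d = 1 -> 0 < Re (y * c) -> expC (lift c d y) = y /\ cder (lift c d) y y^-1.
Proof.
move=> cd yc; split; first by rewrite /lift expCD expC_logC// -mulrA cd mulr1.
have c0 : c != 0.
  by apply/eqP => c0; move/esym/eqP : cd; rewrite c0 mul0r oner_eq0.
have y0 : y != 0 by apply: contraTneq yc => ->; rewrite mul0r ltxx.
have h1 : cder (fun y => y * c) y c by apply: cder_eq (cderM (cder_id y) (cder_cst c y)) _; rewrite mul1r mulr0 addr0.
apply: cder_eq (cderD (@cder_comp _ (@logC R) (fun y => y * c) y _ _ (cder_logC yc) h1) (cder_cst d y)) _.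
by rewrite addr0 invfM mulfVK.
Qed.

Lemma lift_near (U : C -> Prop) c d x : c * expC d = 1 -> 0 < Re (x * c) ->
  (exists2 r : R, 0 < r & forall z, N (z - lift c d x) < r -> U z) ->
  exists2 e : R, 0 < e & forall y, N (y - x) < e -> [/\ U (lift c d y), expC (lift c d y) = y & cder (lift c d) y y^-1].
Proof.
move=> cd xc [r r0 hr]; have [e e0 he] := Re_pos_near xc.
have [_ /cder_cont /(_ _ r0)[e' e'0 he']] := lift_spec cd xc.
exists (Num.min e e'); first by rewrite lt_min e0.
move=> y; rewrite lt_min => /andP[/he h1 /he' h2]; have [h3 h4] := lift_spec cd h1.
by split => //; exact: hr.
Qed.

Lemma mul1_expC0 : 1 * expC 0 = 1 :> C. Proof. by rewrite mul1r expC0. Qed.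

Definition Phi (v : C * C) : C -> K := section_of k lam (solA k lam v) (solB k lam v) (lift 1 0).

Lemma Phi_horizontal v x : 0 < Re x -> Dom (lift 1 0 x) -> horizontal_near (Phi v) x.
Proof.
move=> x0 Dx; apply: (section_horizontal (@solAB R k lam v) (@sh2_Dom R)).
by apply: (lift_near mul1_expC0); [rewrite mulr1|exact: Dom_open].
Qed.

Variables (x0 : R).
Hypothesis x01 : 0 < x0 < 1.
Local Notation b := (x0%:CC : C).
Local Notation zb := ((ln x0)%:CC : C).

Lemma lift_b : lift 1 0 b = zb.
Proof. by case/andP: x01 => x0' _; rewrite /lift mulr1 addr0 logC_real gtr0_norm. Qed.

Lemma zb_neg : Re zb < 0.
Proof. by rewrite /= ln_lt0. Qed.

Lemma Dom_zb : Dom zb. Proof. exact: Dom_real zb_neg. Qed.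

Lemma Re_b : 0 < Re b. Proof. by case/andP: x01. Qed.

Lemma lift_b_near : exists2 e : R, 0 < e &
  forall y, N (y - b) < e -> [/\ Dom (lift 1 0 y), expC (lift 1 0 y) = y & cder (lift 1 0) y y^-1].
Proof.
by apply: (lift_near mul1_expC0); [rewrite mulr1 Re_b|rewrite lift_b; exact/Dom_open/Dom_zb].
Qed.

Lemma comb_linear (W : lmodType C) (p u : W) (a x y z w : C) :
  (a * x + z) *: p + (a * y + w) *: u = a *: (x *: p + y *: u) + (z *: p + w *: u).
Proof. by rewrite scalerDr !scalerDl !scalerA addrACA. Qed.

Lemma Phi_linear a u v : Defs.eq_near b (Phi (a * u.1 + v.1, a * u.2 + v.2)) (fun y => a *: Phi u y + Phi v y).
Proof.
have [e e0 he] := lift_b_near; apply/nbhsCP; exists e => // y /he[Dy _ _].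
have [|h1 h2] := @sol_linE R k lam a 1 u v (a * u.1 + v.1, a * u.2 + v.2) _ _ Dy; first by rewrite !mul1r.
by rewrite /Phi /section_of h1 h2 !mul1r comb_linear.
Qed.

Lemma Phi_inj v : Defs.eq_near b (Phi v) (fun=> 0) -> v = (0, 0).
Proof.
move=> /nbhsCP[d d0 h]; have := h b; rewrite subrr N0 => /(_ d0) /(congr1 coords).
rewrite /Phi /section_of coords_comb coords0 lift_b => -[h1 h2].
have st : star (@Dom R) zb := Dom_star (erefl : Im zb = 0) zb_neg.
have [e1 e2] := sol_uniq0 st (@sh2_Dom R) (@solAB R k lam v) h1 h2 (@Dom_hpi R).
by rewrite solA_mid in e1; rewrite solB_mid in e2; case: v e1 e2 {h h1 h2} => x y /= -> ->.
Qed.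

Lemma sol_at_zb a0 b0 : exists v, solA k lam v zb = a0 /\ solB k lam v zb = b0.
Proof.
have st : star (@Dom R) zb := Dom_star (erefl : Im zb = 0) zb_neg.
have [|f [g [s h1 h2]]] := @sol_transfer R k m (@Dom R) hpi zb st (@Dom_hpi R) (@sh2_Dom R) _ a0 b0.
  move=> a1 b1; exists (solA k lam (a1, b1)), (solB k lam (a1, b1)).
  by split; [exact: solAB|exact: solA_mid|exact: solB_mid].
exists (f hpi, g hpi); have [||-> ->] := @sol_eq R k lam (f hpi, g hpi) f g s _ _ zb Dom_zb; done.
Qed.

Lemma Phi_surj f : horizontal_near f b -> exists v, Defs.eq_near b (Phi v) f.
Proof.
move=> hf; have x0' : 0 < x0 by case/andP: x01.
have eb : expC zb = b by rewrite expC_real lnK.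
have [d d0 s] := horizontal_germ hf eb.
have [v [hv1 hv2]] := sol_at_zb (coords (f b)).1 (coords (f b)).2.
have [r r0 hr] := Dom_open Dom_zb; pose e := Num.min d r.
have e0 : 0 < e by rewrite lt_min d0.
have st : star (fun z => N (z - zb) < e) zb.
  move=> z zd t /andP[t0 t1]; rewrite addrAC subrr add0r NM Nreal ger0_norm//.
  by apply: le_lt_trans zd; rewrite ler_piMl// N_ge0.
have sU z : N (z - zb) < e -> sh2 z != 0.
  by rewrite lt_min => /andP[_ /hr]; exact: sh2_Dom.
exists v; have [e' e'0 he'] := lift_b_near.
have [_ /cder_cont /(_ _ e0)[e2 e20 he2]] : expC (lift 1 0 b) = b /\ cder (lift 1 0) b b^-1.
  by apply: lift_spec mul1_expC0 _; rewrite mulr1 Re_b.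
apply/nbhsCP; exists (Num.min e' e2); first by rewrite lt_min e'0.
move=> y; rewrite lt_min => /andP[/he'[Dy ey _] /he2]; rewrite lift_b => zy.
have s1 : Sol k m (fun z => N (z - zb) < e) (solA k lam v) (solB k lam v).
  by apply: sol_sub (@solAB R k lam v) => z; rewrite lt_min => /andP[_ /hr].
have s2 : Sol k m (fun z => N (z - zb) < e) (fun z => (coords (f (expC z))).1) (fun z => (coords (f (expC z))).2).
  by apply: sol_sub s => z; rewrite lt_min => /andP[].
have [||h1 h2] := sol_uniq st sU s1 s2 _ _ zy; rewrite ?eb//.
by rewrite /Phi /section_of h1 h2 ey -coordsK.
Qed.

End Stalk.

(** * The path of T in the logarithmic coordinate *)

Section MonodromyT.
Variable R : realType.
Local Notation C := (R[i]).
Local Notation Ctop := (R[i]^o).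
Local Notation N := (@ComplexField.Normc.normc R).
Local Notation "x %:CC" := (real_complex R x) (at level 2, format "x %:CC").
Local Notation Re := complex.Re.
Local Notation Im := complex.Im.
Local Notation piI := (piI R).

Definition contR (g : R -> C) (t : R) := forall e : R, 0 < e -> exists2 d : R, 0 < d &
  forall u, `|u - t| < d -> N (g u - g t) < e.

Lemma contR_within (g : R -> C) : (forall t, 0 <= t <= 1 -> contR g t) ->
  {within `[0, 1], continuous (g : R -> Ctop)}.
Proof.
move=> h; apply: continuous_in_subspaceT => t; rewrite inE /= in_itv /= => t01.
apply/cvgrPdist_lt => e e0; have [eE e0'] := pos_real e0; have [d d0 hd] := h t t01 _ e0'.
apply/nbhs_ballP; exists d => //= u; rewrite /ball /= => ut.
by rewrite normE eE ltcR NBC; apply: hd; rewrite distrC.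
Qed.

Lemma contR_comp (f : C -> C) (g : R -> C) t : contR g t -> cont f (g t) -> contR (fun u => f (g u)) t.
Proof.
move=> cg cf e e0; have [d d0 hd] := cf e e0; have [d' d'0 hd'] := cg d d0.
by exists d' => // u /hd'/hd.
Qed.

Lemma contR_real t : contR (fun u => u%:CC) t.
Proof. by move=> e e0; exists e => // u; rewrite -rmorphB Nreal. Qed.

Lemma contR_glue (g g1 g2 : R -> C) (c t : R) : (forall u, u <= c -> g u = g1 u) ->
  (forall u, c <= u -> g u = g2 u) -> contR g1 t -> contR g2 t -> contR g t.
Proof.
move=> h1 h2 c1 c2 e e0; have [d1 d10 hd1] := c1 e e0; have [d2 d20 hd2] := c2 e e0.
have [tc|tc|tc] := ltgtP t c.
- exists (Num.min d1 (c - t)) => [|u]; first by rewrite lt_min d10 subr_gt0.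
  rewrite lt_min => /andP[u1 u2]; rewrite !h1 ?(ltW tc)//; first exact: hd1.
  by move: u2; rewrite ltr_norml => /andP[_]; rewrite ltrD2r => /ltW.
- exists (Num.min d2 (t - c)) => [|u]; first by rewrite lt_min d20 subr_gt0.
  rewrite lt_min => /andP[u1 u2]; rewrite !h2 ?(ltW tc)//; first exact: hd2.
  by move: u2; rewrite distrC ltr_norml => /andP[_]; rewrite ltrD2l ltrN2 => /ltW.
- exists (Num.min d1 d2) => [|u]; first by rewrite lt_min d10.
  rewrite lt_min => /andP[u1 u2]; have [uc|cu] := lerP u c.
    by rewrite !h1 ?tc//; rewrite -tc; exact: hd1.
  by rewrite !h2 ?tc// ?(ltW cu)//; rewrite -tc; exact: hd2.
Qed.

Variables (Z0 eps : R).
Hypotheses (hZ : 0 < Z0 < 1) (he : 0 < eps < 1 - Z0).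
Local Notation Z := (pathZ Z0 eps).

(** The three pieces of the path, extended to a complex argument so that the rules for [cont] apply
    to each. *)
Let pZ1 (z : C) : C := Z0%:CC + 3 * z * (1 - eps - Z0)%:CC.
Let pZ2 (z : C) : C := 1 + eps%:CC * expC (piI * (3 * z)).
Let pZ3 (z : C) : C := (1 + eps)%:CC + (3 * z - 2) * (Z0^-1 - (1 + eps))%:CC.

Lemma three_CC : 3 = 3%:CC :> C. Proof. by rewrite rmorph_nat. Qed.

Lemma pathZ1 t : t <= 3^-1 -> Z t = pZ1 t%:CC.
Proof. by move=> t3; rewrite /pathZ t3 /pZ1 three_CC !(rmorphD, rmorphM). Qed.

Lemma pathZ3 t : 2 / 3 <= t -> Z t = pZ3 t%:CC.
Proof.
move=> t3; have h : (t <= 3^-1) = false by apply/negbTE; rewrite -ltNge; lra.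
rewrite /pathZ h; case: ifP => [t2|_].
  have -> : t = 2 / 3 by apply/eqP; rewrite eq_le t2 t3.
  have -> : (3 * (2 / 3))%:CC = 2 :> C by rewrite two_CC; congr (_%:CC); field.
  rewrite (mulrC piI) expC_2piI mulr1 /pZ3.
  have -> : 3 * (2 / 3)%:CC - 2 = 0 :> C.
    by rewrite three_CC two_CC -rmorphM -rmorphB; have -> : 3 * (2 / 3) - 2 = 0 :> R by field.
  by rewrite mul0r addr0 rmorphD rmorph1.
by rewrite /pZ3 three_CC two_CC -!(rmorphM, rmorphB, rmorphD).
Qed.

Lemma pathZ2 t : 3^-1 <= t -> t <= 2 / 3 -> Z t = pZ2 t%:CC.
Proof.
move=> t1 t2; rewrite /pathZ; case: ifP => [t3|_]; last by rewrite t2 /pZ2 three_CC rmorphM.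
have -> : t = 3^-1 by apply/eqP; rewrite eq_le t3 t1.
have -> : 3 * 3^-1 * (1 - eps - Z0) = 1 - eps - Z0 :> R by field.
have e3 : 3 * (3^-1)%:CC = 1 :> C by rewrite three_CC -rmorphM; have -> : 3 * 3^-1 = 1 :> R by field.
rewrite /pZ2 e3 mulr1 expC_piI mulrN1.
have -> : Z0 + (1 - eps - Z0) = 1 - eps by ring.
by rewrite rmorphB rmorph1.
Qed.

Lemma contR_pathZ t : contR Z t.
Proof.
have c1 : cont pZ1 t%:CC.
  apply: contD; first exact: cont_cst; apply: contM; last exact: cont_cst.
  by apply: contM; [exact: cont_cst|exact: cont_id].
have c2 : cont pZ2 t%:CC.
  apply: contD; first exact: cont_cst; apply: contM; first exact: cont_cst.
  apply: (@cont_comp _ (@expC R) (fun z => piI * (3 * z))); last exact: cder_cont (cder_expC _).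
  by apply: contM; [exact: cont_cst|apply: contM; [exact: cont_cst|exact: cont_id]].
have c3 : cont pZ3 t%:CC.
  apply: contD; first exact: cont_cst; apply: contM; last exact: cont_cst.
  by apply: contB; [apply: contM; [exact: cont_cst|exact: cont_id]|exact: cont_cst].
have r1 := contR_comp (contR_real t) c1; have r2 := contR_comp (contR_real t) c2.
have r3 := contR_comp (contR_real t) c3.
pose g u := if u <= 3^-1 then pZ1 u%:CC else pZ2 u%:CC.
have gE u : u <= 2 / 3 -> Z u = g u.
  by move=> u2; rewrite /g; case: lerP => u1; [exact: pathZ1|apply: pathZ2 => //; exact: ltW].
have rg : contR g t.
  apply: (contR_glue (c := 3^-1) _ _ r1 r2) => u u1; first by rewrite /g u1.
  by have [u2|u2] := lerP u (2 / 3); [rewrite -gE// pathZ2|rewrite /g leNgt (lt_trans _ u2) //; lra].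
by apply: (contR_glue (c := 2 / 3) gE _ rg r3) => u; exact: pathZ3.
Qed.

Lemma pathZ_first t : 0 <= t -> t <= 3^-1 -> exists x : R, 0 < x < 1 /\ Z t = x%:CC.
Proof.
move=> t0 t3; exists (Z0 + 3 * t * (1 - eps - Z0)); split; last by rewrite /pathZ t3.
have t1 : 0 <= 3 * t <= 1 by lra.
by have := @seg_lt R Z0 (1 - eps) 1 _ t1; have := @seg_gt R Z0 (1 - eps) 0 _ t1; case/andP: hZ => ? ?; case/andP: he => ? ?; lra.
Qed.

Lemma pathZ_last t : 2 / 3 <= t -> t <= 1 -> exists x : R, 1 < x /\ Z t = x%:CC.
Proof.
move=> t3 t1; rewrite pathZ3//; exists (1 + eps + (3 * t - 2) * (Z0^-1 - (1 + eps))); split; last first.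
  by rewrite /pZ3 three_CC two_CC !(rmorphM, rmorphB, rmorphD).
have t2 : 0 <= 3 * t - 2 <= 1 by lra.
case/andP: hZ => z0 z1; case/andP: he => e0 e1.
apply: (@seg_gt R (1 + eps) Z0^-1 1 _ t2); first by lra.
by rewrite invf_gt1.
Qed.

(** For 3t between 1 and 2 the positively oriented arc runs below the real axis. *)
Lemma pathZ_arc t : 3^-1 < t -> t < 2 / 3 -> 0 < Re (Z t) /\ Im (Z t) < 0.
Proof.
move=> t1 t2; rewrite pathZ2 ?ltW// /pZ2; case/andP: hZ => z0 z1; case/andP: he => e0 e1.
have -> : piI * (3 * t%:CC) = Complex 0 (3 * t * pi).
  by rewrite piIE three_CC; apply/eqP; rewrite eq_complex /=; apply/andP; split; apply/eqP; ring.
rewrite ReD ImD ReZ ImZ Re_expC Im_expC /= expR0 !mul1r add0r; split.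
  have := cos_geN1 (3 * t * pi); have : 1 - eps > 0 by lra.
  by move=> h1 h2; have := ler_wpM2l (ltW e0) h2; lra.
rewrite pmulr_rlt0// -(subrK pi (3 * t * pi)) sinDpi oppr_lt0 sin_gt0_pi//.
by have pp := pi_gt0 R; apply/andP; split; nra.
Qed.

Lemma Re_pathZ t : 0 <= t <= 1 -> 0 < Re (Z t).
Proof.
move=> /andP[t0 t1]; have [t3|t3] := lerP t 3^-1.
  by have [x [/andP[x1 _] ->]] := pathZ_first t0 t3.
have [t2|t2] := lerP (2 / 3) t; last by have [] := pathZ_arc t3 t2.
by have [x [x1 ->]] := pathZ_last t2 t1; exact: lt_trans x1.
Qed.

(** Half of log Z is log x: the lift of the path to the coordinate z. It stays in |Im z| < pi/4, so
    only the principal branch occurs. *)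
Definition logpath (t : R) : C := (2^-1)%:CC * logC (Z t).
Definition gammaT (t : R) : C := expC (logpath t).

Lemma Im_logpath t : `|Im (logpath t)| < pi / 4.
Proof. by rewrite /logpath ImZ ltr_norml; have := Im_logC (Z t); lra. Qed.

Lemma gammaT_sq t : 0 <= t <= 1 -> gammaT t ^+ 2 = Z t.
Proof.
move=> t01; rewrite /gammaT -(expCMn _ 2) /logpath mulrA -[RHS]expC_logC ?Re_pathZ//.
by congr expC; rewrite two_CC -rmorphM divff ?pnatr_eq0// rmorph1 mul1r.
Qed.

Lemma contR_gammaT t : 0 <= t <= 1 -> contR gammaT t.
Proof.
move=> t01; apply: (contR_comp (f := fun z => expC ((2^-1)%:CC * logC z)) (contR_pathZ t)).
apply: (@cont_comp _ (@expC R) (fun z => (2^-1)%:CC * logC z)); last exact: cder_cont (cder_expC _).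
by apply: contM; [exact: cont_cst|apply: cont_logC; exact: Re_pathZ].
Qed.

Lemma Re_gammaT t : 0 < Re (gammaT t).
Proof.
rewrite /gammaT Re_expC mulr_gt0 ?expR_gt0// cos_gt0_pihalf//.
by have := Im_logpath t; have := pi_gt0 R; rewrite ltr_norml; lra.
Qed.

Lemma lift_gammaT t : lift 1 0 (gammaT t) = logpath t.
Proof.
rewrite /lift mulr1 addr0 logC_expC//; apply: lt_trans (Im_logpath t) _.
by have := pi_gt0 R; lra.
Qed.

Lemma logC_Im_neg (z : C) : 0 < Re z -> Im z < 0 -> Im (logC z) < 0.
Proof.
move=> z0 z1; rewrite ltNge; apply/negP => h; move: z1; rewrite -(expC_logC z0) Im_expC ltNge.
apply/negP/negPn; rewrite mulr_ge0 ?expR_ge0// sin_ge0_pi//.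
by have := Im_logC z; have := pi_gt0 R; rewrite h /=; lra.
Qed.

Lemma logpath_first t : 0 <= t -> t <= 3^-1 -> Im (logpath t) = 0 /\ Re (logpath t) < 0.
Proof.
move=> t0 t3; have [x [/andP[x0 x1] h]] := pathZ_first t0 t3.
rewrite /logpath h logC_real gtr0_norm// ImZ ReZ /= mulr0; split => //.
by rewrite pmulr_rlt0 ?invr_gt0// ln_lt0// x0.
Qed.

Lemma logpath_arc t : 3^-1 < t -> t < 2 / 3 -> Im (logpath t) < 0.
Proof.
move=> t1 t2; have [h1 h2] := pathZ_arc t1 t2.
by rewrite /logpath ImZ pmulr_rlt0 ?invr_gt0//; exact: logC_Im_neg.
Qed.

Lemma logpath_last t : 2 / 3 <= t -> t <= 1 -> Im (logpath t) = 0 /\ 0 < Re (logpath t).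
Proof.
move=> t0 t3; have [x [x1 h]] := pathZ_last t0 t3; have x0 : 0 < x by exact: lt_trans x1.
rewrite /logpath h logC_real gtr0_norm// ImZ ReZ /= mulr0; split => //.
by rewrite mulr_gt0 ?invr_gt0// ln_gt0.
Qed.

Lemma Dom_logpath t : 0 <= t -> t < 2 / 3 -> Dom (logpath t).
Proof.
move=> t0 t2; have [t3|t3] := lerP t 3^-1.
  by have [h1 h2] := logpath_first t0 t3; exact: Dom_real.
split; first by apply: lt_trans (Im_logpath t) _; have := pi_gt0 R; lra.
by left; rewrite lt_eqF// logpath_arc.
Qed.

Lemma Dom_Nlogpath t : 2 / 3 <= t -> t <= 1 -> Dom (- logpath t).
Proof.
move=> t0 t1; have [h1 h2] := logpath_last t0 t1.
by apply: Dom_real; rewrite ?ImN ?ReN ?h1 ?oppr0// oppr_lt0.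
Qed.

End MonodromyT.

(** * Analytic continuation along the two paths *)

Section Continuation.
Variable R : realType.
Local Notation C := (R[i]).
Local Notation N := (@ComplexField.Normc.normc R).
Local Notation "x %:CC" := (real_complex R x) (at level 2, format "x %:CC").
Local Notation Re := complex.Re.
Local Notation Im := complex.Im.
Local Notation piI := (piI R).
Variables (k lam : C) (x0 eps : R).
Hypotheses (x01 : 0 < x0 < 1) (he : 0 < eps < 1 - x0 ^+ 2).
Local Notation K := (Ktheta k lam).
Local Notation up := (up k lam).
Local Notation um := (um k lam).
Local Notation b := (x0%:CC : C).
Local Notation zb := ((ln x0)%:CC : C).

Lemma comb_scale (W : lmodType C) (p u : W) (c x y : C) :
  c *: (x *: p + y *: u) = (c * x) *: p + (c * y) *: u.
Proof. by rewrite scalerDr !scalerA. Qed.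

Lemma s_act_comb (c d : C) : s_act (c *: up + d *: um) = c *: up + (- d) *: um.
Proof. by rewrite /s_act iactD !iactZ -!/(s_act _) s_up s_um scalerN scaleNr. Qed.

Lemma eq_near_refl x (f : C -> K) : Defs.eq_near x f f.
Proof. by apply/nbhsCP; exists 1. Qed.

Definition YPm v : C * C := sc (expC (- (piI * k))) (Pm k lam v).

Let Z01 : 0 < x0 ^+ 2 < 1.
Proof. by case/andP: x01 => h1 h2; rewrite exprn_gt0//= exprn_ilt1// ltW. Qed.

Lemma x0_pos : 0 < x0. Proof. by case/andP: x01. Qed.

Lemma gammaT0 : gammaT (x0 ^+ 2) eps 0 = b.
Proof.
have h : pathZ (x0 ^+ 2) eps 0 = (x0 ^+ 2)%:CC by rewrite /pathZ invr_ge0 ler0n mulr0 mul0r addr0.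
rewrite /gammaT /logpath h logC_real gtr0_norm ?exprn_gt0 ?x0_pos// lnXn ?x0_pos//.
by rewrite -rmorphM -[ln x0 *+ 2]mulr_natl mulrA mulVf// mul1r expC_real lnK// posrE x0_pos.
Qed.

Lemma gammaT1 : gammaT (x0 ^+ 2) eps 1 = b^-1.
Proof.
have h : pathZ (x0 ^+ 2) eps 1 = (x0 ^- 2)%:CC.
  have [h1 h2] : (1 <= 3^-1 :> R) = false /\ (1 <= 2 / 3 :> R) = false.
    by split; apply/negbTE; rewrite -ltNge; lra.
  rewrite /pathZ h1 h2 mulr1.
  by have -> : 1 + eps + (3 - 2) * ((x0 ^+ 2)^-1 - (1 + eps)) = x0 ^- 2 by ring.
rewrite /gammaT /logpath h logC_real gtr0_norm ?invr_gt0 ?exprn_gt0 ?x0_pos//.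
rewrite lnV ?posrE ?exprn_gt0 ?x0_pos// lnXn ?x0_pos//.
rewrite -rmorphM -[ln x0 *+ 2]mulr_natl mulrN mulrA mulVf// mul1r expC_real expRN lnK ?posrE ?x0_pos//.
by rewrite fmorphV.
Qed.

Section Tpath.
Variable v : C * C.

(* The path reaches the cut of Dom at t = 2/3; from there on the germ is
   continued by reflecting the solution with value Tm v. *)
Definition reflected : C -> K := section_of k lam (fun z => solA k lam (Tm k lam v) (- z))
  (fun z => - solB k lam (Tm k lam v) (- z)) (lift 1 0).

Lemma reflected_horizontal x : 0 < Re x -> Dom (- lift 1 0 x) -> horizontal_near reflected x.
Proof.
move=> xp Dx; apply: (section_horizontal (sol_refl (@solAB R k lam (Tm k lam v)))).
  by move=> z /sh2_Dom; rewrite sh2N oppr_eq0.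
apply: (@lift_near R (fun z => Dom (- z)) 1 0 x (@mul1_expC0 R)); first by rewrite mulr1.
have [d d0 hd] := Dom_open Dx; exists d => // z h; apply: hd.
by rewrite -opprD NN.
Qed.

(** Below the real axis - z lies in the upper half strip, where [sol_Tm] identifies the two
    solutions. *)
Lemma reflected_eq x : 0 < Re x -> Im (lift 1 0 x) < 0 -> Defs.eq_near x (Phi k lam v) reflected.
Proof.
move=> xp xi; have xi' : 0 < - Im (lift 1 0 x) by rewrite oppr_gt0.
have [||e e0 h] := @lift_near R (fun z => Im z < 0) 1 0 x (@mul1_expC0 R); first by rewrite mulr1.
  exists (- Im (lift 1 0 x)) => // z; have := Im_le_N (z - lift 1 0 x); rewrite ImB ler_norml.
  by move=> /andP[_ h1] h2; lra.
apply/nbhsCP; exists e => // y /h[yi _ _].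
have yS : Sig0 (- lift 1 0 y).
  have := Im_logC (y * 1); have := pi_gt0 R; move: yi; rewrite /Sig0 /lift ImN addr0.
  by move: (Im (logC _)) => i h1 h2 h3; lra.
have [h1 h2] := @sol_Tm R k lam v _ yS; rewrite opprK in h1 h2.
by rewrite /Phi /reflected /section_of h1 h2 opprK.
Qed.

Lemma T_mono : T_monodromy x0 eps (Phi k lam v) (Phi k lam (Tm k lam v)).
Proof.
exists (gammaT (x0 ^+ 2) eps), reflected; split.
- by move=> t t01; exact: gammaT_sq.
- exact: gammaT0.
- exact: gammaT1.
- split; first by apply: contR_within => t; exact: contR_gammaT.
  exists (fun t => if t < 2 / 3 then Phi k lam v else reflected); split.
  + move=> t /andP[t0 t1]; case: ifP => [t2|/negbT]; last rewrite -leNgt => t2.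
      by apply: Phi_horizontal; [exact: Re_gammaT|rewrite lift_gammaT; exact: Dom_logpath].
    by apply: reflected_horizontal; [exact: Re_gammaT|rewrite lift_gammaT; exact: Dom_Nlogpath].
  + move=> t /andP[t0 t1]; have [t2|t2|t2] := ltgtP t (2 / 3).
    * apply/nbhs_ballP; exists (2 / 3 - t); first by rewrite /= subr_gt0.
      move=> u; rewrite /ball /= distrC ltr_norml => /andP[_ h] _.
      by have -> : u < 2 / 3 by [lra]; exact: eq_near_refl.
    * apply/nbhs_ballP; exists (t - 2 / 3); first by rewrite /= subr_gt0.
      move=> u; rewrite /ball /= ltr_norml => /andP[_ h] _.
      have -> : (u < 2 / 3) = false by apply/negbTE; rewrite -leNgt; lra.
      exact: eq_near_refl.
    * apply/nbhs_ballP; exists 3^-1; first by rewrite /= invr_gt0.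
      move=> u; rewrite /ball /= t2 ltr_norml => /andP[_ h] _.
      case: ifP => u2; last exact: eq_near_refl.
      apply: reflected_eq; first exact: Re_gammaT.
      rewrite lift_gammaT; apply: logpath_arc => //; lra.
  + have -> : (0 : R) < 2 / 3 by lra.
    exact: eq_near_refl.
  + have -> : (1 < 2 / 3 :> R) = false by apply/negbTE; rewrite -leNgt; lra.
    exact: eq_near_refl.
have [e e0 h] := Re_pos_near (x := b) (c := 1) ltac:(by rewrite mulr1 Re_b).
(* The logarithm of y^-1 is - log y, and s changes the sign of the [um] component, which undoes both
   reflections. *)
apply/nbhsCP; exists e => // y /h; rewrite mulr1 => yp.
have E : lift 1 0 y^-1 = - lift 1 0 y.
  rewrite /lift !mulr1 !addr0 -{1}(expC_logC yp) -expCN logC_expC// ImN normrN ltr_norml.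
  exact: Im_logC.
by rewrite /Phi /reflected /section_of E s_act_comb !opprK.
Qed.

End Tpath.

Section OmegaPath.
Variable v : C * C.

(** The branch of log carried along the half turn; at time a it is centred at log x0 + pi i a. *)
Definition turn (a : R) : C -> C := lift (expC (- (piI * a%:CC))) (piI * a%:CC).
Definition gammaO (a : R) : C := expC (piI * a%:CC) * b.

Lemma turn_unit a : expC (- (piI * a%:CC)) * expC (piI * a%:CC) = 1 :> C.
Proof. by rewrite -expCD addNr expC0. Qed.

Lemma gammaO_c a : gammaO a * expC (- (piI * a%:CC)) = b.
Proof. by rewrite /gammaO mulrAC mulrC -expCD subrr expC0 mulr1. Qed.

Lemma Im_turn a : Im (piI * a%:CC) = pi * a.
Proof. by rewrite piIE /=; ring. Qed.
Lemma Re_turn a : Re (piI * a%:CC) = 0.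
Proof. by rewrite piIE /=; ring. Qed.

Lemma turn_gammaO a : turn a (gammaO a) = zb + piI * a%:CC.
Proof. by rewrite /turn /lift gammaO_c logC_real gtr0_norm// x0_pos. Qed.

Lemma turn_near (U : C -> Prop) a :
  (exists2 r : R, 0 < r & forall z, N (z - (zb + piI * a%:CC)) < r -> U z) ->
  exists2 e : R, 0 < e & forall y, N (y - gammaO a) < e ->
    [/\ U (turn a y), expC (turn a y) = y & cder (turn a) y y^-1].
Proof.
move=> h; apply: (lift_near (turn_unit a)); first by rewrite gammaO_c Re_b.
by rewrite -/(turn a) turn_gammaO.
Qed.

(** The change of direction and the deviation of y each contribute less than pi/4, and below pi/2 in
    total [logC] inverts [expC]. *)
Lemma turn_eq u a y : `|u - a| < 4^-1 -> expC (turn u y) = y ->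
  `|Im (turn u y - piI * u%:CC)| < pi / 4 -> turn a y = turn u y.
Proof.
move=> ua ey; set z := turn u y in ey * => hz.
rewrite {1}/turn /lift -ey -expCD logC_expC ?subrK//.
have -> : z + - (piI * a%:CC) = (z - piI * u%:CC) + piI * (u - a)%:CC by rewrite rmorphB; ring.
rewrite ImD Im_turn; apply: le_lt_trans (ler_normD _ _) _.
have pp := pi_gt0 R; rewrite normrM (gtr0_norm pp).
have : pi * `|u - a| < pi * 4^-1 by rewrite ltr_pM2l.
by move: hz; lra.
Qed.

(* At a = 1 the point z = log x0 + pi i lies outside Dom, and the solution is
   read off from its translate by - pi i. *)
Definition turned (a : R) : C -> K :=
  if a < 1 then section_of k lam (solA k lam (YPm v)) (solB k lam (YPm v)) (turn a)
  else section_of k lam (fun z => expC (- (piI * k)) * solA k lam v (z - piI))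
    (fun z => expC (- (piI * k)) * solB k lam v (z - piI)) (turn a).

Lemma turned_horizontal a : 0 <= a <= 1 -> horizontal_near (turned a) (gammaO a).
Proof.
move=> /andP[a0 a1]; rewrite /turned; case: ifP => [a2|/negbT].
  apply: (section_horizontal (@solAB R k lam (YPm v)) (@sh2_Dom R)).
  apply/turn_near/Dom_open; split.
    by rewrite ImD Im_turn /= add0r ger0_norm ?mulr_ge0 ?pi_ge0// gtr_pMr// pi_gt0.
  by right; rewrite ReD Re_turn addr0; exact: zb_neg.
rewrite -leNgt => a2; have -> : a = 1 by apply/eqP; rewrite eq_le a1 a2.
apply: (section_horizontal (sol_scale (expC (- (piI * k))) (sol_unshift (@solAB R k lam v)))).
  by move=> z /sh2_Dom; rewrite -{2}(subrK piI z) sh2Dpi oppr_eq0.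
apply: (@turn_near (fun z => Dom (z - piI))); have [d d0 hd] := Dom_open (Dom_zb x01); exists d => // z h; apply: hd.
by rewrite mulr1 in h; rewrite -addrA -opprD (addrC piI).
Qed.

Lemma sol_YPm z : Sig0 z -> solA k lam (YPm v) z = expC (- (piI * k)) * solA k lam v (z - piI) /\
  solB k lam (YPm v) z = expC (- (piI * k)) * solB k lam v (z - piI).
Proof.
move=> zS; have [h1 h2] := @sol_Pm R k lam v z zS.
have [|h3 h4] := @sol_linE R k lam (expC (- (piI * k))) 0 (Pm k lam v) (Pm k lam v) (YPm v) z _ (Sig0_Dom zS).
  by rewrite /YPm /sc !mul0r !addr0.
by rewrite h3 h4 h1 h2 !mul0r !addr0.
Qed.

Lemma turned_eq a u : 0 <= a <= 1 -> 0 <= u <= 1 -> `|u - a| < 4^-1 -> (a < 1 -> u < 1) ->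
  Defs.eq_near (gammaO u) (turned u) (turned a).
Proof.
move=> a01 u01 ua hau; have pp := pi_gt0 R.
have bnd z (r : R) : N (z - (zb + piI * u%:CC)) < r -> `|Im z - pi * u| < r.
  by have := Im_le_N (z - (zb + piI * u%:CC)); rewrite ImB ImD Im_turn /= add0r; exact: le_lt_trans.
have [a1|a1] := boolP (a < 1).
  have [|e e0 h] := @turn_near (fun z => `|Im (z - piI * u%:CC)| < pi / 4) u.
    by exists (pi / 4) => [|z /bnd]; [rewrite divr_gt0|rewrite ImB Im_turn].
  apply/nbhsCP; exists e => // y /h[h1 h2 _].
  by rewrite /turned a1 hau// /section_of (turn_eq ua h2 h1).
have aE : a = 1 by apply/le_anti; rewrite (leNgt 1) a1 andbT; case/andP: a01.
rewrite aE in ua a1 *; have [u1|u1] := boolP (u < 1); last first.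
  have -> : u = 1 by apply/le_anti; rewrite (leNgt 1) u1 andbT; case/andP: u01.
  exact: eq_near_refl.
have u0 : 3 / 4 < u by move: ua; rewrite ltr_norml; lra.
have pu1 : pi * u < pi by rewrite gtr_pMr.
have pu0 : pi * (3 / 4) < pi * u by rewrite ltr_pM2l.
have [|e e0 h] := @turn_near (fun z => `|Im (z - piI * u%:CC)| < pi / 4 /\ Sig0 z) u.
  exists (Num.min (pi / 4) (pi - pi * u)); first by rewrite lt_min divr_gt0// subr_gt0.
  move=> z /bnd; rewrite lt_min => /andP[z1 z2]; split; first by rewrite ImB Im_turn.
  by move: z1 z2; rewrite /Sig0 !ltr_norml => /andP[? ?] /andP[? ?]; apply/andP; split; lra.
apply/nbhsCP; exists e => // y /h[[h1 h3] h2 _].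
rewrite /turned u1 (negbTE a1) /section_of (turn_eq ua h2 h1).
by have [-> ->] := sol_YPm h3.
Qed.

(** At the end of the half turn the solution with value e^(- pi i k) P v is e^(- pi i k) times the
    translate of the one with value v. The normalization e^(pi i k) removes the factor, so the
    continuation inverts [YPm]. *)
Lemma Omega_mono : Omega_monodromy x0 (Phi k lam (YPm v)) (Phi k lam v).
Proof.
exists (turned 1).
  split.
    apply: contR_within => t _; apply: (contR_comp (f := fun z => expC (piI * z) * b) (@contR_real R t)).
    apply: contM; last exact: cont_cst.
    apply: (@cont_comp _ (@expC R) (fun z => piI * z)); last exact: cder_cont (cder_expC _).
    by apply: contM; [exact: cont_cst|exact: cont_id].
  exists turned; split.
  - by move=> t; exact: turned_horizontal.
  - move=> t t01; have [t1|t1] := ltP t 1.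
      apply/nbhs_ballP; exists (Num.min 4^-1 (1 - t)); first by rewrite /= lt_min invr_gt0 subr_gt0 t1 ltr0n.
      move=> u; rewrite /ball /= distrC lt_min => /andP[h1 h2] u01; apply: turned_eq => // _.
      by move: h2; rewrite ltr_norml; lra.
    apply/nbhs_ballP; exists 4^-1; first by rewrite /= invr_gt0.
    move=> u; rewrite /ball /= distrC => h1 u01; apply: turned_eq => //.
    by rewrite ltNge t1.
  - rewrite /turned ltr01 /Phi /turn mulr0 oppr0 expC0; exact: eq_near_refl.
  - exact: eq_near_refl.
apply/nbhsCP; exists 1 => // y _.
have E : turn 1 (- y) = lift 1 0 y + piI.
  by rewrite /turn /lift rmorph1 !mulr1 expCN expC_piI invrN invr1 mulrN mulr1 opprK addr0.
have ee z : expC (piI * k) * (expC (- (piI * k)) * z) = z by rewrite mulrA exp_ZM mul1r.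
by rewrite /turned ltxx /section_of E addrK comb_scale !ee.
Qed.

End OmegaPath.

End Continuation.

(** * The Hecke relations for T and Y, and the isomorphisms *)

Section Assembly.
Variable R : realType.
Local Notation C := (R[i]).
Local Notation Re := complex.Re.
Local Notation piI := (piI R).
Variables (k lam : C).
Hypothesis lam_ge0 : 0 <= Re lam.
Local Notation V := (C^o * C^o)%type.
Local Notation Lambda := (expC (piI * lam)).
Local Notation q := (expC (2 * piI * k)).
Local Notation T := (Tm k lam : V -> V).
Local Notation Y := (YPm k lam : V -> V).

Let a := P11 k lam.
Let b := P12 k lam.
Let c := P21 k lam.
Let d := P22 k lam.
Let e := expC (- (piI * k)).

Lemma TmE x y : T (x, y) = (a * x + b * y, - (c * x + d * y)).
Proof. by rewrite /Tm PmE. Qed.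
Lemma YPmE x y : Y (x, y) = (e * (a * x + b * y), e * (c * x + d * y)).
Proof. by rewrite /YPm PmE. Qed.

Let aE : a = d + (1 - q).
Proof. by rewrite -(difP k lam) /a /d addrC subrK. Qed.
Let bcE : b * c = a * d - q.
Proof. by rewrite -(detPE k lam) /detP /a /b /c /d; ring. Qed.
Let eq1 : e ^+ 2 * q = 1.
Proof.
rewrite /e -(expCMn _ 2) -expCD -[RHS]expC0; congr expC; ring.
Qed.
Let sE : Lambda + Lambda^-1 = e * (a + d).
Proof.
rewrite /a /d trP// mulrDr -!expCD -expCN addrC; congr (expC _ + expC _); ring.
Qed.
Let q0 : q != 0. Proof. exact: expC_neq0. Qed.
Let e0 : e != 0. Proof. exact: expC_neq0. Qed.

Lemma Tm_linear x (u v : V) : T (x *: u + v) = x *: T u + T v.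
Proof. by case: u v => [u1 u2] [v1 v2]; rewrite pairZD !TmE pairZD; congr (_, _); ring. Qed.

Lemma YPm_linear x (u v : V) : Y (x *: u + v) = x *: Y u + Y v.
Proof. by case: u v => [u1 u2] [v1 v2]; rewrite pairZD !YPmE pairZD; congr (_, _); ring. Qed.

(** Cayley-Hamilton for T, which has trace 1 - q and determinant - q. *)
Lemma Tm_quad (v : V) : T (T v) = (1 - q) *: T v + q *: v.
Proof.
case: v => x y; rewrite !TmE !pairZ pairD.
have h : b * c - ((d + (1 - q)) * d - q) = 0 by rewrite -aE bcE subrr.
congr (_, _); apply: subr0_eq; rewrite aE.
  by transitivity (- (b * c - ((d + (1 - q)) * d - q)) * x); [ring|rewrite h oppr0 mul0r].
by transitivity (- (b * c - ((d + (1 - q)) * d - q)) * y); [ring|rewrite h oppr0 mul0r].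
Qed.

(** Cayley-Hamilton for Y = e P, which has trace Lambda + Lambda^-1 and determinant e^2 q = 1. *)
Lemma YPm_quad (v : V) : Y (Y v) = (Lambda + Lambda^-1) *: Y v - v.
Proof.
rewrite sE -scaleN1r; case: v => x y; rewrite !YPmE !pairZ pairD.
have h : b * c - (a * d - q) = 0 by rewrite bcE subrr.
have h1 : e ^+ 2 * q - 1 = 0 by rewrite eq1 subrr.
congr (_, _); apply: subr0_eq.
  by transitivity (e ^+ 2 * (b * c - (a * d - q)) * x - (e ^+ 2 * q - 1) * x); [ring|rewrite h h1 mulr0 !mul0r subrr].
by transitivity (e ^+ 2 * (b * c - (a * d - q)) * y - (e ^+ 2 * q - 1) * y); [ring|rewrite h h1 mulr0 !mul0r subrr].
Qed.

(** With D = diag(1, -1), the matrix D P + P D - tr(P) D is the scalar P_11 - P_22 = 1 - q;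
    multiplying by e P from the right gives the relation. *)
Lemma TY_cross (v : V) : T (Y v) = (Lambda + Lambda^-1) *: T v - Y (T v) + (1 - q) *: Y v.
Proof.
rewrite sE -[- Y _]scaleN1r; case: v => x y; rewrite !(TmE, YPmE) !pairZ !pairD aE.
by congr (_, _); rewrite /=; ring.
Qed.

Lemma indep_basis (u w : V) : indep u w -> basis u w.
Proof.
case: u w => [u1 u2] [w1 w2]; rewrite /indep /= => D; split.
  move=> [x y]; exists ((x * w2 - y * w1) / (u1 * w2 - u2 * w1)), ((u1 * y - u2 * x) / (u1 * w2 - u2 * w1)).
  by rewrite !pairZ pairD; congr (_, _); field.
move=> x y; rewrite !pairZ pairD => h; have h1 := congr1 fst h; have h2 := congr1 snd h.
rewrite /= in h1 h2; split; apply: (mulfI D); rewrite mulr0.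
  by transitivity ((x * u1 + y * w1) * w2 - (x * u2 + y * w2) * w1); [ring|rewrite h1 h2; ring].
by transitivity ((x * u2 + y * w2) * u1 - (x * u1 + y * w1) * u2); [ring|rewrite h1 h2; ring].
Qed.

Lemma indep_YPm (u : V) : indep u (Pm k lam u) -> indep u (YPm k lam u).
Proof.
rewrite /indep /YPm /sc /= => h.
by rewrite mulrCA (mulrCA u.2) -mulrBr mulf_neq0.
Qed.

Variables (x0 eps : R).
Hypotheses (x01 : 0 < x0 < 1) (he : 0 < eps < 1 - x0 ^+ 2).

Lemma model_monodromy (M : TYrep R) : (exists f : M -> V, model_iso T Y f) -> monodromy_iso k lam x0 eps M.
Proof.
move=> [f [fl finj fsurj fT fY]]; exists (fun v => Phi k lam (f v)); split.
- by move=> v; apply: Phi_horizontal; [exact: Re_b|rewrite lift_b//; exact: Dom_zb].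
- by move=> x u v; rewrite fl; exact: Phi_linear.
- split=> [v /(Phi_inj x01)/finj //|h /(Phi_surj x01) [w hw]].
  by have [v fv] := fsurj w; exists v; rewrite fv.
- by move=> v; rewrite fT; exact: T_mono.
- by move=> v; rewrite fY; exact: Omega_mono.
Qed.

Lemma monodromy_KTheta u : Tm k lam u = u -> indep u (Pm k lam u) ->
  monodromy_iso k lam x0 eps (KTheta q Lambda).
Proof.
move=> Tu hu; apply/model_monodromy.
apply: (central_model q0 Tm_linear YPm_linear Tm_quad YPm_quad TY_cross (t := 1) (u := u)).
  by rewrite scale1r.
exact/indep_basis/indep_YPm.
Qed.

Lemma monodromy_KTheta_minus u : Tm k lam u = sc (- q) u -> indep u (Pm k lam u) ->
  monodromy_iso k lam x0 eps (KTheta_minus q Lambda).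
Proof.
move=> Tu hu; apply/model_monodromy.
apply: (central_model q0 Tm_linear YPm_linear Tm_quad YPm_quad TY_cross (t := - q) (u := u)) => //.
exact/indep_basis/indep_YPm.
Qed.

Let eLambda : e * expC ((k - lam) * piI) = Lambda^-1.
Proof. by rewrite /e -expCD -expCN; congr expC; ring. Qed.

Lemma monodromy_Iind u : Pm k lam u = sc (expC ((k - lam) * piI)) u -> indep u (Tm k lam u) ->
  monodromy_iso k lam x0 eps (Iind q Lambda^-1).
Proof.
move=> Pu hu; apply/model_monodromy.
apply: (principal_model q0 Tm_linear YPm_linear Tm_quad YPm_quad TY_cross (mu := Lambda^-1) (u := u)).
- by rewrite invr_eq0 expC_neq0.
- by rewrite invrK addrC.
- rewrite /YPm Pu -eLambda; case: (u) => x y; rewrite pairZ /sc /=; congr (_, _); exact: mulrA.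
exact: indep_basis.
Qed.

(** Here P is 1 or -1, so T is diag(1, -1) or its negative; in the second case the two coordinates
    are exchanged. *)
Lemma monodromy_split : expC ((k - lam) * piI) ^+ 2 = 1 ->
  (forall v, Pm k lam v = sc (expC ((k - lam) * piI)) v) ->
  monodromy_iso k lam x0 eps (dsum (onedim Lambda^-1 1) (onedim Lambda^-1 (- 1))).
Proof.
move=> c2 Pv; apply/model_monodromy.
have Yv (v : V) : Y v = (Lambda^-1 * v.1, Lambda^-1 * v.2).
  by rewrite /YPm Pv -eLambda /sc /= !mulrA.
move/eqP: c2; rewrite sqrf_eq1 => /orP[]/eqP cE; rewrite cE in Pv.
  exists (fun v => v); split => //; first by move=> v; exists v.
  move=> [x y]; transitivity ((1 * x, -1 * y) : V) => //.
  by rewrite /Tm Pv /sc /=; congr (_, _); ring.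
exists (fun v => (v.2, v.1)); split.
- by move=> x [u1 u2] [v1 v2].
- by case=> x y /= [-> ->].
- by case=> x y; exists (y, x).
- move=> [x y]; transitivity ((-1 * y, 1 * x) : V) => //.
  by rewrite /Tm Pv /sc /=; congr (_, _); ring.
- by case=> x y; rewrite Yv.
Qed.

End Assembly.

Theorem theorem1p5 (R : realType) (k lambda : R[i]) (x0 eps : R)
    (hlambda : 0 <= complex.Re lambda)
    (hx0 : 0 < x0 < 1) (heps : 0 < eps < 1 - x0 ^+ 2) :
  let Lambda := expC (piI R * lambda) in
  let q := expC (2 * piI R * k) in
  let mono := @monodromy_iso R k lambda x0 eps in
  [/\ ~ case1 k lambda -> ~ case2 k lambda -> ~ case3 k lambda ->
        mono (KTheta q Lambda),
      case1 k lambda ->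
        mono (dsum (onedim Lambda^-1 1) (onedim Lambda^-1 (- 1))),
      case2 k lambda -> mono (Iind q Lambda^-1)
    & case3 k lambda -> mono (KTheta_minus q Lambda)].
Proof.
move=> Lambda q mono; split.
- move=> c1 c2 c3; have [u [Tu hu]] := cyclic_T1 hlambda c1 c2 c3.
  exact: monodromy_KTheta Tu hu.
- by move=> c1; have [h1 h2] := scalar_case1 hlambda c1; exact: monodromy_split.
- move=> c2; have [u [Pu hu]] := cyclic_case2 hlambda c2.
  exact: monodromy_Iind Pu hu.
- move=> c3; have [u [Tu hu]] := cyclic_case3 hlambda c3.
  exact: monodromy_KTheta_minus Tu hu.
Qed.
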